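(* Let $Q$ be a symmetric circular quadrilateral with zero angles, and let $0<\beta<\pi/2$. Let $f$ be the conformal mapping of the unit disk $U=\{z\in\mathbb{C}:|z|<1\}$ onto $Q$, normalized by $f(\overline{z})=\overline{f(z)}$, $f(-z)=-f(z)$ for $z\in U$ and $f'(0)>0$, such that under (the boundary extension of) $f$ the four points $\pm e^{\pm i\beta}$ correspond to the vertices of $Q$. Then there is a real number $\gamma$ such that the Schwarzian derivative $S_f$ of $f$ is the rational function given by $$ \frac{1}{2}\,S_f(z)=\frac{e^{i2\beta}}{(z^2-e^{i2\beta})^2}+\frac{e^{-i2\beta}}{(z^2-e^{-i2\beta})^2}-\frac{\gamma}{(z^2-e^{i2\beta})(z^2-e^{-i2\beta})}, $$ and $f$ has the form $$ f(z)=C\,\frac{u(z)}{v(z)},\qquad z\in U, $$ where $C$ is a positive constant and $u$, $v$ are the solutions in $U$ of the initial value problems $$ u''(z)+\tfrac12 S_f(z)u(z)=0,\quad u(0)=0,\ u'(0)=1, $$ $$ v''(z)+\tfrac12 S_f(z)v(z)=0,\quad v(0)=1,\ v'(0)=0. $$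
   Context: The Schwarzian derivative of a meromorphic function $f$ is $S_f(z)=\left(\frac{f''(z)}{f'(z)}\right)'-\frac12\left(\frac{f''(z)}{f'(z)}\right)^2$. A symmetric circular quadrilateral with zero angles is a Jordan domain $Q=A_1A_2A_3A_4$ in the complex plane, symmetric with respect to both the real and the imaginary axes, containing the origin, bounded by four circular arcs and with all inner angles at the four vertices $A_1,A_2,A_3,A_4$ equal to zero, of the following kind. The arcs lie on the circles with centers $\pm t$ and radius $r_1$ and on the circles with centers $\pm is$ and radius $r_2$, where $t,s>0$, $0<r_1<t$, $0<r_2<s$. Each circle centered at $\pm t$ touches each circle centered at $\pm is$ externally (so $t^2+s^2=(r_1+r_2)^2$). The vertices $A_k$ are the four points of tangency, and $Q$ is the bounded domain containing the origin enclosed by the four arcs joining consecutive points of tangency (the component containing $0$ of the complement of the four closed disks). *)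

(* Defs.v *)
(* Stdlib reals with Coquelicot's complex numbers. *)
From Stdlib Require Import Reals.
From Coquelicot Require Import Coquelicot.

Open Scope R_scope.
Open Scope C_scope.

Definition unit_disk (z : C) : Prop := Cmod z < 1.

(* [cis theta] is e^(i theta). *)
Definition cis (theta : R) : C := (cos theta, sin theta).

Definition C_differentiable (f : C -> C) (z : C) : Prop :=
  ex_derive (K := C_AbsRing) (V := C_NormedModule) f z.

(* To be used for an open set [D]. *)
Definition holomorphic_on (D : C -> Prop) (f : C -> C) : Prop :=
  forall z : C, D z -> C_differentiable f z.

Definition conformal_map (D E : C -> Prop) (f : C -> C) : Prop :=
  holomorphic_on D f /\
  (forall z w : C, D z -> D w -> f z = f w -> z = w) /\
  (forall w : C, E w <-> exists z : C, D z /\ f z = w).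

(* [C_derive] is total; its value is the complex derivative wherever the
   latter exists, which is the case throughout this expression for [f]
   holomorphic near [z] with nonzero derivative. *)
Definition schwarzian (f : C -> C) (z : C) : C :=
  C_derive (fun w : C => C_derive (C_derive f) w / C_derive f w) z
  - RtoC (1 / 2) * (C_derive (C_derive f) z / C_derive f z) ^ 2.

Definition connected (S : C -> Prop) : Prop :=
  forall A B : C -> Prop, open A -> open B ->
    (forall z : C, S z -> A z \/ B z) ->
    (exists z : C, S z /\ A z) -> (exists z : C, S z /\ B z) ->
    exists z : C, S z /\ A z /\ B z.

Definition connected_component (E : C -> Prop) (z0 z : C) : Prop :=
  exists S : C -> Prop,
    connected S /\ (forall w : C, S w -> E w) /\ S z0 /\ S z.

(* Circles of radius [r1] about [t], [-t] and of radius [r2] about [is], [-is],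
   each of the first pair externally tangent to each of the second. *)
Definition tangent_circles (t s r1 r2 : R) : Prop :=
  (0 < r1 < t /\ 0 < r2 < s /\ t ^ 2 + s ^ 2 = (r1 + r2) ^ 2)%R.

Definition closed_disk (c : C) (r : R) (z : C) : Prop := Cmod (z - c) <= r.

Definition circle (c : C) (r : R) (z : C) : Prop := Cmod (z - c) = r.

Definition quadrilateral (t s r1 r2 : R) : C -> Prop :=
  connected_component
    (fun z : C =>
       ~ closed_disk (RtoC t) r1 z /\ ~ closed_disk (- RtoC t) r1 z /\
       ~ closed_disk (Ci * RtoC s) r2 z /\ ~ closed_disk (- (Ci * RtoC s)) r2 z)
    (RtoC 0).

(* The points of tangency. *)
Definition vertex (t s r1 r2 : R) (A : C) : Prop :=
  (circle (RtoC t) r1 A \/ circle (- RtoC t) r1 A) /\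
  (circle (Ci * RtoC s) r2 A \/ circle (- (Ci * RtoC s)) r2 A).

(* [A] is the value at the boundary point [zeta] of the continuous extension
   of [f] from the open unit disk. *)
Definition boundary_value (f : C -> C) (zeta A : C) : Prop :=
  filterlim f (within unit_disk (locally zeta)) (locally A).

Definition prevertex (beta : R) (zeta : C) : Prop :=
  zeta = cis beta \/ zeta = cis (- beta) \/
  zeta = - cis beta \/ zeta = - cis (- beta).

Definition prevertices_correspond_to (V : C -> Prop) (beta : R) (f : C -> C)
  : Prop :=
  (forall zeta : C, prevertex beta zeta ->
     exists A : C, V A /\ boundary_value f zeta A) /\
  (forall A : C, V A ->
     exists zeta : C, prevertex beta zeta /\ boundary_value f zeta A).

(* y'' + q y = 0 in the unit disk, y(0) = a, y'(0) = b. *)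
Definition solves_ivp (q : C -> C) (a b : C) (y : C -> C) : Prop :=
  holomorphic_on unit_disk y /\
  holomorphic_on unit_disk (C_derive y) /\
  (forall z : C, unit_disk z -> C_derive (C_derive y) z + q z * y z = RtoC 0) /\
  y (RtoC 0) = a /\ C_derive y (RtoC 0) = b.

(* Functions are total on [C], so a solution is unique only on the disk. *)
Definition the_solution (q : C -> C) (a b : C) (y : C -> C) : Prop :=
  solves_ivp q a b y /\
  (forall w : C -> C, solves_ivp q a b w ->
     forall z : C, unit_disk z -> w z = y z).

(* Main.v *)
(* The Schwarzian is computed from its boundary behaviour. The inverse of [f] has modulus tending to 1
   at the boundary of the quadrilateral, so it continues by reflection across each open arc; this
   gives boundary values of [f] along the arcs, and no gap can remain between the preimages of two
   neighbouring arcs, as [f] would have the constant boundary value [A] there, with [A] their common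
   vertex. Near [A] the map [E = exp (c1 / (f - A) + c2)] is real on both sides of the cusp, hence
   continues analytically in a half-plane coordinate [xi]. The Schwarzian of [f] with respect to
   [xi] is that of [E] plus half the square of [E' / E], so it is real on the real line and, [E]
   having a simple zero at a prevertex, has the double pole [1 / (2 xi^2)] there. Removing these
   double poles from [S_f / 2] and multiplying by [(z^2 - e^(2 i beta)) (z^2 - e^(-2 i beta))]
   leaves a holomorphic function whose imaginary part has boundary values zero: it is a real
   constant, [- gamma]. *)
Require Import Defs.
From Stdlib Require Import Reals.
From Coquelicot Require Import Coquelicot.
From Stdlib Require Import Lra Lia ClassicalEpsilon FunctionalExtensionality.
Local Open Scope R_scope.
Local Open Scope C_scope.

(** Only four boundary values of [f] are given, so its behaviour along the arcs has to be derived.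
    Every continuation across a boundary rests on one gluing theorem for half disks: two bounded
    holomorphic functions whose values at conjugate points become close near the diameter are
    integrated twice, glued, and recovered as a second derivative; no boundary value need exist in
    advance. A continuation might still have a vanishing derivative on the diameter, which would
    spoil local invertibility along the arcs and the Schwarzian at the boundary; as it maps a half
    disk into a half plane, possibly after a Cayley transform, a lemma of Hopf type excludes this.
    The symmetries of [f] reduce the boundary study to the closed first quadrant, and exchanging the
    two axes turns the arc about [is] into the arc about [t] of another quadrilateral of the same
    kind. The constant [C] is [f'(0)]; the quotient of solutions takes the required form because [f]
    is odd, so that [f''(0) = 0]. *)

(** * Complex derivatives *)

Definition Cder (f : C -> C) (z l : C) : Prop :=
  is_derive (K := C_AbsRing) (V := C_NormedModule) f z l.

(** The general derivative quantifies over all filter limits; since limits in [C] are unique, only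
    the point [z] itself remains and an estimate is left. *)
Lemma Cder_eps (f : C -> C) (z l : C) :
  Cder f z l <->
  forall e : R, (0 < e)%R -> exists d : R, (0 < d)%R /\
    forall w : C, Cmod (w - z) < d ->
      Cmod (f w - f z - l * (w - z)) <= (e * Cmod (w - z))%R.
Proof.
split.
- intros [_ H] e He.
  specialize (H z (fun P HP => HP) (mkposreal e He)).
  destruct H as [d Hd]. exists d. split. apply cond_pos.
  intros w Hw. specialize (Hd w).
  assert (B : @ball (AbsRing_UniformSpace C_AbsRing) z d w) by exact Hw.
  specialize (Hd B). simpl in Hd.
  change (norm (minus w z)) with (Cmod (w - z)) in Hd.
  change (Cmod (f w - f z - (w - z) * l) <= (e * Cmod (w - z))%R) in Hd.
  replace (l * (w - z)) with ((w - z) * l) by ring. exact Hd.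
- intros H. split.
  { apply (is_linear_scal_l (K:=C_AbsRing) (V:=C_NormedModule) l). }
  intros x Hx e.
  assert (x = z).
  { symmetry. apply (is_filter_lim_locally_unique (V:=AbsRing_NormedModule C_AbsRing) z x Hx). }
  subst x.
  destruct (H e (cond_pos e)) as [d [Hd H1]].
  exists (mkposreal _ Hd). intros w Hw.
  change (Cmod (w - z) < d) in Hw.
  change (Cmod (f w - f z - (w - z) * l) <= (e * Cmod (w - z))%R).
  replace ((w - z) * l) with (l * (w - z)) by ring. apply H1. exact Hw.
Qed.

Lemma Cder_const (a z : C) : Cder (fun _ => a) z 0.
Proof. apply (is_derive_const (K:=C_AbsRing) (V:=C_NormedModule)). Qed.
Lemma Cder_id (z : C) : Cder (fun w => w) z 1.
Proof.
apply Cder_eps. intros e He. exists 1%R. split. lra. intros w _.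
replace (w - z - 1 * (w - z)) with (RtoC 0) by ring. rewrite Cmod_0.
apply Rmult_le_pos. lra. apply Cmod_ge_0.
Qed.
Lemma Cder_plus f g z a b : Cder f z a -> Cder g z b -> Cder (fun w => f w + g w) z (a + b).
Proof. apply (is_derive_plus (K:=C_AbsRing) (V:=C_NormedModule)). Qed.
Lemma Cder_minus f g z a b : Cder f z a -> Cder g z b -> Cder (fun w => f w - g w) z (a - b).
Proof. apply (is_derive_minus (K:=C_AbsRing) (V:=C_NormedModule)). Qed.
Lemma Cder_continuous_eps f z l : Cder f z l ->
  forall e : R, (0 < e)%R -> exists d : R, (0 < d)%R /\
    forall w : C, Cmod (w - z) < d -> Cmod (f w - f z) < e.
Proof.
intros H e He. destruct (proj1 (Cder_eps f z l) H 1%R Rlt_0_1) as [d [Hd H1]].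
assert (Hl := Cmod_ge_0 l).
exists (Rmin d (e / (2 + Cmod l))). split.
{ apply Rmin_pos; auto. apply Rdiv_lt_0_compat; lra. }
intros w Hw.
assert (H2 := H1 w (Rlt_le_trans _ _ _ Hw (Rmin_l _ _))).
assert (H3 := Rlt_le_trans _ _ _ Hw (Rmin_r _ _)).
replace (f w - f z) with ((f w - f z - l * (w - z)) + l * (w - z)) by ring.
eapply Rle_lt_trans. apply Cmod_triangle. rewrite Cmod_mult.
assert (H0 := Cmod_ge_0 (w - z)).
apply (Rmult_lt_compat_r (2 + Cmod l)) in H3; try lra.
unfold Rdiv in H3. rewrite Rmult_assoc, Rinv_l in H3 by lra. nra.
Qed.

Lemma Cder_mult f g z a b : Cder f z a -> Cder g z b -> Cder (fun w => f w * g w) z (a * g z + f z * b).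
Proof.
intros H1 H2. apply Cder_eps. intros e He.
(* [K] is at least 1 and dominates the three moduli, so each of the four error terms below costs at
   most [e1 * K * h]. *)
set (K := (1 + Cmod (f z) + Cmod (g z) + Cmod a)%R).
assert (K1 : (1 <= K)%R). { unfold K. assert (A1 := Cmod_ge_0 (f z)). assert (A2 := Cmod_ge_0 (g z)).
  assert (A3 := Cmod_ge_0 a). lra. }
set (e1 := Rmin 1 (e / (4 * K))%R).
assert (He1 : (0 < e1)%R). { apply Rmin_pos; try lra. apply Rdiv_lt_0_compat; lra. }
assert (He2 : (e1 * (4 * K) <= e)%R).
{ apply Rle_trans with (e / (4 * K) * (4 * K))%R. apply Rmult_le_compat_r. lra. apply Rmin_r. right; field; lra. }
assert (He3 : (e1 <= 1)%R) by apply Rmin_l.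
destruct (proj1 (Cder_eps f z a) H1 e1 He1) as [d1 [Hd1 E1]].
destruct (proj1 (Cder_eps g z b) H2 e1 He1) as [d2 [Hd2 E2]].
destruct (Cder_continuous_eps g z b H2 e1 He1) as [d3 [Hd3 E3]].
exists (Rmin d1 (Rmin d2 d3)). split. repeat apply Rmin_pos; auto.
intros w Hw.
assert (W1 := Rlt_le_trans _ _ _ Hw (Rmin_l _ _)).
assert (W := Rlt_le_trans _ _ _ Hw (Rmin_r _ _)).
assert (W2 := Rlt_le_trans _ _ _ W (Rmin_l _ _)).
assert (W3 := Rlt_le_trans _ _ _ W (Rmin_r _ _)).
specialize (E1 w W1). specialize (E2 w W2). specialize (E3 w W3).
replace (f w * g w - f z * g z - (a * g z + f z * b) * (w - z)) with
  ((f w - f z - a * (w - z)) * (g w - g z) + ((f w - f z - a * (w - z)) * g z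
  + (f z * (g w - g z - b * (w - z)) + a * (w - z) * (g w - g z)))) by ring.
eapply Rle_trans. apply Cmod_triangle.
eapply Rle_trans. apply Rplus_le_compat_l, Cmod_triangle.
eapply Rle_trans. apply Rplus_le_compat_l, Rplus_le_compat_l, Cmod_triangle.
rewrite !Cmod_mult.
set (h := Cmod (w - z)) in *. assert (Hh : (0 <= h)%R) by apply Cmod_ge_0.
assert (A1 := Cmod_ge_0 (f z)). assert (A2 := Cmod_ge_0 (g z)). assert (A3 := Cmod_ge_0 a).
assert (A4 := Cmod_ge_0 (f w - f z - a * (w - z))). assert (A5 := Cmod_ge_0 (g w - g z)).
assert (A6 := Cmod_ge_0 (g w - g z - b * (w - z))).
assert (Q1 : (Cmod (f w - f z - a * (w - z)) * Cmod (g w - g z) <= e1 * h * 1)%R) by (apply Rmult_le_compat; lra).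
assert (Q2 : (Cmod (f w - f z - a * (w - z)) * Cmod (g z) <= e1 * h * K)%R).
{ apply Rmult_le_compat; try lra. unfold K. lra. }
assert (Q3 : (Cmod (f z) * Cmod (g w - g z - b * (w - z)) <= K * (e1 * h))%R).
{ apply Rmult_le_compat; try lra. unfold K. lra. }
assert (Q4 : (Cmod a * h * Cmod (g w - g z) <= K * h * e1)%R).
{ apply Rmult_le_compat; try lra. nra. apply Rmult_le_compat_r; auto. unfold K. lra. }
assert (e1 * h * 1 <= e1 * h * K)%R by (apply Rmult_le_compat_l; nra).
apply Rle_trans with (e1 * (4 * K) * h)%R. lra. apply Rmult_le_compat_r; auto.
Qed.
Lemma Cder_comp f g z a b : Cder f (g z) a -> Cder g z b -> Cder (fun w => f (g w)) z (a * b).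
Proof.
intros H1 H2. apply Cder_eps. intros e He.
assert (Ha := Cmod_ge_0 a). assert (Hb := Cmod_ge_0 b).
set (K := (2 + Cmod a + Cmod b)%R).
set (e1 := Rmin 1 (e / K)%R).
assert (He1 : (0 < e1)%R). { apply Rmin_pos; try lra. apply Rdiv_lt_0_compat; unfold K; lra. }
assert (He2 : (e1 * K <= e)%R).
{ apply Rle_trans with (e / K * K)%R. apply Rmult_le_compat_r. unfold K; lra. apply Rmin_r. right; field; unfold K; lra.
  }
assert (He3 : (e1 <= 1)%R) by apply Rmin_l.
destruct (proj1 (Cder_eps f (g z) a) H1 e1 He1) as [d1 [Hd1 E1]].
destruct (proj1 (Cder_eps g z b) H2 e1 He1) as [d2 [Hd2 E2]].
destruct (Cder_continuous_eps g z b H2 d1 Hd1) as [d3 [Hd3 E3]].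
exists (Rmin d2 d3). split. repeat apply Rmin_pos; auto.
intros w Hw.
assert (W2 := Rlt_le_trans _ _ _ Hw (Rmin_l _ _)).
assert (W3 := Rlt_le_trans _ _ _ Hw (Rmin_r _ _)).
specialize (E2 w W2). specialize (E3 w W3). specialize (E1 (g w) E3).
replace (f (g w) - f (g z) - a * b * (w - z)) with
  ((f (g w) - f (g z) - a * (g w - g z)) + a * (g w - g z - b * (w - z))) by ring.
eapply Rle_trans. apply Cmod_triangle. rewrite Cmod_mult.
assert (T := Cmod_triangle (g w - g z - b * (w - z)) (b * (w - z))).
replace (g w - g z - b * (w - z) + b * (w - z)) with (g w - g z) in T by ring.
rewrite Cmod_mult in T.
set (h := Cmod (w - z)) in *. assert (Hh : (0 <= h)%R) by apply Cmod_ge_0.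
apply Rle_trans with (e1 * K * h)%R; [|apply Rmult_le_compat_r; auto].
assert (Q1 : (e1 * Cmod (g w - g z) <= e1 * ((1 + Cmod b) * h))%R).
{ apply Rmult_le_compat_l; nra. }
assert (Q2 : (Cmod a * Cmod (g w - g z - b * (w - z)) <= Cmod a * (e1 * h))%R).
{ apply Rmult_le_compat_l; lra. }
unfold K. nra.
Qed.
Lemma Cder_unique f z a b : Cder f z a -> Cder f z b -> a = b.
Proof. intros H1 H2. apply is_C_derive_unique in H1. apply is_C_derive_unique in H2. congruence. Qed.

Lemma Cder_ext_loc f g z l :
  (exists d : R, (0 < d)%R /\ forall w : C, Cmod (w - z) < d -> f w = g w) ->
  Cder f z l -> Cder g z l.
Proof.
intros [d [Hd H]] H1. apply Cder_eps. intros e He.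
destruct (proj1 (Cder_eps f z l) H1 e He) as [d' [Hd' H2]].
exists (Rmin d d'). split. apply Rmin_pos; auto.
intros w Hw. rewrite <- (H w), <- (H z). apply H2.
apply (Rlt_le_trans _ _ _ Hw (Rmin_r _ _)).
replace (z - z) with (RtoC 0) by ring. rewrite Cmod_0. auto.
apply (Rlt_le_trans _ _ _ Hw (Rmin_l _ _)).
Qed.

Lemma Cder_inv_id z : z <> RtoC 0 -> Cder (fun w => / w) z (- / (z * z)).
Proof.
intros Hz. apply Cder_eps. intros e He.
assert (Hm := proj1 (Cmod_gt_0 z) Hz). set (m := Cmod z) in *.
exists (Rmin (m / 2) (e * (m * m * m) / 2)). split.
{ apply Rmin_pos; try lra. assert (0 < m * m)%R by nra. assert (0 < m * m * m)%R by nra. nra. }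
intros w Hw.
assert (H1 := Rlt_le_trans _ _ _ Hw (Rmin_l _ _)).
assert (H2 := Rlt_le_trans _ _ _ Hw (Rmin_r _ _)).
assert (Hwm : (m / 2 < Cmod w)%R).
{ assert (T := Cmod_triangle w (z - w)). replace (w + (z - w)) with z in T by ring.
  replace (z - w) with (- (w - z)) in T by ring. rewrite Cmod_opp in T. fold m in T. lra. }
assert (Hw0 : w <> RtoC 0). { intros E. rewrite E, Cmod_0 in Hwm. lra. }
replace (/ w - / z - - / (z * z) * (w - z)) with ((w - z) * (w - z) / (w * (z * z))) by (field; auto).
rewrite Cmod_div, !Cmod_mult by (repeat apply Cmult_neq_0; auto). fold m.
assert (H0 := Cmod_ge_0 (w - z)).
unfold Rdiv. rewrite Rmult_assoc, (Rmult_comm e). apply Rmult_le_compat_l; auto.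
assert (0 < m * m)%R by nra.
apply Rle_div_l. nra.
apply Rle_trans with (e * (m * m * m) / 2)%R. lra.
replace (e * (m * m * m) / 2)%R with (e * (m / 2 * (m * m)))%R by field.
apply Rmult_le_compat_l; try lra. apply Rmult_le_compat_r; lra.
Qed.

Lemma Cder_inv f z a : Cder f z a -> f z <> RtoC 0 -> Cder (fun w => / f w) z (- a / (f z * f z)).
Proof.
intros H Hz. replace (- a / (f z * f z)) with (- / (f z * f z) * a) by (field; auto).
apply (Cder_comp (fun w => / w) f); auto. apply Cder_inv_id; auto.
Qed.

Lemma Cder_div f g z a b : Cder f z a -> Cder g z b -> g z <> RtoC 0 ->
  Cder (fun w => f w / g w) z ((a * g z - f z * b) / (g z * g z)).
Proof.
intros Hf Hg Hz.
replace ((a * g z - f z * b) / (g z * g z)) with (a * / g z + f z * (- b / (g z * g z))) by (field; auto).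
apply (Cder_mult f (fun w => / g w)); auto. apply Cder_inv; auto.
Qed.

Lemma Cder_scal c f z a : Cder f z a -> Cder (fun w => c * f w) z (c * a).
Proof.
intros H. replace (c * a) with (RtoC 0 * f z + c * a) by ring.
apply (Cder_mult (fun _ => c) f); auto. apply Cder_const.
Qed.

Lemma Cder_opp f z a : Cder f z a -> Cder (fun w => - f w) z (- a).
Proof.
intros H. replace (- a) with (- RtoC 1 * a) by ring.
apply (Cder_ext_loc (fun w => - RtoC 1 * f w)). exists 1%R. split. lra. intros; ring.
apply Cder_scal; auto.
Qed.

Lemma Cder_C_derive f z l : Cder f z l -> C_derive f z = l.
Proof. apply is_C_derive_unique. Qed.

Lemma Cder_differentiable f z : C_differentiable f z -> Cder f z (C_derive f z).
Proof. intros H. apply C_derive_correct; auto. Qed.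

Lemma Cder_is_differentiable f z l : Cder f z l -> C_differentiable f z.
Proof. intros H. exists l. exact H. Qed.

Lemma Cder_eq f z a b : Cder f z a -> a = b -> Cder f z b.
Proof. intros H <-; auto. Qed.

(** * Complex limits *)

(** Stated with [Cmod] rather than with the balls of the product uniform structure of [C];
    [locally_C_iff] compares the two. *)
Definition climit {T : Type} (F : (T -> Prop) -> Prop) (f : T -> C) (l : C) : Prop :=
  forall e : R, (0 < e)%R -> F (fun t => Cmod (f t - l) < e).

Section Climit.
Context {T : Type} (F : (T -> Prop) -> Prop) {FF : Filter F}.

Lemma climit_const (a : C) : climit F (fun _ => a) a.
Proof. intros e He. apply filter_forall. intros _. replace (a - a) with (RtoC 0) by ring. rewrite Cmod_0; auto. Qed.

Lemma climit_ext f g l : F (fun t => f t = g t) -> climit F f l -> climit F g l.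
Proof. intros H H1 e He. generalize (filter_and _ _ H (H1 e He)). apply filter_imp. intros x [<- H2]; auto. Qed.

Lemma climit_plus f g l m : climit F f l -> climit F g m -> climit F (fun t => f t + g t) (l + m).
Proof.
intros H1 H2 e He. assert (He2 : (0 < e / 2)%R) by lra.
generalize (filter_and _ _ (H1 _ He2) (H2 _ He2)). apply filter_imp. intros x [A B].
replace (f x + g x - (l + m)) with ((f x - l) + (g x - m)) by ring.
eapply Rle_lt_trans. apply Cmod_triangle. lra.
Qed.

Lemma climit_opp f l : climit F f l -> climit F (fun t => - f t) (- l).
Proof.
intros H e He. generalize (H e He). apply filter_imp. intros x A.
replace (- f x - - l) with (- (f x - l)) by ring. rewrite Cmod_opp; auto.
Qed.

Lemma climit_minus f g l m : climit F f l -> climit F g m -> climit F (fun t => f t - g t) (l - m).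
Proof. intros H1 H2. apply (climit_plus f (fun t => - g t) l (- m)); auto. apply climit_opp; auto. Qed.

Lemma climit_mult f g l m : climit F f l -> climit F g m -> climit F (fun t => f t * g t) (l * m).
Proof.
intros H1 H2 e He.
assert (Hl := Cmod_ge_0 l). assert (Hm := Cmod_ge_0 m).
set (d := Rmin 1 (e / (2 + Cmod l + Cmod m))).
assert (Hd : (0 < d)%R). { apply Rmin_pos; try lra. apply Rdiv_lt_0_compat; lra. }
assert (Hd1 : (d <= 1)%R) by apply Rmin_l.
assert (Hd2 : (d * (2 + Cmod l + Cmod m) <= e)%R).
{ apply Rle_trans with (e / (2 + Cmod l + Cmod m) * (2 + Cmod l + Cmod m))%R.
  apply Rmult_le_compat_r. lra. apply Rmin_r. right. field. lra. }
generalize (filter_and _ _ (H1 d Hd) (H2 d Hd)). apply filter_imp. intros x [A B].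
replace (f x * g x - l * m) with ((f x - l) * (g x - m) + (l * (g x - m) + m * (f x - l))) by ring.
assert (T1 := Cmod_triangle ((f x - l) * (g x - m)) (l * (g x - m) + m * (f x - l))).
assert (T2 := Cmod_triangle (l * (g x - m)) (m * (f x - l))).
rewrite !Cmod_mult in *.
assert (Ha := Cmod_ge_0 (f x - l)). assert (Hb := Cmod_ge_0 (g x - m)).
nra.
Qed.

Lemma climit_comp (g : C -> C) f l m : climit (locally l) g m -> climit F f l -> climit F (fun t => g (f t)) m.
Proof.
intros H1 H2 e He. destruct (H1 e He) as [d Hd].
generalize (H2 d (cond_pos d)). apply filter_imp. intros x A. apply Hd.
apply (C_NormedModule_mixin_compat1 l (f x) d). exact A.
Qed.
End Climit.

Lemma locally_C_iff (z : C) (P : C -> Prop) :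
  locally (T:=C_UniformSpace) z P <-> exists d : R, (0 < d)%R /\ forall w : C, Cmod (w - z) < d -> P w.
Proof.
split.
- intros [d H]. exists d. split. apply cond_pos. intros w Hw. apply H.
  apply (C_NormedModule_mixin_compat1 z w d). exact Hw.
(* A product ball of radius [d / 2] lies in the disk of radius [sqrt 2 * d / 2 < d]. *)
- intros [d [Hd H]]. assert (Hd2 : (0 < d / 2)%R) by lra.
  exists (mkposreal _ Hd2). intros w Hw. apply H.
  apply (C_NormedModule_mixin_compat2 z w (mkposreal _ Hd2)) in Hw. simpl in Hw.
  change (Cmod (minus w z) < d). eapply Rlt_trans. exact Hw.
  assert (sqrt 2 < 2)%R. { rewrite <- (sqrt_square 2) at 2 by lra. apply sqrt_lt_1; lra. }
  nra.
Qed.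

Definition Ccont (f : C -> C) (z : C) : Prop := climit (locally (T:=C_UniformSpace) z) f (f z).
Definition Rcont (f : R -> C) (t : R) : Prop := climit (locally (T:=R_UniformSpace) t) f (f t).

Lemma Ccont_eps f z : Ccont f z <-> forall e : R, (0 < e)%R -> exists d : R, (0 < d)%R /\
    forall w : C, Cmod (w - z) < d -> Cmod (f w - f z) < e.
Proof. split; intros H e He. apply locally_C_iff, H, He. apply locally_C_iff, H, He. Qed.

Lemma Cder_Ccont f z l : Cder f z l -> Ccont f z.
Proof. intros H. apply Ccont_eps. apply (Cder_continuous_eps f z l H). Qed.

Lemma climit_inv {T : Type} (F : (T -> Prop) -> Prop) {FF : Filter F} f l :
  l <> RtoC 0 -> climit F f l -> climit F (fun t => / f t) (/ l).
Proof.
intros Hl H. apply (climit_comp F (fun w => / w) f l); auto.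
apply (Cder_Ccont _ _ _ (Cder_inv_id l Hl)).
Qed.

Lemma Rcont_comp (g : C -> C) (f : R -> C) t : Ccont g (f t) -> Rcont f t -> Rcont (fun s => g (f s)) t.
Proof. intros H1 H2. unfold Rcont. apply (climit_comp _ g f (f t)); auto. Qed.

Lemma Rcont_eps f t : Rcont f t <-> forall e : R, (0 < e)%R -> exists d : R, (0 < d)%R /\
    forall w : R, (Rabs (w - t) < d)%R -> Cmod (f w - f t) < e.
Proof.
split; intros H e He.
- destruct (H e He) as [d Hd]. exists d. split. apply cond_pos. exact Hd.
- destruct (H e He) as [d [Hd H1]]. exists (mkposreal d Hd). exact H1.
Qed.

Lemma Rcont_pair (f g : R -> R) t : continuous f t -> continuous g t -> Rcont (fun s => (f s, g s)) t.
Proof.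
intros H1 H2 e He. assert (He2 : (0 < e / 2)%R) by lra.
assert (A := H1 _ (locally_ball (f t) (mkposreal _ He2))).
assert (B := H2 _ (locally_ball (g t) (mkposreal _ He2))).
destruct A as [d1 A], B as [d2 B].
exists (mkposreal _ (Rmin_stable_in_posreal d1 d2)). intros x Hx.
assert (X := A x (Rlt_le_trans _ _ _ Hx (Rmin_l _ _))).
assert (Y := B x (Rlt_le_trans _ _ _ Hx (Rmin_r _ _))).
change (Rabs (f x - f t) < e / 2)%R in X. change (Rabs (g x - g t) < e / 2)%R in Y.
replace ((f x, g x) - (f t, g t)) with (RtoC (f x - f t) + Ci * RtoC (g x - g t)).
2:{ apply injective_projections; simpl; ring. }
eapply Rle_lt_trans. apply Cmod_triangle. rewrite Cmod_mult, Cmod_Ci, !Cmod_R. lra.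
Qed.

Lemma Rcont_re f t : Rcont f t -> continuous (fun s => Re (f s)) t.
Proof.
intros H P [e HP]. destruct (H e (cond_pos e)) as [d Hd]. exists d. intros x B. apply HP.
assert (Hx := Hd x B).
change (Rabs (Re (f x) - Re (f t)) < e)%R. eapply Rle_lt_trans; [|exact Hx].
replace (Re (f x) - Re (f t))%R with (Re (f x - f t)). apply re_le_Cmod.
destruct (f x), (f t); simpl. ring.
Qed.

Lemma im_le_Cmod (c : C) : (Rabs (Im c) <= Cmod c)%R.
Proof. eapply Rle_trans; [apply Rmax_r|apply Rmax_Cmod]. Qed.

Lemma Rcont_im f t : Rcont f t -> continuous (fun s => Im (f s)) t.
Proof.
intros H P [e HP]. destruct (H e (cond_pos e)) as [d Hd]. exists d. intros x B. apply HP.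
assert (Hx := Hd x B).
change (Rabs (Im (f x) - Im (f t)) < e)%R. eapply Rle_lt_trans; [|exact Hx].
replace (Im (f x) - Im (f t))%R with (Im (f x - f t)). apply im_le_Cmod.
destruct (f x), (f t); simpl. ring.
Qed.

Lemma Cmod_le_re_im (c : C) : (Cmod c <= Rabs (Re c) + Rabs (Im c))%R.
Proof.
replace (Cmod c) with (Cmod (RtoC (Re c) + Ci * RtoC (Im c))).
eapply Rle_trans. apply Cmod_triangle. rewrite Cmod_mult, Cmod_Ci, !Cmod_R. lra.
f_equal. destruct c. apply injective_projections; simpl; ring.
Qed.

(** * Curves in the plane with a real parameter *)

Lemma is_derive_eps (f : R -> R) (t l : R) : is_derive f t l <->
  forall e : R, (0 < e)%R -> exists d : R, (0 < d)%R /\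
    forall s : R, (Rabs (s - t) < d)%R -> (Rabs (f s - f t - l * (s - t)) <= e * Rabs (s - t))%R.
Proof.
split.
- intros [_ H] e He. specialize (H t (fun P HP => HP) (mkposreal e He)). destruct H as [d Hd].
  exists d. split. apply cond_pos. intros s Hs. specialize (Hd s Hs).
  change (Rabs ((f s - f t) - (s - t) * l) <= e * Rabs (s - t))%R in Hd.
  rewrite (Rmult_comm l). exact Hd.
- intros H. split. apply (is_linear_scal_l (K:=R_AbsRing) (V:=R_NormedModule) l).
  intros x Hx e. assert (x = t).
  { symmetry. apply (is_filter_lim_locally_unique (V:=R_NormedModule) t x Hx). } subst x.
  destruct (H e (cond_pos e)) as [d [Hd H1]]. exists (mkposreal d Hd). intros s Hs.
  change (Rabs ((f s - f t) - (s - t) * l) <= e * Rabs (s - t))%R.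
  rewrite (Rmult_comm (s - t)). apply H1. exact Hs.
Qed.

Definition Rder (g : R -> C) (t : R) (v : C) : Prop :=
  forall e : R, (0 < e)%R -> exists d : R, (0 < d)%R /\
    forall s : R, (Rabs (s - t) < d)%R ->
      Cmod (g s - g t - v * RtoC (s - t)) <= (e * Rabs (s - t))%R.

Lemma Rder_re g t v : Rder g t v -> is_derive (fun s => Re (g s)) t (Re v).
Proof.
intros H. apply is_derive_eps. intros e He. destruct (H e He) as [d [Hd H1]]. exists d. split; auto.
intros s Hs. eapply Rle_trans; [|apply (H1 s Hs)].
replace (Re (g s) - Re (g t) - Re v * (s - t))%R with (Re (g s - g t - v * RtoC (s - t))).
apply re_le_Cmod. destruct (g s), (g t), v. simpl. ring.
Qed.
Lemma Rder_im g t v : Rder g t v -> is_derive (fun s => Im (g s)) t (Im v).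
Proof.
intros H. apply is_derive_eps. intros e He. destruct (H e He) as [d [Hd H1]]. exists d. split; auto.
intros s Hs. eapply Rle_trans; [|apply (H1 s Hs)].
replace (Im (g s) - Im (g t) - Im v * (s - t))%R with (Im (g s - g t - v * RtoC (s - t))).
apply im_le_Cmod. destruct (g s), (g t), v. simpl. ring.
Qed.
Lemma Rder_pair (f g : R -> R) t a b : is_derive f t a -> is_derive g t b -> Rder (fun s => (f s, g s)) t (a, b).
Proof.
intros Hf Hg e He. assert (He2 : (0 < e / 2)%R) by lra.
destruct (proj1 (is_derive_eps _ _ _) Hf _ He2) as [d1 [Hd1 H1]].
destruct (proj1 (is_derive_eps _ _ _) Hg _ He2) as [d2 [Hd2 H2]].
exists (Rmin d1 d2). split. apply Rmin_pos; auto. intros s Hs.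
specialize (H1 s (Rlt_le_trans _ _ _ Hs (Rmin_l _ _))).
specialize (H2 s (Rlt_le_trans _ _ _ Hs (Rmin_r _ _))).
eapply Rle_trans. apply Cmod_le_re_im. simpl.
replace (f s + - f t + - (a * (s - t) - b * 0))%R with (f s - f t - a * (s - t))%R by ring.
replace (g s + - g t + - (a * 0 + b * (s - t)))%R with (g s - g t - b * (s - t))%R by ring.
lra.
Qed.

Lemma Rder_Rcont g t v : Rder g t v -> Rcont g t.
Proof.
intros H. apply Rcont_eps. intros e He.
destruct (H 1%R Rlt_0_1) as [d [Hd H1]]. assert (Hl := Cmod_ge_0 v).
exists (Rmin d (e / (2 + Cmod v))). split.
{ apply Rmin_pos; auto. apply Rdiv_lt_0_compat; lra. }
intros w Hw.
specialize (H1 w (Rlt_le_trans _ _ _ Hw (Rmin_l _ _))).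
assert (H3 := Rlt_le_trans _ _ _ Hw (Rmin_r _ _)).
replace (g w - g t) with ((g w - g t - v * RtoC (w - t)) + v * RtoC (w - t)) by ring.
eapply Rle_lt_trans. apply Cmod_triangle. rewrite Cmod_mult, Cmod_R.
assert (H0 := Rabs_pos (w - t)).
apply (Rmult_lt_compat_r (2 + Cmod v)) in H3; try lra.
unfold Rdiv in H3. rewrite Rmult_assoc, Rinv_l in H3 by lra. nra.
Qed.

Lemma Rder_comp F g t l v : Cder F (g t) l -> Rder g t v -> Rder (fun s => F (g s)) t (l * v).
Proof.
intros HF Hg e He.
assert (Ha := Cmod_ge_0 l). assert (Hb := Cmod_ge_0 v).
set (K := (2 + Cmod l + Cmod v)%R).
set (e1 := Rmin 1 (e / K)%R).
assert (He1 : (0 < e1)%R). { apply Rmin_pos; try lra. apply Rdiv_lt_0_compat; unfold K; lra. }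
assert (He2 : (e1 * K <= e)%R).
{ apply Rle_trans with (e / K * K)%R. apply Rmult_le_compat_r. unfold K; lra. apply Rmin_r. right; field; unfold K; lra.
  }
assert (He3 : (e1 <= 1)%R) by apply Rmin_l.
destruct (proj1 (Cder_eps F (g t) l) HF e1 He1) as [d1 [Hd1 E1]].
destruct (Hg e1 He1) as [d2 [Hd2 E2]].
destruct (proj1 (Rcont_eps g t) (Rder_Rcont g t v Hg) d1 Hd1) as [d3 [Hd3 E3]].
exists (Rmin d2 d3). split. apply Rmin_pos; auto.
intros w Hw.
specialize (E2 w (Rlt_le_trans _ _ _ Hw (Rmin_l _ _))).
specialize (E3 w (Rlt_le_trans _ _ _ Hw (Rmin_r _ _))). specialize (E1 (g w) E3).
replace (F (g w) - F (g t) - l * v * RtoC (w - t)) with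
  ((F (g w) - F (g t) - l * (g w - g t)) + l * (g w - g t - v * RtoC (w - t))) by ring.
eapply Rle_trans. apply Cmod_triangle. rewrite Cmod_mult.
assert (T := Cmod_triangle (g w - g t - v * RtoC (w - t)) (v * RtoC (w - t))).
replace (g w - g t - v * RtoC (w - t) + v * RtoC (w - t)) with (g w - g t) in T by ring.
rewrite Cmod_mult, Cmod_R in T.
set (h := Rabs (w - t)) in *. assert (Hh : (0 <= h)%R) by apply Rabs_pos.
apply Rle_trans with (e1 * K * h)%R; [|apply Rmult_le_compat_r; auto].
assert (Q1 : (e1 * Cmod (g w - g t) <= e1 * ((1 + Cmod v) * h))%R).
{ apply Rmult_le_compat_l; nra. }
assert (Q2 : (Cmod l * Cmod (g w - g t - v * RtoC (w - t)) <= Cmod l * (e1 * h))%R).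
{ apply Rmult_le_compat_l; lra. }
unfold K. nra.
Qed.

Lemma Rder_affine a b t : Rder (fun s => a + RtoC s * b) t b.
Proof.
intros e He. exists 1%R. split. lra. intros s _.
replace (a + RtoC s * b - (a + RtoC t * b) - b * RtoC (s - t)) with (RtoC 0).
rewrite Cmod_0. apply Rmult_le_pos. lra. apply Rabs_pos.
rewrite RtoC_minus. ring.
Qed.

Lemma Rder_const a t : Rder (fun s => a) t 0.
Proof.
intros e He. exists 1%R. split. lra. intros s _.
replace (a - a - 0 * RtoC (s - t)) with (RtoC 0) by ring.
rewrite Cmod_0. apply Rmult_le_pos. lra. apply Rabs_pos.
Qed.

Lemma Rder_plus f g t a b : Rder f t a -> Rder g t b -> Rder (fun s => f s + g s) t (a + b).
Proof.
intros Hf Hg e He. assert (He2 : (0 < e / 2)%R) by lra.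
destruct (Hf _ He2) as [d1 [Hd1 H1]]. destruct (Hg _ He2) as [d2 [Hd2 H2]].
exists (Rmin d1 d2). split. apply Rmin_pos; auto. intros s Hs.
specialize (H1 s (Rlt_le_trans _ _ _ Hs (Rmin_l _ _))).
specialize (H2 s (Rlt_le_trans _ _ _ Hs (Rmin_r _ _))).
replace (f s + g s - (f t + g t) - (a + b) * RtoC (s - t)) with
 ((f s - f t - a * RtoC (s - t)) + (g s - g t - b * RtoC (s - t))) by ring.
eapply Rle_trans. apply Cmod_triangle. lra.
Qed.

Lemma Rder_scal c f t a : Rder f t a -> Rder (fun s => c * f s) t (c * a).
Proof.
intros H. apply (Rder_comp (fun w => c * w)); auto.
apply (Cder_eq _ _ (c * 1)). apply (Cder_scal c (fun w => w)). apply Cder_id. ring.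
Qed.

(** * The complex exponential *)

Definition Cexp (z : C) : C := (exp (Re z) * cos (Im z), exp (Re z) * sin (Im z))%R.

Lemma Cexp_plus z w : Cexp (z + w) = Cexp z * Cexp w.
Proof.
destruct z as [a b], w as [c d]. unfold Cexp. simpl. rewrite exp_plus, cos_plus, sin_plus.
apply injective_projections; simpl; ring.
Qed.
Lemma Cexp_0 : Cexp 0 = 1.
Proof. unfold Cexp. simpl. rewrite exp_0, cos_0, sin_0. apply injective_projections; simpl; ring. Qed.
Lemma Cmod_Cexp z : Cmod (Cexp z) = exp (Re z).
Proof.
unfold Cexp, Cmod. simpl.
replace (exp (Re z) * cos (Im z) * (exp (Re z) * cos (Im z) * 1) +
   exp (Re z) * sin (Im z) * (exp (Re z) * sin (Im z) * 1))%R with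
     (Rsqr (exp (Re z)) * (Rsqr (sin (Im z)) + Rsqr (cos (Im z))))%R.
rewrite sin2_cos2, Rmult_1_r. apply sqrt_Rsqr. left; apply exp_pos. unfold Rsqr; ring.
Qed.
Lemma Cexp_neq0 z : Cexp z <> RtoC 0.
Proof. apply Cmod_gt_0. rewrite Cmod_Cexp. apply exp_pos. Qed.

Lemma Cder_Cexp_0 : Cder Cexp 0 1.
Proof.
apply Cder_eps. intros e He.
assert (X : is_derive exp 0%R (exp 0)%R) by apply is_derive_exp. rewrite exp_0 in X.
assert (Yc : is_derive cos 0%R (- sin 0)%R) by apply is_derive_cos. rewrite sin_0, Ropp_0 in Yc.
assert (Ys : is_derive sin 0%R (cos 0)%R) by apply is_derive_sin. rewrite cos_0 in Ys.
(* The margin 1 bounds the factor [exp x] by 2; the margin [e / 8] controls the mixed term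
   [(exp x - 1) * y]. *)
assert (Xc : exists d : R, (0 < d)%R /\ forall s, (Rabs s < d -> Rabs (exp s - 1) < Rmin 1 (e / 8))%R).
{ assert (Cc : Rcont (fun s => RtoC (exp s)) 0%R).
  { apply (Rcont_pair exp (fun _ => 0%R)). apply (ex_derive_continuous (V:=R_NormedModule)). eexists; eauto.
    apply continuous_const. }
  assert (P8 : (0 < Rmin 1 (e / 8))%R) by (apply Rmin_pos; lra).
  destruct (proj1 (Rcont_eps _ _) Cc _ P8) as [d [Hd H]]. exists d; split; auto.
  intros s Hs. specialize (H s). rewrite Rminus_0_r in H. specialize (H Hs).
  rewrite <- RtoC_minus, Cmod_R, exp_0 in H. exact H. }
assert (E8 : (0 < e / 8)%R) by lra.
destruct (proj1 (is_derive_eps _ _ _) X _ E8) as [d1 [Hd1 H1]].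
destruct (proj1 (is_derive_eps _ _ _) Yc _ E8) as [d2 [Hd2 H2]].
destruct (proj1 (is_derive_eps _ _ _) Ys _ E8) as [d3 [Hd3 H3]].
destruct Xc as [d4 [Hd4 H4]].
exists (Rmin (Rmin d1 d2) (Rmin d3 d4)). split. repeat apply Rmin_pos; auto.
intros [x y] Hw. replace ((x, y) - 0) with ((x, y) : C) in * by (apply injective_projections; simpl; ring).
assert (Bx := re_le_Cmod (x, y)). assert (By := im_le_Cmod (x, y)). simpl in Bx, By.
assert (K1 : (Cmod (x, y) < d1)%R). { eapply Rlt_le_trans; [exact Hw|]. eapply Rle_trans; [apply Rmin_l|apply Rmin_l]. }
assert (K2 : (Cmod (x, y) < d2)%R). { eapply Rlt_le_trans; [exact Hw|]. eapply Rle_trans; [apply Rmin_l|apply Rmin_r]. }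
assert (K3 : (Cmod (x, y) < d3)%R). { eapply Rlt_le_trans; [exact Hw|]. eapply Rle_trans; [apply Rmin_r|apply Rmin_l]. }
assert (K4 : (Cmod (x, y) < d4)%R). { eapply Rlt_le_trans; [exact Hw|]. eapply Rle_trans; [apply Rmin_r|apply Rmin_r]. }
set (m := Cmod (x, y)) in *.
specialize (H1 x). specialize (H2 y). specialize (H3 y). specialize (H4 x).
rewrite Rminus_0_r in *. rewrite exp_0, cos_0, sin_0 in *.
specialize (H1 ltac:(lra)). specialize (H2 ltac:(lra)). specialize (H3 ltac:(lra)). specialize (H4 ltac:(lra)).
rewrite Cexp_0. eapply Rle_trans. apply Cmod_le_re_im. unfold Cexp. simpl.
replace (exp x * cos y + - (1) + - (1 * x - 0 * y))%R with ((exp x - 1 - 1 * x) + exp x * (cos y - 1 - 0 * y))%R by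
  ring.
replace (exp x * sin y + -0 + - (1 * y + 0 * x))%R with ((exp x) * (sin y - 0 - 1 * y) + (exp x - 1) * y)%R by ring.
assert (A4 : (Rabs (exp x - 1) < 1)%R) by (eapply Rlt_le_trans; [exact H4|apply Rmin_l]).
assert (A5 : (Rabs (exp x - 1) < e / 8)%R) by (eapply Rlt_le_trans; [exact H4|apply Rmin_r]).
assert (A6 : (Rabs (exp x) <= 2)%R). { replace (exp x) with ((exp x - 1) + 1)%R by ring. eapply Rle_trans.
  apply Rabs_triang. rewrite Rabs_R1. lra. }
assert (M0 : (0 <= m)%R) by apply Cmod_ge_0.
assert (T1 := Rabs_triang (exp x - 1 - 1 * x) (exp x * (cos y - 1 - 0 * y))).
assert (T2 := Rabs_triang (exp x * (sin y - 0 - 1 * y)) ((exp x - 1) * y)).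
rewrite (Rabs_mult (exp x)) in T1, T2. rewrite (Rabs_mult (exp x - 1)) in T2.
assert (S1 : (e / 8 * Rabs x <= e / 8 * m)%R) by (apply Rmult_le_compat_l; lra).
assert (S2 : (e / 8 * Rabs y <= e / 8 * m)%R) by (apply Rmult_le_compat_l; lra).
assert (P1 : (Rabs (exp x) * Rabs (cos y - 1 - 0 * y) <= 2 * (e / 8 * m))%R) by (apply Rmult_le_compat;
  try apply Rabs_pos; lra).
assert (P2 : (Rabs (exp x) * Rabs (sin y - 0 - 1 * y) <= 2 * (e / 8 * m))%R) by (apply Rmult_le_compat;
  try apply Rabs_pos; lra).
assert (P3 : (Rabs (exp x - 1) * Rabs y <= e / 8 * m)%R) by (apply Rmult_le_compat; try apply Rabs_pos; lra).
assert (0 <= e * m)%R by (apply Rmult_le_pos; lra). lra.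
Qed.

Lemma Cder_Cexp z : Cder Cexp z (Cexp z).
Proof.
apply (Cder_ext_loc (fun w => Cexp z * Cexp (w - z))).
{ exists 1%R. split. lra. intros w _. rewrite <- Cexp_plus. f_equal. ring. }
apply (Cder_eq _ _ (Cexp z * 1)). 2: ring.
apply (Cder_scal (Cexp z) (fun w => Cexp (w - z))).
apply (Cder_eq _ _ (1 * (1 - 0))). 2: ring.
apply (Cder_comp Cexp (fun w => w - z)).
replace (z - z) with (RtoC 0) by ring. apply Cder_Cexp_0.
apply Cder_minus. apply Cder_id. apply Cder_const.
Qed.

Lemma cis_Cexp th : cis th = Cexp (Ci * RtoC th).
Proof. unfold cis, Cexp. simpl. replace (0 * th - 1 * 0)%R with 0%R by ring. replace (0 * 0 + 1 * th)%R with th by ring.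
rewrite exp_0. apply injective_projections; simpl; ring. Qed.

Lemma Cmod_cis th : Cmod (cis th) = 1%R.
Proof. rewrite cis_Cexp, Cmod_Cexp. simpl. replace (0 * th - 1 * 0)%R with 0%R by ring. apply exp_0. Qed.

Lemma cis_neq0 th : cis th <> RtoC 0.
Proof. apply Cmod_gt_0. rewrite Cmod_cis. lra. Qed.

Lemma cis_plus a b : cis (a + b) = cis a * cis b.
Proof. rewrite !cis_Cexp, <- Cexp_plus. f_equal. rewrite RtoC_plus. ring. Qed.

Lemma cis_opp a : cis (- a) = Cconj (cis a).
Proof. unfold cis, Cconj. simpl. rewrite cos_neg, sin_neg. auto. Qed.

Lemma Rder_cis t : Rder cis t (Ci * cis t).
Proof.
replace (Ci * cis t) with ((- sin t, cos t)%R : C).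
2:{ unfold cis. apply injective_projections; simpl; ring. }
apply Rder_pair. apply is_derive_cos. apply is_derive_sin.
Qed.

(** * Line integrals, Goursat and Cauchy *)

Definition CInt (f : R -> C) (a b : R) : C := (RInt (fun t => Re (f t)) a b, RInt (fun t => Im (f t)) a b).

Lemma Rcont_ex_re f a b : (a <= b)%R -> (forall t, (a <= t <= b)%R -> Rcont f t) -> ex_RInt (fun t => Re (f t)) a b.
Proof.
intros Hab H. apply (ex_RInt_continuous (V:=R_CompleteNormedModule)). intros z Hz.
rewrite Rmin_left, Rmax_right in Hz by auto.
apply Rcont_re, H, Hz.
Qed.
Lemma Rcont_ex_im f a b : (a <= b)%R -> (forall t, (a <= t <= b)%R -> Rcont f t) -> ex_RInt (fun t => Im (f t)) a b.
Proof.
intros Hab H. apply (ex_RInt_continuous (V:=R_CompleteNormedModule)). intros z Hz.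
rewrite Rmin_left, Rmax_right in Hz by auto.
apply Rcont_im, H, Hz.
Qed.

Lemma CInt_bound f a b M : (a <= b)%R -> (forall t, (a <= t <= b)%R -> Rcont f t) ->
  (forall t, (a <= t <= b)%R -> Cmod (f t) <= M) -> Cmod (CInt f a b) <= (2 * M * (b - a))%R.
Proof.
intros Hab Hc HM. eapply Rle_trans. apply Cmod_le_re_im. simpl.
assert (H1 : (Rabs (RInt (fun t => Re (f t)) a b) <= M * (b - a))%R).
{ rewrite Rmult_comm. apply abs_RInt_le_const; auto. apply Rcont_ex_re; auto. intros t Ht. eapply Rle_trans.
  apply re_le_Cmod. auto. }
assert (H2 : (Rabs (RInt (fun t => Im (f t)) a b) <= M * (b - a))%R).
{ rewrite Rmult_comm. apply abs_RInt_le_const; auto. apply Rcont_ex_im; auto. intros t Ht. eapply Rle_trans.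
  apply im_le_Cmod. auto. }
lra.
Qed.

Lemma CInt_ext f g a b : (a <= b)%R -> (forall t, (a <= t <= b)%R -> f t = g t) -> CInt f a b = CInt g a b.
Proof.
intros Hab H. unfold CInt.
f_equal; apply RInt_ext; intros t Ht; rewrite Rmin_left, Rmax_right in Ht by auto; rewrite H; auto; lra.
Qed.

Lemma CInt_scal c f a b : (a <= b)%R -> (forall t, (a <= t <= b)%R -> Rcont f t) ->
  CInt (fun t => c * f t) a b = c * CInt f a b.
Proof.
intros Hab Hf. assert (E1 := Rcont_ex_re f a b Hab Hf). assert (E2 := Rcont_ex_im f a b Hab Hf).
unfold CInt. apply injective_projections; simpl.
- rewrite <- !(RInt_scal (V:=R_CompleteNormedModule)) by auto.
  rewrite <- (RInt_minus (V:=R_CompleteNormedModule)). reflexivity.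
  apply (ex_RInt_scal (V:=R_NormedModule)); auto. apply (ex_RInt_scal (V:=R_NormedModule)); auto.
- rewrite <- !(RInt_scal (V:=R_CompleteNormedModule)) by auto.
  rewrite <- (RInt_plus (V:=R_CompleteNormedModule)). reflexivity.
  apply (ex_RInt_scal (V:=R_NormedModule)); auto. apply (ex_RInt_scal (V:=R_NormedModule)); auto.
Qed.

Lemma CInt_minus f g a b : (a <= b)%R -> (forall t, (a <= t <= b)%R -> Rcont f t) -> (forall t, (a <= t <= b)%R ->
  Rcont g t) ->
  CInt (fun t => f t - g t) a b = CInt f a b - CInt g a b.
Proof.
intros Hab Hf Hg. unfold CInt, Cminus, Cplus. simpl.
apply injective_projections; simpl.
- apply (RInt_minus (V:=R_CompleteNormedModule)); apply Rcont_ex_re; auto.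
- apply (RInt_minus (V:=R_CompleteNormedModule)); apply Rcont_ex_im; auto.
Qed.

Lemma CInt_Chasles f a b c : (a <= b <= c)%R -> (forall t, (a <= t <= c)%R -> Rcont f t) ->
  CInt f a b + CInt f b c = CInt f a c.
Proof.
intros Hab Hf. unfold CInt. apply injective_projections; simpl.
- apply (RInt_Chasles (V:=R_CompleteNormedModule)); apply Rcont_ex_re; try lra; intros; apply Hf; lra.
- apply (RInt_Chasles (V:=R_CompleteNormedModule)); apply Rcont_ex_im; try lra; intros; apply Hf; lra.
Qed.

Lemma CInt_FTC g g' a b : (a <= b)%R -> (forall t, (a <= t <= b)%R -> Rder g t (g' t)) ->
  (forall t, (a <= t <= b)%R -> Rcont g' t) -> CInt g' a b = g b - g a.
Proof.
intros Hab Hd Hc. unfold CInt. apply injective_projections; simpl.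
- apply (is_RInt_unique (V:=R_CompleteNormedModule)).
  apply (is_RInt_derive (V:=R_CompleteNormedModule) (fun t => Re (g t)) (fun t => Re (g' t))); intros t Ht;
    rewrite Rmin_left, Rmax_right in Ht by auto.
  apply Rder_re; auto. apply Rcont_re; auto.
- apply (is_RInt_unique (V:=R_CompleteNormedModule)).
  apply (is_RInt_derive (V:=R_CompleteNormedModule) (fun t => Im (g t)) (fun t => Im (g' t))); intros t Ht;
    rewrite Rmin_left, Rmax_right in Ht by auto.
  apply Rder_im; auto. apply Rcont_im; auto.
Qed.

Lemma CInt_const c a b : (a <= b)%R -> CInt (fun _ => c) a b = c * RtoC (b - a).
Proof.
intros Hab. rewrite (CInt_FTC (fun t => 0 + RtoC t * c)); auto.
- rewrite RtoC_minus. ring.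
- intros; apply Rder_affine.
- intros. apply climit_const, locally_filter.
Qed.

Ltac cder := lazymatch goal with
  | |- Cder (fun w => w) _ _ => apply Cder_id
  | |- Cder (fun _ => ?a) _ _ => apply (Cder_const a)
  | |- Cder (fun w => @?f w + @?g w) _ _ => eapply (Cder_plus f g); [cder|cder]
  | |- Cder (fun w => @?f w - @?g w) _ _ => eapply (Cder_minus f g); [cder|cder]
  | |- Cder (fun w => @?f w * @?g w) _ _ => eapply (Cder_mult f g); [cder|cder]
  | |- Cder (fun w => @?f w / @?g w) _ _ => eapply (Cder_div f g); [cder|cder|]
  | |- Cder (fun w => / @?g w) _ _ => eapply (Cder_inv g); [cder|]
  | |- Cder (fun w => - @?g w) _ _ => eapply (Cder_opp g); cder
  | |- Cder (fun w => Cexp (@?g w)) _ _ => eapply (Cder_comp Cexp g); [apply Cder_Cexp|cder]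
  | |- _ => try eassumption
  end.

Lemma nested_intervals (u v : nat -> R) :
  (forall n, u n <= v n)%R -> (forall n, u n <= u (S n))%R -> (forall n, v (S n) <= v n)%R ->
  exists x : R, forall n, (u n <= x <= v n)%R.
Proof.
intros H1 H2 H3.
assert (M : forall n m, (n <= m)%nat -> (u n <= u m)%R).
{ intros n m Hnm. induction Hnm. lra. specialize (H2 m). lra. }
assert (N : forall n m, (n <= m)%nat -> (v m <= v n)%R).
{ intros n m Hnm. induction Hnm. lra. specialize (H3 m). lra. }
assert (UV : forall n m, (u n <= v m)%R).
{ intros n m. specialize (M n (max n m) ltac:(lia)). specialize (N m (max n m) ltac:(lia)).
  specialize (H1 (max n m)). lra. }
destruct (completeness (fun r => exists n, r = u n)) as [x [Hx1 Hx2]].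
{ exists (v 0%nat). intros r [n ->]. apply UV. }
{ exists (u 0%nat). exists 0%nat; auto. }
exists x. intros n. split. apply Hx1. exists n; auto.
apply Hx2. intros r [m ->]. apply UV.
Qed.

(** A rectangle on which [P] fails has a quarter on which it fails. Repeating this yields nested
    failing rectangles shrinking to a point, where the local hypothesis contradicts their
    failure. *)
Lemma bisection2 (P : R -> R -> R -> R -> Prop) (a b c d : R) :
  (a <= b)%R -> (c <= d)%R ->
  (forall a b c d : R, (a <= b)%R -> (c <= d)%R ->
     P a ((a + b) / 2)%R c ((c + d) / 2)%R -> P ((a + b) / 2)%R b c ((c + d) / 2)%R ->
     P a ((a + b) / 2)%R ((c + d) / 2)%R d -> P ((a + b) / 2)%R b ((c + d) / 2)%R d -> P a b c d) ->
  (forall x y : R, (a <= x <= b)%R -> (c <= y <= d)%R -> exists e : R, (0 < e)%R /\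
     forall a' b' c' d' : R, (a <= a' <= x)%R -> (x <= b' <= b)%R -> (c <= c' <= y)%R -> (y <= d' <= d)%R ->
       (b' - a' < e)%R -> (d' - c' < e)%R -> P a' b' c' d') ->
  P a b c d.
Proof.
intros Hab Hcd Hsplit Hloc. apply NNPP. intros HN.
set (bad := fun r : R * R * (R * R) => let '((a', b'), (c', d')) := r in
  (a' <= b')%R /\ (c' <= d')%R /\ ~ P a' b' c' d').
set (quarter := fun r s : R * R * (R * R) => let '((a', b'), (c', d')) := r in let '((a2, b2), (c2, d2)) := s in
  (a' <= a2)%R /\ (b2 <= b')%R /\ (c' <= c2)%R /\ (d2 <= d')%R /\ (b2 - a2 = (b' - a') / 2)%R /\
    (d2 - c2 = (d' - c') / 2)%R).
assert (Hstep : forall r, bad r -> exists s, bad s /\ quarter r s).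
{ intros [[a' b'] [c' d']] [Ha [Hc Hn]].
  set (m := ((a' + b') / 2)%R). set (n := ((c' + d') / 2)%R).
  assert (Hm : (a' <= m <= b')%R) by (unfold m; lra). assert (Hn' : (c' <= n <= d')%R) by (unfold n; lra).
  destruct (classic (P a' m c' n)) as [P1|P1].
  2:{ exists ((a', m), (c', n)). simpl. repeat split; try lra; auto; unfold m, n; lra. }
  destruct (classic (P m b' c' n)) as [P2|P2].
  2:{ exists ((m, b'), (c', n)). simpl. repeat split; try lra; auto; unfold m, n; lra. }
  destruct (classic (P a' m n d')) as [P3|P3].
  2:{ exists ((a', m), (n, d')). simpl. repeat split; try lra; auto; unfold m, n; lra. }
  destruct (classic (P m b' n d')) as [P4|P4].
  2:{ exists ((m, b'), (n, d')). simpl. repeat split; try lra; auto; unfold m, n; lra. }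
  exfalso. apply Hn. apply Hsplit; auto. }
assert (B0 : bad ((a, b), (c, d))) by (simpl; auto).
set (next := fun r : {r | bad r} =>
  let H := constructive_indefinite_description _ (Hstep (proj1_sig r) (proj2_sig r)) in
  exist bad (proj1_sig H) (proj1 (proj2_sig H))).
assert (Hnext : forall r, quarter (proj1_sig r) (proj1_sig (next r))).
{ intros r. unfold next. simpl.
  apply (proj2 (proj2_sig (constructive_indefinite_description _ (Hstep (proj1_sig r) (proj2_sig r))))). }
set (seq := fun n => nat_rect (fun _ => {r | bad r}) (exist bad _ B0) (fun _ => next) n).
set (sa := fun n => fst (fst (proj1_sig (seq n)))). set (sb := fun n => snd (fst (proj1_sig (seq n)))).
set (sc := fun n => fst (snd (proj1_sig (seq n)))). set (sd := fun n => snd (snd (proj1_sig (seq n)))).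
assert (Hq : forall n, (sa n <= sa (S n) /\ sb (S n) <= sb n /\ sc n <= sc (S n) /\ sd (S n) <= sd n
   /\ sb (S n) - sa (S n) = (sb n - sa n) / 2 /\ sd (S n) - sc (S n) = (sd n - sc n) / 2)%R).
{ intros n. assert (Q := Hnext (seq n)). unfold sa, sb, sc, sd. simpl (seq (S n)).
  destruct (proj1_sig (seq n)) as [[a1 b1] [c1 d1]]. destruct (proj1_sig (next (seq n))) as [[a2 b2] [c2 d2]].
  simpl in Q. simpl. tauto. }
assert (Hbad : forall n, (sa n <= sb n)%R /\ (sc n <= sd n)%R /\ ~ P (sa n) (sb n) (sc n) (sd n)).
{ intros n. assert (Q := proj2_sig (seq n)). unfold sa, sb, sc, sd.
  destruct (proj1_sig (seq n)) as [[a1 b1] [c1 d1]]. simpl in *. tauto. }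
destruct (nested_intervals sa sb) as [x Hx]. apply Hbad. apply Hq. intros n; apply Hq.
destruct (nested_intervals sc sd) as [y Hy]. apply Hbad. intros n; apply Hq. intros n; apply Hq.
assert (Wab : forall n, (sb n - sa n = (b - a) * (/ 2) ^ n)%R).
{ induction n. simpl. unfold sa, sb; simpl. ring. destruct (Hq n) as (_ & _ & _ & _ & E & _). rewrite E, IHn. simpl.
  field. }
assert (Wcd : forall n, (sd n - sc n = (d - c) * (/ 2) ^ n)%R).
{ induction n. simpl. unfold sc, sd; simpl. ring. destruct (Hq n) as (_ & _ & _ & _ & _ & E). rewrite E, IHn. simpl.
  field. }
assert (Ina : forall n, (a <= sa n)%R). { induction n. unfold sa; simpl; lra. destruct (Hq n). lra. }
assert (Inb : forall n, (sb n <= b)%R). { induction n. unfold sb; simpl; lra. destruct (Hq n). lra. }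
assert (Inc : forall n, (c <= sc n)%R). { induction n. unfold sc; simpl; lra. destruct (Hq n). lra. }
assert (Ind : forall n, (sd n <= d)%R). { induction n. unfold sd; simpl; lra. destruct (Hq n). lra. }
destruct (Hloc x y) as [e [He Hl]]. apply (Hx 0%nat). apply (Hy 0%nat).
assert (Hpow : exists n, ((b - a + (d - c)) * (/ 2) ^ n < e)%R).
{ destruct (pow_lt_1_zero (/ 2)) with (y := (e / (1 + (b - a + (d - c))))%R) as [n Hn].
  rewrite Rabs_right; lra. apply Rdiv_lt_0_compat; lra.
  exists n. specialize (Hn n (le_n n)). rewrite Rabs_right in Hn by (apply Rle_ge, pow_le; lra).
  apply (Rmult_lt_compat_r (1 + (b - a + (d - c)))) in Hn; [|lra].
  unfold Rdiv in Hn. rewrite Rmult_assoc, Rinv_l, Rmult_1_r in Hn by lra.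
  assert (0 <= (/ 2) ^ n)%R by (apply pow_le; lra). nra. }
destruct Hpow as [n Hn].
assert (0 <= (/ 2) ^ n)%R by (apply pow_le; lra).
apply (Hbad n).
apply Hl; try (specialize (Hx n); specialize (Hy n); specialize (Ina n); specialize (Inb n); specialize (Inc n);
  specialize (Ind n); lra).
rewrite Wab. nra. rewrite Wcd. nra.
Qed.

(** The linear approximation of [f] has a quadratic primitive, so its integral is a difference of
    end values, which cancel around a closed contour; only the integral of the error is left to
    estimate. *)
Lemma line_estimate (f : C -> C) (g g' : R -> C) (u v : R) (z0 f0 l : C) (M : R) :
  (u <= v)%R ->
  (forall t, (u <= t <= v)%R -> Rder g t (g' t)) ->
  (forall t, (u <= t <= v)%R -> Rcont g' t) ->
  (forall t, (u <= t <= v)%R -> Rcont (fun s => f (g s)) t) ->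
  (forall t, (u <= t <= v)%R -> Cmod ((f (g t) - f0 - l * (g t - z0)) * g' t) <= M) ->
  Cmod (CInt (fun t => f (g t) * g' t) u v -
    ((f0 * g v + l * ((g v - z0) * (g v - z0) * / 2)) - (f0 * g u + l * ((g u - z0) * (g u - z0) * / 2))))
  <= (2 * M * (v - u))%R.
Proof.
intros Huv Hd Hc Hf HM.
assert (Hlf : forall t, Filter (locally (T:=R_UniformSpace) t)) by (intros; apply locally_filter).
rewrite <- (CInt_FTC (fun t => f0 * g t + l * ((g t - z0) * (g t - z0) * / 2)) (fun t => (f0 +
  l * (g t - z0)) * g' t)); auto.
- assert (Hlin : forall t, (u <= t <= v)%R -> Rcont (fun t => (f0 + l * (g t - z0)) * g' t) t).
  { intros t Ht. assert (Rcont g t) by (eapply Rder_Rcont; eauto).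
   apply climit_mult; auto. 2: apply Hc; auto. apply climit_plus; auto. apply climit_const; auto.
   apply climit_mult; auto. apply climit_const; auto.
   apply climit_minus; auto. apply climit_const; auto. }
  rewrite <- CInt_minus; auto.
  2:{ intros t Ht. apply climit_mult; auto. apply (Hf t Ht). apply (Hc t Ht). }
  apply CInt_bound; auto.
  + intros t Ht. apply climit_minus; auto. apply climit_mult; auto. apply (Hf t Ht). apply (Hc t Ht). apply (Hlin t Ht).
  + intros t Ht. specialize (HM t Ht).
    replace (f (g t) * g' t - (f0 + l * (g t - z0)) * g' t) with ((f (g t) - f0 - l * (g t - z0)) * g' t) by ring. auto.
- intros t Ht. apply (Rder_comp (fun z => f0 * z + l * ((z - z0) * (z - z0) * / 2))). 2: apply Hd; auto.
  eapply Cder_eq. cder. field.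
- intros t Ht. assert (Rcont g t) by (eapply Rder_Rcont; eauto).
   apply climit_mult; auto. 2: apply Hc; auto. apply climit_plus; auto. apply climit_const; auto.
   apply climit_mult; auto. apply climit_const; auto.
   apply climit_minus; auto. apply climit_const; auto.
Qed.

(** The subdivision takes place in the parameter rectangle and not in its image. One statement then
    serves both for triangles, seen as cones over a segment, and for the deformation of one circle
    into another. *)
Lemma goursat (f : C -> C) (Psi Px Py : R -> R -> C) (a b c d L : R) :
  (a <= b)%R -> (c <= d)%R -> (0 < L)%R ->
  (forall x y, (a <= x <= b)%R -> (c <= y <= d)%R -> Rder (fun s => Psi s y) x (Px x y)) ->
  (forall x y, (a <= x <= b)%R -> (c <= y <= d)%R -> Rder (fun s => Psi x s) y (Py x y)) ->
  (forall x y, (a <= x <= b)%R -> (c <= y <= d)%R -> Rcont (fun s => Px s y) x) ->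
  (forall x y, (a <= x <= b)%R -> (c <= y <= d)%R -> Rcont (fun s => Py x s) y) ->
  (forall x y, (a <= x <= b)%R -> (c <= y <= d)%R -> Cmod (Px x y) <= L) ->
  (forall x y, (a <= x <= b)%R -> (c <= y <= d)%R -> Cmod (Py x y) <= L) ->
  (forall x y x' y', (a <= x <= b)%R -> (c <= y <= d)%R -> (a <= x' <= b)%R -> (c <= y' <= d)%R ->
     Cmod (Psi x y - Psi x' y') <= (L * (Rabs (x - x') + Rabs (y - y')))%R) ->
  (forall x y, (a <= x <= b)%R -> (c <= y <= d)%R -> C_differentiable f (Psi x y)) ->
  CInt (fun s => f (Psi s c) * Px s c) a b + CInt (fun s => f (Psi b s) * Py b s) c d
  - CInt (fun s => f (Psi s d) * Px s d) a b - CInt (fun s => f (Psi a s) * Py a s) c d = 0.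
Proof.
intros Hab Hcd HL Dx Dy Cx Cy Bx By Lip Df.
assert (Hlf : forall t, Filter (locally (T:=R_UniformSpace) t)) by (intros; apply locally_filter).
set (Phi := fun a b c d => CInt (fun s => f (Psi s c) * Px s c) a b + CInt (fun s => f (Psi b s) * Py b s) c d
  - CInt (fun s => f (Psi s d) * Px s d) a b - CInt (fun s => f (Psi a s) * Py a s) c d).
change (Phi a b c d = 0).
assert (fx : forall x y, (a <= x <= b)%R -> (c <= y <= d)%R -> Rcont (fun s => f (Psi s y)) x).
{ intros x y Hx Hy. apply (Rcont_comp f (fun s => Psi s y)).
  apply Cder_Ccont with (l := C_derive f (Psi x y)). apply Cder_differentiable; auto. eapply Rder_Rcont; eauto. }
assert (fy : forall x y, (a <= x <= b)%R -> (c <= y <= d)%R -> Rcont (fun s => f (Psi x s)) y).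
{ intros x y Hx Hy. apply (Rcont_comp f (fun s => Psi x s)).
  apply Cder_Ccont with (l := C_derive f (Psi x y)). apply Cder_differentiable; auto. eapply Rder_Rcont; eauto. }
assert (gx : forall x y, (a <= x <= b)%R -> (c <= y <= d)%R -> Rcont (fun s => f (Psi s y) * Px s y) x).
{ intros x y Hx Hy. apply climit_mult; auto. apply (fx x y Hx Hy). apply (Cx x y Hx Hy). }
assert (gy : forall x y, (a <= x <= b)%R -> (c <= y <= d)%R -> Rcont (fun s => f (Psi x s) * Py x s) y).
{ intros x y Hx Hy. apply climit_mult; auto. apply (fy x y Hx Hy). apply (Cy x y Hx Hy). }
(* The bound is compatible with quartering: a quarter has half the sum of side lengths, so its bound
   is a fourth of that of the whole. *)
assert (Key : forall e, (0 < e)%R -> (Cmod (Phi a b c d) <= e * ((b - a) + (d - c)) * ((b - a) + (d - c)))%R).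
{ intros e He.
  cut ((a <= a)%R -> (b <= b)%R -> (c <= c)%R -> (d <= d)%R ->
    (Cmod (Phi a b c d) <= e * ((b - a) + (d - c)) * ((b - a) + (d - c)))%R).
  { intros H; apply H; lra. }
  apply (bisection2 (fun a' b' c' d' => (a <= a')%R -> (b' <= b)%R -> (c <= c')%R -> (d' <= d)%R ->
    (Cmod (Phi a' b' c' d') <= e * ((b' - a') + (d' - c')) * ((b' - a') + (d' - c')))%R)); auto.
  - intros a' b' c' d' Ha' Hc' P1 P2 P3 P4 A1 A2 A3 A4.
    set (m := ((a' + b') / 2)%R) in *. set (n := ((c' + d') / 2)%R) in *.
    assert (Hm : (a' <= m <= b')%R) by (unfold m; lra). assert (Hn' : (c' <= n <= d')%R) by (unfold n; lra).
    assert (E : Phi a' b' c' d' = (Phi a' m c' n + Phi m b' c' n) + (Phi a' m n d' + Phi m b' n d')).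
    { unfold Phi.
      rewrite <- (CInt_Chasles (fun s => f (Psi s c') * Px s c') a' m b'); [|lra|intros; apply gx; lra].
      rewrite <- (CInt_Chasles (fun s => f (Psi s d') * Px s d') a' m b'); [|lra|intros; apply gx; lra].
      rewrite <- (CInt_Chasles (fun s => f (Psi b' s) * Py b' s) c' n d'); [|lra|intros; apply gy; lra].
      rewrite <- (CInt_Chasles (fun s => f (Psi a' s) * Py a' s) c' n d'); [|lra|intros; apply gy; lra].
      ring. }
    rewrite E. specialize (P1 ltac:(lra) ltac:(lra) ltac:(lra) ltac:(lra)).
    specialize (P2 ltac:(lra) ltac:(lra) ltac:(lra) ltac:(lra)).
    specialize (P3 ltac:(lra) ltac:(lra) ltac:(lra) ltac:(lra)).
    specialize (P4 ltac:(lra) ltac:(lra) ltac:(lra) ltac:(lra)).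
    eapply Rle_trans. apply Cmod_triangle.
    assert (T1 := Cmod_triangle (Phi a' m c' n) (Phi m b' c' n)).
    assert (T2 := Cmod_triangle (Phi a' m n d') (Phi m b' n d')).
    replace (m - a')%R with ((b' - a') / 2)%R in * by (unfold m; field).
    replace (b' - m)%R with ((b' - a') / 2)%R in * by (unfold m; field).
    replace (n - c')%R with ((d' - c') / 2)%R in * by (unfold n; field).
    replace (d' - n)%R with ((d' - c') / 2)%R in * by (unfold n; field).
    replace (e * (b' - a' + (d' - c')) * (b' - a' + (d' - c')))%R with
     (4 * (e * ((b' - a') / 2 + (d' - c') / 2) * ((b' - a') / 2 + (d' - c') / 2)))%R by field. lra.
  - intros x y Hx Hy.
    assert (LL : (0 < L * L)%R) by nra.
    (* Each side contributes at most [2 * (e1 * L * L * sg)] times its length, and the four lengths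
       add up to [2 * sg]. *)
    set (e1 := (e / (4 * (L * L)))%R). assert (He1 : (0 < e1)%R) by (apply Rdiv_lt_0_compat; lra).
    assert (E1 : (4 * (e1 * L * L) = e)%R) by (unfold e1; field; lra).
    set (l := C_derive f (Psi x y)). set (z0 := Psi x y).
    destruct (proj1 (Cder_eps f z0 l) (Cder_differentiable _ _ (Df x y Hx Hy)) e1 He1) as [r [Hr Hf]].
    exists (r / (2 * L))%R. split. apply Rdiv_lt_0_compat; lra.
    intros a' b' c' d' A1 A2 A3 A4 S1 S2 A5 A6 A7 A8.
    set (sg := ((b' - a') + (d' - c'))%R).
    assert (Hsg : (L * sg < r)%R).
    { unfold sg. apply Rle_lt_trans with (L * (2 * Rmax (b' - a') (d' - c')))%R.
      apply Rmult_le_compat_l; try lra. assert (J1 := Rmax_l (b' - a') (d' - c')).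
      assert (J2 := Rmax_r (b' - a') (d' - c')). lra.
      apply Rlt_le_trans with (L * (2 * (r / (2 * L))))%R. apply Rmult_lt_compat_l; auto. apply Rmult_lt_compat_l. lra.
      apply Rmax_lub_lt; auto.
      right; field; lra. }
    assert (Hnear : forall s t, (a' <= s <= b')%R -> (c' <= t <= d')%R ->
      (Cmod (f (Psi s t) - f z0 - l * (Psi s t - z0)) <= e1 * (L * sg))%R).
    { intros s t Hs Ht. assert (D : (Cmod (Psi s t - z0) <= L * sg)%R).
      { unfold z0. eapply Rle_trans. apply Lip; lra. apply Rmult_le_compat_l; try lra. unfold sg.
        apply Rplus_le_compat; apply Rabs_le; lra. }
      eapply Rle_trans. apply Hf. lra. apply Rmult_le_compat_l; lra. }
    assert (Hb : forall p q : C, (Cmod p <= e1 * (L * sg))%R -> (Cmod q <= L)%R -> (Cmod (p * q) <= e1 * L * L * sg)%R).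
    { intros p q Hp Hq. rewrite Cmod_mult. replace (e1 * L * L * sg)%R with (e1 * (L * sg) * L)%R by ring.
      apply Rmult_le_compat; auto; apply Cmod_ge_0. }
    assert (I1 := line_estimate f (fun s => Psi s c') (fun s => Px s c') a' b' z0 (f z0) l (e1 * L * L * sg) ltac:(lra)
      ltac:(intros; apply Dx; lra) ltac:(intros; apply Cx; lra) ltac:(intros; apply fx; lra) ltac:(intros; apply Hb;
        [apply Hnear|apply Bx]; lra)).
    assert (I2 := line_estimate f (fun s => Psi b' s) (fun s => Py b' s) c' d' z0 (f z0) l (e1 * L * L * sg) ltac:(lra)
      ltac:(intros; apply Dy; lra) ltac:(intros; apply Cy; lra) ltac:(intros; apply fy; lra) ltac:(intros; apply Hb;
        [apply Hnear|apply By]; lra)).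
    assert (I3 := line_estimate f (fun s => Psi s d') (fun s => Px s d') a' b' z0 (f z0) l (e1 * L * L * sg) ltac:(lra)
      ltac:(intros; apply Dx; lra) ltac:(intros; apply Cx; lra) ltac:(intros; apply fx; lra) ltac:(intros; apply Hb;
        [apply Hnear|apply Bx]; lra)).
    assert (I4 := line_estimate f (fun s => Psi a' s) (fun s => Py a' s) c' d' z0 (f z0) l (e1 * L * L * sg) ltac:(lra)
      ltac:(intros; apply Dy; lra) ltac:(intros; apply Cy; lra) ltac:(intros; apply fy; lra) ltac:(intros; apply Hb;
        [apply Hnear|apply By]; lra)).
    cbv beta in I1, I2, I3, I4.
    match type of I1 with (Cmod ?x <= _)%R => set (J1 := x) in * end.
    match type of I2 with (Cmod ?x <= _)%R => set (J2 := x) in * end.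
    match type of I3 with (Cmod ?x <= _)%R => set (J3 := x) in * end.
    match type of I4 with (Cmod ?x <= _)%R => set (J4 := x) in * end.
    replace (Phi a' b' c' d') with ((J1 + J2) + ((- J3) + (- J4))).
    2:{ unfold J1, J2, J3, J4, Phi. ring. }
    eapply Rle_trans. apply Cmod_triangle.
    assert (T1 := Cmod_triangle J1 J2). assert (T2 := Cmod_triangle (-J3) (-J4)). rewrite !Cmod_opp in T2.
    fold sg. rewrite <- E1.
    replace (4 * (e1 * L * L) * sg * sg)%R with (4 * (e1 * L * L * sg) * ((b' - a') + (d' - c')))%R by (unfold sg;
      ring).
    lra. }
apply Cmod_eq_0. apply Rle_antisym; [|apply Cmod_ge_0].
set (S := ((b - a + (d - c)) * (b - a + (d - c)))%R).
assert (0 <= S)%R by (unfold S; nra).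
destruct (Rle_or_lt (Cmod (Phi a b c d)) 0) as [|Hp]; auto.
assert (He : (0 < Cmod (Phi a b c d) / (2 * (1 + S)))%R) by (apply Rdiv_lt_0_compat; lra).
specialize (Key _ He). rewrite Rmult_assoc in Key. fold S in Key.
assert (Cmod (Phi a b c d) / (2 * (1 + S)) * S < Cmod (Phi a b c d))%R.
{ apply Rlt_le_trans with (Cmod (Phi a b c d) / (2 * (1 + S)) * (2 * (1 + S)))%R.
  apply Rmult_lt_compat_l; lra. right; field; lra. }
lra.
Qed.

Lemma Rcont_const a t : Rcont (fun _ => a) t.
Proof. apply climit_const, locally_filter. Qed.
Lemma Rcont_plus f g t : Rcont f t -> Rcont g t -> Rcont (fun s => f s + g s) t.
Proof. intros; apply (climit_plus _ f g); auto; apply locally_filter. Qed.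
Lemma Rcont_minus f g t : Rcont f t -> Rcont g t -> Rcont (fun s => f s - g s) t.
Proof. intros; apply (climit_minus _ f g); auto; apply locally_filter. Qed.
Lemma Rcont_mult f g t : Rcont f t -> Rcont g t -> Rcont (fun s => f s * g s) t.
Proof. intros; apply (climit_mult _ f g); auto; apply locally_filter. Qed.
Lemma Rcont_inv f t : f t <> RtoC 0 -> Rcont f t -> Rcont (fun s => / f s) t.
Proof. intros; apply (climit_inv _ f); auto; apply locally_filter. Qed.
Lemma Rcont_div f g t : g t <> RtoC 0 -> Rcont f t -> Rcont g t -> Rcont (fun s => f s / g s) t.
Proof. intros. apply (Rcont_mult f (fun s => / g s)); auto. apply Rcont_inv; auto. Qed.
Lemma Rcont_RtoC t : Rcont RtoC t.
Proof. apply (Rcont_pair (fun s => s) (fun _ => 0%R)). apply continuous_id. apply continuous_const. Qed.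
Lemma Rcont_cis t : Rcont cis t.
Proof. eapply Rder_Rcont, Rder_cis. Qed.
Lemma Rcont_diff f g t : C_differentiable f (g t) -> Rcont g t -> Rcont (fun s => f (g s)) t.
Proof. intros H1 H2. apply (Rcont_comp f g); auto. eapply Cder_Ccont, Cder_differentiable, H1. Qed.

Ltac rcont := lazymatch goal with
  | |- Rcont (fun _ => ?a) _ => apply (Rcont_const a)
  | |- Rcont RtoC _ => apply Rcont_RtoC
  | |- Rcont (fun s => RtoC s) _ => apply Rcont_RtoC
  | |- Rcont (fun s => cis s) _ => apply Rcont_cis
  | |- Rcont (fun w => @?f w + @?g w) _ => apply (Rcont_plus f g); [rcont|rcont]
  | |- Rcont (fun w => @?f w - @?g w) _ => apply (Rcont_minus f g); [rcont|rcont]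
  | |- Rcont (fun w => @?f w * @?g w) _ => apply (Rcont_mult f g); [rcont|rcont]
  | |- Rcont (fun w => @?f w / @?g w) _ => apply (Rcont_div f g); [|rcont|rcont]
  | |- Rcont (fun w => / @?g w) _ => apply (Rcont_inv g); [|rcont]
  | |- _ => try assumption
  end.

Definition segment_integral (f : C -> C) (z w : C) : C := (w - z) * CInt (fun t => f (z + RtoC t * (w - z))) 0 1.
Definition convexC (D : C -> Prop) : Prop :=
  forall z w, D z -> D w -> forall t, (0 <= t <= 1)%R -> D (z + RtoC t * (w - z)).
Definition openC (D : C -> Prop) : Prop :=
  forall z, D z -> exists d : R, (0 < d)%R /\ forall w, Cmod (w - z) < d -> D w.

Lemma Cmod_RtoC_pos (r : R) : (0 <= r)%R -> Cmod (RtoC r) = r.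
Proof. intros H. rewrite Cmod_R. apply Rabs_right. lra. Qed.

Lemma Cmod_minus_sym (z w : C) : Cmod (z - w) = Cmod (w - z).
Proof. rewrite <- Cmod_opp. f_equal. ring. Qed.

(** The triangle is the cone with tip [c] over the segment from [z] to [w]. One side of the
    parameter rectangle collapses to the tip and contributes nothing; the other three are the sides
    of the triangle. *)
Lemma segment_integral_add (D : C -> Prop) f c z w : convexC D -> (forall z, D z -> C_differentiable f z) ->
  D c -> D z -> D w -> segment_integral f c z + segment_integral f z w = segment_integral f c w.
Proof.
intros HD Hf Hc Hz Hw.
assert (A1 := Cmod_ge_0 (z - c)). assert (A2 := Cmod_ge_0 (w - z)).
assert (In : forall x y, (0 <= x <= 1)%R -> (0 <= y <= 1)%R -> D (c + RtoC x * ((z + RtoC y * (w - z)) - c))).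
{ intros x y Hx Hy. apply HD; auto. }
assert (B : forall y, (0 <= y <= 1)%R -> Cmod ((z - c) + RtoC y * (w - z)) <= (1 + Cmod (z - c) + Cmod (w - z))%R).
{ intros y Hy. eapply Rle_trans. apply Cmod_triangle. rewrite Cmod_mult, Cmod_RtoC_pos by lra. nra. }
assert (G := goursat f (fun x y => c + RtoC x * ((z - c) + RtoC y * (w - z))) (fun x y => (z - c) + RtoC y * (w - z))
  (fun x y => RtoC x * (w - z)) 0 1 0 1 (1 + Cmod (z - c) + Cmod (w - z))).
cbv beta in G.
specialize (G ltac:(lra) ltac:(lra) ltac:(lra)).
assert (In' : forall x y, (0 <= x <= 1)%R -> (0 <= y <= 1)%R -> D (c + RtoC x * ((z - c) + RtoC y * (w - z)))).
{ intros x y Hx Hy. specialize (In x y Hx Hy).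
  match goal with |- D ?a => match type of In with D ?b => replace a with b by ring; auto end end. }
assert (G' := fun h1 h2 h3 h4 h5 h6 h7 h8 => G h1 h2 h3 h4 h5 h6 h7 h8). clear G.
assert (Hseg : forall a b, D a -> D b -> forall t, (0 <= t <= 1)%R -> Rcont (fun t => f (a + RtoC t * (b - a))) t).
{ intros a b Ha Hb t Ht. apply (Rcont_diff f (fun t => a + RtoC t * (b - a))). apply Hf, HD; auto. rcont. }
match type of G' with _ -> _ -> _ -> _ -> _ -> _ -> _ -> _ -> ?x = _ => assert (E : x = 0) end.
{ apply G'.
  - intros. apply Rder_affine.
  - intros x y _ _. rewrite <- (Cplus_0_l (RtoC x * (w - z))).
    apply (Rder_plus (fun _ => c) (fun s => RtoC x * ((z - c) + RtoC s * (w - z)))). apply Rder_const.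
    apply (Rder_scal (RtoC x) (fun s => (z - c) + RtoC s * (w - z))). apply Rder_affine.
  - intros. rcont.
  - intros. rcont.
  - intros; apply B; auto.
  - intros x y Hx Hy. rewrite Cmod_mult, Cmod_RtoC_pos by lra. nra.
  - intros x y x' y' Hx Hy Hx' Hy'.
    replace (c + RtoC x * (z - c + RtoC y * (w - z)) - (c + RtoC x' * (z - c + RtoC y' * (w - z)))) with
     (RtoC (x - x') * (z - c + RtoC y * (w - z)) + RtoC (y - y') * (RtoC x' * (w - z))) by (rewrite !RtoC_minus; ring).
    eapply Rle_trans. apply Cmod_triangle. rewrite !Cmod_mult, (Cmod_RtoC_pos x') by lra. rewrite !Cmod_R.
    specialize (B y Hy). assert (J1 := Rabs_pos (x - x')). assert (J2 := Rabs_pos (y - y')).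
    assert (Rabs (x - x') * Cmod (z - c + RtoC y * (w - z)) <= Rabs (x - x') * (1 + Cmod (z - c) + Cmod (w - z)))%R by
      (apply Rmult_le_compat_l; auto).
    assert (Rabs (y - y') * (x' * Cmod (w - z)) <= Rabs (y - y') * (1 + Cmod (z - c) + Cmod (w - z)))%R by
      (apply Rmult_le_compat_l; nra).
    lra.
  - intros; apply Hf, In'; auto. }
clear G'.
unfold segment_integral.
rewrite <- !CInt_scal; try lra; try (apply Hseg; auto).
rewrite (CInt_ext (fun t => (z - c) * f (c + RtoC t * (z - c))) (fun s => f (c + RtoC s * (z - c +
  0 * (w - z))) * (z - c + 0 * (w - z)))); [|lra|intros; replace (z - c + 0 * (w - z)) with (z - c) by ring; ring].
rewrite (CInt_ext (fun t => (w - z) * f (z + RtoC t * (w - z))) (fun s => f (c + 1 * (z - c +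
  RtoC s * (w - z))) * (1 * (w - z)))); [|lra|intros;
    replace (c + 1 * (z - c + RtoC t * (w - z))) with (z + RtoC t * (w - z)) by ring; ring].
rewrite (CInt_ext (fun t => (w - c) * f (c + RtoC t * (w - c))) (fun s => f (c + RtoC s * (z - c +
  1 * (w - z))) * (z - c + 1 * (w - z)))); [|lra|intros; replace (z - c + 1 * (w - z)) with (w - c) by ring; ring].
rewrite (CInt_ext (fun s => f (c + 0 * (z - c + RtoC s * (w - z))) * (0 * (w - z))) (fun _ => 0)) in E; [|lra|intros;
  ring].
rewrite CInt_const in E by lra.
match type of E with ?a + ?b - ?d - ?e = _ => replace (a + b) with (a + b - d - e + (d + e)) by ring; rewrite E;
  ring end.
Qed.

Lemma segment_integral_bound f z w M : (forall t, (0 <= t <= 1)%R -> Rcont (fun t => f (z + RtoC t * (w - z))) t) ->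
  (forall t, (0 <= t <= 1)%R -> Cmod (f (z + RtoC t * (w - z))) <= M) ->
    Cmod (segment_integral f z w) <= (2 * M * Cmod (w - z))%R.
Proof.
intros Hc HM. unfold segment_integral. rewrite Cmod_mult, Rmult_comm. apply Rmult_le_compat_r. apply Cmod_ge_0.
replace (2 * M)%R with (2 * M * (1 - 0))%R by ring. apply CInt_bound; auto. lra.
Qed.

Lemma segment_integral_minus_const f z w a : (forall t, (0 <= t <= 1)%R ->
  Rcont (fun t => f (z + RtoC t * (w - z))) t) ->
  segment_integral f z w - a * (w - z) = segment_integral (fun u => f u - a) z w.
Proof.
intros Hc. unfold segment_integral.
rewrite (CInt_minus (fun t => f (z + RtoC t * (w - z))) (fun _ => a)); auto; try lra.
rewrite CInt_const by lra. replace (RtoC (1 - 0)) with (RtoC 1) by (f_equal; ring). ring.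
intros; apply Rcont_const.
Qed.

Lemma segment_Rcont (D : C -> Prop) f z w : convexC D -> (forall z, D z -> C_differentiable f z) -> D z -> D w ->
  forall t, (0 <= t <= 1)%R -> Rcont (fun t => f (z + RtoC t * (w - z))) t.
Proof.
intros HD Hf Ha Hb t Ht. apply (Rcont_diff f (fun t => z + RtoC t * (w - z))). apply Hf, HD; auto. rcont.
Qed.

Lemma segment_dist z w t : (0 <= t <= 1)%R -> Cmod (z + RtoC t * (w - z) - z) <= Cmod (w - z).
Proof.
intros Ht. replace (z + RtoC t * (w - z) - z) with (RtoC t * (w - z)) by ring.
rewrite Cmod_mult, Cmod_RtoC_pos by lra. assert (H := Cmod_ge_0 (w - z)). nra.
Qed.

Lemma primitive_segment_integral (D : C -> Prop) f c : convexC D -> openC D -> (forall z, D z ->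
  C_differentiable f z) -> D c ->
  forall z, D z -> Cder (segment_integral f c) z (f z).
Proof.
intros HD HO Hf Hc z Hz. apply Cder_eps. intros e He.
assert (He2 : (0 < e / 2)%R) by lra.
destruct (HO z Hz) as [d1 [Hd1 H1]].
destruct (Cder_continuous_eps f z _ (Cder_differentiable _ _ (Hf z Hz)) _ He2) as [d2 [Hd2 H2]].
exists (Rmin d1 d2). split. apply Rmin_pos; auto. intros w Hw.
assert (Hw1 := H1 w (Rlt_le_trans _ _ _ Hw (Rmin_l _ _))).
rewrite <- (segment_integral_add D f c z w); auto.
replace (segment_integral f c z + segment_integral f z w - segment_integral f c z - f z * (w - z)) with
  (segment_integral f z w - f z * (w - z)) by ring.
assert (Hs := segment_Rcont D f z w HD Hf Hz Hw1).
rewrite segment_integral_minus_const by auto.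
replace e with (2 * (e / 2))%R by field.
apply segment_integral_bound.
- intros t Ht. apply (Rcont_minus (fun t => f (z + RtoC t * (w - z))) (fun _ => f z)). apply (Hs t Ht).
  apply Rcont_const.
- intros t Ht. left. apply H2. eapply Rle_lt_trans. apply segment_dist; auto.
  apply (Rlt_le_trans _ _ _ Hw (Rmin_r _ _)).
Qed.

Lemma Ci_neq0 : Ci <> RtoC 0.
Proof. intros E. apply (f_equal snd) in E. simpl in E. lra. Qed.

Lemma Rder_RtoC_mult_cis a b t : Rder (fun s => a + b * cis s) t (b * (Ci * cis t)).
Proof.
replace (b * (Ci * cis t)) with (0 + b * (Ci * cis t)) by ring.
apply (Rder_plus (fun _ => a)). apply Rder_const. apply Rder_scal, Rder_cis.
Qed.

Lemma cis_lip s t : Cmod (cis s - cis t) <= (2 * Rabs (s - t))%R.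
Proof.
assert (L : forall s t, (s <= t)%R -> Cmod (cis t - cis s) <= (2 * (t - s))%R).
{ clear. intros s t H. rewrite <- (CInt_FTC cis (fun t => Ci * cis t)); auto.
  replace (2 * (t - s))%R with (2 * 1 * (t - s))%R by ring. apply CInt_bound; auto. intros; rcont. intros.
  rewrite Cmod_mult, Cmod_Ci, Cmod_cis. lra.
  intros; apply Rder_cis. intros; rcont. }
destruct (Rle_or_lt s t).
- rewrite Cmod_minus_sym, Rabs_minus_sym, Rabs_right by lra. auto.
- rewrite Rabs_right by lra. apply L; lra.
Qed.

Lemma Cmod_triangle_sub (z w : C) : (Cmod z - Cmod w <= Cmod (z - w))%R.
Proof. assert (T := Cmod_triangle (z - w) w). replace (z - w + w) with z in T by ring. lra. Qed.

(** The circle is deformed into a small one about [w], its centre and radius moving linearly. The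
    sides at angles [0] and [2 * PI] are the same path and cancel, so both circles give the same
    integral, and on the small one [f] is close to [f w]. *)
Lemma cauchy_formula (f : C -> C) (z0 w : C) (r : R) :
  (forall z, Cmod (z - z0) <= r -> C_differentiable f z) -> Cmod (w - z0) < r ->
  CInt (fun th => f (z0 + RtoC r * cis th) * (RtoC r * cis th) / (z0 + RtoC r * cis th - w)) 0 (2 * PI)
   = RtoC (2 * PI) * f w.
Proof.
intros Hf Hw. assert (HP := PI_RGT_0).
assert (Hd0 := Cmod_ge_0 (w - z0)). set (dw := Cmod (w - z0)) in *.
set (I0 := CInt (fun th => f (z0 + RtoC r * cis th) * (RtoC r * cis th) / (z0 + RtoC r * cis th - w)) 0 (2 * PI)).
assert (Hf0 : C_differentiable f w). { apply Hf. fold dw. lra. }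
assert (rne : forall th, z0 + RtoC r * cis th - w <> RtoC 0).
{ intros th. apply Cmod_gt_0. replace (z0 + RtoC r * cis th - w) with (RtoC r * cis th - (w - z0)) by ring.
  eapply Rlt_le_trans; [|apply Cmod_triangle_sub]. rewrite Cmod_mult, Cmod_cis, Cmod_RtoC_pos by lra. fold dw. lra. }
assert (Key : forall e, (0 < e)%R -> Cmod (I0 - RtoC (2 * PI) * f w) <= (e * (4 * PI))%R).
{ intros e He.
  destruct (Cder_continuous_eps f w _ (Cder_differentiable _ _ Hf0) e He) as [d [Hd Hcont]].
  (* [p < d] makes [f] close to [f w] on the small circle; [p < r - dw] keeps all intermediate
     circles inside the closed disk. *)
  set (p := Rmin (d / 2) ((r - dw) / 2)).
  assert (Hp : (0 < p)%R) by (apply Rmin_pos; lra).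
  assert (Hp1 : (p < d)%R). { apply Rle_lt_trans with (d / 2)%R. apply Rmin_l. lra. }
  assert (Hp2 : (p < r - dw)%R). { apply Rle_lt_trans with ((r - dw) / 2)%R. apply Rmin_r. lra. }
  set (rho := fun x => (r + x * (p - r))%R).
  set (Psi := fun x y => z0 + RtoC x * (w - z0) + RtoC (rho x) * cis y).
  assert (Hrho : forall x, (0 <= x <= 1)%R -> (0 < rho x <= r)%R). { intros x Hx. unfold rho. nra. }
  assert (Pne : forall x y, (0 <= x <= 1)%R -> Psi x y - w <> RtoC 0).
  { intros x y Hx. apply Cmod_gt_0. unfold Psi.
    replace (z0 + RtoC x * (w - z0) + RtoC (rho x) * cis y - w) with
      (RtoC (rho x) * cis y - RtoC (1 - x) * (w - z0)) by (rewrite RtoC_minus; ring).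
    eapply Rlt_le_trans; [|apply Cmod_triangle_sub]. specialize (Hrho x Hx).
    rewrite !Cmod_mult, Cmod_cis, !Cmod_RtoC_pos by lra. fold dw. unfold rho. nra. }
  assert (Pin : forall x y, (0 <= x <= 1)%R -> Cmod (Psi x y - z0) <= r).
  { intros x y Hx. unfold Psi.
    replace (z0 + RtoC x * (w - z0) + RtoC (rho x) * cis y - z0) with (RtoC x * (w - z0) + RtoC (rho x) * cis y) by
      ring.
    eapply Rle_trans. apply Cmod_triangle. specialize (Hrho x Hx).
    rewrite !Cmod_mult, Cmod_cis, !Cmod_RtoC_pos by lra. fold dw. unfold rho. nra. }
  set (F := fun z => f z / (z - w)).
  assert (HF : forall x y, (0 <= x <= 1)%R -> C_differentiable F (Psi x y)).
  { intros x y Hx. unfold F. eapply Cder_is_differentiable. assert (H := Cder_differentiable _ _ (Hf _ (Pin x y Hx))).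
    cder. apply Pne; auto. }
  set (Px := fun (x y : R) => (w - z0) + RtoC (p - r) * cis y).
  set (Py := fun (x y : R) => RtoC (rho x) * (Ci * cis y)).
  assert (G : CInt (fun s => F (Psi s 0%R) * Px s 0%R) 0 1 + CInt (fun s => F (Psi 1%R s) * Py 1%R s) 0 (2 * PI)
     - CInt (fun s => F (Psi s (2 * PI)%R) * Px s (2 * PI)%R) 0 1 - CInt (fun s => F (Psi 0%R s) * Py 0%R s) 0 (2 * PI)
       = 0).
  { apply (goursat F Psi Px Py 0 1 0 (2 * PI) (dw + 2 * r + 1)); try lra.
    - intros x y Hx Hy. unfold Px.
      assert (E : (fun s => Psi s y) = (fun s => (z0 + RtoC r * cis y) + RtoC s * ((w - z0) + RtoC (p - r) * cis y))).
      { extensionality s. unfold Psi, rho. rewrite RtoC_plus, RtoC_mult. ring. }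
      rewrite E. apply Rder_affine.
    - intros x y Hx Hy. apply Rder_RtoC_mult_cis.
    - intros x y Hx Hy. unfold Px. apply Rcont_const.
    - intros x y Hx Hy. unfold Py. rcont.
    - intros x y Hx Hy. unfold Px. eapply Rle_trans. apply Cmod_triangle.
      rewrite Cmod_mult, Cmod_cis, Cmod_R, Rabs_left by lra. fold dw. lra.
    - intros x y Hx Hy. specialize (Hrho x Hx). unfold Py. rewrite !Cmod_mult, Cmod_cis, Cmod_Ci, Cmod_RtoC_pos by lra.
      lra.
    - intros x y x' y' Hx Hy Hx' Hy'.
      replace (Psi x y - Psi x' y') with (RtoC (x - x') * (w - z0) + (RtoC ((x - x') * (p - r)) * cis y +
        RtoC (rho x') * (cis y - cis y'))).
      2:{ unfold Psi, rho. rewrite !RtoC_plus, !RtoC_mult, !RtoC_minus. ring. }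
      eapply Rle_trans. apply Cmod_triangle. eapply Rle_trans. apply Rplus_le_compat_l, Cmod_triangle.
      specialize (Hrho x' Hx'). assert (K := cis_lip y y').
      rewrite !Cmod_mult, Cmod_cis, !Cmod_R, Rabs_mult, (Rabs_left (p - r)), (Rabs_right (rho x')) by lra. fold dw.
      assert (J1 := Rabs_pos (x - x')). assert (J2 := Rabs_pos (y - y')).
      assert (rho x' * Cmod (cis y - cis y') <= r * (2 * Rabs (y - y')))%R by (apply Rmult_le_compat; try lra;
        apply Cmod_ge_0).
      nra.
    - intros x y Hx Hy. apply HF; auto. }
  assert (cis2 : cis (2 * PI) = cis 0). { unfold cis. rewrite cos_2PI, sin_2PI, cos_0, sin_0. auto. }
  replace (fun s => F (Psi s (2 * PI)%R) * Px s (2 * PI)%R) with (fun s => F (Psi s 0%R) * Px s 0%R) in G.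
  2:{ extensionality s. unfold Psi, Px. rewrite cis2. auto. }
  assert (G2 : CInt (fun s => F (Psi 1%R s) * Py 1%R s) 0 (2 * PI) =
    CInt (fun s => F (Psi 0%R s) * Py 0%R s) 0 (2 * PI)).
  { match type of G with ?a + ?b - ?a' - ?d = _ => replace b with ((a + b - a' - d) + d) by ring; rewrite G end. ring. }
  clear G.
  assert (Q0 : CInt (fun s => F (Psi 0%R s) * Py 0%R s) 0 (2 * PI) = Ci * I0).
  { unfold I0. rewrite <- CInt_scal; try lra.
    apply CInt_ext; try lra. intros t Ht. unfold F, Py, Psi, rho. replace (r + 0 * (p - r))%R with r by ring.
    replace (z0 + 0 * (w - z0) + RtoC r * cis t) with (z0 + RtoC r * cis t) by ring. field. apply rne.
    intros t Ht. rcont. apply rne. apply (Rcont_diff f (fun t => z0 + RtoC r * cis t)).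
    specialize (Pin 0%R t ltac:(lra)). unfold Psi, rho in Pin. replace (r + 0 * (p - r))%R with r in Pin by ring.
    replace (z0 + 0 * (w - z0) + RtoC r * cis t) with (z0 + RtoC r * cis t) in Pin by ring. apply Hf; auto. rcont. }
  assert (Hcw : forall t, Cmod (w + RtoC p * cis t - w) < d).
  { intros t. replace (w + RtoC p * cis t - w) with (RtoC p * cis t) by ring.
    rewrite Cmod_mult, Cmod_cis, Cmod_RtoC_pos; lra. }
  assert (Rc : forall t : R, Rcont (fun s => f (w + RtoC p * cis s)) t).
  { intros t. apply (Rcont_diff f (fun t => w + RtoC p * cis t)). apply Hf.
    replace (w + RtoC p * cis t - z0) with ((w - z0) + RtoC p * cis t) by ring. eapply Rle_trans. apply Cmod_triangle.
    rewrite Cmod_mult, Cmod_cis, Cmod_RtoC_pos by lra. fold dw. lra. rcont. }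
  assert (Q1 : CInt (fun s => F (Psi 1%R s) * Py 1%R s) 0 (2 * PI) = Ci * CInt (fun s => f (w +
    RtoC p * cis s)) 0 (2 * PI)).
  { rewrite <- CInt_scal; try lra. 2: auto.
    apply CInt_ext; try lra. intros t Ht. unfold F, Py, Psi, rho. replace (r + 1 * (p - r))%R with p by ring.
    replace (z0 + 1 * (w - z0) + RtoC p * cis t) with (w + RtoC p * cis t) by ring. field.
    replace (w + RtoC p * cis t - w) with (RtoC p * cis t) by ring. apply Cmult_neq_0. intros E.
    apply (f_equal fst) in E; simpl in E; lra. apply cis_neq0. }
  assert (Q : I0 = CInt (fun s => f (w + RtoC p * cis s)) 0 (2 * PI)).
  { rewrite Q0, Q1 in G2. apply (f_equal (fun x => / Ci * x)) in G2.
    rewrite !Cmult_assoc, Cinv_l, !Cmult_1_l in G2 by apply Ci_neq0. auto. }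
  rewrite Q. replace (RtoC (2 * PI) * f w) with (CInt (fun _ => f w) 0 (2 * PI)).
  2:{ rewrite CInt_const by lra. rewrite Rminus_0_r. ring. }
  rewrite <- CInt_minus; try lra; auto. 2: intros; apply Rcont_const.
  replace (e * (4 * PI))%R with (2 * e * (2 * PI - 0))%R by ring.
  apply CInt_bound; try lra.
  - intros t _. apply (Rcont_minus (fun s => f (w + RtoC p * cis s))). apply Rc. apply Rcont_const.
  - intros t _. left. apply Hcont, Hcw. }
assert (Z : Cmod (I0 - RtoC (2 * PI) * f w) = 0%R).
{ apply Rle_antisym; [|apply Cmod_ge_0]. apply Rnot_lt_le. intros HN.
  specialize (Key (Cmod (I0 - RtoC (2 * PI) * f w) / (8 * PI))%R ltac:(apply Rdiv_lt_0_compat; lra)).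
  replace (Cmod (I0 - RtoC (2 * PI) * f w) / (8 * PI) * (4 * PI))%R with
    (Cmod (I0 - RtoC (2 * PI) * f w) / 2)%R in Key by (field; lra).
  lra. }
apply Cmod_eq_0 in Z. replace I0 with ((I0 - RtoC (2 * PI) * f w) + RtoC (2 * PI) * f w) by ring. rewrite Z. ring.
Qed.

(** * Cauchy integrals depending on a parameter *)

(** Differentiation under the integral from a remainder that is quadratic uniformly in [t]; for
    powers of the Cauchy kernel such a remainder is explicit algebra. *)
Lemma CInt_differentiable (K : C -> R -> C) (K' : R -> C) (w0 : C) (a b B eta : R) :
  (a <= b)%R -> (0 < eta)%R -> (0 <= B)%R ->
  (forall w t, Cmod (w - w0) < eta -> (a <= t <= b)%R -> Rcont (K w) t) ->
  (forall t, (a <= t <= b)%R -> Rcont K' t) ->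
  (forall w t, Cmod (w - w0) < eta -> (a <= t <= b)%R ->
     Cmod (K w t - K w0 t - K' t * (w - w0)) <= (B * Cmod (w - w0) * Cmod (w - w0))%R) ->
  Cder (fun w => CInt (K w) a b) w0 (CInt K' a b).
Proof.
intros Hab Heta HB Hc Hc' HE. apply Cder_eps. intros e He.
assert (Hw0 : Cmod (w0 - w0) < eta). { replace (w0 - w0) with (RtoC 0) by ring. rewrite Cmod_0; lra. }
exists (Rmin eta (e / (1 + 2 * B * (b - a)))).
assert (Hden : (0 < 1 + 2 * B * (b - a))%R) by nra.
split. { apply Rmin_pos; auto. apply Rdiv_lt_0_compat; lra. }
intros w Hw. assert (W1 := Rlt_le_trans _ _ _ Hw (Rmin_l _ _)). assert (W2 := Rlt_le_trans _ _ _ Hw (Rmin_r _ _)).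
replace (CInt (K w) a b - CInt (K w0) a b - CInt K' a b * (w - w0)) with
  (CInt (fun t => K w t - K w0 t - (w - w0) * K' t) a b).
2:{ rewrite (CInt_minus (fun t => K w t - K w0 t) (fun t => (w - w0) * K' t)); auto.
    rewrite (CInt_minus (K w) (K w0)), CInt_scal; auto. ring.
    intros; apply Rcont_minus; auto. intros. rcont. auto. }
assert (H0 := Cmod_ge_0 (w - w0)). set (h := Cmod (w - w0)) in *.
eapply Rle_trans. apply CInt_bound with (M := (B * h * h)%R); auto.
- intros t Ht. apply (Rcont_minus (fun t => K w t - K w0 t) (fun t => (w - w0) * K' t)). apply Rcont_minus; auto.
  rcont; auto.
- intros t Ht. rewrite (Cmult_comm (w - w0)). apply HE; auto.
- replace (2 * (B * h * h) * (b - a))%R with ((2 * B * (b - a) * h) * h)%R by ring.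
  apply Rmult_le_compat_r; auto.
  apply Rmult_lt_compat_r with (r := (1 + 2 * B * (b - a))%R) in W2; auto.
  replace (e / (1 + 2 * B * (b - a)) * (1 + 2 * B * (b - a)))%R with e in W2 by (field; lra). nra.
Qed.

Definition circ (z0 : C) (r : R) (th : R) : C := z0 + RtoC r * cis th.

Lemma Rcont_circ z0 r t : Rcont (circ z0 r) t.
Proof. unfold circ. rcont. Qed.

Lemma circ_dist z0 r th : (0 < r)%R -> Cmod (circ z0 r th - z0) = r.
Proof. intros Hr. unfold circ. replace (z0 + RtoC r * cis th - z0) with (RtoC r * cis th) by ring.
 rewrite Cmod_mult, Cmod_cis, Cmod_RtoC_pos by lra. ring. Qed.

Lemma circ_far z0 r th w : (0 < r)%R -> (r - Cmod (w - z0) <= Cmod (circ z0 r th - w))%R.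
Proof. intros Hr. replace (circ z0 r th - w) with ((circ z0 r th - z0) - (w - z0)) by ring.
 eapply Rle_trans; [|apply Cmod_triangle_sub]. rewrite circ_dist; lra. Qed.

Lemma circ_ne z0 r th w : (0 < r)%R -> Cmod (w - z0) < r -> circ z0 r th - w <> RtoC 0.
Proof. intros Hr Hw. apply Cmod_gt_0. assert (H := circ_far z0 r th w Hr). lra. Qed.

Lemma cis_surj (z : C) : Cmod z = 1%R -> exists t, (0 <= t <= 2 * PI)%R /\ z = cis t.
Proof.
intros H. destruct z as [x y]. assert (HP := PI_RGT_0).
assert (E : (x * x + y * y = 1)%R).
{ assert (E := Cmod2_alt (x, y)). rewrite H in E. simpl in E. lra. }
assert (Hx : (-1 <= x <= 1)%R) by nra.
assert (B := acos_bound x).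
assert (S : sqrt (1 - x²) = Rabs y). { rewrite <- sqrt_Rsqr_abs. f_equal. unfold Rsqr. lra. }
destruct (Rle_or_lt 0 y).
- exists (acos x). split. lra. unfold cis. rewrite cos_acos, sin_acos, S, Rabs_right by lra. auto.
- exists (2 * PI - acos x)%R. split. lra. unfold cis.
  replace (2 * PI - acos x)%R with (- acos x + 2 * INR 1 * PI)%R by (simpl; ring).
  rewrite cos_period, sin_period, cos_neg, sin_neg, cos_acos, sin_acos, S, Rabs_left by lra. f_equal; ring.
Qed.

Lemma circ_surj z0 r z : (0 < r)%R -> Cmod (z - z0) = r -> exists t, (0 <= t <= 2 * PI)%R /\ z = circ z0 r t.
Proof.
intros Hr H. assert (N : RtoC r <> RtoC 0) by (intros E; apply (f_equal fst) in E; simpl in E; lra).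
destruct (cis_surj ((z - z0) / RtoC r)) as [t [Ht E]].
{ rewrite Cmod_div, H, Cmod_RtoC_pos by (auto; lra). field; lra. }
exists t. split; auto. unfold circ. rewrite <- E. field. auto.
Qed.

Lemma Rcont_bounded (k : R -> C) a b : (a <= b)%R -> (forall t, (a <= t <= b)%R -> Rcont k t) ->
  exists M : R, (0 <= M)%R /\ forall t, (a <= t <= b)%R -> Cmod (k t) <= M.
Proof.
intros Hab Hk.
destruct (continuity_ab_maj (fun t => Cmod (k t)) a b Hab) as [x [Hx _]].
- intros c Hc e He. destruct (proj1 (Rcont_eps k c) (Hk c Hc) e He) as [d [Hd H]]. exists d. split; auto.
  intros x [_ Hx]. eapply Rle_lt_trans; [|apply (H x Hx)]. simpl. unfold R_dist.
  apply Rabs_le. split. 2: apply Cmod_triangle_sub.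
  assert (T := Cmod_triangle_sub (k c) (k x)). rewrite Cmod_minus_sym in T. lra.
- exists (Cmod (k x)). split. apply Cmod_ge_0. auto.
Qed.

Lemma Rcont_away (k : R -> C) a b : (a <= b)%R -> (forall t, (a <= t <= b)%R -> Rcont k t) ->
  (forall t, (a <= t <= b)%R -> k t <> RtoC 0) ->
  exists m : R, (0 < m)%R /\ forall t, (a <= t <= b)%R -> m <= Cmod (k t).
Proof.
intros Hab Hk Hn. destruct (Rcont_bounded (fun t => / k t) a b Hab) as [M [HM0 HM]].
{ intros t Ht. apply Rcont_inv; auto. }
exists (/ (M + 1))%R. split. apply Rinv_0_lt_compat; lra.
intros t Ht. specialize (HM t Ht). rewrite Cmod_inv in HM by auto.
assert (P := proj1 (Cmod_gt_0 _) (Hn t Ht)).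
rewrite <- (Rinv_inv (Cmod (k t))). apply Rinv_le_contravar. apply Rinv_0_lt_compat; auto. lra.
Qed.

(** The density is arbitrary, because besides the boundary values of [f] those of its difference
    quotients will be inserted. *)
Lemma cauchy_kernel_der (k : R -> C) z0 r w0 : (0 < r)%R ->
  (forall t, (0 <= t <= 2 * PI)%R -> Rcont k t) -> Cmod (w0 - z0) < r ->
  Cder (fun w => CInt (fun t => k t / (circ z0 r t - w)) 0 (2 * PI)) w0
    (CInt (fun t => k t / ((circ z0 r t - w0) * (circ z0 r t - w0))) 0 (2 * PI)).
Proof.
intros Hr Hk Hw. assert (HP := PI_RGT_0).
destruct (Rcont_bounded k 0 (2 * PI) ltac:(lra) Hk) as [M [HM0 HM]].
set (m := ((r - Cmod (w0 - z0)) / 2)%R). assert (Hm : (0 < m)%R) by (unfold m; lra).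
assert (Hnear : forall w t, Cmod (w - w0) < m -> m <= Cmod (circ z0 r t - w)).
{ intros w t Hwm. assert (F := circ_far z0 r t w Hr). assert (T := Cmod_triangle (w - w0) (w0 - z0)).
  replace (w - w0 + (w0 - z0)) with (w - z0) in T by ring. unfold m in *. lra. }
assert (Hne : forall w t, Cmod (w - w0) < m -> circ z0 r t - w <> RtoC 0).
{ intros w t H. apply Cmod_gt_0. specialize (Hnear w t H). lra. }
assert (H00 : Cmod (w0 - w0) < m). { replace (w0 - w0) with (RtoC 0) by ring. rewrite Cmod_0; lra. }
assert (m3 : (0 < m * (m * m))%R) by (assert (0 < m * m)%R by nra; nra).
apply CInt_differentiable with (B := (M / (m * (m * m)))%R) (eta := m); try lra.
- apply Rmult_le_pos; auto. left; apply Rinv_0_lt_compat; auto.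
- intros w t H Ht. rcont. apply Hne; auto. auto. apply Rcont_circ.
- intros t Ht. rcont; try apply Rcont_circ; auto. apply Cmult_neq_0; apply Hne; auto.
- intros w t H Ht. set (z := circ z0 r t).
  assert (N1 := Hne w t H). assert (N2 := Hne w0 t H00). fold z in N1, N2.
  replace (k t / (z - w) - k t / (z - w0) - k t / ((z - w0) * (z - w0)) * (w - w0)) with
    ((k t / ((z - w) * ((z - w0) * (z - w0)))) * ((w - w0) * (w - w0))) by (field; auto).
  rewrite !Cmod_mult, Cmod_div, !Cmod_mult by (repeat apply Cmult_neq_0; auto).
  assert (M1 := Hnear w t H). assert (M2 := Hnear w0 t H00). fold z in M1, M2.
  rewrite Rmult_assoc. apply Rmult_le_compat_r. apply Rmult_le_pos; apply Cmod_ge_0.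
  apply Rmult_le_compat; auto. apply Cmod_ge_0. left; apply Rinv_0_lt_compat; repeat apply Rmult_lt_0_compat; lra.
  apply Rinv_le_contravar; auto. apply Rmult_le_compat; try lra. nra. apply Rmult_le_compat; lra.
Qed.

Lemma cauchy_kernel_der2 (k : R -> C) z0 r w0 : (0 < r)%R ->
  (forall t, (0 <= t <= 2 * PI)%R -> Rcont k t) -> Cmod (w0 - z0) < r ->
  C_differentiable (fun w => CInt (fun t => k t / ((circ z0 r t - w) * (circ z0 r t - w))) 0 (2 * PI)) w0.
Proof.
intros Hr Hk Hw. assert (HP := PI_RGT_0). apply Cder_is_differentiable with
    (l := CInt (fun t => 2 * k t / ((circ z0 r t - w0) * ((circ z0 r t - w0) * (circ z0 r t - w0)))) 0 (2 * PI)).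
destruct (Rcont_bounded k 0 (2 * PI) ltac:(lra) Hk) as [M [HM0 HM]].
set (m := ((r - Cmod (w0 - z0)) / 2)%R). assert (Hm : (0 < m)%R) by (unfold m; lra).
assert (Hnear : forall w t, Cmod (w - w0) < m -> m <= Cmod (circ z0 r t - w)).
{ intros w t Hwm. assert (F := circ_far z0 r t w Hr). assert (T := Cmod_triangle (w - w0) (w0 - z0)).
  replace (w - w0 + (w0 - z0)) with (w - z0) in T by ring. unfold m in *. lra. }
assert (Hne : forall w t, Cmod (w - w0) < m -> circ z0 r t - w <> RtoC 0).
{ intros w t H. apply Cmod_gt_0. specialize (Hnear w t H). lra. }
assert (H00 : Cmod (w0 - w0) < m). { replace (w0 - w0) with (RtoC 0) by ring. rewrite Cmod_0; lra. }
set (A := ((m * m) * (m * (m * m)))%R).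
assert (m5 : (0 < A)%R) by (unfold A; assert (0 < m * m)%R by nra; assert (0 < m * (m * m))%R by nra; nra).
(* The remainder has the numerator [3 * (z - w0) - 2 * (w - w0)], of modulus at most [8 * r], over
   five factors each of modulus at least [m]; [A] is their product [m ^ 5]. *)
apply CInt_differentiable with (B := (M * (8 * r) / A)%R) (eta := m); try lra.
- apply Rmult_le_pos. nra. left; apply Rinv_0_lt_compat; auto.
- intros w t H Ht. rcont; try apply Rcont_circ; auto. apply Cmult_neq_0; apply Hne; auto.
- intros t Ht. rcont; try apply Rcont_circ; auto. repeat apply Cmult_neq_0; apply Hne; auto.
- intros w t H Ht. set (z := circ z0 r t).
  assert (N1 := Hne w t H). assert (N2 := Hne w0 t H00). fold z in N1, N2.
  replace (k t / ((z - w) * (z - w)) - k t / ((z - w0) * (z - w0))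
  - 2 * k t / ((z - w0) * ((z - w0) * (z - w0))) * (w - w0)) with
    ((k t * (3 * (z - w0) - 2 * (w - w0)) / (((z - w) * (z - w)) * ((z - w0) * ((z - w0) * (z - w0))))) * ((w - w0) *
      (w - w0))) by (field; auto).
  rewrite !Cmod_mult, Cmod_div, !Cmod_mult by (repeat apply Cmult_neq_0; auto).
  assert (M1 := Hnear w t H). assert (M2 := Hnear w0 t H00). fold z in M1, M2.
  replace (M * (8 * r) / A * Cmod (w - w0) * Cmod (w - w0))%R with
    (M * (8 * r) / A * (Cmod (w - w0) * Cmod (w - w0)))%R by ring.
  apply Rmult_le_compat_r. apply Rmult_le_pos; apply Cmod_ge_0.
  apply Rmult_le_compat; auto. apply Rmult_le_pos; apply Cmod_ge_0.
  left; apply Rinv_0_lt_compat; repeat apply Rmult_lt_0_compat; lra.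
  + apply Rmult_le_compat; auto; try apply Cmod_ge_0.
    replace (3 * (z - w0) - 2 * (w - w0)) with (3 * (z - w0) + - (2 * (w - w0))) by ring.
    eapply Rle_trans. apply Cmod_triangle. rewrite Cmod_opp, !Cmod_mult, !Cmod_RtoC_pos by lra.
    assert (T := Cmod_triangle (z - z0) (z0 - w0)). replace (z - z0 + (z0 - w0)) with (z - w0) in T by ring.
    unfold z in T at 2. rewrite circ_dist in T by auto. rewrite (Cmod_minus_sym z0) in T.
    assert (Q0 := Cmod_ge_0 (w0 - z0)). unfold m in H. lra.
  + apply Rinv_le_contravar; auto. unfold A. apply Rmult_le_compat; try nra. apply Rmult_le_compat; try nra.
Qed.

Lemma cauchy_disk (f : C -> C) z0 r w : (0 < r)%R -> (forall z, Cmod (z - z0) <= r -> C_differentiable f z) ->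
  Cmod (w - z0) < r ->
  f w = CInt (fun t => f (circ z0 r t) * (RtoC r * cis t) / (circ z0 r t - w)) 0 (2 * PI) / RtoC (2 * PI).
Proof.
intros Hr Hf Hw. assert (H := cauchy_formula f z0 w r Hf Hw). unfold circ. rewrite H. field.
intros E. apply (f_equal fst) in E. simpl in E. assert (HP := PI_RGT_0). lra.
Qed.

Lemma cauchy_density_Rcont (f : C -> C) z0 r t : (0 < r)%R -> (forall z, Cmod (z - z0) <= r -> C_differentiable f z) ->
  Rcont (fun t => f (circ z0 r t) * (RtoC r * cis t)) t.
Proof.
intros Hr Hf. rcont. apply (Rcont_diff f (circ z0 r)). apply Hf. rewrite circ_dist; lra. apply Rcont_circ.
Qed.

Lemma disk_openC z0 r : openC (fun z => Cmod (z - z0) < r).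
Proof.
intros z Hz. exists (r - Cmod (z - z0))%R. split. lra. intros w Hw.
assert (T := Cmod_triangle (w - z) (z - z0)). replace (w - z + (z - z0)) with (w - z0) in T by ring. lra.
Qed.

Lemma openC_inner_disk D z0 : openC D -> D z0 -> exists r : R, (0 < r)%R /\ forall z, Cmod (z - z0) <= r -> D z.
Proof.
intros HO Hz. destruct (HO z0 Hz) as [d [Hd H]]. exists (d / 2)%R. split. lra. intros z Hz'. apply H. lra.
Qed.

(** Cauchy's formula exhibits [f], and hence its derivative, as integrals over a fixed circle, and
    the kernel of the second one can be differentiated once more. *)
Theorem C_derive_differentiable (D : C -> Prop) (f : C -> C) : openC D ->
  (forall z, D z -> C_differentiable f z) -> forall z, D z -> C_differentiable (C_derive f) z.
Proof.
intros HO Hf z0 Hz. destruct (openC_inner_disk D z0 HO Hz) as [r [Hr HD]].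
assert (Hf' : forall z, Cmod (z - z0) <= r -> C_differentiable f z) by (intros; apply Hf, HD; auto).
set (k := fun t => f (circ z0 r t) * (RtoC r * cis t)).
assert (Hk : forall t, (0 <= t <= 2 * PI)%R -> Rcont k t) by (intros; apply cauchy_density_Rcont; auto).
assert (HE : forall w, Cmod (w - z0) < r -> C_derive f w =
   CInt (fun t => k t / ((circ z0 r t - w) * (circ z0 r t - w))) 0 (2 * PI) / RtoC (2 * PI)).
{ intros w Hw. apply Cder_C_derive.
  apply (Cder_ext_loc (fun w => CInt (fun t => k t / (circ z0 r t - w)) 0 (2 * PI) * / RtoC (2 * PI))).
  - destruct (disk_openC z0 r w Hw) as [d [Hd H]]. exists d. split; auto. intros u Hu. symmetry.
    apply cauchy_disk; auto.
  - eapply Cder_eq.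
    apply (Cder_mult (fun w => CInt (fun t => k t / (circ z0 r t - w)) 0 (2 * PI)) (fun _ => / RtoC (2 * PI))).
    apply cauchy_kernel_der; auto. apply Cder_const. unfold Cdiv. ring. }
assert (H00 : Cmod (z0 - z0) < r). { replace (z0 - z0) with (RtoC 0) by ring. rewrite Cmod_0; lra. }
destruct (cauchy_kernel_der2 k z0 r z0 Hr Hk H00) as [l Hl].
apply Cder_is_differentiable with (l := l * / RtoC (2 * PI) +
  CInt (fun t => k t / ((circ z0 r t - z0) * (circ z0 r t - z0))) 0 (2 * PI) * 0).
apply (Cder_ext_loc (fun w => CInt (fun t => k t / ((circ z0 r t - w) * (circ z0 r t - w))) 0 (2 * PI) * / RtoC (2 *
  PI))).
exists r. split; auto. intros w Hw. symmetry. apply HE; auto.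
apply (Cder_mult (fun w => CInt (fun t => k t / ((circ z0 r t - w) * (circ z0 r t - w))) 0 (2 * PI))
  (fun _ => / RtoC (2 * PI))).
exact Hl. apply Cder_const.
Qed.

(** * Difference quotients and the maximum principle *)

Definition diff_quot (f : C -> C) (c z : C) : C :=
  if excluded_middle_informative (z = c) then C_derive f c else (f z - f c) / (z - c).

Lemma diff_quot_neq f c z : z <> c -> diff_quot f c z = (f z - f c) / (z - c).
Proof. intros H. unfold diff_quot. destruct excluded_middle_informative; tauto. Qed.
Lemma diff_quot_diag f c : diff_quot f c c = C_derive f c.
Proof. unfold diff_quot. destruct excluded_middle_informative; tauto. Qed.
Lemma diff_quot_mult f c z : (z - c) * diff_quot f c z = f z - f c.
Proof.
destruct (classic (z = c)) as [->|H]. ring. rewrite diff_quot_neq by auto. field. intros E; apply H.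
replace z with (z - c + c) by ring. rewrite E. ring.
Qed.

Lemma Cminus_neq0 (z w : C) : z <> w -> z - w <> RtoC 0.
Proof. intros H E; apply H. replace z with (z - w + w) by ring. rewrite E. ring. Qed.

Lemma Cmod_pos_neq (z w : C) : z <> w -> (0 < Cmod (z - w))%R.
Proof. intros H. apply Cmod_gt_0, Cminus_neq0, H. Qed.

(** By partial fractions the quotient is, near [c] and at [c] itself, the Cauchy integral with the
    density of [f] divided by [circ c r t - c]. This takes the place of a removable singularity
    theorem. *)
Lemma diff_quot_differentiable (D : C -> Prop) f c : openC D -> (forall z, D z -> C_differentiable f z) -> D c ->
  forall z, D z -> C_differentiable (diff_quot f c) z.
Proof.
intros HO Hf Hc z Hz. destruct (classic (z = c)) as [->|H].
- destruct (openC_inner_disk D c HO Hc) as [r [Hr HD]].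
  assert (Hf' : forall z, Cmod (z - c) <= r -> C_differentiable f z) by (intros; apply Hf, HD; auto).
  assert (H00 : Cmod (c - c) < r). { replace (c - c) with (RtoC 0) by ring. rewrite Cmod_0; lra. }
  set (k := fun t => f (circ c r t) * (RtoC r * cis t)).
  assert (Hk : forall t, (0 <= t <= 2 * PI)%R -> Rcont k t) by (intros; apply cauchy_density_Rcont; auto).
  assert (Hk2 : forall t, (0 <= t <= 2 * PI)%R -> Rcont (fun t => k t / (circ c r t - c)) t).
  { intros t Ht. rcont. apply circ_ne; auto. apply Hk; auto. apply Rcont_circ. }
  assert (HP := PI_RGT_0).
  assert (P0 : RtoC (2 * PI) <> RtoC 0). { intros E. apply (f_equal fst) in E. simpl in E. lra. }
  eapply Cder_is_differentiable.
  apply (Cder_ext_loc (fun w => CInt (fun t => (k t / (circ c r t - c)) / (circ c r t - w)) 0 (2 * PI) * / RtoC (2 *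
    PI))).
  + exists r. split; auto. intros w Hw. destruct (classic (w = c)) as [->|Hwc].
    * rewrite diff_quot_diag. symmetry. apply Cder_C_derive.
      apply (Cder_ext_loc (fun w => CInt (fun t => k t / (circ c r t - w)) 0 (2 * PI) * / RtoC (2 * PI))).
      { exists r. split; auto. intros u Hu. symmetry. apply cauchy_disk; auto. }
      eapply Cder_eq.
      apply (Cder_mult (fun w => CInt (fun t => k t / (circ c r t - w)) 0 (2 * PI)) (fun _ => / RtoC (2 * PI))).
      apply cauchy_kernel_der; auto. apply Cder_const.
      rewrite Cmult_0_r, Cplus_0_r. f_equal. apply CInt_ext. lra. intros t Ht. field. apply circ_ne; auto.
    * rewrite diff_quot_neq by auto. rewrite (cauchy_disk f c r w), (cauchy_disk f c r c) by auto. fold k.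
      assert (N := Cminus_neq0 w c Hwc).
      rewrite (CInt_ext _ (fun t => / (w - c) * (k t / (circ c r t - w) - k t / (circ c r t - c)))).
      2: lra. 2:{ intros t Ht. field. repeat split; auto; apply circ_ne; auto. }
      assert (C1 : forall t, (0 <= t <= 2 * PI)%R -> Rcont (fun t => k t / (circ c r t - w)) t).
      { intros t Ht. rcont. apply circ_ne; auto. apply Hk; auto. apply Rcont_circ. }
      rewrite CInt_scal, CInt_minus; auto; try lra. unfold k. field. auto.
      intros t Ht. apply (Rcont_minus (fun t => k t / (circ c r t - w)) (fun t => k t / (circ c r t - c))); auto.
  + apply (Cder_mult (fun w => CInt (fun t => (k t / (circ c r t - c)) / (circ c r t - w)) 0 (2 * PI))
    (fun _ => / RtoC (2 * PI))).
    apply (cauchy_kernel_der (fun t => k t / (circ c r t - c))); auto. apply Cder_const.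
- assert (Hd := Cder_differentiable _ _ (Hf z Hz)). eapply Cder_is_differentiable.
  apply (Cder_ext_loc (fun w => (f w - f c) / (w - c))).
  + exists (Cmod (z - c)). split. apply Cmod_pos_neq; auto. intros w Hw. symmetry. apply diff_quot_neq. intros ->.
    rewrite Cmod_minus_sym in Hw. lra.
  + cder. apply Cminus_neq0; auto.
Qed.

(** Cauchy's formula for [f ^ n] gives [Cmod (f w) ^ n <= K * M ^ n] with [K] independent of [n];
    letting [n] grow removes [K]. *)
Lemma max_modulus (f : C -> C) z0 r M w : (0 < r)%R -> (forall z, Cmod (z - z0) <= r -> C_differentiable f z) ->
  (forall t, (0 <= t <= 2 * PI)%R -> Cmod (f (circ z0 r t)) <= M) -> Cmod (w - z0) < r -> Cmod (f w) <= M.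
Proof.
intros Hr Hf HM Hw. assert (HP := PI_RGT_0).
assert (M0 : (0 <= M)%R). { eapply Rle_trans. apply Cmod_ge_0. apply (HM 0%R). lra. }
assert (P0 : RtoC (2 * PI) <> RtoC 0). { intros E. apply (f_equal fst) in E. simpl in E. lra. }
set (dd := (r - Cmod (w - z0))%R). assert (Hdd : (0 < dd)%R) by (unfold dd; lra).
set (K := (2 * r / dd)%R). assert (HK : (0 < K)%R) by (apply Rdiv_lt_0_compat; lra).
assert (Hn : forall n, (Cmod (f w) ^ n <= K * M ^ n)%R).
{ intros n.
  assert (Hfn : forall n z, Cmod (z - z0) <= r -> C_differentiable (fun z => f z ^ n) z).
  { clear n. intros n z Hz. induction n. eapply Cder_is_differentiable. apply (Cder_const 1).
    destruct IHn as [l Hl]. eapply Cder_is_differentiable. apply (Cder_mult f (fun z => f z ^ n)).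
    apply Cder_differentiable; auto. exact Hl. }
  rewrite <- Cmod_pow. rewrite (cauchy_disk (fun z => f z ^ n) z0 r w Hr (Hfn n) Hw).
  rewrite Cmod_div, Cmod_RtoC_pos by (auto; lra).
  apply Rle_div_l. lra.
  replace (K * M ^ n * (2 * PI))%R with (2 * (M ^ n * r / dd) * (2 * PI - 0))%R by (unfold K; field; lra).
  assert (Rk := fun t => cauchy_density_Rcont (fun z => f z ^ n) z0 r t Hr (Hfn n)).
  apply CInt_bound. lra.
  - intros t Ht. apply (Rcont_div (fun t => f (circ z0 r t) ^ n * (RtoC r * cis t))). apply circ_ne; auto. apply Rk.
    rcont. apply Rcont_circ.
  - intros t Ht. rewrite Cmod_div by (apply circ_ne; auto).
    rewrite !Cmod_mult, Cmod_cis, Cmod_pow, Cmod_RtoC_pos by lra.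
    assert (F := circ_far z0 r t w Hr). rewrite Rmult_1_r. apply Rmult_le_compat.
    apply Rmult_le_pos. apply pow_le, Cmod_ge_0. lra. left; apply Rinv_0_lt_compat. unfold dd in Hdd. lra.
    apply Rmult_le_compat_r. lra. apply pow_incr. split. apply Cmod_ge_0. auto.
    apply Rinv_le_contravar; auto. }
apply Rnot_lt_le. intros Hlt.
destruct (Req_dec M 0) as [E|E].
- specialize (Hn 1%nat). rewrite E in *. simpl in Hn. lra.
- assert (HM1 : (0 < M)%R) by lra. set (q := (Cmod (f w) / M)%R).
  assert (Hq : (1 < q)%R). { unfold q. apply Rlt_div_r; lra. }
  destruct (Pow_x_infinity q) with (b := (K + 1)%R) as [N HN]. rewrite Rabs_right; lra.
  specialize (HN N (le_n N)). rewrite Rabs_right in HN by (apply Rle_ge, pow_le; lra).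
  specialize (Hn N). assert (Hp : (0 < M ^ N)%R) by (apply pow_lt; auto).
  assert (q ^ N <= K)%R. { unfold q, Rdiv. rewrite Rpow_mult_distr, pow_inv. apply Rle_div_l; auto. }
  lra.
Qed.

Lemma min_modulus (f : C -> C) z0 r m w : (0 < r)%R -> (0 < m)%R -> (forall z, Cmod (z - z0) <= r ->
  C_differentiable f z) ->
  (forall z, Cmod (z - z0) <= r -> f z <> RtoC 0) ->
  (forall t, (0 <= t <= 2 * PI)%R -> m <= Cmod (f (circ z0 r t))) -> Cmod (w - z0) < r -> m <= Cmod (f w).
Proof.
intros Hr Hm Hf Hn HM Hw.
assert (H : (Cmod (/ f w) <= / m)%R).
{ apply (max_modulus (fun z => / f z) z0 r); auto.
  - intros z Hz. assert (Hd := Cder_differentiable _ _ (Hf z Hz)). eapply Cder_is_differentiable. cder. apply Hn; auto.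
  - intros t Ht. rewrite Cmod_inv. apply Rinv_le_contravar; auto. apply Hn. rewrite circ_dist; lra. }
rewrite Cmod_inv in H by (apply Hn; lra).
assert (P := proj1 (Cmod_gt_0 _) (Hn w ltac:(lra))).
rewrite <- (Rinv_inv m), <- (Rinv_inv (Cmod (f w))). apply Rinv_le_contravar; auto. apply Rinv_0_lt_compat; auto.
Qed.

(** If a value [w] near [f z0] were omitted, [f - w] would have no zero, and the minimum principle
    would keep [f z0] as far from [w] as the values on the circle are. *)
Lemma open_mapping (f : C -> C) z0 r : (0 < r)%R -> (forall z, Cmod (z - z0) <= r -> C_differentiable f z) ->
  (forall t, (0 <= t <= 2 * PI)%R -> f (circ z0 r t) <> f z0) ->
  exists e : R, (0 < e)%R /\ forall w, Cmod (w - f z0) < e -> exists z, Cmod (z - z0) < r /\ f z = w.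
Proof.
intros Hr Hf Hn. assert (HP := PI_RGT_0).
assert (Rc : forall t, Rcont (fun t => f (circ z0 r t)) t).
{ intros t. apply (Rcont_diff f (circ z0 r)). apply Hf. rewrite circ_dist; lra. apply Rcont_circ. }
destruct (Rcont_away (fun t => f (circ z0 r t) - f z0) 0 (2 * PI)) as [m [Hm H]]. lra.
intros; rcont; apply Rc. intros; apply Cminus_neq0; auto.
exists (m / 2)%R. split. lra. intros w Hw. apply NNPP. intros HN.
assert (HC : forall t, (0 <= t <= 2 * PI)%R -> m / 2 <= Cmod (f (circ z0 r t) - w)).
{ intros t Ht. specialize (H t Ht). replace (f (circ z0 r t) - w) with ((f (circ z0 r t) - f z0) - (w - f z0)) by ring.
  eapply Rle_trans; [|apply Cmod_triangle_sub]. lra. }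
assert (HH : (m / 2 <= Cmod (f z0 - w))%R).
{ assert (H00 : Cmod (z0 - z0) < r). { replace (z0 - z0) with (RtoC 0) by ring. rewrite Cmod_0; lra. }
  destruct (Rcont_away (fun t => f (circ z0 r t) - w) 0 (2 * PI)) as [m' [Hm' _]]. lra.
  intros; rcont; apply Rc. intros t Ht. apply Cmod_gt_0. specialize (HC t Ht). lra.
  apply (min_modulus (fun z => f z - w) z0 r); auto; try lra.
  - intros z Hz. assert (Hd := Cder_differentiable _ _ (Hf z Hz)). eapply Cder_is_differentiable. cder.
  - intros z Hz E. destruct (Rle_lt_or_eq_dec _ _ Hz) as [Hlt|Heq].
    + apply HN. exists z. split; auto. replace w with (f z - (f z - w)) by ring. rewrite E. ring.
    + destruct (circ_surj z0 r z Hr Heq) as [t [Ht ->]]. specialize (HC t Ht). rewrite E, Cmod_0 in HC. lra. }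
rewrite Cmod_minus_sym in HH. lra.
Qed.

Lemma Cmod_self (z : C) : Cmod (z - z) = 0%R.
Proof. replace (z - z) with (RtoC 0) by ring. apply Cmod_0. Qed.

Lemma disk_convex z0 r : convexC (fun z => Cmod (z - z0) < r).
Proof.
intros z w Hz Hw t Ht.
replace (z + RtoC t * (w - z) - z0) with (RtoC (1 - t) * (z - z0) + RtoC t * (w - z0)) by (rewrite RtoC_minus; ring).
eapply Rle_lt_trans. apply Cmod_triangle. rewrite !Cmod_mult, !Cmod_RtoC_pos by lra.
destruct (Req_dec t 0) as [->|]. lra.
assert (H1 : ((1 - t) * Cmod (z - z0) <= (1 - t) * r)%R) by (apply Rmult_le_compat_l; lra).
assert (H2 : (t * Cmod (w - z0) < t * r)%R) by (apply Rmult_lt_compat_l; lra). lra.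
Qed.

Lemma C_derive_zero_const (D : C -> Prop) f : convexC D -> (forall z, D z -> Cder f z 0) ->
  forall z w, D z -> D w -> f z = f w.
Proof.
intros HD Hf z w Hz Hw.
assert (E := CInt_FTC (fun t => f (z + RtoC t * (w - z))) (fun t => 0) 0 1 ltac:(lra)).
rewrite CInt_const in E by lra. cbv beta in E.
replace (z + 1 * (w - z)) with w in E by ring. replace (z + 0 * (w - z)) with z in E by ring.
assert (E2 : 0 * RtoC (1 - 0) = f w - f z).
{ apply E. intros t Ht. replace (RtoC 0) with (0 * (w - z)) by ring.
  apply (Rder_comp f (fun t => z + RtoC t * (w - z))).
  apply Hf, HD; auto. apply Rder_affine. intros; apply Rcont_const. }
replace (f w) with (f w - f z + f z) by ring. rewrite <- E2. ring.
Qed.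

(** No power series: at a point [c] near [z0] with nonzero derivative, the difference quotient about
    [c] has no zero by injectivity, so the minimum principle bounds it below at [z0]. A vanishing
    derivative at [z0] would make that same quotient too small. *)
Theorem injective_C_derive_neq0 (D : C -> Prop) f : openC D -> (forall z, D z -> C_differentiable f z) ->
  (forall z w, D z -> D w -> f z = f w -> z = w) -> forall z, D z -> C_derive f z <> RtoC 0.
Proof.
intros HO Hf Hi z0 Hz0 H0. destruct (openC_inner_disk D z0 HO Hz0) as [r [Hr HD]]. assert (HP := PI_RGT_0).
assert (Rc : forall t, Rcont (fun t => f (circ z0 r t)) t).
{ intros t. apply (Rcont_diff f (circ z0 r)). apply Hf, HD. rewrite circ_dist; lra. apply Rcont_circ. }
destruct (Rcont_away (fun t => f (circ z0 r t) - f z0) 0 (2 * PI)) as [m [Hm Hmin]]. lra.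
{ intros; rcont; apply Rc. }
{ intros t Ht E. assert (circ z0 r t = z0). { apply Hi; auto. apply HD. rewrite circ_dist; lra.
   replace (f (circ z0 r t)) with (f (circ z0 r t) - f z0 + f z0) by ring. rewrite E. ring. }
  assert (Hd := circ_dist z0 r t Hr). rewrite H, Cmod_self in Hd. lra. }
(* On the circle [f] differs from [f c] by at least [m / 2], and the points of the circle are at
   most [2 * r] away from [c]. *)
set (m2 := ((m / 2) / (2 * r))%R). assert (Hm2 : (0 < m2)%R) by (unfold m2; repeat apply Rdiv_lt_0_compat; lra).
assert (Hd0 := Cder_differentiable _ _ (Hf z0 Hz0)).
destruct (proj1 (Cder_eps _ _ _) Hd0 (m2 / 2)%R ltac:(lra)) as [d1 [Hd1 H1]].
destruct (Cder_continuous_eps _ _ _ Hd0 (m / 2)%R ltac:(lra)) as [d2 [Hd2 H2]].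
set (d := Rmin r (Rmin d1 d2)). assert (Hd : (0 < d)%R) by (repeat apply Rmin_pos; auto).
(* Otherwise [f] would be constant near [z0], against injectivity. *)
assert (Hc : exists c, Cmod (c - z0) < d /\ C_derive f c <> RtoC 0).
{ apply NNPP. intros HN.
  assert (K : f (z0 + RtoC (d / 2)) = f z0).
  { apply (C_derive_zero_const (fun z => Cmod (z - z0) < d)). apply disk_convex.
    - intros z Hz. assert (E : C_derive f z = 0). { apply NNPP. intros HH. apply HN. exists z; auto. }
      rewrite <- E. apply Cder_differentiable, Hf, HD. left. eapply Rlt_le_trans. exact Hz. apply Rmin_l.
    - replace (z0 + RtoC (d / 2) - z0) with (RtoC (d / 2)) by ring. rewrite Cmod_RtoC_pos; lra.
    - rewrite Cmod_self; auto. }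
  apply Hi in K; auto.
  - assert (E : RtoC (d / 2) = RtoC 0). { replace (RtoC (d / 2)) with (z0 + RtoC (d / 2) - z0) by ring. rewrite K. ring.
      }
    apply (f_equal fst) in E. simpl in E. lra.
  - apply HD. replace (z0 + RtoC (d / 2) - z0) with (RtoC (d / 2)) by ring. rewrite Cmod_RtoC_pos by lra.
    assert (d <= r)%R by apply Rmin_l. lra. }
destruct Hc as [c [Hc1 Hc2]].
assert (B1 := Rlt_le_trans _ _ _ Hc1 (Rmin_l _ _)).
assert (B0 := Rlt_le_trans _ _ _ Hc1 (Rmin_r _ _)).
assert (B2 := Rlt_le_trans _ _ _ B0 (Rmin_l _ _)). assert (B3 := Rlt_le_trans _ _ _ B0 (Rmin_r _ _)). clear B0.
assert (Hne : c <> z0). { intros ->. auto. }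
specialize (H1 c B2). specialize (H2 c B3). rewrite H0 in H1.
replace (f c - f z0 - 0 * (c - z0)) with (f c - f z0) in H1 by ring.
assert (DC : D c). { apply HD; lra. }
assert (Key : (m2 <= Cmod (diff_quot f c z0))%R).
{ apply (min_modulus (diff_quot f c) z0 r); auto.
  - intros z Hz. apply (diff_quot_differentiable D); auto.
  - intros z Hz. destruct (classic (z = c)) as [->|Hzc]. rewrite diff_quot_diag; auto.
    intros E. assert (Q := diff_quot_mult f c z). rewrite E, Cmult_0_r in Q. apply Hzc, Hi; auto.
    replace (f z) with (f z - f c + f c) by ring. rewrite <- Q. ring.
  - intros t Ht. assert (Hzc : circ z0 r t <> c). { intros E. assert (Q := circ_dist z0 r t Hr). rewrite E in Q. lra. }
    rewrite diff_quot_neq, Cmod_div by (auto; apply Cminus_neq0; auto). unfold m2, Rdiv.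
    apply Rmult_le_compat; try lra. left; apply Rinv_0_lt_compat; lra.
    + specialize (Hmin t Ht). replace (f (circ z0 r t) - f c) with ((f (circ z0 r t) - f z0) - (f c - f z0)) by ring.
      eapply Rle_trans; [|apply Cmod_triangle_sub]. lra.
    + apply Rinv_le_contravar. apply Cmod_pos_neq; auto.
      replace (circ z0 r t - c) with ((circ z0 r t - z0) + - (c - z0)) by ring. eapply Rle_trans. apply Cmod_triangle.
      rewrite Cmod_opp, circ_dist; lra.
  - rewrite Cmod_self; auto. }
assert (Q := diff_quot_mult f c z0). apply (f_equal Cmod) in Q.
rewrite Cmod_mult, (Cmod_minus_sym z0), (Cmod_minus_sym (f z0)) in Q.
assert (P := Cmod_pos_neq _ _ Hne).
assert (Cmod (c - z0) * m2 <= Cmod (c - z0) * Cmod (diff_quot f c z0))%R by (apply Rmult_le_compat_l; lra). nra.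
Qed.

Lemma schwarz (p : C -> C) : (forall z, Cmod z < 1 -> C_differentiable p z) -> p 0 = 0 ->
  (forall z, Cmod z < 1 -> Cmod (p z) <= 1%R) -> forall z, Cmod z < 1 -> Cmod (p z) <= Cmod z.
Proof.
intros Hp H0 H1 z Hz.
assert (HO : openC (fun z => Cmod z < 1)).
{ intros u Hu. destruct (disk_openC 0 1 u) as [d [Hd H]]. replace (u - 0) with u by ring; auto.
  exists d; split; auto. intros w Hw. specialize (H w Hw). replace (w - 0) with w in H by ring. auto. }
assert (K : (Cmod (diff_quot p 0 z) <= 1)%R).
{ apply Rnot_lt_le. intros HN. set (q := Cmod (diff_quot p 0 z)) in *.
  (* The circle must enclose [z] and satisfy [/ r < q], so that the bound [/ r] on the quotient is
     violated at [z]. *)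
  set (r := Rmax ((1 + Cmod z) / 2) ((1 + / q) / 2)).
  assert (Hq : (0 < / q < 1)%R). { split. apply Rinv_0_lt_compat; lra. rewrite <- Rinv_1. apply Rinv_lt_contravar; lra.
    }
  assert (R1 : (Cmod z < r)%R). { eapply Rlt_le_trans; [|apply Rmax_l]. lra. }
  assert (R2 : (/ q < r)%R). { eapply Rlt_le_trans; [|apply Rmax_r]. lra. }
  assert (R3 : (r < 1)%R). { apply Rmax_lub_lt; lra. }
  assert (Q : (q <= / r)%R).
  { apply (max_modulus (diff_quot p 0) 0 r). lra.
    - intros u Hu. replace (u - 0) with u in Hu by ring. apply (diff_quot_differentiable (fun z => Cmod z < 1)); auto.
      rewrite Cmod_0; lra. lra.
    - intros t Ht. assert (Hd := circ_dist 0 r t ltac:(lra)). replace (circ 0 r t - 0) with (circ 0 r t) in Hd by ring.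
      assert (Hn : circ 0 r t <> 0). { apply Cmod_gt_0. rewrite Hd. lra. }
      rewrite diff_quot_neq, H0 by auto. replace (p (circ 0 r t) - 0) with (p (circ 0 r t)) by ring.
      replace (circ 0 r t - 0) with (circ 0 r t) by ring.
      rewrite Cmod_div, Hd by auto. rewrite <- (Rmult_1_l (/ r)). apply Rmult_le_compat_r.
      left; apply Rinv_0_lt_compat; lra. apply H1. lra.
    - replace (z - 0) with z by ring. auto. }
  apply Rinv_le_contravar in Q; [|lra]. rewrite Rinv_inv in Q. lra. }
assert (E := diff_quot_mult p 0 z). rewrite H0 in E. replace (p z - 0) with (p z) in E by ring.
replace (z - 0) with z in E by ring.
rewrite <- E, Cmod_mult. assert (P := Cmod_ge_0 z). nra.
Qed.

Lemma Im_minus (a b : C) : Im (a - b) = (Im a - Im b)%R.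
Proof. destruct a, b; simpl; ring. Qed.
Lemma Re_minus (a b : C) : Re (a - b) = (Re a - Re b)%R.
Proof. destruct a, b; simpl; ring. Qed.

Lemma Cayley_mod (h h0 : C) : (Cmod (h - Cconj h0) ^ 2 - Cmod (h - h0) ^ 2 = 4 * Im h * Im h0)%R.
Proof. rewrite !Cmod2_alt. destruct h, h0; simpl. ring. Qed.

(** The disk of radius [rho] about [i rho] touches the real line at [0]. There [h], followed by the
    Cayley transform that sends [h0] to [0], obeys the Schwarz lemma, and this makes [Im h] grow at
    least linearly along the imaginary axis. *)
Theorem hopf (h : C -> C) (R0 : R) : (0 < R0)%R -> (forall z, Cmod z < R0 -> C_differentiable h z) ->
  (forall z, Cmod z < R0 -> (0 < Im z)%R -> (0 < Im (h z))%R) -> Im (h 0) = 0%R -> C_derive h 0 <> RtoC 0.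
Proof.
intros HR Hh Hp H0 HD.
set (rho := (R0 / 4)%R). assert (Hrho : (0 < rho)%R) by (unfold rho; lra).
set (c := Ci * RtoC rho).
assert (Hin : forall z, Cmod z < 1 -> Cmod (c + RtoC rho * z) < R0 /\ (0 < Im (c + RtoC rho * z))%R).
{ intros z Hz. split. eapply Rle_lt_trans. apply Cmod_triangle. unfold c.
  rewrite !Cmod_mult, Cmod_Ci, Cmod_RtoC_pos by lra. unfold rho in *. nra.
  assert (B := im_le_Cmod z). apply Rabs_le_between in B. destruct z as [x y]. unfold c. simpl in *. nra. }
assert (Z0 : Cmod 0 < 1) by (rewrite Cmod_0; lra).
set (h0 := h (c + RtoC rho * 0)). set (Y0 := Im h0).
assert (HY0 : (0 < Y0)%R). { destruct (Hin 0 Z0). apply Hp; auto. }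
assert (Hne : forall w, (0 < Im w)%R -> w - Cconj h0 <> RtoC 0).
{ intros w Hw E. apply (f_equal Im) in E. rewrite Im_minus in E. simpl in E. unfold Y0 in HY0. destruct h0; simpl in *.
  lra. }
set (p := fun z => (h (c + RtoC rho * z) - h0) / (h (c + RtoC rho * z) - Cconj h0)).
assert (Hpmod : forall z, Cmod z < 1 -> Cmod (p z) <= 1%R).
{ intros z Hz. destruct (Hin z Hz) as [A B]. specialize (Hp _ A B). unfold p. rewrite Cmod_div by (apply Hne; auto).
  apply Rle_div_l. apply Cmod_gt_0, Hne; auto. rewrite Rmult_1_l.
  assert (E := Cayley_mod (h (c + RtoC rho * z)) h0). fold Y0 in E.
  assert (P1 := Cmod_ge_0 (h (c + RtoC rho * z) - h0)). assert (P2 := Cmod_ge_0 (h (c + RtoC rho * z) - Cconj h0)).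
  apply Rsqr_incr_0; auto. unfold Rsqr. nra. }
assert (S : forall z, Cmod z < 1 -> Cmod (p z) <= Cmod z).
{ apply schwarz; auto.
  - intros z Hz. destruct (Hin z Hz) as [A B]. assert (Hd := Cder_differentiable _ _ (Hh _ A)).
    assert (Hd2 : Cder (fun z => h (c + RtoC rho * z)) z (C_derive h (c + RtoC rho * z) * (RtoC rho * 1))).
    { apply (Cder_comp h (fun z => c + RtoC rho * z)); auto. eapply Cder_eq. cder. ring. }
    eapply Cder_is_differentiable. unfold p. cder. apply Hne; auto.
  - unfold p. fold h0. unfold Cdiv. ring. }
assert (H00 : Cmod 0 < R0) by (rewrite Cmod_0; lra).
(* At [i rho eta] the Schwarz lemma will give [Im h >= eta * Y0 / 4], while a zero derivative with
   this error bound gives at most [eta * Y0 / 8]. *)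
destruct (proj1 (Cder_eps _ _ _) (Cder_differentiable _ _ (Hh 0 H00)) (Y0 / (8 * rho))%R) as [d [Hd Hdd]].
{ apply Rdiv_lt_0_compat; lra. }
set (eta := Rmin (1 / 2) (d / (2 * rho))).
assert (He : (0 < eta)%R). { apply Rmin_pos. lra. apply Rdiv_lt_0_compat; lra. }
assert (He1 : (eta <= 1 / 2)%R) by apply Rmin_l.
assert (He2 : (rho * eta < d)%R).
{ apply Rle_lt_trans with (rho * (d / (2 * rho)))%R. apply Rmult_le_compat_l. lra. apply Rmin_r.
  replace (rho * (d / (2 * rho)))%R with (d / 2)%R by (field; lra). lra. }
set (z := - (Ci * RtoC (1 - eta))).
assert (Ez : c + RtoC rho * z = Ci * RtoC (rho * eta)). { unfold c, z. rewrite RtoC_mult, RtoC_minus. ring. }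
assert (Mz : Cmod z = (1 - eta)%R). { unfold z. rewrite Cmod_opp, Cmod_mult, Cmod_Ci, Cmod_RtoC_pos; lra. }
specialize (S z ltac:(lra)). destruct (Hin z ltac:(lra)) as [A B]. specialize (Hp _ A B).
unfold p in S. rewrite Ez in *. set (w := h (Ci * RtoC (rho * eta))) in *.
rewrite Cmod_div, Mz in S by (apply Hne; auto). apply Rle_div_l in S; [|apply Cmod_gt_0, Hne; auto].
assert (E := Cayley_mod w h0). fold Y0 in E.
assert (P1 := Cmod_ge_0 (w - h0)). assert (P2 : (Y0 <= Cmod (w - Cconj h0))%R).
{ eapply Rle_trans; [|apply im_le_Cmod]. rewrite Im_minus, im_conj. fold Y0. rewrite Rabs_right; lra. }
set (X := Cmod (w - Cconj h0)) in *. set (V := Cmod (w - h0)) in *.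
assert (Ylow : (eta * Y0 / 4 <= Im w)%R).
{ assert (V ^ 2 <= ((1 - eta) * X) ^ 2)%R. { apply pow_incr. lra. }
  assert (eta * X ^ 2 <= X ^ 2 - V ^ 2)%R.
  { replace (((1 - eta) * X) ^ 2)%R with ((1 - 2 * eta + eta * eta) * X ^ 2)%R in H by ring.
    assert (0 <= X ^ 2)%R by (apply pow_le; lra). nra. }
  assert (Y0 ^ 2 <= X ^ 2)%R by (apply pow_incr; lra).
  assert (eta * Y0 ^ 2 <= 4 * Im w * Y0)%R by nra.
  apply Rmult_le_reg_r with Y0; auto. nra. }
specialize (Hdd (Ci * RtoC (rho * eta))). rewrite HD in Hdd.
replace (Ci * RtoC (rho * eta) - 0) with (Ci * RtoC (rho * eta)) in Hdd by ring.
replace (h (Ci * RtoC (rho * eta)) - h 0 - 0 * (Ci * RtoC (rho * eta))) with (w - h 0) in Hdd by (unfold w; ring).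
rewrite Cmod_mult, Cmod_Ci, Cmod_RtoC_pos in Hdd by nra. specialize (Hdd ltac:(lra)).
assert (Up : (Im w <= Cmod (w - h 0))%R). { eapply Rle_trans; [|apply im_le_Cmod]. rewrite Im_minus, H0.
  rewrite Rminus_0_r. apply Rle_abs. }
replace (Y0 / (8 * rho) * (1 * (rho * eta)))%R with (eta * Y0 / 8)%R in Hdd by (field; lra).
assert (0 < eta * Y0)%R by (apply Rmult_lt_0_compat; auto). lra.
Qed.

(** An identity principle: [k] can be divided by [z] indefinitely, each quotient still vanishing on
    the lower half disk and so at [0]. The maximum principle for the quotients gives
    [Cmod (k z) <= M * (Cmod z / r) ^ n] for all [n]. *)
Lemma zero_half_disk (k : C -> C) (R0 : R) : (forall z, Cmod z < R0 -> C_differentiable k z) ->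
  (forall z, Cmod z < R0 -> (Im z < 0)%R -> k z = 0) -> forall z, Cmod z < R0 -> k z = 0.
Proof.
intros Hk Hz z Hzr. assert (HP := PI_RGT_0). assert (HZ := Cmod_ge_0 z).
set (r := ((Cmod z + R0) / 2)%R). assert (Hr : (Cmod z < r < R0)%R) by (unfold r; lra).
assert (Hr0 : (0 < r)%R) by lra.
assert (HO : openC (fun z => Cmod z < R0)).
{ intros u Hu. destruct (disk_openC 0 R0 u) as [d [Hd H]]. replace (u - 0) with u by ring; auto.
  exists d; split; auto. intros w Hw. specialize (H w Hw). replace (w - 0) with w in H by ring. auto. }
assert (H00 : Cmod 0 < R0) by (rewrite Cmod_0; lra).
assert (Hn : forall n, exists kn, (forall z, Cmod z < R0 -> C_differentiable kn z) /\
   (forall z, Cmod z < R0 -> (Im z < 0)%R -> kn z = 0) /\ forall z, k z = z ^ n * kn z).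
{ induction n.
  - exists k. repeat split; auto. intros; simpl; ring.
  - destruct IHn as [kn [A [B E]]].
    assert (K0 : kn 0 = 0).
    { apply Cmod_eq_0, Rle_antisym; [|apply Cmod_ge_0]. apply Rnot_lt_le. intros HN.
      destruct (Cder_continuous_eps _ _ _ (Cder_differentiable _ _ (A 0 H00)) _ HN) as [d [Hd HH]].
      set (s := (Rmin d R0 / 2)%R). assert (Hs : (0 < s)%R). { unfold s.
        assert (0 < Rmin d R0)%R by (apply Rmin_pos; lra). lra. }
      assert (s < d)%R by (unfold s in *; assert (J := Rmin_l d R0); lra).
      assert (s < R0)%R by (unfold s in *; assert (J := Rmin_r d R0); lra).
      assert (Ms : Cmod (- (Ci * RtoC s)) = s) by (rewrite Cmod_opp, Cmod_mult, Cmod_Ci, Cmod_RtoC_pos; lra).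
      specialize (HH (- (Ci * RtoC s))). replace (- (Ci * RtoC s) - 0) with (- (Ci * RtoC s)) in HH by ring.
      rewrite B in HH. replace (0 - kn 0) with (- kn 0) in HH by ring. rewrite (Cmod_opp (kn 0)) in HH.
      specialize (HH ltac:(lra)). lra. lra. simpl. lra. }
    exists (diff_quot kn 0). repeat split.
    + intros u Hu. apply (diff_quot_differentiable (fun z => Cmod z < R0)); auto.
    + intros u Hu Hi. rewrite diff_quot_neq, B, K0 by (auto; intros ->; simpl in Hi; lra). unfold Cdiv; ring.
    + intros u. rewrite E. assert (Q := diff_quot_mult kn 0 u). rewrite K0 in Q.
      replace (kn u - 0) with (kn u) in Q by ring.
      rewrite <- Q. simpl. ring. }
destruct (Rcont_bounded (fun t => k (circ 0 r t)) 0 (2 * PI) ltac:(lra)) as [M [HM0 HM]].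
{ intros t Ht. apply (Rcont_diff k (circ 0 r)). apply Hk. assert (Hd := circ_dist 0 r t ltac:(lra)).
  replace (circ 0 r t - 0) with (circ 0 r t) in Hd by ring. lra. apply Rcont_circ. }
assert (Bd : forall n, (Cmod (k z) <= M * (Cmod z / r) ^ n)%R).
{ intros n. destruct (Hn n) as [kn [A [_ E]]]. rewrite E, Cmod_mult, Cmod_pow.
  assert (rn : (0 < r ^ n)%R) by (apply pow_lt; lra).
  assert (Q : (Cmod (kn z) <= M / r ^ n)%R).
  { apply (max_modulus kn 0 r). lra.
    - intros u Hu. replace (u - 0) with u in Hu by ring. apply A. lra.
    - intros t Ht. assert (Hd := circ_dist 0 r t ltac:(lra)). replace (circ 0 r t - 0) with (circ 0 r t) in Hd by ring.
      specialize (HM t Ht). rewrite E, Cmod_mult, Cmod_pow, Hd in HM. apply Rle_div_r; auto. lra.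
    - replace (z - 0) with z by ring. lra. }
  unfold Rdiv. rewrite Rpow_mult_distr, pow_inv. assert (0 <= Cmod z ^ n)%R by (apply pow_le; lra).
  replace (M * (Cmod z ^ n * / r ^ n))%R with (Cmod z ^ n * (M / r ^ n))%R by (unfold Rdiv; ring).
  apply Rmult_le_compat_l; auto. }
apply Cmod_eq_0, Rle_antisym; [|apply Cmod_ge_0]. apply Rnot_lt_le. intros HN.
assert (Hq : (0 <= Cmod z / r < 1)%R). { split. apply Rle_div_r; lra. apply Rlt_div_l; lra. }
destruct (pow_lt_1_zero (Cmod z / r)) with (y := (Cmod (k z) / (M + 1))%R) as [N HNN]. rewrite Rabs_right; lra.
apply Rdiv_lt_0_compat; lra.
specialize (HNN N (le_n N)). rewrite Rabs_right in HNN by (apply Rle_ge, pow_le; lra).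
specialize (Bd N). apply Rlt_div_r in HNN; [|lra].
assert (0 <= (Cmod z / r) ^ N)%R by (apply pow_le; lra). nra.
Qed.

(** * Reflection *)

Ltac splits := lazymatch goal with |- _ /\ _ => split; [|splits] | _ => idtac end.

(** The sign [sg] is [1] for the upper and [-1] for the lower half, so that one-sided lemmas are
    proved once. *)
Definition half_disk (R0 sg : R) (z : C) : Prop := Cmod z < R0 /\ (0 < sg * Im z)%R.

Lemma Im_segment z w t : Im (z + RtoC t * (w - z)) = ((1 - t) * Im z + t * Im w)%R.
Proof. destruct z, w; simpl; ring. Qed.

Lemma half_disk_convex R0 sg : convexC (half_disk R0 sg).
Proof.
intros z w [Hz1 Hz2] [Hw1 Hw2] t Ht. split.
- assert (H := disk_convex 0 R0 z w). cbv beta in H. replace (z - 0) with z in H by ring.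
  replace (w - 0) with w in H by ring.
  specialize (H Hz1 Hw1 t Ht).
  match type of H with Rlt (Cmod (Cminus ?a (RtoC 0))) _ => replace (a - RtoC 0) with a in H by ring end. auto.
- rewrite Im_segment. destruct (Req_dec t 0) as [->|]. lra.
  assert (0 < t * (sg * Im w))%R by (apply Rmult_lt_0_compat; lra).
  assert (0 <= (1 - t) * (sg * Im z))%R by (apply Rmult_le_pos; lra). lra.
Qed.

Lemma half_disk_open R0 sg : (sg = 1 \/ sg = -1)%R -> openC (half_disk R0 sg).
Proof.
intros Hsg z [Hz1 Hz2]. exists (Rmin (R0 - Cmod z) (sg * Im z)). split. apply Rmin_pos; lra.
intros w Hw. assert (W1 := Rlt_le_trans _ _ _ Hw (Rmin_l _ _)). assert (W2 := Rlt_le_trans _ _ _ Hw (Rmin_r _ _)).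
split.
- assert (T := Cmod_triangle (w - z) z). replace (w - z + z) with w in T by ring. lra.
- assert (B := im_le_Cmod (w - z)). rewrite Im_minus in B. apply Rabs_le_between in B. destruct Hsg as [-> | ->]; lra.
Qed.

(** A primitive of a bounded function is Lipschitz, so it has limits on the diameter, which [k]
    itself need not have. *)
Lemma half_disk_primitive R0 sg k M : (0 < R0)%R -> (sg = 1 \/ sg = -1)%R ->
  (forall z, half_disk R0 sg z -> C_differentiable k z) ->
  (forall z, half_disk R0 sg z -> Cmod (k z) <= M) ->
  exists K, (forall z w, half_disk R0 sg z -> half_disk R0 sg w -> K w - K z = segment_integral k z w) /\
    (forall z, half_disk R0 sg z -> Cder K z (k z)) /\
    (forall z w, half_disk R0 sg z -> half_disk R0 sg w -> Cmod (K w - K z) <= (2 * M * Cmod (w - z))%R).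
Proof.
intros HR Hsg Hk HM. set (c := Ci * RtoC (sg * (R0 / 2))).
assert (Hc : half_disk R0 sg c).
{ split. unfold c. rewrite Cmod_mult, Cmod_Ci, Cmod_R, Rmult_1_l. destruct Hsg as [-> | ->]. rewrite Rabs_right; lra.
  rewrite Rabs_left; lra.
  unfold c. simpl. destruct Hsg as [-> | ->]; lra. }
assert (Cv := half_disk_convex R0 sg). assert (Op := half_disk_open R0 sg Hsg).
assert (A : forall z w, half_disk R0 sg z -> half_disk R0 sg w ->
  segment_integral k c w - segment_integral k c z = segment_integral k z w).
{ intros z w Hz Hw. rewrite <- (segment_integral_add _ k c z w Cv Hk Hc Hz Hw). ring. }
exists (segment_integral k c). splits; auto.
- apply (primitive_segment_integral _ k c Cv Op Hk Hc).
- intros z w Hz Hw. rewrite A by auto. apply segment_integral_bound. apply (segment_Rcont _ k z w Cv Hk Hz Hw).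
  intros t Ht. apply HM, Cv; auto.
Qed.

Lemma Rle_all_eps (a b c : R) : (0 <= c)%R -> (forall e, (0 < e)%R -> (a <= b + c * e)%R) -> (a <= b)%R.
Proof.
intros Hc H. apply Rnot_lt_le. intros HN. specialize (H ((a - b) / (2 * (c + 1)))%R ltac:(apply Rdiv_lt_0_compat; lra)).
assert (c * ((a - b) / (2 * (c + 1))) < a - b)%R.
{ apply Rle_lt_trans with ((c + 1) * ((a - b) / (2 * (c + 1))))%R. apply Rmult_le_compat_r.
  left; apply Rdiv_lt_0_compat; lra. lra.
  replace ((c + 1) * ((a - b) / (2 * (c + 1))))%R with ((a - b) / 2)%R by (field; lra). lra. }
lra.
Qed.

(** Completeness provides the limit; the rate of convergence is kept because it yields the first
    order expansion of a primitive of [phi] at [p]. *)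
Lemma lipschitz_limit (D : C -> Prop) (phi : C -> C) (L : R) (p : C) :
  (0 <= L)%R -> (forall z w, D z -> D w -> Cmod (phi w - phi z) <= (L * Cmod (w - z))%R) ->
  (forall e, (0 < e)%R -> exists z, D z /\ Cmod (z - p) < e) ->
  exists l, forall z, D z -> Cmod (phi z - l) <= (L * Cmod (z - p))%R.
Proof.
intros HL Hlip Hadh.
set (F := within D (locally (T:=C_UniformSpace) p)).
assert (FF : ProperFilter F).
{ split.
  - intros P HP. apply locally_C_iff in HP. destruct HP as [d [Hd H]]. destruct (Hadh d Hd) as [z [Hz Hz2]]. exists z.
    apply H; auto.
  - apply within_filter, locally_filter. }
assert (Hc : forall (part : C -> R), (forall a b, (Rabs (part a - part b) <= Cmod (a - b))%R) ->
   exists y : R, filterlim (fun z => part (phi z)) F (locally y)).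
{ intros part Hpart. apply (filterlim_locally_cauchy (U:=R_CompleteSpace)). intros eps.
  exists (fun z => D z /\ Cmod (z - p) < eps / (2 * (L + 1)))%R. split.
  - apply locally_C_iff. exists (eps / (2 * (L + 1)))%R. split. apply Rdiv_lt_0_compat. apply cond_pos. lra. auto.
  - intros u v [Du Hu] [Dv Hv]. change (Rabs (part (phi v) - part (phi u)) < eps)%R.
    eapply Rle_lt_trans. apply Hpart. eapply Rle_lt_trans. apply Hlip; auto.
    assert (T := Cmod_triangle (v - p) (p - u)). replace (v - p + (p - u)) with (v - u) in T by ring.
    rewrite (Cmod_minus_sym p u) in T.
    assert (Cmod (v - u) < eps / (L + 1))%R.
    { replace (eps / (L + 1))%R with (eps / (2 * (L + 1)) + eps / (2 * (L + 1)))%R by (field; lra). lra. }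
    apply Rlt_div_r in H; [|lra]. assert (Q := Cmod_ge_0 (v - u)). nra. }
destruct (Hc Re) as [a Ha]. { intros x y. rewrite <- Re_minus. apply re_le_Cmod. }
destruct (Hc Im) as [b Hb]. { intros x y. rewrite <- Im_minus. apply im_le_Cmod. }
exists (a, b). intros z Hz.
apply Rle_all_eps with (c := (L + 2)%R). lra. intros e He.
assert (A1 := Ha _ (locally_ball a (mkposreal e He))). assert (B1 := Hb _ (locally_ball b (mkposreal e He))).
unfold filtermap, F, within in A1, B1.
apply locally_C_iff in A1. apply locally_C_iff in B1. destruct A1 as [d1 [Hd1 A1]]. destruct B1 as [d2 [Hd2 B1]].
destruct (Hadh (Rmin e (Rmin d1 d2))) as [w [Dw Hw]]. repeat apply Rmin_pos; auto.
assert (W1 := Rlt_le_trans _ _ _ Hw (Rmin_l _ _)). assert (W2 := Rlt_le_trans _ _ _ Hw (Rmin_r _ _)).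
specialize (A1 w (Rlt_le_trans _ _ _ W2 (Rmin_l _ _)) Dw). specialize (B1 w (Rlt_le_trans _ _ _ W2 (Rmin_r _ _)) Dw).
change (Rabs (Re (phi w) - a) < e)%R in A1. change (Rabs (Im (phi w) - b) < e)%R in B1.
replace (phi z - (a, b)) with ((phi z - phi w) + (phi w - (a, b))) by ring.
eapply Rle_trans. apply Cmod_triangle. specialize (Hlip w z Dw Hz).
assert (N := Cmod_le_re_im (phi w - (a, b))). rewrite Re_minus, Im_minus in N. simpl (Re (a, b)) in N.
simpl (Im (a, b)) in N.
assert (T := Cmod_triangle (z - p) (p - w)). replace (z - p + (p - w)) with (z - w) in T by ring.
rewrite (Cmod_minus_sym p w) in T.
assert (L * Cmod (z - w) <= L * (Cmod (z - p) + e))%R by (apply Rmult_le_compat_l; lra). lra.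
Qed.

Lemma half_disk_adherent R0 sg w : (sg = 1 \/ sg = -1)%R -> (0 <= sg * Im w)%R ->
  forall s, (0 < s < R0 - Cmod w)%R -> half_disk R0 sg (w + Ci * RtoC (sg * s)).
Proof.
intros Hsg Hi s Hs. split.
- eapply Rle_lt_trans. apply Cmod_triangle. rewrite Cmod_mult, Cmod_Ci, Cmod_R.
  destruct Hsg as [-> | ->]. rewrite Rabs_right; lra. rewrite Rabs_left; lra.
- destruct w; simpl in *. destruct Hsg as [-> | ->]; lra.
Qed.

Lemma Cmod_Ci_sg sg s : (sg = 1 \/ sg = -1)%R -> (0 < s)%R -> Cmod (Ci * RtoC (sg * s)) = s.
Proof.
intros Hsg Hs. rewrite Cmod_mult, Cmod_Ci, Cmod_R. destruct Hsg as [-> | ->]. rewrite Rabs_right; lra.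
rewrite Rabs_left; lra.
Qed.

Lemma half_disk_adherent' R0 sg w : (sg = 1 \/ sg = -1)%R -> Cmod w < R0 -> (0 <= sg * Im w)%R ->
  forall e, (0 < e)%R -> exists z, half_disk R0 sg z /\ Cmod (z - w) < e.
Proof.
intros Hsg Hw Hi e He. set (s := (Rmin e (R0 - Cmod w) / 2)%R).
assert (M1 := Rmin_l e (R0 - Cmod w)). assert (M2 := Rmin_r e (R0 - Cmod w)).
assert (M0 : (0 < Rmin e (R0 - Cmod w))%R) by (apply Rmin_pos; lra).
exists (w + Ci * RtoC (sg * s)). split. apply half_disk_adherent; auto. unfold s; lra.
replace (w + Ci * RtoC (sg * s) - w) with (Ci * RtoC (sg * s)) by ring. rewrite Cmod_Ci_sg; auto; unfold s; lra.
Qed.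

(* One-sided first order expansion at the diameter; the two sides together make the glued
   function differentiable there. *)
Lemma half_disk_taylor R0 sg (K KK G : C -> C) (L L2 : R) (x : C) (K0 : C) :
  (sg = 1 \/ sg = -1)%R -> (0 <= L)%R -> (0 <= L2)%R -> Im x = 0%R -> Cmod x < R0 ->
  (forall z, half_disk R0 sg z -> C_differentiable K z) ->
  (forall z, half_disk R0 sg z -> Cmod (K z - K0) <= (L * Cmod (z - x))%R) ->
  (forall z w, half_disk R0 sg z -> half_disk R0 sg w -> KK w - KK z = segment_integral K z w) ->
  (forall w, Cmod w < R0 -> (0 <= sg * Im w)%R -> forall z, half_disk R0 sg z ->
  Cmod (KK z - G w) <= (L2 * Cmod (z - w))%R) ->
  forall w, Cmod w < R0 -> (0 <= sg * Im w)%R ->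
    Cmod (G w - G x - K0 * (w - x)) <= (2 * L * Cmod (w - x) * Cmod (w - x))%R.
Proof.
intros Hsg HL HL2 Hx Hxr HK HK0 HKK HG w Hw Hwi.
assert (Hxi : (0 <= sg * Im x)%R) by (rewrite Hx; lra).
assert (Q := Cmod_ge_0 (w - x)). set (h := Cmod (w - x)) in *.
apply Rle_all_eps with (c := (2 * L * h + 2 * L2)%R). nra. intros e He.
set (s := (Rmin e (Rmin (R0 - Cmod w) (R0 - Cmod x)) / 2)%R).
assert (M1 := Rmin_l e (Rmin (R0 - Cmod w) (R0 - Cmod x))). assert (M2 := Rmin_r e (Rmin (R0 - Cmod w) (R0 - Cmod x))).
assert (M3 := Rmin_l (R0 - Cmod w) (R0 - Cmod x)). assert (M4 := Rmin_r (R0 - Cmod w) (R0 - Cmod x)).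
assert (M0 : (0 < Rmin e (Rmin (R0 - Cmod w) (R0 - Cmod x)))%R) by (repeat apply Rmin_pos; lra).
assert (Hs : (0 < s)%R) by (unfold s; lra). assert (Hse : (s <= e)%R) by (unfold s; lra).
assert (Hz' : half_disk R0 sg (w + Ci * RtoC (sg * s))) by (apply half_disk_adherent; auto; unfold s in *; lra).
assert (Hz : half_disk R0 sg (x + Ci * RtoC (sg * s))) by (apply half_disk_adherent; auto; unfold s in *; lra).
set (d := Ci * RtoC (sg * s)) in *. assert (Hd : Cmod d = s) by (unfold d; apply Cmod_Ci_sg; auto).
assert (B1 := HG w Hw Hwi _ Hz'). assert (B2 := HG x Hxr Hxi _ Hz).
replace (w + d - w) with d in B1 by ring. replace (x + d - x) with d in B2 by ring. rewrite Hd in *.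
replace (G w - G x - K0 * (w - x)) with
  ((KK (w + d) - KK (x + d) - K0 * ((w + d) - (x + d))) + (- (KK (w + d) - G w) + (KK (x + d) - G x))) by ring.
eapply Rle_trans. apply Cmod_triangle.
assert (T := Cmod_triangle (- (KK (w + d) - G w)) (KK (x + d) - G x)). rewrite Cmod_opp in T.
assert (Cv := half_disk_convex R0 sg).
rewrite HKK by auto.
assert (Rc := segment_Rcont _ K (x + d) (w + d) Cv HK Hz Hz').
rewrite segment_integral_minus_const by auto.
assert (SB : Cmod (segment_integral (fun u => K u - K0) (x + d) (w + d)) <= (2 * (L * (h + s)) * h)%R).
{ unfold h at 2. replace (w - x) with (w + d - (x + d)) by ring. apply segment_integral_bound.
  - intros t Ht. apply (Rcont_minus (fun t => K (x + d + RtoC t * (w + d - (x + d)))) (fun _ => K0)). apply (Rc t Ht).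
    apply Rcont_const.
  - intros t Ht. eapply Rle_trans. apply HK0. apply Cv; auto. apply Rmult_le_compat_l; auto.
    replace (x + d + RtoC t * (w + d - (x + d)) - x) with (d + RtoC t * (w - x)) by ring.
    eapply Rle_trans. apply Cmod_triangle. rewrite Cmod_mult, Cmod_RtoC_pos, Hd by lra. fold h. nra. }
assert (L * s * h <= L * e * h)%R. { apply Rmult_le_compat_r; auto. apply Rmult_le_compat_l; auto. }
assert (L2 * s <= L2 * e)%R by (apply Rmult_le_compat_l; auto). lra.
Qed.

(** The two sides are compared only at conjugate points and neither need have a limit at [x]. This
    suits reflection, where the boundary values are unknown but their imaginary part or modulus is
    known. *)
Definition vanishing_gap (R0 : R) (kp km : C -> C) : Prop :=
  forall x : R, (Rabs x < R0)%R -> forall e, (0 < e)%R -> exists d, (0 < d)%R /\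
    forall z, half_disk R0 1 z -> Cmod (z - RtoC x) < d -> Cmod (kp z - km (Cconj z)) <= e.

Lemma half_disk_conj R0 z : half_disk R0 1 z -> half_disk R0 (-1) (Cconj z).
Proof. intros [H1 H2]. split. rewrite Cmod_conj; auto. rewrite im_conj. lra. Qed.

Lemma primitive_pair R0 kp km M : (0 < R0)%R -> (0 <= M)%R ->
  (forall z, half_disk R0 1 z -> C_differentiable kp z) ->
  (forall z, half_disk R0 (-1) z -> C_differentiable km z) ->
  (forall z, half_disk R0 1 z -> Cmod (kp z) <= M) ->
  (forall z, half_disk R0 (-1) z -> Cmod (km z) <= M) ->
  vanishing_gap R0 kp km ->
  exists Kp Km M', (0 <= M')%R /\
    (forall z w, half_disk R0 1 z -> half_disk R0 1 w -> Kp w - Kp z = segment_integral kp z w) /\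
    (forall z w, half_disk R0 (-1) z -> half_disk R0 (-1) w -> Km w - Km z = segment_integral km z w) /\
    (forall z, half_disk R0 1 z -> Cder Kp z (kp z)) /\
    (forall z, half_disk R0 (-1) z -> Cder Km z (km z)) /\
    (forall z, half_disk R0 1 z -> Cmod (Kp z) <= M') /\
    (forall z, half_disk R0 (-1) z -> Cmod (Km z) <= M') /\
    (forall z w, half_disk R0 1 z -> half_disk R0 1 w -> Cmod (Kp w - Kp z) <= (2 * M * Cmod (w - z))%R) /\
    (forall z w, half_disk R0 (-1) z -> half_disk R0 (-1) w -> Cmod (Km w - Km z) <= (2 * M * Cmod (w - z))%R) /\
    vanishing_gap R0 Kp Km.
Proof.
intros HR HM0 Dp Dm Bp Bm Hgap.
destruct (half_disk_primitive R0 1 kp M) as [Kp [P1 [P2 P3]]]; auto.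
destruct (half_disk_primitive R0 (-1) km M) as [K0 [Q1 [Q2 Q3]]]; auto.
set (Delta := fun z => Kp z - K0 (Cconj z)).
assert (DL : forall z w, half_disk R0 1 z -> half_disk R0 1 w -> Cmod (Delta w - Delta z) <= (4 * M * Cmod (w - z))%R).
{ intros z w Hz Hw. unfold Delta.
  replace (Kp w - K0 (Cconj w) - (Kp z - K0 (Cconj z))) with ((Kp w - Kp z) + - (K0 (Cconj w) - K0 (Cconj z))) by ring.
  eapply Rle_trans. apply Cmod_triangle. rewrite Cmod_opp. specialize (P3 z w Hz Hw).
  specialize (Q3 _ _ (half_disk_conj _ _ Hz) (half_disk_conj _ _ Hw)). rewrite <- Cminus_conj, Cmod_conj in Q3. lra. }
assert (Lim : forall x : R, (Rabs x < R0)%R -> exists l, forall z, half_disk R0 1 z ->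
  Cmod (Delta z - l) <= (4 * M * Cmod (z - RtoC x))%R).
{ intros x Hx. apply lipschitz_limit; auto. lra. apply half_disk_adherent'; auto. rewrite Cmod_R; auto. simpl. lra. }
destruct (Lim 0%R) as [k0 Hk0]. rewrite Rabs_R0; auto.
assert (Hsame : forall x : R, (Rabs x < R0)%R -> forall z, half_disk R0 1 z ->
  Cmod (Delta z - k0) <= (4 * M * Cmod (z - RtoC x))%R).
{ intros x Hx. destruct (Lim x Hx) as [l Hl]. replace k0 with l; auto.
  assert (Z : Cmod (l - k0) = 0%R); [|apply Cmod_eq_0 in Z; replace l with (l - k0 + k0) by ring; rewrite Z; ring].
  apply Rle_antisym; [|apply Cmod_ge_0]. apply Rle_all_eps with (c := (8 * M + 2 * Rabs x)%R).
  assert (Ax := Rabs_pos x); lra.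
  intros e He.
  assert (Hpt : forall u, exists d : posreal, (Rabs u < R0)%R -> forall z, half_disk R0 1 z ->
    Cmod (z - RtoC u) < 2 * d -> Cmod (kp z - km (Cconj z)) <= e).
  { intros u. destruct (Rlt_or_le (Rabs u) R0) as [Hu|Hu].
    - destruct (Hgap u Hu e He) as [d [Hd HH]]. assert (Hd2 : (0 < d / 2)%R) by lra. exists (mkposreal _ Hd2). simpl.
      intros _ z Hz Hz2. apply HH; auto. lra.
    - exists (mkposreal 1 Rlt_0_1). intros; lra. }
  set (delta := fun u => proj1_sig (constructive_indefinite_description _ (Hpt u))).
  assert (Hdelta : forall u, (Rabs u < R0)%R -> forall z, half_disk R0 1 z -> Cmod (z - RtoC u) < 2 * delta u ->
    Cmod (kp z - km (Cconj z)) <= e).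
  { intros u. apply (proj2_sig (constructive_indefinite_description _ (Hpt u))). }
  (* Compactness makes the gap at most [e] on a whole segment at a small height [s]. The factor 2 in
     [Hdelta] leaves room for the horizontal distance and for the height. *)
  destruct (compactness_value_1d (- Rabs x)%R (Rabs x) delta) as [d Hd].
  set (s := (Rmin (Rmin e d) (R0 - Rabs x) / 2)%R).
  assert (M1 := Rmin_l (Rmin e d) (R0 - Rabs x)). assert (M2 := Rmin_r (Rmin e d) (R0 - Rabs x)).
  assert (M3 := Rmin_l e d). assert (M4 := Rmin_r e d). assert (Hdp := cond_pos d).
  assert (M0 : (0 < Rmin (Rmin e d) (R0 - Rabs x))%R) by (repeat apply Rmin_pos; lra).
  assert (Hs : (0 < s)%R) by (unfold s; lra). assert (Hse : (s <= e)%R) by (unfold s; lra).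
  assert (Hsd : (s < d)%R) by (unfold s; lra). assert (HsR : (s < R0 - Rabs x)%R) by (unfold s; lra).
  assert (Hin : forall y, (Rabs y <= Rabs x)%R -> half_disk R0 1 (RtoC y + Ci * RtoC s)).
  { intros y Hy. replace (RtoC s) with (RtoC (1 * s)) by (f_equal; ring). apply half_disk_adherent; auto. simpl; lra.
    rewrite Cmod_R; lra. }
  assert (Hu : forall y, (Rabs y <= Rabs x)%R ->
    Cmod (kp (RtoC y + Ci * RtoC s) - km (Cconj (RtoC y + Ci * RtoC s))) <= e).
  { intros y Hy. apply Rnot_lt_le. intros HN. apply (Hd y). apply Rabs_le_between; auto. intros [u [Hu1 [Hu2 Hu3]]].
    apply (Rlt_irrefl e). eapply Rlt_le_trans. exact HN. apply (Hdelta u). apply Rle_lt_trans with (Rabs x); auto.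
    apply Rabs_le; lra. apply Hin; auto.
    replace (RtoC y + Ci * RtoC s - RtoC u) with (RtoC (y - u) + Ci * RtoC s) by (rewrite RtoC_minus; ring).
    eapply Rle_lt_trans. apply Cmod_triangle. rewrite Cmod_mult, Cmod_Ci, (Cmod_RtoC_pos s), Cmod_R by lra. lra. }
  assert (H0r : (Rabs 0 <= Rabs x)%R) by (rewrite Rabs_R0; apply Rabs_pos).
  set (z0 := RtoC 0 + Ci * RtoC s). set (zx := RtoC x + Ci * RtoC s).
  assert (I0 : half_disk R0 1 z0) by (apply Hin; auto). assert (Ix : half_disk R0 1 zx) by (apply Hin; lra).
  assert (DD : Cmod (Delta zx - Delta z0) <= (2 * e * Rabs x)%R).
  { unfold Delta.
    replace (Kp zx - K0 (Cconj zx) - (Kp z0 - K0 (Cconj z0))) with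
      ((Kp zx - Kp z0) - (K0 (Cconj zx) - K0 (Cconj z0))) by ring.
    rewrite P1, Q1 by (auto; apply half_disk_conj; auto). unfold segment_integral.
    replace (zx - z0) with (RtoC x) by (unfold zx, z0; ring).
    assert (Ez : Cconj zx - Cconj z0 = RtoC x). { unfold zx, z0. apply injective_projections; simpl; ring. }
    assert (S1 := segment_Rcont _ kp z0 zx (half_disk_convex R0 1) Dp I0 Ix).
    assert (S2 := segment_Rcont _ km (Cconj z0) (Cconj zx) (half_disk_convex R0 (-1)) Dm (half_disk_conj _ _ I0)
      (half_disk_conj _ _ Ix)).
    replace (zx - z0) with (RtoC x) in S1 by (unfold zx, z0; ring). rewrite Ez in S2. rewrite Ez.
    replace (RtoC x * CInt (fun t => kp (z0 + RtoC t * RtoC x)) 0 1 - RtoC x * CInt (fun t => km (Cconj z0 +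
    RtoC t * RtoC x)) 0 1) with
     (RtoC x * (CInt (fun t => kp (z0 + RtoC t * RtoC x)) 0 1 - CInt (fun t => km (Cconj z0 +
       RtoC t * RtoC x)) 0 1)) by ring.
    rewrite <- CInt_minus by (auto; lra). rewrite Cmod_mult, Cmod_R, Rmult_comm. apply Rmult_le_compat_r.
    apply Rabs_pos.
    replace (2 * e)%R with (2 * e * (1 - 0))%R by ring. apply CInt_bound. lra.
    - intros t Ht.
      apply (Rcont_minus (fun t => kp (z0 + RtoC t * RtoC x)) (fun t => km (Cconj z0 + RtoC t * RtoC x))); auto.
    - intros t Ht. specialize (Hu (t * x)%R).
      replace (z0 + RtoC t * RtoC x) with (RtoC (t * x) + Ci * RtoC s) by (unfold z0; rewrite RtoC_mult; ring).
      replace (Cconj z0 + RtoC t * RtoC x) with (Cconj (RtoC (t * x) + Ci * RtoC s)).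
      2:{ unfold z0. apply injective_projections; simpl; ring. }
      apply Hu. rewrite Rabs_mult, (Rabs_right t) by lra. assert (Ax := Rabs_pos x). nra. }
  specialize (Hl zx Ix). specialize (Hk0 z0 I0).
  replace (zx - RtoC x) with (Ci * RtoC s) in Hl by (unfold zx; ring).
  replace (z0 - RtoC 0) with (Ci * RtoC s) in Hk0 by (unfold z0; ring).
  rewrite Cmod_mult, Cmod_Ci, Cmod_RtoC_pos in Hl, Hk0 by lra.
  replace (l - k0) with (- (Delta zx - l) + ((Delta zx - Delta z0) + (Delta z0 - k0))) by ring.
  eapply Rle_trans. apply Cmod_triangle. rewrite Cmod_opp. eapply Rle_trans. apply Rplus_le_compat_l, Cmod_triangle.
  assert (4 * M * (1 * s) <= 4 * M * e)%R by (apply Rmult_le_compat_l; lra). lra. }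
set (c := Ci * RtoC (1 * (R0 / 2))). set (c' := Ci * RtoC (-1 * (R0 / 2))).
assert (Hbase : forall sg, (sg = 1 \/ sg = -1)%R -> half_disk R0 sg (Ci * RtoC (sg * (R0 / 2)))).
{ intros sg Hsg. replace (Ci * RtoC (sg * (R0 / 2))) with (0 + Ci * RtoC (sg * (R0 / 2))) by ring.
  apply half_disk_adherent; auto; rewrite ?Cmod_0; simpl; lra. }
assert (Ic : half_disk R0 1 c) by (apply Hbase; auto). assert (Ic' : half_disk R0 (-1) c') by (apply Hbase; auto).
assert (Dist : forall sg z w, half_disk R0 sg z -> half_disk R0 sg w -> (Cmod (w - z) <= 2 * R0)%R).
{ intros sg z w [Hz _] [Hw _]. replace (w - z) with (w + - z) by ring. eapply Rle_trans. apply Cmod_triangle.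
  rewrite Cmod_opp. lra. }
exists Kp, (fun z => K0 z + k0), (Cmod (Kp c) + Cmod (K0 c' + k0) + 4 * M * R0)%R.
assert (N1 := Cmod_ge_0 (Kp c)). assert (N2 := Cmod_ge_0 (K0 c' + k0)). assert (N3 : (0 <= M * R0)%R) by nra.
assert (Bnd : forall sg K cc z, half_disk R0 sg z -> half_disk R0 sg cc ->
  (Cmod (K z - K cc) <= 2 * M * Cmod (z - cc))%R -> (Cmod (K z) <= Cmod (K cc) + 4 * M * R0)%R).
{ intros sg K cc z Hz Hcc HH. specialize (Dist sg cc z Hcc Hz). assert (T := Cmod_triangle (K z - K cc) (K cc)).
  replace (K z - K cc + K cc) with (K z) in T by ring.
  assert (2 * M * Cmod (z - cc) <= 2 * M * (2 * R0))%R by (apply Rmult_le_compat_l; lra). lra. }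
splits; auto.
- lra.
- intros z w Hz Hw. rewrite <- Q1 by auto. ring.
- intros z Hz. eapply Cder_eq. apply (Cder_plus K0 (fun _ => k0)). apply Q2; auto. apply Cder_const. ring.
- intros z Hz. assert (B := Bnd 1%R Kp c z Hz Ic (P3 _ _ Ic Hz)). lra.
- intros z Hz. assert (B := Bnd (-1)%R (fun z => K0 z + k0) c' z Hz Ic'). cbv beta in B.
  replace (K0 z + k0 - (K0 c' + k0)) with (K0 z - K0 c') in B by ring.
  specialize (B (Q3 _ _ Ic' Hz)). lra.
- intros z w Hz Hw. replace (K0 w + k0 - (K0 z + k0)) with (K0 w - K0 z) by ring. auto.
- intros x Hx e He. exists (e / (4 * M + 1))%R. split. apply Rdiv_lt_0_compat; lra.
  intros z Hz Hd. replace (Kp z - (K0 (Cconj z) + k0)) with (Delta z - k0) by (unfold Delta; ring).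
  eapply Rle_trans. apply (Hsame x Hx z Hz). apply Rlt_div_r in Hd; [|lra]. assert (Q := Cmod_ge_0 (z - RtoC x)). nra.
Qed.

(** One integration only gives common limits on the diameter. After the second, these limits are the
    derivative there of the glued function [G], by the expansion from both sides; so [G] is
    holomorphic, and so are its derivatives. *)
Theorem half_disk_gluing R0 kp km M : (0 < R0)%R -> (0 <= M)%R ->
  (forall z, half_disk R0 1 z -> C_differentiable kp z) ->
  (forall z, half_disk R0 (-1) z -> C_differentiable km z) ->
  (forall z, half_disk R0 1 z -> Cmod (kp z) <= M) ->
  (forall z, half_disk R0 (-1) z -> Cmod (km z) <= M) ->
  vanishing_gap R0 kp km ->
  exists k, (forall z, Cmod z < R0 -> C_differentiable k z) /\
    (forall z, half_disk R0 1 z -> k z = kp z) /\ (forall z, half_disk R0 (-1) z -> k z = km z).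
Proof.
intros HR HM Dp Dm Bp Bm Hgap.
destruct (primitive_pair R0 kp km M HR HM Dp Dm Bp Bm Hgap) as (Kp & Km & M1 & HM1 & Sp & Sm & Ep & Em & Bp1 & Bm1 & Lp
  & Lm & G1).
assert (Dp1 : forall z, half_disk R0 1 z -> C_differentiable Kp z) by (intros; eapply Cder_is_differentiable; auto).
assert (Dm1 : forall z, half_disk R0 (-1) z -> C_differentiable Km z) by (intros; eapply Cder_is_differentiable; auto).
destruct (primitive_pair R0 Kp Km M1 HR HM1 Dp1 Dm1 Bp1 Bm1 G1) as (KKp & KKm & M2 & HM2 & Sp2 & Sm2 & Ep2 & Em2 & Bp2
  & Bm2 & Lp2 & Lm2 & G2).
assert (Adh : forall sg, (sg = 1 \/ sg = -1)%R -> forall w, Cmod w < R0 -> (0 <= sg * Im w)%R -> forall e, (0 < e)%R ->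
  exists z, half_disk R0 sg z /\ Cmod (z - w) < e).
{ intros sg Hsg w Hw Hi. apply half_disk_adherent'; auto. }
assert (Limit : forall A B L, (0 <= L)%R -> vanishing_gap R0 A B ->
   (forall z w, half_disk R0 1 z -> half_disk R0 1 w -> Cmod (A w - A z) <= (L * Cmod (w - z))%R) ->
   (forall z w, half_disk R0 (-1) z -> half_disk R0 (-1) w -> Cmod (B w - B z) <= (L * Cmod (w - z))%R) ->
   forall x, Im x = 0%R -> Cmod x < R0 -> exists l, (forall z, half_disk R0 1 z ->
   Cmod (A z - l) <= (L * Cmod (z - x))%R) /\
     (forall z, half_disk R0 (-1) z -> Cmod (B z - l) <= (L * Cmod (z - x))%R)).
{ intros A B L HL HG LA LB x Hx Hxr.
  assert (Ex : x = RtoC (Re x)). { destruct x; simpl in Hx; subst; auto. }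
  destruct (lipschitz_limit _ A L x HL LA) as [l Hl]. { apply Adh; auto. rewrite Hx; lra. }
  exists l. split; auto. intros z Hz. apply Rle_all_eps with (c := (2 * L + 1)%R). lra. intros e He.
  destruct (HG (Re x)) with (e := e) as [d [Hd HH]]; auto. rewrite Ex, Cmod_R in Hxr; auto.
  destruct (Adh 1%R (or_introl eq_refl) x Hxr ltac:(rewrite Hx; lra) (Rmin d e) ltac:(apply Rmin_pos;
    auto)) as [w [Hw Hwd]].
  specialize (HH w Hw). rewrite <- Ex in HH. specialize (HH (Rlt_le_trans _ _ _ Hwd (Rmin_l _ _))).
  assert (W2 := Rlt_le_trans _ _ _ Hwd (Rmin_r _ _)).
  specialize (Hl w Hw). specialize (LB _ z (half_disk_conj _ _ Hw) Hz).
  replace (B z - l) with ((B z - B (Cconj w)) + (- (A w - B (Cconj w)) + (A w - l))) by ring.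
  eapply Rle_trans. apply Cmod_triangle. eapply Rle_trans. apply Rplus_le_compat_l, Cmod_triangle. rewrite Cmod_opp.
  assert (T := Cmod_triangle (z - x) (x - Cconj w)). replace (z - x + (x - Cconj w)) with (z - Cconj w) in T by ring.
  replace (x - Cconj w) with (- Cconj (w - x)) in T. 2:{ rewrite Ex. apply injective_projections; simpl; ring. }
  rewrite Cmod_opp, Cmod_conj in T.
  assert (L * Cmod (z - Cconj w) <= L * (Cmod (z - x) + e))%R by (apply Rmult_le_compat_l; lra).
  assert (L * Cmod (w - x) <= L * e)%R by (apply Rmult_le_compat_l; lra). lra. }
(* The premises stand under the existential so that choice produces a total function [lim]. *)
assert (Ch : forall x, exists l, Im x = 0%R -> Cmod x < R0 -> (forall z, half_disk R0 1 z ->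
Cmod (KKp z - l) <= (2 * M1 * Cmod (z - x))%R) /\
     (forall z, half_disk R0 (-1) z -> Cmod (KKm z - l) <= (2 * M1 * Cmod (z - x))%R)).
{ intros x. destruct (classic (Im x = 0%R /\ Cmod x < R0)) as [[H1 H2]|H].
  - destruct (Limit KKp KKm (2 * M1)%R ltac:(lra) G2 Lp2 Lm2 x H1 H2) as [l Hl]. exists l; auto.
  - exists 0. tauto. }
set (lim := fun x => proj1_sig (constructive_indefinite_description _ (Ch x))).
assert (Hlim : forall x, Im x = 0%R -> Cmod x < R0 -> (forall z, half_disk R0 1 z ->
Cmod (KKp z - lim x) <= (2 * M1 * Cmod (z - x))%R) /\
     (forall z, half_disk R0 (-1) z -> Cmod (KKm z - lim x) <= (2 * M1 * Cmod (z - x))%R)).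
{ intros x. apply (proj2_sig (constructive_indefinite_description _ (Ch x))). }
set (G := fun z : C => if Rlt_dec 0 (Im z) then KKp z else if Rlt_dec (Im z) 0 then KKm z else lim z).
assert (Gp : forall z, half_disk R0 1 z -> G z = KKp z).
{ intros z [_ Hz]. unfold G. destruct Rlt_dec; auto. lra. }
assert (Gm : forall z, half_disk R0 (-1) z -> G z = KKm z).
{ intros z [_ Hz]. unfold G. destruct Rlt_dec; [lra|]. destruct Rlt_dec; auto. lra. }
assert (G0 : forall z, Im z = 0%R -> G z = lim z).
{ intros z Hz. unfold G. destruct Rlt_dec; [lra|]. destruct Rlt_dec; auto. lra. }
assert (GLp : forall w, Cmod w < R0 -> (0 <= 1 * Im w)%R -> forall z, half_disk R0 1 z ->
  Cmod (KKp z - G w) <= (2 * M1 * Cmod (z - w))%R).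
{ intros w Hw Hi z Hz. destruct (Req_dec (Im w) 0) as [E|E]. rewrite G0 by auto. apply Hlim; auto.
  assert (half_disk R0 1 w) by (split; auto; lra). rewrite Gp by auto. apply Lp2; auto. }
assert (GLm : forall w, Cmod w < R0 -> (0 <= -1 * Im w)%R -> forall z, half_disk R0 (-1) z ->
  Cmod (KKm z - G w) <= (2 * M1 * Cmod (z - w))%R).
{ intros w Hw Hi z Hz. destruct (Req_dec (Im w) 0) as [E|E]. rewrite G0 by auto. apply Hlim; auto.
  assert (half_disk R0 (-1) w) by (split; auto; lra). rewrite Gm by auto. apply Lm2; auto. }
assert (DGp : forall z, half_disk R0 1 z -> Cder G z (Kp z)).
{ intros z Hz. apply (Cder_ext_loc KKp); auto. destruct (half_disk_open R0 1 ltac:(auto) z Hz) as [d [Hd H]]. exists d.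
  split; auto.
  intros w Hw. symmetry. auto. }
assert (DGm : forall z, half_disk R0 (-1) z -> Cder G z (Km z)).
{ intros z Hz. apply (Cder_ext_loc KKm); auto. destruct (half_disk_open R0 (-1) ltac:(auto) z Hz) as [d [Hd H]].
  exists d. split; auto.
  intros w Hw. symmetry. auto. }
assert (DG : forall z, Cmod z < R0 -> C_differentiable G z).
{ intros x Hx. destruct (Rtotal_order (Im x) 0) as [Hi|[Hi|Hi]].
  - eapply Cder_is_differentiable. apply DGm. split; auto; lra.
  - destruct (Limit Kp Km (2 * M)%R ltac:(lra) G1 Lp Lm x Hi Hx) as [K0 [HKp HKm]].
    apply Cder_is_differentiable with (l := K0). apply Cder_eps. intros e He.
    assert (Tp := half_disk_taylor R0 1 Kp KKp G (2 * M)
      (2 * M1) x K0 (or_introl eq_refl) ltac:(lra) ltac:(lra) Hi Hx Dp1 HKp Sp2 GLp).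
    assert (Tm := half_disk_taylor R0 (-1) Km KKm G (2 * M)
      (2 * M1) x K0 (or_intror eq_refl) ltac:(lra) ltac:(lra) Hi Hx Dm1 HKm Sm2 GLm).
    exists (Rmin (R0 - Cmod x) (e / (2 * (2 * M) + 1))). split. apply Rmin_pos. lra. apply Rdiv_lt_0_compat; lra.
    intros w Hw. assert (W1 := Rlt_le_trans _ _ _ Hw (Rmin_l _ _)). assert (W2 := Rlt_le_trans _ _ _ Hw (Rmin_r _ _)).
    assert (Hwr : Cmod w < R0). { assert (T := Cmod_triangle (w - x) x). replace (w - x + x) with w in T by ring. lra. }
    assert (Q := Cmod_ge_0 (w - x)).
    apply Rle_trans with (2 * (2 * M) * Cmod (w - x) * Cmod (w - x))%R.
    destruct (Rle_or_lt 0 (Im w)). apply Tp; auto; lra. apply Tm; auto; lra.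
    apply Rmult_le_compat_r; auto. apply Rlt_div_r in W2; lra.
  - eapply Cder_is_differentiable. apply DGp. split; auto; lra. }
assert (HO : openC (fun z => Cmod z < R0)).
{ intros u Hu. exists (R0 - Cmod u)%R. split. lra. intros w Hw. assert (T := Cmod_triangle (w - u) u).
  replace (w - u + u) with w in T by ring. lra. }
exists (C_derive (C_derive G)). splits.
- intros z Hz. apply (C_derive_differentiable (fun z => Cmod z < R0)); auto. apply C_derive_differentiable; auto.
- intros z Hz. apply Cder_C_derive. apply (Cder_ext_loc Kp); auto.
  destruct (half_disk_open R0 1 ltac:(auto) z Hz) as [d [Hd H]]. exists d. split; auto.
  intros w Hw. symmetry. apply Cder_C_derive. auto.
- intros z Hz. apply Cder_C_derive. apply (Cder_ext_loc Km); auto.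
  destruct (half_disk_open R0 (-1) ltac:(auto) z Hz) as [d [Hd H]]. exists d. split; auto.
  intros w Hw. symmetry. apply Cder_C_derive. auto.
Qed.

Lemma Cder_conj f z l : Cder f (Cconj z) l -> Cder (fun w => Cconj (f (Cconj w))) z (Cconj l).
Proof.
intros H. apply Cder_eps. intros e He. destruct (proj1 (Cder_eps _ _ _) H e He) as [d [Hd H1]].
exists d. split; auto. intros w Hw.
specialize (H1 (Cconj w)). rewrite <- Cminus_conj, Cmod_conj in H1. specialize (H1 Hw).
rewrite <- (Cmod_conj (_ - _ - _)), !Cminus_conj, Cmult_conj, !Cconj_conj.
rewrite Cminus_conj in *. exact H1.
Qed.

Lemma C_derive_conj f z : C_differentiable f z ->
  (exists d, (0 < d)%R /\ forall w, Cmod (w - z) < d -> f (Cconj w) = Cconj (f w)) ->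
  Cder f (Cconj z) (Cconj (C_derive f z)).
Proof.
intros Hf [d [Hd H]]. apply (Cder_ext_loc (fun w => Cconj (f (Cconj w)))).
- exists d. split; auto. intros w Hw.
  assert (Hw2 : Cmod (Cconj w - z) < d).
  { rewrite <- Cmod_conj, Cminus_conj, Cconj_conj. auto. }
  specialize (H _ Hw2). rewrite Cconj_conj in H. auto.
- apply Cder_conj. rewrite Cconj_conj. apply Cder_differentiable; auto.
Qed.

Lemma real_of_conj (z : C) : Cconj z = z -> Im z = 0%R.
Proof. intros H. apply (f_equal Im) in H. rewrite im_conj in H. lra. Qed.

Lemma Cconj_of_real (z : C) : Im z = 0%R -> Cconj z = z.
Proof. destruct z as [a b]; simpl; intros ->. apply injective_projections; simpl; ring. Qed.

Lemma half_disk_conj' R0 z : half_disk R0 (-1) z -> half_disk R0 1 (Cconj z).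
Proof. intros [H1 H2]. split. rewrite Cmod_conj; auto. rewrite im_conj. lra. Qed.

(** The gap between [h] and its reflection at conjugate points is twice [Im h], so gluing applies
    without any boundary values of [h]. *)
Theorem schwarz_reflection (h : C -> C) R0 M : (0 < R0)%R ->
  (forall z, half_disk R0 1 z -> C_differentiable h z) ->
  (forall z, half_disk R0 1 z -> Cmod (h z) <= M) ->
  (forall x : R, (Rabs x < R0)%R -> forall e, (0 < e)%R -> exists d, (0 < d)%R /\
     forall z, half_disk R0 1 z -> Cmod (z - RtoC x) < d -> (Rabs (Im (h z)) <= e)%R) ->
  exists k, (forall z, Cmod z < R0 -> C_differentiable k z) /\
    (forall z, half_disk R0 1 z -> k z = h z) /\
    (forall z, Cmod z < R0 -> k (Cconj z) = Cconj (k z)).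
Proof.
intros HR Hh HM HI.
assert (HM0 : (0 <= M)%R).
{ eapply Rle_trans. 2: apply (HM (Ci * RtoC (R0 / 2))). apply Cmod_ge_0. split.
  rewrite Cmod_mult, Cmod_Ci, Cmod_RtoC_pos; lra. simpl. lra. }
destruct (half_disk_gluing R0 h (fun z => Cconj (h (Cconj z))) M) as [k [D [P1 P2]]]; auto.
- intros z Hz. assert (Hd := Cder_differentiable _ _ (Hh _ (half_disk_conj' _ _ Hz))). apply Cder_conj in Hd.
  eapply Cder_is_differentiable; eauto.
- intros z Hz. rewrite Cmod_conj. apply HM, half_disk_conj'; auto.
- intros x Hx e He. destruct (HI x Hx (e / 2)%R ltac:(lra)) as [d [Hd H]]. exists d. split; auto.
  intros z Hz Hzd. rewrite Cconj_conj, im_alt', !Cmod_mult, Cmod_Ci, Cmod_RtoC_pos, Cmod_R by lra.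
  specialize (H z Hz Hzd). lra.
- exists k. splits; auto. intros z Hz. destruct (Rtotal_order (Im z) 0) as [Hi|[Hi|Hi]].
  + assert (H1 : half_disk R0 (-1) z) by (split; auto; lra).
    rewrite (P1 _ (half_disk_conj' _ _ H1)), (P2 _ H1), Cconj_conj. auto.
  + rewrite (Cconj_of_real z Hi). symmetry. apply Cconj_of_real.
    assert (Ex : z = RtoC (Re z)). { destruct z; simpl in Hi; subst; auto. }
    assert (Z : (Rabs (Im (k z)) <= 0)%R).
    2:{ apply Rle_antisym; [|]; apply Rabs_le_between in Z; lra. }
    apply Rle_all_eps with (c := 2%R). lra. intros e He.
    destruct (HI (Re z)) with (e := e) as [d1 [Hd1 H1]]; auto. rewrite Ex, Cmod_R in Hz; auto. rewrite <- Ex in H1.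
    destruct (Cder_continuous_eps _ _ _ (Cder_differentiable _ _ (D z Hz)) e He) as [d2 [Hd2 H2]].
    destruct (half_disk_adherent' R0 1 z (or_introl eq_refl) Hz ltac:(rewrite Hi;
      lra) (Rmin d1 d2) ltac:(apply Rmin_pos; auto)) as [w [Hw Hwd]].
    specialize (H1 w Hw (Rlt_le_trans _ _ _ Hwd (Rmin_l _ _))). specialize (H2 w (Rlt_le_trans _ _ _ Hwd (Rmin_r _ _))).
    rewrite P1 in H2 by auto. assert (B := im_le_Cmod (h w - k z)). rewrite Im_minus in B.
    apply Rabs_le. apply Rabs_le_between in B. apply Rabs_le_between in H1. lra.
  + assert (H1 : half_disk R0 1 z) by (split; auto; lra). rewrite (P1 _ H1), (P2 _ (half_disk_conj _ _ H1)), Cconj_conj.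
    auto.
Qed.

(** Here the reflection is in the unit circle: the gap [k - 1 / conj k] equals
    [(Cmod k ^ 2 - 1) / conj k] and vanishes where the modulus tends to 1. The lower bound [1 / 2]
    keeps the reflected function bounded. *)
Theorem circle_reflection (k : C -> C) R0 : (0 < R0)%R ->
  (forall z, half_disk R0 1 z -> C_differentiable k z) ->
  (forall z, half_disk R0 1 z -> 1 / 2 <= Cmod (k z) <= 1)%R ->
  (forall x : R, (Rabs x < R0)%R -> forall e, (0 < e)%R -> exists d, (0 < d)%R /\
     forall z, half_disk R0 1 z -> Cmod (z - RtoC x) < d -> (1 - e <= Cmod (k z))%R) ->
  exists K, (forall z, Cmod z < R0 -> C_differentiable K z) /\
    (forall z, half_disk R0 1 z -> K z = k z) /\
    (forall z, half_disk R0 (-1) z -> K z = / Cconj (k (Cconj z))) /\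
    (forall x : R, (Rabs x < R0)%R -> Cmod (K (RtoC x)) = 1%R).
Proof.
intros HR Hk HB HI.
assert (Hne : forall z, half_disk R0 1 z -> k z <> RtoC 0). { intros z Hz. apply Cmod_gt_0. specialize (HB z Hz). lra. }
assert (Hinv : forall z, half_disk R0 1 z -> (/ Cmod (k z) <= 2)%R).
{ intros z Hz. specialize (HB z Hz). rewrite <- (Rinv_inv 2). apply Rinv_le_contravar; lra. }
destruct (half_disk_gluing R0 k (fun z => / Cconj (k (Cconj z))) 2) as [K [D [P1 P2]]]; auto; try lra.
- intros z Hz. assert (Hc := half_disk_conj' _ _ Hz). assert (Hd := Cder_differentiable _ _ (Hk _ Hc)).
  apply Cder_conj in Hd.
  eapply Cder_is_differentiable. apply (Cder_inv (fun z => Cconj (k (Cconj z)))). exact Hd.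
  intros E. apply (Hne _ Hc). apply (f_equal Cmod) in E. rewrite Cmod_conj, Cmod_0 in E. apply Cmod_eq_0; auto.
- intros z Hz. specialize (HB z Hz). lra.
- intros z Hz. assert (Hc := half_disk_conj' _ _ Hz). rewrite <- Cinv_conj, Cmod_conj, Cmod_inv by (apply Hne; auto).
  apply Hinv; auto.
- intros x Hx e He. destruct (HI x Hx (e / 4)%R ltac:(lra)) as [d [Hd H]]. exists d. split; auto.
  intros z Hz Hzd. specialize (H z Hz Hzd). rewrite Cconj_conj. specialize (HB z Hz). assert (Hn := Hne z Hz).
  assert (Hcn : Cconj (k z) <> RtoC 0). { intros E. apply Hn. apply (f_equal Cmod) in E. rewrite Cmod_conj, Cmod_0 in E.
    apply Cmod_eq_0; auto. }
  replace (k z - / Cconj (k z)) with ((k z * Cconj (k z) - 1) * / Cconj (k z)) by (field; auto).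
  rewrite <- Cmod2_conj, Cmod_mult, Cmod_inv, Cmod_conj by auto.
  rewrite <- RtoC_minus, Cmod_R.
  assert (Rabs (Cmod (k z) ^ 2 - 1) <= 2 * (e / 4))%R. { apply Rabs_le. simpl. nra. }
  specialize (Hinv z Hz). assert (0 < / Cmod (k z))%R by (apply Rinv_0_lt_compat; lra).
  assert (Q := Rabs_pos (Cmod (k z) ^ 2 - 1)). nra.
- exists K. splits; auto. intros x Hx.
  assert (Hx2 : Cmod (RtoC x) < R0) by (rewrite Cmod_R; auto).
  assert (Z : (Rabs (Cmod (K (RtoC x)) - 1) <= 0)%R).
  2:{ apply Rabs_le_between in Z. lra. }
  apply Rle_all_eps with (c := 2%R). lra. intros e He.
  destruct (HI x Hx e He) as [d1 [Hd1 H1]].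
  destruct (Cder_continuous_eps _ _ _ (Cder_differentiable _ _ (D _ Hx2)) e He) as [d2 [Hd2 H2]].
  destruct (half_disk_adherent' R0 1 (RtoC x) (or_introl eq_refl) Hx2 ltac:(simpl;
    lra) (Rmin d1 d2) ltac:(apply Rmin_pos; auto)) as [w [Hw Hwd]].
  specialize (H1 w Hw (Rlt_le_trans _ _ _ Hwd (Rmin_l _ _))). specialize (H2 w (Rlt_le_trans _ _ _ Hwd (Rmin_r _ _))).
  rewrite P1 in H2 by auto. assert (T1 := Cmod_triangle_sub (k w) (K (RtoC x))).
  assert (T2 := Cmod_triangle_sub (K (RtoC x)) (k w)).
  rewrite Cmod_minus_sym in T2. specialize (HB w Hw). apply Rabs_le. lra.
Qed.

(** * Moduli in coordinates, connected sets and components *)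

Lemma Cmod_sq (z : C) : (Cmod z * Cmod z = Re z * Re z + Im z * Im z)%R.
Proof. assert (H := Cmod2_alt z). simpl in H. lra. Qed.

Lemma Cmod_le_iff (z : C) r : (0 <= r)%R -> Cmod z <= r <-> (Re z * Re z + Im z * Im z <= r * r)%R.
Proof.
intros Hr. rewrite <- Cmod_sq. assert (H := Cmod_ge_0 z). split; intros. nra. apply Rsqr_incr_0; auto.
Qed.

Lemma Cmod_eq_iff (z : C) r : (0 <= r)%R -> Cmod z = r <-> (Re z * Re z + Im z * Im z = r * r)%R.
Proof.
intros Hr. rewrite <- Cmod_sq. assert (H := Cmod_ge_0 z). split; intros. nra. apply Rsqr_inj; auto.
Qed.

Lemma openC_open (D : C -> Prop) : openC D -> open (T:=C_UniformSpace) D.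
Proof. intros H z Hz. apply locally_C_iff. apply H; auto. Qed.
Lemma open_openC (D : C -> Prop) : open (T:=C_UniformSpace) D -> openC D.
Proof. intros H z Hz. apply (locally_C_iff z D). apply H; auto. Qed.

Lemma connected_union S1 S2 p : connected S1 -> connected S2 -> S1 p -> S2 p -> connected (fun z => S1 z \/ S2 z).
Proof.
intros C1 C2 P1 P2 A B HA HB Hcov [x [Hx Ax]] [y [Hy By]].
assert (Hp : A p \/ B p) by auto.
assert (X1 : (exists z, S1 z /\ A z) -> (exists z, S1 z /\ B z) -> exists z, (S1 z \/ S2 z) /\ A z /\ B z).
{ intros E1 E2. destruct (C1 A B) as [z [Hz K]]; auto. exists z; tauto. }
assert (X2 : (exists z, S2 z /\ A z) -> (exists z, S2 z /\ B z) -> exists z, (S1 z \/ S2 z) /\ A z /\ B z).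
{ intros E1 E2. destruct (C2 A B) as [z [Hz K]]; auto. exists z; tauto. }
destruct Hp as [Hp|Hp].
- destruct Hy; [apply X1|apply X2]; eauto.
- destruct Hx; [apply X1|apply X2]; eauto.
Qed.

(** Let [c] be the supremum of the parameters up to which the path stays in [A]. If [g c] is in [A],
    the stay can be prolonged unless [c = b]; if it is in [B], so are earlier points, which are in
    [A]. The lemma also serves as an intermediate value theorem. *)
Lemma path_connected_aux (g : R -> C) (a b : R) (A B : C -> Prop) : (a <= b)%R ->
  (forall t, (a <= t <= b)%R -> Rcont g t) -> openC A -> openC B ->
  (forall t, (a <= t <= b)%R -> A (g t) \/ B (g t)) -> A (g a) -> B (g b) ->
  exists t, (a <= t <= b)%R /\ A (g t) /\ B (g t).
Proof.
intros Hab Hg HA HB Hcov Ha Hb. apply NNPP. intros HN.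
assert (Hdis : forall t, (a <= t <= b)%R -> A (g t) -> B (g t) -> False) by (intros; apply HN; eauto).
assert (Hloc : forall P, openC P -> forall c, (a <= c <= b)%R -> P (g c) -> exists d, (0 < d)%R /\
  forall t, (Rabs (t - c) < d)%R -> P (g t)).
{ intros P HP c Hc Pc. destruct (HP _ Pc) as [e [He H]]. destruct (proj1 (Rcont_eps _ _) (Hg c Hc) e He) as [d [Hd H2]].
  exists d; split; auto. }
set (E := fun x => (a <= x <= b)%R /\ forall y, (a <= y <= x)%R -> A (g y)).
assert (Ea : E a). { split. lra. intros y Hy. replace y with a by lra. auto. }
destruct (completeness E) as [c [Hc1 Hc2]].
{ exists b. intros x [Hx _]. lra. } { exists a; auto. }
assert (Hac : (a <= c)%R) by (apply Hc1; auto).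
assert (Hcb : (c <= b)%R). { apply Hc2. intros x [Hx _]. lra. }
assert (Near : forall d, (0 < d)%R -> exists x, E x /\ (c - d < x)%R).
{ intros d Hd. apply NNPP. intros HH. assert (c <= c - d)%R; [|lra]. apply Hc2. intros x Hx. apply Rnot_lt_le.
  intros HL. apply HH. exists x; auto. }
destruct (Hcov c ltac:(lra)) as [Ac|Bc].
- destruct (Hloc A HA c ltac:(lra) Ac) as [d [Hd H]].
  destruct (Req_dec c b) as [->|Hne]. eapply (Hdis b); auto; lra.
  set (x := Rmin b (c + d / 2)). assert (Hx1 : (x <= b)%R) by apply Rmin_l.
  assert (Hx2 : (x <= c + d / 2)%R) by apply Rmin_r.
  assert (Hx3 : (c < x)%R) by (apply Rmin_glb_lt; lra).
  assert (Ex : E x). { split. lra. intros y Hy. destruct (Rle_or_lt y (c - d / 2)).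
    - destruct (Near (d / 2)%R ltac:(lra)) as [x0 [[_ Hx0] Hx0']]. apply Hx0. lra.
    - apply H. apply Rabs_def1; lra. }
  specialize (Hc1 x Ex). lra.
- destruct (Hloc B HB c ltac:(lra) Bc) as [d [Hd H]].
  destruct (Near d Hd) as [x [Ex Hx]]. assert (Hxc := Hc1 x Ex). destruct Ex as [Hxab Hx2].
  apply (Hdis x); auto. apply Hx2; lra. apply H. apply Rabs_def1; lra.
Qed.

Lemma path_connected (g : R -> C) : (forall t, (0 <= t <= 1)%R -> Rcont g t) ->
  connected (fun z => exists t, (0 <= t <= 1)%R /\ z = g t).
Proof.
intros Hg A B HA HB Hcov [x [[tx [Htx ->]] Ax]] [y [[ty [Hty ->]] By]].
apply open_openC in HA. apply open_openC in HB.
destruct (Rle_or_lt tx ty) as [Hle|Hlt].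
- destruct (path_connected_aux g tx ty A B) as [t [Ht K]]; auto. intros; apply Hg; lra. intros t Ht; apply Hcov.
  exists t; split; auto; lra.
  exists (g t). split; auto. exists t; split; auto; lra.
- destruct (path_connected_aux g ty tx B A) as [t [Ht K]]; auto; try lra. intros; apply Hg; lra.
  intros t Ht. assert (A (g t) \/ B (g t)). { apply Hcov. exists t; split; auto; lra. } tauto.
  exists (g t). split. exists t; split; auto; lra. tauto.
Qed.

Lemma component_path (E : C -> Prop) z0 (g : R -> C) : connected_component E z0 (g 0%R) ->
  (forall t, (0 <= t <= 1)%R -> Rcont g t) -> (forall t, (0 <= t <= 1)%R -> E (g t)) ->
    connected_component E z0 (g 1%R).
Proof.
intros [S [HS [HE [H0 Hz]]]] Hg HEg.
exists (fun z => S z \/ exists t, (0 <= t <= 1)%R /\ z = g t). splits; auto.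
- apply (connected_union _ _ (g 0%R)); auto. apply path_connected; auto. exists 0%R; split; auto; lra.
- intros w [Hw|[t [Ht ->]]]; auto.
- right. exists 1%R; split; auto; lra.
Qed.

Lemma component_segment (E : C -> Prop) z0 z w : connected_component E z0 z ->
  (forall t, (0 <= t <= 1)%R -> E (z + RtoC t * (w - z))) -> connected_component E z0 w.
Proof.
intros H HE. replace w with (z + 1 * (w - z)) by ring.
apply (component_path E z0 (fun t => z + RtoC t * (w - z))); auto.
- replace (z + 0 * (w - z)) with z by ring. auto.
- intros; rcont.
Qed.

Lemma component_refl (E : C -> Prop) z0 : E z0 -> connected_component E z0 z0.
Proof.
intros H. exists (fun z => z = z0). splits; auto.
- intros A B _ _ _ [x [-> Ax]] [y [-> By]]. exists z0; auto.
- intros w ->; auto.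
Qed.

Lemma component_open (E : C -> Prop) z0 : openC E -> openC (connected_component E z0).
Proof.
intros HE z Hz. assert (Ez : E z). { destruct Hz as [S [_ [H [_ Sz]]]]; auto. }
destruct (HE z Ez) as [d [Hd H]]. exists d. split; auto. intros w Hw.
apply (component_segment E z0 z w Hz). intros t Ht. apply H. eapply Rle_lt_trans. apply segment_dist; auto. auto.
Qed.

Lemma component_in (E : C -> Prop) z0 z : connected_component E z0 z -> E z.
Proof. intros [S [_ [H [_ Sz]]]]; auto. Qed.

(** If [p] were in the open set [E], a short segment inside [E] would join it to the component. *)
Lemma component_boundary (E : C -> Prop) z0 p : openC E -> ~ connected_component E z0 p ->
  (forall e, (0 < e)%R -> exists z, connected_component E z0 z /\ Cmod (z - p) < e) -> ~ E p.
Proof.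
intros HE Hp Hadh Ep. destruct (HE p Ep) as [d [Hd H]]. destruct (Hadh d Hd) as [z [Hz Hzp]]. apply Hp.
apply (component_segment E z0 z p Hz). intros t Ht. apply H.
replace (z + RtoC t * (p - z) - p) with (RtoC (1 - t) * (z - p)) by (rewrite RtoC_minus; ring).
rewrite Cmod_mult, Cmod_RtoC_pos by lra. assert (Q := Cmod_ge_0 (z - p)). nra.
Qed.

(** Reflection in the diagonal. It exchanges [(t, r1)] with [(s, r2)], so that statements about the
    arc about [t] carry over to the arc about [is]. *)
Definition Cswap (z : C) : C := (Im z, Re z).
Lemma Cswap_invol z : Cswap (Cswap z) = z.
Proof. destruct z; auto. Qed.
Lemma Cswap_minus z w : Cswap (z - w) = Cswap z - Cswap w.
Proof. destruct z, w; auto. Qed.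
Lemma Cmod_Cswap z : Cmod (Cswap z) = Cmod z.
Proof. unfold Cmod. simpl. f_equal. destruct z; simpl; ring. Qed.
Lemma Cswap_dist z w : Cmod (Cswap z - w) = Cmod (z - Cswap w).
Proof. rewrite <- Cmod_Cswap, Cswap_minus, Cswap_invol. auto. Qed.

Lemma connected_swap S : connected S -> connected (fun z => S (Cswap z)).
Proof.
intros H A B HA HB Hcov [x [Hx Ax]] [y [Hy By]].
assert (Hop : forall P, open (T:=C_UniformSpace) P -> open (T:=C_UniformSpace) (fun z => P (Cswap z))).
{ intros P HP. apply openC_open. apply open_openC in HP. intros z Hz. destruct (HP _ Hz) as [d [Hd HH]]. exists d.
  split; auto.
  intros w Hw. apply HH. rewrite <- Cswap_minus, Cmod_Cswap. auto. }
destruct (H (fun z => A (Cswap z)) (fun z => B (Cswap z))) as [z [Hz [K1 K2]]]; auto.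
- intros z Hz. apply Hcov. rewrite Cswap_invol; auto.
- exists (Cswap x). rewrite Cswap_invol; auto.
- exists (Cswap y). rewrite Cswap_invol; auto.
- exists (Cswap z). rewrite Cswap_invol; auto.
Qed.

(** * The quadrilateral *)

Definition outside_disks (t s r1 r2 : R) (z : C) : Prop :=
  ~ closed_disk (RtoC t) r1 z /\ ~ closed_disk (- RtoC t) r1 z /\
  ~ closed_disk (Ci * RtoC s) r2 z /\ ~ closed_disk (- (Ci * RtoC s)) r2 z.

Lemma outside_disks_iff t s r1 r2 z : (0 < r1)%R -> (0 < r2)%R -> outside_disks t s r1 r2 z <->
  (r1 * r1 < (Re z - t) * (Re z - t) + Im z * Im z)%R /\
  (r1 * r1 < (Re z + t) * (Re z + t) + Im z * Im z)%R /\
  (r2 * r2 < Re z * Re z + (Im z - s) * (Im z - s))%R /\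
  (r2 * r2 < Re z * Re z + (Im z + s) * (Im z + s))%R.
Proof.
intros H1 H2. unfold outside_disks, closed_disk. rewrite !Cmod_le_iff by lra.
assert (E1 : forall a b c d : R, (~ (a <= b)%R <-> (b < a)%R)) by (intros; lra).
rewrite !E1 by (exact 0%R). destruct z as [x y]. simpl.
split; intros (A1 & A2 & A3 & A4); repeat split; nra.
Qed.

Lemma outside_disks_open t s r1 r2 : openC (outside_disks t s r1 r2).
Proof.
intros z (H1 & H2 & H3 & H4). unfold closed_disk in *.
set (d := Rmin (Rmin (Cmod (z - RtoC t) - r1) (Cmod (z - - RtoC t) - r1)) (Rmin (Cmod (z - Ci * RtoC s) - r2)
  (Cmod (z - - (Ci * RtoC s)) - r2))).
exists d. split. unfold d. repeat apply Rmin_pos; lra.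
intros w Hw. unfold d in Hw.
assert (W1 := Rlt_le_trans _ _ _ Hw (Rmin_l _ _)). assert (W2 := Rlt_le_trans _ _ _ Hw (Rmin_r _ _)).
assert (W11 := Rlt_le_trans _ _ _ W1 (Rmin_l _ _)). assert (W12 := Rlt_le_trans _ _ _ W1 (Rmin_r _ _)).
assert (W21 := Rlt_le_trans _ _ _ W2 (Rmin_l _ _)). assert (W22 := Rlt_le_trans _ _ _ W2 (Rmin_r _ _)).
assert (K : forall c r, (Cmod (w - z) < Cmod (z - c) - r)%R -> ~ (Cmod (w - c) <= r)%R).
{ intros c r HH. assert (T := Cmod_triangle (z - w) (w - c)). replace (z - w + (w - c)) with (z - c) in T by ring.
  rewrite (Cmod_minus_sym z w) in T. lra. }
unfold outside_disks, closed_disk. repeat split; apply K; auto.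
Qed.

Lemma quadrilateral_eq t s r1 r2 : quadrilateral t s r1 r2 = connected_component (outside_disks t s r1 r2) (RtoC 0).
Proof. reflexivity. Qed.

Lemma quadrilateral_open t s r1 r2 : openC (quadrilateral t s r1 r2).
Proof. apply component_open, outside_disks_open. Qed.

Lemma outside_disks_swap t s r1 r2 z : (0 < r1)%R -> (0 < r2)%R -> outside_disks t s r1 r2 z ->
  outside_disks s t r2 r1 (Cswap z).
Proof. intros H1 H2. rewrite !outside_disks_iff by auto. destruct z; simpl. intros (A1 & A2 & A3 & A4).
repeat split; nra. Qed.

Lemma quadrilateral_swap t s r1 r2 z : (0 < r1)%R -> (0 < r2)%R -> quadrilateral t s r1 r2 z ->
  quadrilateral s t r2 r1 (Cswap z).
Proof.
intros H1 H2 [S [HS [HE [H0 Hz]]]]. exists (fun z => S (Cswap z)). splits.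
- apply connected_swap; auto.
- intros w Hw. rewrite <- (Cswap_invol w). apply (outside_disks_swap t s r1 r2); auto. apply HE; auto.
- replace (Cswap 0) with (RtoC 0) by auto. auto.
- rewrite Cswap_invol; auto.
Qed.

Lemma tangent_circles_swap t s r1 r2 : tangent_circles t s r1 r2 -> tangent_circles s t r2 r1.
Proof. unfold tangent_circles. intros [H1 [H2 H3]]. repeat split; lra. Qed.

(* The closed disks cover the sides of the rhombus of the four centres. *)
Lemma quadrilateral_rhombus t s r1 r2 z : tangent_circles t s r1 r2 -> quadrilateral t s r1 r2 z ->
  (Rabs (Re z) / t + Rabs (Im z) / s < 1)%R.
Proof.
intros [[Hr1 Ht] [[Hr2 Hs] Htan]] [S [HS [HE [H0 Hz]]]].
set (N := fun z : C => (Rabs (Re z) / t + Rabs (Im z) / s)%R).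
assert (Lip : forall w z, (Rabs (N w - N z) <= (/ t + / s) * Cmod (w - z))%R).
{ intros w u. unfold N. assert (B1 := re_le_Cmod (w - u)). assert (B2 := im_le_Cmod (w - u)). rewrite Re_minus in B1.
  rewrite Im_minus in B2.
  assert (A1 := Rabs_triang_inv2 (Re w) (Re u)). assert (A2 := Rabs_triang_inv2 (Im w) (Im u)).
  assert (I1 : (0 < / t)%R) by (apply Rinv_0_lt_compat; lra).
  assert (I2 : (0 < / s)%R) by (apply Rinv_0_lt_compat; lra).
  replace (Rabs (Re w) / t + Rabs (Im w) / s - (Rabs (Re u) / t + Rabs (Im u) / s))%R with
   (/ t * (Rabs (Re w) - Rabs (Re u)) + / s * (Rabs (Im w) - Rabs (Im u)))%R by (field; lra).
  eapply Rle_trans. apply Rabs_triang. rewrite !Rabs_mult, (Rabs_right (/ t)), (Rabs_right (/ s)) by lra.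
  assert (/ t * Rabs (Rabs (Re w) - Rabs (Re u)) <= / t * Cmod (w - u))%R by (apply Rmult_le_compat_l; lra).
  assert (/ s * Rabs (Rabs (Im w) - Rabs (Im u)) <= / s * Cmod (w - u))%R by (apply Rmult_le_compat_l; lra). lra. }
assert (Kp : (0 < / t + / s)%R). { assert (0 < / t)%R by (apply Rinv_0_lt_compat; lra).
  assert (0 < / s)%R by (apply Rinv_0_lt_compat; lra). lra. }
assert (OpA : openC (fun z => N z < 1)%R).
{ intros u Hu. exists ((1 - N u) / (/ t + / s))%R. split. apply Rdiv_lt_0_compat; lra. intros w Hw.
  apply Rlt_div_r in Hw; auto. specialize (Lip w u). apply Rabs_le_between in Lip. lra. }
assert (OpB : openC (fun z => 1 < N z)%R).
{ intros u Hu. exists ((N u - 1) / (/ t + / s))%R. split. apply Rdiv_lt_0_compat; lra. intros w Hw.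
  apply Rlt_div_r in Hw; auto. specialize (Lip w u). apply Rabs_le_between in Lip. lra. }
assert (NE : forall w, S w -> N w <> 1%R).
{ intros w Hw E. specialize (HE w Hw). apply outside_disks_iff in HE; auto. destruct HE as (A1 & A2 & A3 & A4).
  unfold N in E. set (X := Rabs (Re w)) in *. set (Y := Rabs (Im w)) in *.
  assert (HX : (X * X = Re w * Re w)%R) by (unfold X; rewrite <- Rabs_mult; apply Rabs_right; nra).
  assert (HY : (Y * Y = Im w * Im w)%R) by (unfold Y; rewrite <- Rabs_mult; apply Rabs_right; nra).
  assert (X0 : (0 <= X)%R) by apply Rabs_pos. assert (Y0 : (0 <= Y)%R) by apply Rabs_pos.
  assert (B1 : (r1 * r1 < (X - t) * (X - t) + Y * Y)%R).
  { unfold X at 1 2. unfold Rabs. destruct (Rcase_abs (Re w)); rewrite HY; lra. }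
  assert (B2 : (r2 * r2 < X * X + (Y - s) * (Y - s))%R).
  { unfold Y at 1 2. unfold Rabs. destruct (Rcase_abs (Im w)); rewrite HX; lra. }
  (* Position on the side of the rhombus, of length [r1 + r2]: the distances to its ends are
     [u * (r1 + r2)] and [(1 - u) * (r1 + r2)], and they cannot exceed [r1] and [r2] at the same
     time. *)
  set (u := (Y / s)%R). assert (EY : Y = (s * u)%R) by (unfold u; field; lra).
  assert (EX : X = (t * (1 - u))%R). { replace (1 - u)%R with (X / t)%R by (unfold u; lra). field; lra. }
  assert (Hu : (0 <= u <= 1)%R). { split; nra. }
  rewrite EX, EY in B1, B2.
  replace ((t * (1 - u) - t) * (t * (1 - u) - t) + s * u * (s * u))%R with (u * u * (t ^ 2 + s ^ 2))%R in B1 by ring.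
  replace (t * (1 - u) * (t * (1 - u)) + (s * u - s) * (s * u - s))%R with
    ((1 - u) * (1 - u) * (t ^ 2 + s ^ 2))%R in B2 by ring.
  rewrite Htan in *.
  assert (r1 < u * (r1 + r2))%R by nra. assert (r2 < (1 - u) * (r1 + r2))%R by nra. lra. }
destruct (Rlt_or_le (N z) 1) as [|Hge]; auto. exfalso.
destruct (HS (fun z => N z < 1)%R (fun z => 1 < N z)%R) as [w [Hw [W1 W2]]].
- apply openC_open; auto. - apply openC_open; auto.
- intros w Hw. specialize (NE w Hw). destruct (Rtotal_order (N w) 1) as [|[|]]; auto. tauto.
- exists 0. split; auto. unfold N. simpl. rewrite Rabs_R0. unfold Rdiv. lra.
- exists z. split; auto. specialize (NE z Hz). lra.
- lra.
Qed.

Lemma local_open_mapping (f : C -> C) z0 R0 : (0 < R0)%R -> (forall z, Cmod (z - z0) < R0 -> C_differentiable f z) ->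
  C_derive f z0 <> RtoC 0 -> forall r0, (0 < r0)%R ->
  exists e : R, (0 < e)%R /\ forall w, Cmod (w - f z0) < e -> exists z, Cmod (z - z0) < r0 /\ f z = w.
Proof.
intros HR Hf Hd r0 Hr0. assert (Hp := proj1 (Cmod_gt_0 _) Hd).
assert (H00 : Cmod (z0 - z0) < R0) by (rewrite Cmod_self; auto).
destruct (proj1 (Cder_eps _ _ _) (Cder_differentiable _ _ (Hf _ H00))
  (Cmod (C_derive f z0) / 2)%R ltac:(lra)) as [d [Hdp H]].
set (r := (Rmin r0 (Rmin R0 d) / 2)%R).
assert (M1 := Rmin_l r0 (Rmin R0 d)). assert (M2 := Rmin_r r0 (Rmin R0 d)). assert (M3 := Rmin_l R0 d).
assert (M4 := Rmin_r R0 d).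
assert (M0 : (0 < Rmin r0 (Rmin R0 d))%R) by (repeat apply Rmin_pos; auto).
assert (Hr : (0 < r)%R) by (unfold r; lra).
destruct (open_mapping f z0 r Hr) as [e [He HO]].
- intros z Hz. apply Hf. unfold r in Hz. lra.
- intros t Ht E. assert (Hc := circ_dist z0 r t Hr). specialize (H (circ z0 r t)). rewrite Hc, E in H.
  replace (f z0 - f z0 - C_derive f z0 * (circ z0 r t - z0)) with (- (C_derive f z0 * (circ z0 r t - z0))) in H by ring.
  rewrite Cmod_opp, Cmod_mult, Hc in H. specialize (H ltac:(unfold r; lra)). nra.
- exists e. split; auto. intros w Hw. destruct (HO w Hw) as [z [Hz1 Hz2]]. exists z. split; auto. unfold r in Hz1. lra.
Qed.

(* [arc t r xi] for real [xi] runs along the circle of radius [r] about [t], from [t - r] at [0];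
   the exterior of the disk corresponds to [0 < Im xi]. *)
Definition arc (t r : R) (xi : C) : C := RtoC t - RtoC r * Cexp (- (Ci * xi)).

Lemma arc_re t r xi : Re (arc t r xi) = (t - r * exp (Im xi) * cos (Re xi))%R.
Proof.
destruct xi as [x y]. unfold arc, Cexp. simpl.
replace (- (0 * x - 1 * y))%R with y by ring. replace (- (0 * y + 1 * x))%R with (- x)%R by ring.
rewrite cos_neg, sin_neg. ring.
Qed.
Lemma arc_im t r xi : Im (arc t r xi) = (r * exp (Im xi) * sin (Re xi))%R.
Proof.
destruct xi as [x y]. unfold arc, Cexp. simpl.
replace (- (0 * x - 1 * y))%R with y by ring. replace (- (0 * y + 1 * x))%R with (- x)%R by ring.
rewrite cos_neg, sin_neg. ring.
Qed.

Lemma arc_Cder t r xi : Cder (arc t r) xi (Ci * RtoC r * Cexp (- (Ci * xi))).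
Proof. unfold arc. eapply Cder_eq. cder. ring. Qed.

Lemma arc_dist t r xi : (0 < r)%R -> Cmod (arc t r xi - RtoC t) = (r * exp (Im xi))%R.
Proof.
intros Hr. unfold arc.
replace (RtoC t - RtoC r * Cexp (- (Ci * xi)) - RtoC t) with (- (RtoC r * Cexp (- (Ci * xi)))) by ring.
rewrite Cmod_opp, Cmod_mult, Cmod_Cexp, Cmod_RtoC_pos by lra. f_equal. f_equal. destruct xi; simpl; ring.
Qed.

Lemma arc_local_inverse t r (tau : R) : (0 < r)%R -> forall r0, (0 < r0)%R -> exists e, (0 < e)%R /\
  forall w, Cmod (w - arc t r (RtoC tau)) < e -> exists xi, Cmod (xi - RtoC tau) < r0 /\ arc t r xi = w.
Proof.
intros Hr. apply (local_open_mapping (arc t r) (RtoC tau) 1). lra.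
- intros; eapply Cder_is_differentiable, arc_Cder.
- rewrite (Cder_C_derive _ _ _ (arc_Cder t r (RtoC tau))). apply Cmult_neq_0. apply Cmult_neq_0. apply Ci_neq0.
  intros E; apply (f_equal fst) in E; simpl in E; lra. apply Cexp_neq0.
Qed.

(** The angle at [t] of the triangle with vertices [0], [t], [is]. The vertex of the quadrilateral
    in the first quadrant, called [apex] below, lies on the segment from [t] to [is], so on
    [arc t r1] it has this parameter. *)
Definition apex_angle (t s : R) : R := atan (s / t).
Definition apex (t s r1 r2 : R) : C := (t * r2 / (r1 + r2), s * r1 / (r1 + r2))%R.

Lemma apex_swap t s r1 r2 : Cswap (apex t s r1 r2) = apex s t r2 r1.
Proof. unfold apex, Cswap. simpl. rewrite (Rplus_comm r2 r1). auto. Qed.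

Section Quadrilateral.
Variables t s r1 r2 : R.
Hypothesis HT : tangent_circles t s r1 r2.
Notation tA := (apex_angle t s).
Notation Q := (quadrilateral t s r1 r2).

Lemma apex_angle_bound : (0 < tA < PI / 2)%R.
Proof.
destruct HT as [H1 [H2 H3]]. unfold apex_angle. split.
- rewrite <- atan_0. apply atan_increasing. apply Rdiv_lt_0_compat; lra.
- apply atan_bound.
Qed.

Lemma apex_angle_cos_sin : (t = (r1 + r2) * cos tA /\ s = (r1 + r2) * sin tA)%R.
Proof.
destruct HT as [H1 [H2 H3]]. unfold apex_angle.
assert (E : sqrt (1 + (s / t)²) = ((r1 + r2) / t)%R).
{ apply sqrt_lem_1. assert (X := Rle_0_sqr (s / t)). lra. apply Rlt_le, Rdiv_lt_0_compat; lra.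
  unfold Rsqr. replace ((r1 + r2) / t * ((r1 + r2) / t))%R with ((r1 + r2) ^ 2 / (t * t))%R by (field; lra).
  rewrite <- H3. field; lra. }
rewrite cos_atan, sin_atan, E. split; field; lra.
Qed.

(** Polar coordinates about [t]. By the law of cosines the squared distances to [is] and [-is] are
    [(r1 + r2) ^ 2 + rho ^ 2 - 2 * rho * (r1 + r2) * x], with [x] the cosine of [tA - phi] or
    [tA + phi]; they exceed [r2 ^ 2] as long as [rho - r1 < r1 * (1 - c)]. *)
Lemma near_arc_outside rho phi c : (r1 < rho < t)%R -> (rho < r1 + r1 * (1 - c))%R ->
  (cos (tA - phi) <= c)%R -> (cos (tA + phi) <= c)%R -> (c < 1)%R ->
  outside_disks t s r1 r2 (t - rho * cos phi, rho * sin phi)%R.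
Proof.
intros Hr Hrc Hc1 Hc2 Hc. destruct HT as [H1 [H2 H3]]. destruct apex_angle_cos_sin as [Et Es].
apply outside_disks_iff; try lra. simpl.
assert (SC := sin2_cos2 phi). unfold Rsqr in SC.
assert (CB := COS_bound phi).
assert (Main : forall x, (x <= c)%R -> (r2 * r2 < (r1 + r2) ^ 2 + rho * rho - 2 * rho * (r1 + r2) * x)%R).
{ intros x Hx.
  assert (r2 * r2 < (r1 + r2) ^ 2 + rho * rho - 2 * rho * (r1 + r2) * c)%R.
  { set (d := (rho - r1)%R). assert (Hd : (0 < d < r1 * (1 - c))%R) by (unfold d; lra).
    replace ((r1 + r2) ^ 2 + rho * rho - 2 * rho * (r1 + r2) * c)%R with
      (r2 * r2 + (d * d + 2 * (rho * (r1 + r2) * (1 - c) - r2 * d)))%R by (unfold d; ring).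
    assert (r2 * d < r2 * (r1 * (1 - c)))%R by (apply Rmult_lt_compat_l; lra).
    assert (r1 * r2 <= rho * (r1 + r2))%R by nra.
    assert (r1 * r2 * (1 - c) <= rho * (r1 + r2) * (1 - c))%R by (apply Rmult_le_compat_r; lra).
    assert (0 <= d * d)%R by nra. lra. }
  assert (0 < rho * (r1 + r2))%R by nra. nra. }
repeat split.
- replace ((t - rho * cos phi - t) * (t - rho * cos phi - t) + rho * sin phi * (rho * sin phi))%R with
  (rho * rho * (sin phi * sin phi + cos phi * cos phi))%R by ring.
  rewrite SC. nra.
- replace ((t - rho * cos phi + t) * (t - rho * cos phi + t) + rho * sin phi * (rho * sin phi))%R with
  ((2 * t - rho) * (2 * t - rho) + 4 * t * rho * (1 - cos phi) + rho * rho * (sin phi * sin phi +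
    cos phi * cos phi - 1))%R by ring.
  rewrite SC. assert (0 <= 4 * t * rho * (1 - cos phi))%R by (apply Rmult_le_pos; nra). nra.
- rewrite cos_minus in Hc1. specialize (Main _ Hc1).
  replace ((t - rho * cos phi) * (t - rho * cos phi) + (rho * sin phi - s) * (rho * sin phi - s))%R with
   (t ^ 2 + s ^ 2 + rho * rho * (sin phi * sin phi + cos phi * cos phi) - 2 * rho * (t * cos phi + s * sin phi))%R by
     ring.
  rewrite SC, H3. assert (Ec : (t * cos phi = (r1 + r2) * cos tA * cos phi)%R) by (f_equal; exact Et).
  assert (Esn : (s * sin phi = (r1 + r2) * sin tA * sin phi)%R) by (f_equal; exact Es). rewrite Ec, Esn. lra.
- rewrite cos_plus in Hc2. specialize (Main _ Hc2).
  replace ((t - rho * cos phi) * (t - rho * cos phi) + (rho * sin phi + s) * (rho * sin phi + s))%R with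
   (t ^ 2 + s ^ 2 + rho * rho * (sin phi * sin phi + cos phi * cos phi) - 2 * rho * (t * cos phi - s * sin phi))%R by
     ring.
  rewrite SC, H3. assert (Ec : (t * cos phi = (r1 + r2) * cos tA * cos phi)%R) by (f_equal; exact Et).
  assert (Esn : (s * sin phi = (r1 + r2) * sin tA * sin phi)%R) by (f_equal; exact Es). rewrite Ec, Esn. lra.
Qed.

Lemma quadrilateral_0 : Q 0.
Proof.
rewrite quadrilateral_eq. apply component_refl. destruct HT as [H1 [H2 H3]]. apply outside_disks_iff; try lra. simpl.
repeat split; nra.
Qed.

(** Being outside the disks is not enough; the point must be joined to [0]. The path is the real
    segment from [0] to [t - rho] followed by an arc of radius [rho] about [t]. *)
Lemma quadrilateral_near_arc (tau0 : R) : (Rabs tau0 < tA)%R -> exists d, (0 < d)%R /\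
  forall xi, Cmod (xi - RtoC tau0) < d -> (0 < Im xi)%R -> Q (arc t r1 xi).
Proof.
intros Htau. destruct apex_angle_bound as [A1 A2]. destruct HT as [H1 [H2 H3]].
assert (Hab := Rabs_pos tau0).
(* The path will keep to angles of absolute value at most [tau1], halfway to the apex, so a single
   [c < 1] bounds both cosines. *)
set (tau1 := ((Rabs tau0 + tA) / 2)%R). set (c := cos (tA - tau1)).
assert (Ht1 : (0 < tau1 < tA)%R) by (unfold tau1; lra). assert (HPI := PI_RGT_0).
assert (Hc : (c < 1)%R). { unfold c. rewrite <- cos_0. apply cos_decreasing_1; lra. }
set (rm := Rmin t (r1 + r1 * (1 - c))).
assert (Hrm : (r1 < rm)%R). { apply Rmin_glb_lt; nra. }
assert (Hcos : forall phi, (Rabs phi <= tau1)%R -> (cos (tA - phi) <= c)%R /\ (cos (tA + phi) <= c)%R).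
{ intros phi Hphi. apply Rabs_le_between in Hphi. unfold c. split; apply cos_decr_1; lra. }
exists (Rmin ((tA - Rabs tau0) / 2) (ln (rm / r1))). split.
{ apply Rmin_pos. lra. rewrite <- ln_1. apply ln_increasing. lra. apply Rlt_div_r; lra. }
intros xi Hxi Him. assert (X1 := Rlt_le_trans _ _ _ Hxi (Rmin_l _ _)).
assert (X2 := Rlt_le_trans _ _ _ Hxi (Rmin_r _ _)).
set (tau := Re xi). set (rho := (r1 * exp (Im xi))%R).
assert (Htau1 : (Rabs tau <= tau1)%R).
{ assert (B := re_le_Cmod (xi - RtoC tau0)). rewrite Re_minus in B. simpl in B. fold tau in B.
  assert (T := Rabs_triang (tau - tau0) tau0). replace (tau - tau0 + tau0)%R with tau in T by ring. unfold tau1. lra. }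
assert (Hrho : (r1 < rho < rm)%R).
{ unfold rho. split. assert (1 < exp (Im xi))%R. { rewrite <- exp_0. apply exp_increasing; auto. } nra.
  assert (B := im_le_Cmod (xi - RtoC tau0)). rewrite Im_minus in B. simpl in B.
  rewrite Rminus_0_r, Rabs_right in B by lra.
  assert (exp (Im xi) < rm / r1)%R. { rewrite <- (exp_ln (rm / r1)) by (apply Rdiv_lt_0_compat; lra).
    apply exp_increasing. lra. }
  apply (Rmult_lt_compat_l r1) in H; [|lra]. replace (r1 * (rm / r1))%R with rm in H by (field; lra). auto. }
assert (R1 : (rho < t)%R) by (eapply Rlt_le_trans; [apply Hrho|apply Rmin_l]).
assert (R2 : (rho < r1 + r1 * (1 - c))%R) by (eapply Rlt_le_trans; [apply Hrho|apply Rmin_r]).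
assert (Qr : Q (RtoC (t - rho))).
{ rewrite quadrilateral_eq. apply (component_segment _ _ (RtoC 0)). apply quadrilateral_0. intros u Hu.
  replace (RtoC 0 + RtoC u * (RtoC (t - rho) - RtoC 0)) with (RtoC (u * (t - rho))) by (rewrite RtoC_mult; ring).
  assert (Hx : (0 <= u * (t - rho) <= t - rho)%R) by nra. set (x := (u * (t - rho))%R) in *.
  apply outside_disks_iff; try lra. simpl. assert (0 <= x * x)%R by nra. repeat split.
  - replace ((x - t) * (x - t) + 0 * 0)%R with ((t - x) * (t - x))%R by ring. assert (r1 < t - x)%R by lra. nra.
  - nra.
  - nra.
  - nra. }
replace (arc t r1 xi) with ((fun u => RtoC t - RtoC rho * cis (- (u * tau))) 1%R).
2:{ apply injective_projections. change fst with Re. rewrite arc_re. fold tau rho. cbv beta. unfold cis. simpl.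
  rewrite Rmult_1_l, cos_neg. ring.
    change snd with Im. rewrite arc_im. fold tau rho. cbv beta. unfold cis. simpl. rewrite Rmult_1_l, sin_neg. ring. }
rewrite quadrilateral_eq.
apply (component_path (outside_disks t s r1 r2) (RtoC 0) (fun u => RtoC t - RtoC rho * cis (- (u * tau)))).
- replace (RtoC t - RtoC rho * cis (- (0 * tau))) with (RtoC (t - rho)). exact Qr.
  unfold cis. rewrite Rmult_0_l, Ropp_0, cos_0, sin_0. apply injective_projections; simpl; ring.
- intros u Hu. apply Rcont_minus. apply Rcont_const. apply Rcont_mult. apply Rcont_const.
  assert (E : (fun w => cis (- (w * tau))) = (fun w => Cexp (Ci * (RtoC w * RtoC (- tau))))).
  { extensionality w. rewrite cis_Cexp. f_equal. f_equal. rewrite <- RtoC_mult. f_equal. ring. }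
  rewrite E. apply (Rcont_diff Cexp). eapply Cder_is_differentiable, Cder_Cexp. rcont.
- intros u Hu.
  replace (RtoC t - RtoC rho * cis (- (u * tau))) with ((t - rho * cos (u * tau), rho * sin (u * tau))%R : C).
  2:{ unfold cis. rewrite cos_neg, sin_neg. apply injective_projections; simpl; ring. }
  destruct (Hcos (u * tau)%R). { rewrite Rabs_mult, (Rabs_right u) by lra. assert (X := Rabs_pos tau). nra. }
  apply near_arc_outside with (c := c); auto. split; lra.
Qed.

Definition adherent (D : C -> Prop) (p : C) : Prop := forall e, (0 < e)%R -> exists z, D z /\ Cmod (z - p) < e.

Lemma adherent_outside c r p : (forall z, Q z -> (r < Cmod (z - c))%R) -> adherent Q p -> (r <= Cmod (p - c))%R.
Proof.
intros H Hp. apply Rnot_lt_le. intros HN. destruct (Hp (r - Cmod (p - c))%R ltac:(lra)) as [z [Hz Hzp]].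
specialize (H z Hz).
assert (T := Cmod_triangle (z - p) (p - c)). replace (z - p + (p - c)) with (z - c) in T by ring. lra.
Qed.

Lemma adherent_rhombus p : adherent Q p -> (Re p / t + Im p / s <= 1)%R.
Proof.
intros Hp. destruct HT as [H1 [H2 H3]]. assert (I1 : (0 < / t)%R) by (apply Rinv_0_lt_compat; lra).
assert (I2 : (0 < / s)%R) by (apply Rinv_0_lt_compat; lra).
apply Rle_all_eps with (c := (/ t + / s)%R). lra. intros e He. destruct (Hp e He) as [z [Hz Hzp]].
assert (R := quadrilateral_rhombus t s r1 r2 z HT Hz).
assert (B1 := re_le_Cmod (z - p)). assert (B2 := im_le_Cmod (z - p)). rewrite Re_minus in B1. rewrite Im_minus in B2.
apply Rabs_le_between in B1. apply Rabs_le_between in B2. assert (C1 := Rle_abs (Re z)). assert (C2 := Rle_abs (Im z)).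
unfold Rdiv in *.
assert (Re p * / t <= (Rabs (Re z) + e) * / t)%R by (apply Rmult_le_compat_r; lra).
assert (Im p * / s <= (Rabs (Im z) + e) * / s)%R by (apply Rmult_le_compat_r; lra). lra.
Qed.

(** In the angle [tau] about [t] the rhombus inequality reads [sin (tau - tA) <= 0]; it cuts the
    circle off at the apex. *)
Lemma arc_param p : Cmod (p - RtoC t) = r1 -> (0 <= Im p)%R -> (Re p / t + Im p / s <= 1)%R ->
  p = apex t s r1 r2 \/ exists tau : R, (0 <= tau < tA)%R /\ p = arc t r1 (RtoC tau).
Proof.
intros Hp Hi Hrh. destruct apex_angle_bound as [A1 A2]. destruct apex_angle_cos_sin as [Et Es].
destruct HT as [H1 [H2 H3]].
apply Cmod_eq_iff in Hp; [|lra]. destruct p as [x y]. simpl in *.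
replace (x + - t)%R with (- (t - x))%R in Hp by ring. replace (y + - 0)%R with y in Hp by ring.
set (u := ((t - x) / r1)%R). assert (Eu : (t - x = r1 * u)%R) by (unfold u; field; lra).
set (v := (y / r1)%R). assert (Ev : (y = r1 * v)%R) by (unfold v; field; lra).
assert (Huv : (u * u + v * v = 1)%R).
{ rewrite Eu, Ev in Hp. assert (r1 * r1 * (u * u + v * v) = r1 * r1 * 1)%R by lra. apply Rmult_eq_reg_l in H; nra. }
assert (Hv : (0 <= v)%R) by (unfold v; apply Rle_div_r; lra).
set (tau := acos u). assert (Hu : (-1 <= u <= 1)%R) by nra. assert (Ht := acos_bound u). fold tau in Ht.
assert (Ec : cos tau = u) by (apply cos_acos; auto).
assert (Esn : sin tau = v). { unfold tau. rewrite sin_acos by auto. apply sqrt_lem_1; unfold Rsqr; nra. }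
assert (Ex : x = (t - r1 * cos tau)%R) by (rewrite Ec; lra). assert (Ey : y = (r1 * sin tau)%R) by (rewrite Esn; auto).
assert (Hs : (sin (tau - tA) <= 0)%R).
{ rewrite sin_minus.
  assert (K : (r1 * sin tau / s <= r1 * cos tau / t)%R).
  { rewrite Ex, Ey in Hrh. unfold Rdiv in *. rewrite Rmult_minus_distr_r, Rinv_r in Hrh by lra. lra. }
  assert (K2 : (sin tau * t <= cos tau * s)%R).
  { apply (Rmult_le_compat_l (s * t / r1)) in K; [|apply Rlt_le, Rdiv_lt_0_compat; nra].
    replace (s * t / r1 * (r1 * sin tau / s))%R with (sin tau * t)%R in K by (field; repeat split; lra).
    replace (s * t / r1 * (r1 * cos tau / t))%R with (cos tau * s)%R in K by (field; repeat split; lra). auto. }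
  assert (E1 : (sin tau * t = sin tau * ((r1 + r2) * cos tA))%R) by (f_equal; exact Et).
  assert (E2 : (cos tau * s = cos tau * ((r1 + r2) * sin tA))%R) by (f_equal; exact Es).
  rewrite E1, E2 in K2. nra. }
assert (Hle : (tau <= tA)%R).
{ apply Rnot_lt_le. intros HL. assert (0 < sin (tau - tA))%R by (apply sin_gt_0; lra). lra. }
destruct (Rle_lt_or_eq_dec _ _ Hle) as [Hlt|Heq].
- right. exists tau. split. lra.
  apply injective_projections; [change fst with Re; rewrite arc_re|change snd with Im; rewrite arc_im]; simpl;
    rewrite exp_0; lra.
- left. unfold apex. rewrite Ex, Ey, Heq. f_equal.
  + assert (cos tA = t / (r1 + r2))%R by (apply Rmult_eq_reg_r with (r1 + r2)%R; [rewrite Rmult_comm, <- Et; field;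
    lra|lra]).
    rewrite H. field; lra.
  + assert (sin tA = s / (r1 + r2))%R by (apply Rmult_eq_reg_r with (r1 + r2)%R; [rewrite Rmult_comm, <- Es; field;
    lra|lra]).
    rewrite H. field; lra.
Qed.

Lemma apex_eq_arc : apex t s r1 r2 = arc t r1 (RtoC tA).
Proof.
destruct apex_angle_cos_sin as [Et Es]. destruct HT as [H1 [H2 H3]].
apply injective_projections; [change fst with Re; rewrite arc_re|change snd with Im; rewrite arc_im]; simpl;
  rewrite exp_0.
+ assert (cos tA = t / (r1 + r2))%R by (apply Rmult_eq_reg_r with (r1 + r2)%R; [rewrite Rmult_comm, <- Et; field;
  lra|lra]).
  rewrite H. field; lra.
+ assert (sin tA = s / (r1 + r2))%R by (apply Rmult_eq_reg_r with (r1 + r2)%R; [rewrite Rmult_comm, <- Es; field;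
  lra|lra]).
  rewrite H. field; lra.
Qed.

Lemma arc_neq_apex (tau : R) : (Rabs tau < tA)%R -> arc t r1 (RtoC tau) <> apex t s r1 r2.
Proof.
intros Htau E. rewrite apex_eq_arc in E. destruct apex_angle_bound as [A1 A2]. assert (HPI := PI_RGT_0).
destruct HT as [H1 [H2 H3]].
apply (f_equal Re) in E. rewrite !arc_re in E. simpl in E. rewrite exp_0 in E.
assert (cos (Rabs tau) = cos tau). { unfold Rabs. destruct Rcase_abs; auto. apply cos_neg. }
assert (cos tA < cos (Rabs tau))%R. { assert (X := Rabs_pos tau). apply cos_decreasing_1; lra. }
nra.
Qed.
End Quadrilateral.

(** An adherent point is in none of the open disks and, not belonging to the component, not outside
    all the closed ones. It thus lies on a circle, in this quadrant on the one about [t] or the one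
    about [is], and the rhombus restricts it to the arcs. *)
Lemma quadrilateral_boundary t s r1 r2 p : tangent_circles t s r1 r2 -> ~ quadrilateral t s r1 r2 p ->
  adherent (quadrilateral t s r1 r2) p -> (0 <= Re p)%R -> (0 <= Im p)%R ->
  p = apex t s r1 r2 \/
  (exists tau : R, (0 <= tau < apex_angle t s)%R /\ p = arc t r1 (RtoC tau)) \/
  (exists tau : R, (0 <= tau < apex_angle s t)%R /\ p = Cswap (arc s r2 (RtoC tau))).
Proof.
intros HT Hp Hadh Hr Hi. assert (HT' := HT). destruct HT' as [H1 [H2 H3]].
assert (HN : ~ outside_disks t s r1 r2 p).
{ apply (component_boundary _ (RtoC 0)); auto. apply outside_disks_open. }
assert (O1 : (r1 <= Cmod (p - RtoC t))%R).
{ apply (adherent_outside t s r1 r2); auto. intros z Hz. apply component_in in Hz. destruct Hz as (X & _).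
  unfold closed_disk in X. lra. }
assert (O3 : (r2 <= Cmod (p - Ci * RtoC s))%R).
{ apply (adherent_outside t s r1 r2); auto. intros z Hz. apply component_in in Hz. destruct Hz as (_ & _ & X & _).
  unfold closed_disk in X. lra. }
assert (Hrh := adherent_rhombus t s r1 r2 HT p Hadh).
destruct (Rle_or_lt (Cmod (p - RtoC t)) r1) as [L1|L1].
{ destruct (arc_param t s r1 r2 HT p) as [E|E]; auto. lra. }
destruct (Rle_or_lt (Cmod (p - Ci * RtoC s)) r2) as [L3|L3].
{ assert (HS := tangent_circles_swap _ _ _ _ HT).
  destruct (arc_param s t r2 r1 HS (Cswap p)) as [E|[tau [Ht E]]].
  - rewrite Cswap_dist. replace (Cswap (RtoC s)) with (Ci * RtoC s) by (apply injective_projections; simpl; ring). lra.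
  - simpl. auto.
  - simpl. lra.
  - left. rewrite <- (Cswap_invol p), E, apex_swap. auto.
  - right. right. exists tau. split; auto. rewrite <- E, Cswap_invol. auto. }
exfalso. apply HN. unfold outside_disks, closed_disk.
repeat split; try lra; rewrite Cmod_le_iff by lra; destruct p as [x y]; simpl in *; intros HH; nra.
Qed.

Lemma quadrilateral_bounded t s r1 r2 z : tangent_circles t s r1 r2 -> quadrilateral t s r1 r2 z -> Cmod z <= (t + s)%R.
Proof.
intros HT Hz. assert (R := quadrilateral_rhombus _ _ _ _ z HT Hz). destruct HT as [H1 [H2 H3]].
assert (A1 := Rabs_pos (Re z)). assert (A2 := Rabs_pos (Im z)).
assert (B1 : (0 <= Rabs (Re z) / t)%R) by (apply Rle_div_r; lra).
assert (B2 : (0 <= Rabs (Im z) / s)%R) by (apply Rle_div_r; lra).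
eapply Rle_trans. apply Cmod_le_re_im. apply Rplus_le_compat.
- assert (X : (Rabs (Re z) / t <= 1)%R) by lra. apply Rle_div_l in X; lra.
- assert (X : (Rabs (Im z) / s <= 1)%R) by lra. apply Rle_div_l in X; lra.
Qed.

Lemma vertex_first_quadrant t s r1 r2 p : tangent_circles t s r1 r2 -> vertex t s r1 r2 p -> (0 <= Re p)%R ->
  (0 <= Im p)%R ->
  p = apex t s r1 r2.
Proof.
intros [H1 [H2 H3]] [V1 V2] Hr Hi. unfold circle in *.
assert (E1 : Cmod (p - RtoC t) = r1). { destruct V1 as [V1|V1]; auto. apply Cmod_eq_iff in V1; [|lra].
  destruct p as [x y]; simpl in *. nra. }
assert (E2 : Cmod (p - Ci * RtoC s) = r2). { destruct V2 as [V2|V2]; auto. apply Cmod_eq_iff in V2; [|lra].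
  destruct p as [x y]; simpl in *. nra. }
apply Cmod_eq_iff in E1; [|lra]. apply Cmod_eq_iff in E2; [|lra]. destruct p as [x y]; simpl in *.
set (d := (r1 + r2)%R) in *. unfold apex. fold d.
set (X := (x * d - t * r2)%R). set (Y := (y * d - s * r1)%R).
(* Stewart's theorem for the apex, which divides the segment between the centres [t] and [is] in the
   ratio [r1 : r2]: a point at distances [r1] and [r2] from the ends has distance zero from it. *)
assert (E : (X * X + Y * Y = 0)%R).
{ unfold X, Y. assert (r2 = d - r1)%R by (unfold d; ring).
  assert (K1 : ((x - t) * (x - t) + y * y = r1 * r1)%R) by lra.
  assert (K2 : (x * x + (y - s) * (y - s) = r2 * r2)%R) by lra.
  assert (T : (t * t + s * s = d * d)%R) by lra.
  replace ((x * d - t * r2) * (x * d - t * r2) + (y * d - s * r1) * (y * d - s * r1))%R with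
   (d * (r2 * ((x - t) * (x - t) + y * y) + r1 * (x * x + (y - s) * (y - s))) + (d * d - d * (r1 + r2)) * (x * x +
     y * y) + t * t * (r2 * r2 - d * r2) + s * s * (r1 * r1 - d * r1))%R by ring.
  rewrite K1, K2, H. replace ((d - r1) * (d - r1) - d * (d - r1))%R with (- (r1 * (d - r1)))%R by ring.
  replace (r1 * r1 - d * r1)%R with (- (r1 * (d - r1)))%R by ring.
  replace (d * ((d - r1) * (r1 * r1) + r1 * ((d - r1) * (d - r1))) + (d * d - d * (r1 + (d - r1))) * (x * x + y * y) +
  t * t * - (r1 * (d - r1)) + s * s * - (r1 * (d - r1)))%R with
   (d * d * (r1 * (d - r1)) - (t * t + s * s) * (r1 * (d - r1)))%R by ring. rewrite T. ring. }
assert (X = 0 /\ Y = 0)%R by nra. destruct H as [HX HY]. unfold X, Y in *.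
assert (Hd : (0 < d)%R) by (unfold d; lra).
f_equal; apply (Rmult_eq_reg_r d); try lra; unfold Rdiv; rewrite Rmult_assoc, Rinv_l; lra.
Qed.

(** * The unit disk, inverse functions and boundary limits *)

Lemma unit_disk_openC : openC unit_disk.
Proof.
intros u Hu. unfold unit_disk in *. exists (1 - Cmod u)%R. split. lra. intros w Hw.
assert (T := Cmod_triangle (w - u) u). replace (w - u + u) with w in T by ring. lra.
Qed.

Lemma unit_disk_convex : convexC unit_disk.
Proof.
intros z w Hz Hw t Ht. assert (H := disk_convex 0 1 z w). cbv beta in H. replace (z - 0) with z in H by ring.
replace (w - 0) with w in H by ring.
specialize (H Hz Hw t Ht).
match type of H with Rlt (Cmod (Cminus ?a (RtoC 0))) _ => replace (a - RtoC 0) with a in H by ring end. auto.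
Qed.

Lemma unit_disk_0 : unit_disk 0.
Proof. unfold unit_disk. rewrite Cmod_0. lra. Qed.

(** The increment of [g] is the increment of [w] divided by the difference quotient of [f] at [g w];
    that quotient is continuous with a nonzero value, so continuity of [g] suffices. *)
Lemma Ccont_Cder_inverse (f g : C -> C) (w0 : C) (D E : C -> Prop) : openC D -> openC E ->
  (forall z, D z -> C_differentiable f z) -> (forall w, E w -> D (g w) /\ f (g w) = w) -> E w0 ->
  Ccont g w0 -> C_derive f (g w0) <> RtoC 0 -> Cder g w0 (/ C_derive f (g w0)).
Proof.
intros HD HE Hf Hg Hw0 Hc Hn. destruct (Hg w0 Hw0) as [Dz0 Fz0]. set (z0 := g w0) in *.
assert (Hq := diff_quot_differentiable D f z0 HD Hf Dz0 z0 Dz0).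
assert (Cq : Ccont (fun w => / diff_quot f z0 (g w)) w0).
{ unfold Ccont. apply (climit_inv _ (fun w => diff_quot f z0 (g w))). fold z0. rewrite diff_quot_diag; auto.
  apply (climit_comp _ (diff_quot f z0) g z0). fold z0. eapply Cder_Ccont, Cder_differentiable, Hq. exact Hc. }
apply Cder_eps. intros e He. apply Ccont_eps with (e := e) in Cq; auto. destruct Cq as [d1 [Hd1 H1]].
destruct (HE w0 Hw0) as [d2 [Hd2 H2]].
assert (Hnz : exists d, (0 < d)%R /\ forall w, Cmod (w - w0) < d -> diff_quot f z0 (g w) <> RtoC 0).
{ assert (Cq2 : Ccont (fun w => diff_quot f z0 (g w)) w0).
  { apply (climit_comp _ (diff_quot f z0) g z0). fold z0. eapply Cder_Ccont, Cder_differentiable, Hq. exact Hc. }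
  apply Ccont_eps with (e := Cmod (C_derive f z0)) in Cq2. 2: apply Cmod_gt_0; auto. destruct Cq2 as [d [Hd H]].
  exists d. split; auto.
  intros w Hw E0. specialize (H w Hw). fold z0 in H. rewrite E0, diff_quot_diag in H.
  replace (0 - C_derive f z0) with (- C_derive f z0) in H by ring. rewrite Cmod_opp in H. lra. }
destruct Hnz as [d3 [Hd3 H3]].
exists (Rmin d1 (Rmin d2 d3)). split. repeat apply Rmin_pos; auto. intros w Hw.
assert (W1 := Rlt_le_trans _ _ _ Hw (Rmin_l _ _)). assert (W := Rlt_le_trans _ _ _ Hw (Rmin_r _ _)).
assert (W2 := Rlt_le_trans _ _ _ W (Rmin_l _ _)). assert (W3 := Rlt_le_trans _ _ _ W (Rmin_r _ _)).
specialize (H1 w W1). specialize (H3 w W3). fold z0 in H1. rewrite diff_quot_diag in H1.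
destruct (Hg w (H2 w W2)) as [Dw Fw].
assert (Em := diff_quot_mult f z0 (g w)). rewrite Fw, Fz0 in Em.
fold z0. replace (g w - z0 - / C_derive f z0 * (w - w0)) with ((/ diff_quot f z0 (g w) - / C_derive f z0) * (w - w0)).
rewrite Cmod_mult. apply Rmult_le_compat_r. apply Cmod_ge_0. lra.
rewrite <- Em. field. auto.
Qed.

(** Compactness in the form of a Lebesgue number: [P z d] is a property at the scale [d], preserved
    when the scale shrinks, and a common scale is found. *)
Lemma compact_disk (r : R) (P : C -> R -> Prop) :
  (forall z d d', (0 < d' <= d)%R -> P z d -> P z d') ->
  (forall u, Cmod u <= r -> exists d, (0 < d)%R /\ forall z, Cmod (z - u) < d -> P z d) ->
  exists d, (0 < d)%R /\ forall z, Cmod z <= r -> P z d.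
Proof.
intros Hmon Hloc.
assert (Hpt : forall x y : R, exists d : posreal, forall z, Cmod z <= r -> (Rabs (Re z - x) < d)%R ->
  (Rabs (Im z - y) < d)%R -> P z d).
{ intros x y. destruct (Rle_or_lt (Cmod (x, y)) r) as [Hin|Hout].
  - destruct (Hloc _ Hin) as [d [Hd H]]. assert (Hd2 : (0 < d / 2)%R) by lra. exists (mkposreal _ Hd2). simpl.
    intros z Hz H1 H2.
    apply (Hmon z d). lra. apply H. eapply Rle_lt_trans. apply Cmod_le_re_im. rewrite Re_minus, Im_minus.
    simpl (Re (x, y)). simpl (Im (x, y)). lra.
  - assert (Hd2 : (0 < (Cmod (x, y) - r) / 2)%R) by lra. exists (mkposreal _ Hd2). simpl. intros z Hz H1 H2. exfalso.
    assert (K : Cmod (z - (x, y)) < (Cmod (x, y) - r)%R). { eapply Rle_lt_trans. apply Cmod_le_re_im.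
      rewrite Re_minus, Im_minus. simpl (Re (x, y)). simpl (Im (x, y)). lra. }
    assert (T := Cmod_triangle_sub (x, y) z). rewrite Cmod_minus_sym in T. lra. }
set (delta := fun x y => proj1_sig (constructive_indefinite_description _ (Hpt x y))).
assert (Hdelta : forall x y z, Cmod z <= r -> (Rabs (Re z - x) < delta x y)%R -> (Rabs (Im z - y) < delta x y)%R ->
  P z (delta x y)).
{ intros x y. apply (proj2_sig (constructive_indefinite_description _ (Hpt x y))). }
destruct (compactness_value_2d (- r) r (- r) r delta) as [d Hd]. exists d. split. apply cond_pos.
intros z Hz. apply NNPP. intros HN.
assert (B1 := re_le_Cmod z). assert (B2 := im_le_Cmod z). apply Rabs_le_between in B1. apply Rabs_le_between in B2.
apply (Hd (Re z) (Im z)); try lra. intros [u [v [_ [_ [H1 [H2 H3]]]]]]. apply HN. apply (Hmon z (delta u v)).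
split; auto. apply cond_pos. apply Hdelta; auto.
Qed.

Definition blim (f : C -> C) (zeta p : C) : Prop := forall e, (0 < e)%R -> exists d, (0 < d)%R /\
  forall z, unit_disk z -> Cmod (z - zeta) < d -> Cmod (f z - p) < e.

Lemma boundary_value_blim f zeta p : boundary_value f zeta p -> blim f zeta p.
Proof.
intros H e He. assert (HP : locally (T:=C_UniformSpace) p (fun w => Cmod (w - p) < e)).
{ apply locally_C_iff. exists e; auto. }
apply H in HP. unfold filtermap, within in HP. apply locally_C_iff in HP. destruct HP as [d [Hd H1]].
exists d; split; auto.
Qed.

Lemma unit_circle_adherent zeta : Cmod zeta = 1%R -> forall e, (0 < e)%R -> exists z, unit_disk z /\
  Cmod (z - zeta) < e.
Proof.
intros Hz e He. set (x := (Rmin 1 e / 2)%R). assert (M1 := Rmin_l 1 e). assert (M2 := Rmin_r 1 e).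
assert (M0 : (0 < Rmin 1 e)%R) by (apply Rmin_pos; lra).
exists (RtoC (1 - x) * zeta). unfold unit_disk. split.
- rewrite Cmod_mult, Hz, Cmod_RtoC_pos; unfold x; lra.
- replace (RtoC (1 - x) * zeta - zeta) with (- (RtoC x * zeta)) by (rewrite RtoC_minus; ring).
  rewrite Cmod_opp, Cmod_mult, Hz, Cmod_RtoC_pos; unfold x; lra.
Qed.

Lemma blim_unique f zeta p q : Cmod zeta = 1%R -> blim f zeta p -> blim f zeta q -> p = q.
Proof.
intros Hz H1 H2. apply NNPP. intros HN. assert (P := Cmod_pos_neq _ _ HN).
destruct (H1 (Cmod (p - q) / 2)%R ltac:(lra)) as [d1 [Hd1 K1]].
destruct (H2 (Cmod (p - q) / 2)%R ltac:(lra)) as [d2 [Hd2 K2]].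
destruct (unit_circle_adherent zeta Hz (Rmin d1 d2)) as [z [Hz1 Hz2]]. apply Rmin_pos; auto.
specialize (K1 z Hz1 (Rlt_le_trans _ _ _ Hz2 (Rmin_l _ _))).
specialize (K2 z Hz1 (Rlt_le_trans _ _ _ Hz2 (Rmin_r _ _))).
assert (T := Cmod_triangle (p - f z) (f z - q)). replace (p - f z + (f z - q)) with (p - q) in T by ring.
rewrite (Cmod_minus_sym p (f z)) in T. lra.
Qed.

(** By injectivity and the symmetry only real points have real values. So [Im F] keeps one sign on
    the upper half disk, and the derivative at [0] makes it positive. *)
Lemma upper_half_preserved (F : C -> C) : holomorphic_on unit_disk F ->
  (forall z w, unit_disk z -> unit_disk w -> F z = F w -> z = w) ->
  (forall z, unit_disk z -> F (Cconj z) = Cconj (F z)) -> F 0 = 0 ->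
  Im (C_derive F 0) = 0%R -> (0 < Re (C_derive F 0))%R ->
  forall z, unit_disk z -> (0 < Im z)%R -> (0 < Im (F z))%R.
Proof.
intros Hh Hi Hc H0 HI HR z Hz Hzi.
assert (Hreal : forall u, unit_disk u -> Im (F u) = 0%R -> Im u = 0%R).
{ intros u Hu E. apply real_of_conj. apply Hi; auto. unfold unit_disk. rewrite Cmod_conj; auto. rewrite Hc by auto.
  apply Cconj_of_real; auto. }
set (l := Re (C_derive F 0)) in *. assert (El : C_derive F 0 = RtoC l). { unfold l.
  destruct (C_derive F 0); simpl in *; subst; auto. }
destruct (proj1 (Cder_eps _ _ _) (Cder_differentiable _ _ (Hh 0 unit_disk_0)) (l / 2)%R ltac:(lra)) as [d [Hd HD]].
set (y := (Rmin 1 d / 2)%R). assert (M1 := Rmin_l 1 d). assert (M2 := Rmin_r 1 d).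
assert (M0 : (0 < Rmin 1 d)%R) by (apply Rmin_pos; lra).
assert (Hy : (0 < y)%R) by (unfold y; lra).
assert (Ey : Cmod (Ci * RtoC y) = y) by (rewrite Cmod_mult, Cmod_Ci, Cmod_RtoC_pos; lra).
assert (Uy : unit_disk (Ci * RtoC y)) by (unfold unit_disk; rewrite Ey; unfold y; lra).
assert (Fy : (0 < Im (F (Ci * RtoC y)%C))%R).
{ specialize (HD (Ci * RtoC y)). rewrite El, H0 in HD. replace (Ci * RtoC y - 0) with (Ci * RtoC y) in HD by ring.
  rewrite Ey in HD.
  specialize (HD ltac:(unfold y; lra)). assert (B := im_le_Cmod (F (Ci * RtoC y) - 0 - RtoC l * (Ci * RtoC y))).
  rewrite !Im_minus in B.
  apply Rabs_le_between in B. simpl (Im 0) in B.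
  replace (Im (RtoC l * (Ci * RtoC y))) with (l * y)%R in B by (simpl; ring).
  assert (0 < l * y)%R by (apply Rmult_lt_0_compat; auto). lra. }
destruct (Rtotal_order (Im (F z)) 0) as [Hn|[Hn|Hn]]; auto; exfalso.
- destruct (path_connected_aux (fun t => F (z +
  RtoC t * (Ci * RtoC y - z))) 0 1 (fun w => Im w < 0)%R (fun w => 0 < Im w)%R) as [t [_ [K1 K2]]]; try lra.
  + intros t Ht. apply (segment_Rcont unit_disk F); auto. apply unit_disk_convex.
  + intros w Hw. exists (- Im w)%R. split. lra. intros u Hu. assert (B := im_le_Cmod (u - w)). rewrite Im_minus in B.
    apply Rabs_le_between in B. lra.
  + intros w Hw. exists (Im w)%R. split. lra. intros u Hu. assert (B := im_le_Cmod (u - w)). rewrite Im_minus in B.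
    apply Rabs_le_between in B. lra.
  + intros t Ht. assert (Uu := unit_disk_convex _ _ Hz Uy t Ht).
    destruct (Rtotal_order (Im (F (z + RtoC t * (Ci * RtoC y - z)))) 0) as [A|[A|A]]; auto. apply Hreal in A; auto.
    rewrite Im_segment in A. simpl (Im (Ci * RtoC y)) in A.
    exfalso. replace (0 * 0 + 1 * y)%R with y in A by ring. destruct (Req_dec t 0) as [->|]. lra.
    assert (0 < t * y)%R by (apply Rmult_lt_0_compat; lra). assert (0 <= (1 - t) * Im z)%R by (apply Rmult_le_pos; lra).
    lra.
  + replace (z + 0 * (Ci * RtoC y - z)) with z by ring. auto.
  + replace (z + 1 * (Ci * RtoC y - z)) with (Ci * RtoC y) by ring. auto.
- apply Hreal in Hn; auto. lra.
Qed.

(** * The boundary behaviour of [f] *)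

Section Map.
Variables (t s r1 r2 : R) (f : C -> C).
Hypothesis HT : tangent_circles t s r1 r2.
Hypothesis Hf : conformal_map unit_disk (quadrilateral t s r1 r2) f.
Hypothesis Hconj : forall z : C, unit_disk z -> f (Cconj z) = Cconj (f z).
Hypothesis Hodd : forall z : C, unit_disk z -> f (- z) = - f z.
Hypothesis Hpos : Im (C_derive f (RtoC 0)) = 0%R /\ (0 < Re (C_derive f (RtoC 0)))%R.
Notation tA := (apex_angle t s).
Notation Q := (quadrilateral t s r1 r2).

Definition finv (w : C) : C := epsilon (inhabits (RtoC 0)) (fun z => unit_disk z /\ f z = w).
Notation g := finv.

Lemma finv_spec w : Q w -> unit_disk (g w) /\ f (g w) = w.
Proof.
intros Hw. unfold finv. apply epsilon_spec. destruct Hf as [_ [_ H]]. apply H in Hw. auto.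
Qed.
Lemma f_in z : unit_disk z -> Q (f z).
Proof. intros Hz. destruct Hf as [_ [_ H]]. apply H. exists z; auto. Qed.
Lemma finv_f z : unit_disk z -> g (f z) = z.
Proof. intros Hz. destruct (finv_spec _ (f_in z Hz)) as [H1 H2]. destruct Hf as [_ [H _]]. apply H; auto. Qed.
Lemma f_hol z : unit_disk z -> C_differentiable f z.
Proof. destruct Hf as [H _]. apply H. Qed.
Lemma f_inj z w : unit_disk z -> unit_disk w -> f z = f w -> z = w.
Proof. destruct Hf as [_ [H _]]. apply H. Qed.
Lemma f_derive_neq0 z : unit_disk z -> C_derive f z <> RtoC 0.
Proof. apply (injective_C_derive_neq0 unit_disk f). apply unit_disk_openC. apply f_hol. apply f_inj. Qed.
Lemma f_0 : f 0 = 0.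
Proof. assert (H := Hodd 0 unit_disk_0). replace (- 0) with (RtoC 0) in H by ring.
 assert (E : 2 * f 0 = 0). { replace (2 * f 0) with (f 0 + f 0) by ring. rewrite H at 1. ring. }
 apply (f_equal (fun x => / 2 * x)) in E. replace (/ 2 * (2 * f 0)) with (f 0) in E by field. rewrite E. ring. Qed.

Lemma f_local_open z0 r0 : unit_disk z0 -> (0 < r0)%R -> exists e, (0 < e)%R /\
  forall w, Cmod (w - f z0) < e -> exists z, (Cmod (z - z0) < r0 /\ unit_disk z) /\ f z = w.
Proof.
intros Hz Hr. destruct (unit_disk_openC z0 Hz) as [d [Hd H]].
destruct (local_open_mapping f z0 d Hd) with (r0 := Rmin r0 d) as [e [He HH]].
- intros z Hzd. apply f_hol, H; auto.
- apply f_derive_neq0; auto.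
- apply Rmin_pos; auto.
- exists e. split; auto. intros w Hw. destruct (HH w Hw) as [z [Hz1 Hz2]]. exists z. split; auto. split.
  eapply Rlt_le_trans; [exact Hz1|apply Rmin_l].
  apply H. eapply Rlt_le_trans; [exact Hz1|apply Rmin_r].
Qed.

Lemma finv_Ccont w : Q w -> Ccont g w.
Proof.
intros Hw. apply Ccont_eps. intros e He. destruct (finv_spec w Hw) as [Hz Ez].
destruct (f_local_open (g w) e Hz He) as [d [Hd H]]. rewrite Ez in H. exists d. split; auto.
intros u Hu. destruct (H u Hu) as [z [[H1 H2] H3]]. rewrite <- H3, finv_f by auto. auto.
Qed.

Lemma finv_differentiable w : Q w -> C_differentiable g w.
Proof.
intros Hw. eapply Cder_is_differentiable. apply (Ccont_Cder_inverse f g w unit_disk Q); auto.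
apply unit_disk_openC. apply quadrilateral_open. apply f_hol. apply finv_spec. apply finv_Ccont; auto.
apply f_derive_neq0, finv_spec; auto.
Qed.

(** Properness of [f]: on the compact disk of radius [r] its values keep a positive distance from
    [p]. *)
Lemma finv_boundary p r : ~ Q p -> (0 <= r < 1)%R -> exists d, (0 < d)%R /\ forall w, Q w -> Cmod (w - p) < d ->
  (r < Cmod (g w))%R.
Proof.
intros Hp Hr.
destruct (compact_disk r (fun z d => d <= Cmod (f z - p))%R) as [d [Hd H]]; try lra.
- intros z d d' Hdd H. lra.
- intros u Hu. assert (Uu : unit_disk u) by (unfold unit_disk; lra).
  assert (Hne : f u <> p). { intros E. apply Hp. rewrite <- E. apply f_in; auto. }
  assert (P := Cmod_pos_neq _ _ Hne).
  destruct (Cder_continuous_eps _ _ _ (Cder_differentiable _ _ (f_hol u Uu))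
    (Cmod (f u - p) / 2)%R ltac:(lra)) as [d [Hd HH]].
  exists (Rmin d (Cmod (f u - p) / 2)). split. apply Rmin_pos; lra. intros z Hz.
  specialize (HH z (Rlt_le_trans _ _ _ Hz (Rmin_l _ _))).
  eapply Rle_trans. apply Rmin_r. assert (T := Cmod_triangle (f u - f z) (f z - p)).
  replace (f u - f z + (f z - p)) with (f u - p) in T by ring.
  rewrite (Cmod_minus_sym (f u) (f z)) in T. lra.
- exists d. split; auto. intros w Hw Hwp. apply Rnot_le_lt. intros HN. specialize (H _ HN).
  destruct (finv_spec w Hw) as [_ E]. rewrite E in H. lra.
Qed.

(** By continuity of the inverse, values near [w1] are taken only near [g w1], away from the unit
    circle. Hence cluster values at [zeta] lie outside the quadrilateral. *)
Lemma boundary_not_interior zeta w1 : Cmod zeta = 1%R -> Q w1 -> exists d, (0 < d)%R /\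
  forall z, unit_disk z -> Cmod (z - zeta) < d -> Cmod (f z - w1) < d -> False.
Proof.
intros Hz Hw. destruct (finv_spec w1 Hw) as [U1 E1]. unfold unit_disk in U1.
set (e := ((1 - Cmod (g w1)) / 2)%R).
destruct (proj1 (Ccont_eps _ _) (finv_Ccont w1 Hw) e ltac:(unfold e; lra)) as [d [Hd H]].
exists (Rmin e d). split. apply Rmin_pos; unfold e; lra. intros z Uz Hzz Hfz.
specialize (H (f z) (Rlt_le_trans _ _ _ Hfz (Rmin_r _ _))). rewrite finv_f in H by auto.
assert (X := Rlt_le_trans _ _ _ Hzz (Rmin_l _ _)).
assert (T := Cmod_triangle (zeta - z) (z - g w1)). replace (zeta - z + (z - g w1)) with (zeta - g w1) in T by ring.
assert (T2 := Cmod_triangle_sub zeta (g w1)). rewrite (Cmod_minus_sym zeta z) in T. unfold e in *. lra.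
Qed.

(* Compactness of the cluster set of [f] at [zeta]. *)
Lemma cluster_property zeta (Good : C -> Prop) : Cmod zeta = 1%R ->
  (forall w1, ~ Q w1 -> adherent Q w1 -> exists d, (0 < d)%R /\
    forall z, unit_disk z -> Cmod (z - zeta) < d -> Cmod (f z - w1) < d -> Good z) ->
  exists d, (0 < d)%R /\ forall z, unit_disk z -> Cmod (z - zeta) < d -> Good z.
Proof.
intros Hz HG.
destruct (compact_disk (t + s) (fun w d => forall z, unit_disk z -> f z = w -> Cmod (z - zeta) < d ->
  Good z)) as [d [Hd H]].
- intros w d d' Hdd H z Uz E Hzd. apply (H z); auto. lra.
- intros u Hu.
  assert (K : exists d, (0 < d)%R /\ forall z, unit_disk z -> Cmod (z - zeta) < d -> Cmod (f z - u) < d -> Good z).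
  { destruct (classic (Q u)) as [Qu|Qu].
    - destruct (boundary_not_interior zeta u Hz Qu) as [d [Hd H]]. exists d. split; auto. intros z H1 H2 H3. exfalso.
      eauto.
    - destruct (classic (adherent Q u)) as [Au|Au]. auto.
      assert (exists e, (0 < e)%R /\ forall z, Q z -> ~ Cmod (z - u) < e).
      { apply NNPP. intros HN. apply Au. intros e He. apply NNPP. intros HH. apply HN. exists e. split; auto.
        intros z Hqz Hzu. apply HH. exists z; auto. }
      destruct H as [e [He H]]. exists e. split; auto. intros z H1 H2 H3. exfalso. apply (H (f z)); auto.
      apply f_in; auto. }
  destruct K as [d [Hd H]]. exists d. split; auto. intros w Hw z Uz E Hzd. apply H; auto. rewrite E; auto.
- exists d. split; auto. intros z Uz Hzd. apply (H (f z)); auto. apply (quadrilateral_bounded t s r1 r2); auto.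
  apply f_in; auto.
Qed.

Lemma f_upper z : unit_disk z -> (0 < Im z)%R -> (0 < Im (f z))%R.
Proof. apply upper_half_preserved; auto. intros u; apply f_hol. apply f_inj. apply f_0. apply Hpos. apply Hpos. Qed.

Lemma rotation_Cder z : unit_disk z -> Cder (fun z => Ci * f (- (Ci * z))) z (C_derive f (- (Ci * z))).
Proof.
intros Hz. assert (U : unit_disk (- (Ci * z))). { unfold unit_disk. rewrite Cmod_opp, Cmod_mult, Cmod_Ci.
  unfold unit_disk in Hz. lra. }
assert (H1 : Cder (fun z => f (- (Ci * z))) z (C_derive f (- (Ci * z)) * (- Ci))).
{ apply (Cder_comp f (fun z => - (Ci * z))). apply Cder_differentiable, f_hol; auto. eapply Cder_eq. cder. ring. }
eapply Cder_eq. apply (Cder_scal Ci _ _ _ H1).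
replace (Ci * (C_derive f (- (Ci * z)) * - Ci)) with (- (Ci * Ci) * C_derive f (- (Ci * z))) by ring.
replace (- (Ci * Ci)) with (RtoC 1) by (apply injective_projections; simpl; ring). ring.
Qed.

(** [Cswap] is antiholomorphic, but as [f] commutes with complex conjugation, conjugating it by the
    swap amounts to conjugating it by a rotation. The result is therefore holomorphic. *)
Lemma swap_rotation z : unit_disk z -> Cswap (f (Cswap z)) = Ci * f (- (Ci * z)).
Proof.
intros Hz. assert (U : unit_disk (- (Ci * z))). { unfold unit_disk. rewrite Cmod_opp, Cmod_mult, Cmod_Ci.
  unfold unit_disk in Hz. lra. }
replace (Cswap z) with (Cconj (- (Ci * z))). rewrite Hconj by auto. destruct (f (- (Ci * z))).
apply injective_projections; simpl; ring.
destruct z. apply injective_projections; simpl; ring.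
Qed.

Definition f_swap (z : C) : C := Cswap (f (Cswap z)).

Lemma unit_disk_swap z : unit_disk z -> unit_disk (Cswap z).
Proof. unfold unit_disk. rewrite Cmod_Cswap; auto. Qed.

Lemma f_swap_Cder z : unit_disk z -> Cder f_swap z (C_derive f (- (Ci * z))).
Proof.
intros Hz. destruct (unit_disk_openC z Hz) as [d [Hd H]]. apply (Cder_ext_loc (fun z => Ci * f (- (Ci * z)))).
exists d. split; auto. intros w Hw. symmetry. apply swap_rotation; auto. apply rotation_Cder; auto.
Qed.

Lemma f_swap_conformal : conformal_map unit_disk (quadrilateral s t r2 r1) f_swap.
Proof.
destruct HT as [[H1 _] [[H2 _] _]].
unfold conformal_map. splits.
- intros z Hz. eapply Cder_is_differentiable, f_swap_Cder; auto.
- intros z w Hz Hw E. unfold f_swap in E. apply (f_equal Cswap) in E. rewrite !Cswap_invol in E.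
  apply f_inj in E; try (apply unit_disk_swap; auto).
  apply (f_equal Cswap) in E. rewrite !Cswap_invol in E. auto.
- intros w. split.
  + intros Hw. apply quadrilateral_swap in Hw; auto. destruct (finv_spec _ Hw) as [A B]. exists (Cswap (g (Cswap w))).
    split. apply unit_disk_swap; auto.
    unfold f_swap. rewrite Cswap_invol, B, Cswap_invol. auto.
  + intros [z [Hz <-]]. apply quadrilateral_swap; auto. apply f_in, unit_disk_swap; auto.
Qed.

Lemma f_swap_conj z : unit_disk z -> f_swap (Cconj z) = Cconj (f_swap z).
Proof.
intros Hz. unfold f_swap.
replace (Cswap (Cconj z)) with (Cconj (- Cswap z)) by (destruct z; apply injective_projections; simpl; ring).
assert (U := unit_disk_swap z Hz).
rewrite Hconj, Hodd; auto. destruct (f (Cswap z)); apply injective_projections; simpl; ring. unfold unit_disk in *.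
rewrite Cmod_opp; auto.
Qed.
Lemma f_swap_odd z : unit_disk z -> f_swap (- z) = - f_swap z.
Proof.
intros Hz. unfold f_swap. replace (Cswap (- z)) with (- Cswap z) by (destruct z; auto).
rewrite Hodd by (apply unit_disk_swap; auto). destruct (f (Cswap z)); auto.
Qed.
Lemma f_swap_pos : Im (C_derive f_swap 0) = 0%R /\ (0 < Re (C_derive f_swap 0))%R.
Proof. rewrite (Cder_C_derive _ _ _ (f_swap_Cder 0 unit_disk_0)). replace (- (Ci * 0)) with (RtoC 0) by ring.
apply Hpos. Qed.

Lemma f_right z : unit_disk z -> (0 < Re z)%R -> (0 < Re (f z))%R.
Proof.
intros Hz Hr. assert (H := upper_half_preserved f_swap).
destruct f_swap_conformal as [A [B _]].
specialize (H A B f_swap_conj). change (Re (f z)) with (Im (Cswap (f z))). rewrite <- (Cswap_invol z).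
apply H; try apply f_swap_pos.
unfold f_swap. replace (Cswap 0) with (RtoC 0) by auto. rewrite f_0. auto. apply unit_disk_swap; auto. auto.
Qed.

Lemma f_upper_le z : unit_disk z -> (0 <= Im (f z))%R -> (0 <= Im z)%R.
Proof.
intros Hz Hi. apply Rnot_lt_le. intros HN. assert (H := f_upper (Cconj z)). rewrite Hconj in H by auto.
rewrite !im_conj in H. unfold unit_disk in H. rewrite Cmod_conj in H. specialize (H Hz). lra.
Qed.
Lemma f_right_le z : unit_disk z -> (0 <= Re (f z))%R -> (0 <= Re z)%R.
Proof.
intros Hz Hi. apply Rnot_lt_le. intros HN. assert (H := f_right (- z)). rewrite Hodd, !re_opp in H by auto.
unfold unit_disk in H. rewrite Cmod_opp in H. specialize (H Hz). lra.
Qed.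
Lemma f_real z : unit_disk z -> Im (f z) = 0%R -> Im z = 0%R.
Proof.
intros Hz E. apply real_of_conj. apply f_inj; auto. unfold unit_disk. rewrite Cmod_conj; auto. rewrite Hconj by auto.
apply Cconj_of_real; auto.
Qed.

Lemma arc_real_not_in (x : R) : ~ Q (arc t r1 (RtoC x)).
Proof.
intros H. apply component_in in H. destruct H as [H _]. apply H. unfold closed_disk. rewrite arc_dist. simpl.
rewrite exp_0. lra. apply HT.
Qed.

Lemma arc_Ccont xi : Ccont (arc t r1) xi.
Proof. eapply Cder_Ccont, arc_Cder. Qed.

Lemma Im_cayley (a b : C) : (Cmod b < Cmod a)%R -> a + b <> RtoC 0 -> (0 < Im (Ci * ((a - b) / (a + b))))%R.
Proof.
intros Hab Hn. set (q := (a - b) / (a + b)). assert (E : q * (a + b) = a - b) by (unfold q; field; auto).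
assert (P := proj1 (Cmod_gt_0 _) Hn).
assert (K : (Re q * (Cmod (a + b) * Cmod (a + b)) = Cmod a * Cmod a - Cmod b * Cmod b)%R).
{ rewrite !Cmod_sq. assert (E1 := f_equal Re E). assert (E2 := f_equal Im E).
  destruct q as [q1 q2], a as [a1 a2], b as [b1 b2]. simpl in *.
  replace (q1 * ((a1 + b1) * (a1 + b1) + (a2 + b2) * (a2 + b2)))%R with
    ((q1 * (a1 + b1) - q2 * (a2 + b2)) * (a1 + b1) + (q1 * (a2 + b2) + q2 * (a1 + b1)) * (a2 + b2))%R by ring.
  rewrite E1, E2. ring. }
replace (Im (Ci * q)) with (Re q) by (destruct q; simpl; ring).
assert (Cb := Cmod_ge_0 b). assert (0 < Cmod a * Cmod a - Cmod b * Cmod b)%R by nra.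
apply Rnot_le_lt. intros HN. assert (0 < Cmod (a + b) * Cmod (a + b))%R by nra. nra.
Qed.

(** The modulus of the inverse tends to 1 at the arc, so in the coordinate of [arc] it continues by
    reflection in the unit circle. Its derivative at [0] does not vanish by [hopf], applied after
    the Cayley transform that sends the disk to the upper half plane and [K 0] to [0]. *)
Lemma arc_extension (tau0 : R) : (Rabs tau0 < tA)%R -> exists (R0 : R) (K : C -> C), (0 < R0)%R /\
  (forall z, Cmod z < R0 -> C_differentiable K z) /\
  (forall z, half_disk R0 1 z -> Q (arc t r1 (RtoC tau0 + z)) /\ K z = g (arc t r1 (RtoC tau0 + z))) /\
  (forall z, half_disk R0 (-1) z -> (1 <= Cmod (K z))%R) /\
  (forall x : R, (Rabs x < R0)%R -> Cmod (K (RtoC x)) = 1%R) /\ C_derive K 0 <> RtoC 0.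
Proof.
intros Htau. assert (Hr1 : (0 < r1)%R) by apply HT.
destruct (quadrilateral_near_arc t s r1 r2 HT tau0 Htau) as [d1 [Hd1 N1]].
destruct (finv_boundary (arc t r1 (RtoC tau0)) (1 / 2) (arc_real_not_in tau0) ltac:(lra)) as [d2 [Hd2 N2]].
destruct (proj1 (Ccont_eps _ _) (arc_Ccont (RtoC tau0)) d2 Hd2) as [d3 [Hd3 N3]].
set (R0 := Rmin d1 d3). assert (HR0 : (0 < R0)%R) by (apply Rmin_pos; auto).
assert (Near : forall z, Cmod z < R0 -> Cmod (RtoC tau0 + z - RtoC tau0) < d1 /\ Cmod (RtoC tau0 + z - RtoC tau0) < d3).
{ intros z Hz. replace (RtoC tau0 + z - RtoC tau0) with z by ring.
  split; eapply Rlt_le_trans; [exact Hz|apply Rmin_l|exact Hz|apply Rmin_r]. }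
set (k := fun z => g (arc t r1 (RtoC tau0 + z))).
assert (Im0 : forall z, Im (RtoC tau0 + z) = Im z) by (intros [x y]; simpl; ring).
assert (HQ : forall z, half_disk R0 1 z -> Q (arc t r1 (RtoC tau0 + z))).
{ intros z [Hz1 Hz2]. apply N1. apply Near; auto. rewrite Im0. lra. }
destruct (circle_reflection k R0 HR0) as [K [D [P1 [P2 P3]]]].
- intros z Hz. assert (Hg := Cder_differentiable _ _ (finv_differentiable _ (HQ z Hz))). eapply Cder_is_differentiable.
  apply (Cder_comp g (fun z => arc t r1 (RtoC tau0 + z))). exact Hg.
  apply (Cder_comp (arc t r1) (fun z => RtoC tau0 + z)). apply arc_Cder. cder.
- intros z Hz. destruct (finv_spec _ (HQ z Hz)) as [U _]. unfold unit_disk in U. destruct Hz as [Hz1 Hz2].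
  assert (1 / 2 < Cmod (k z))%R. { apply N2. apply HQ; split; auto. apply N3. apply Near; auto. } unfold k in *. lra.
- intros x Hx e He. set (rr := Rmax 0 (1 - e)). assert (Hrr : (0 <= rr < 1)%R). { split. apply Rmax_l.
    apply Rmax_lub_lt; lra. }
  destruct (finv_boundary (arc t r1 (RtoC (tau0 + x))) rr (arc_real_not_in _) Hrr) as [d4 [Hd4 N4]].
  destruct (proj1 (Ccont_eps _ _) (arc_Ccont (RtoC (tau0 + x))) d4 Hd4) as [d5 [Hd5 N5]].
  exists d5. split; auto. intros z Hz Hzx. apply Rle_trans with rr. apply Rmax_r. left. apply N4. apply HQ; auto.
  apply N5.
  rewrite RtoC_plus. replace (RtoC tau0 + z - (RtoC tau0 + RtoC x)) with (z - RtoC x) by ring. auto.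
- exists R0, K. splits; auto.
  + intros z Hz. assert (Hc := half_disk_conj' _ _ Hz). rewrite P2 by auto. destruct (finv_spec _ (HQ _ Hc)) as [U _].
    unfold unit_disk in U. fold (k (Cconj z)) in U.
    assert (Cp : (0 < Cmod (k (Cconj z)))%R).
    { apply Rlt_trans with (1 / 2)%R. lra. apply N2. apply HQ; auto. apply N3. apply Near. destruct Hc; auto. }
    rewrite <- Cinv_conj, Cmod_conj, Cmod_inv by (apply Cmod_gt_0; auto). rewrite <- Rinv_1.
    apply Rinv_le_contravar; lra.
  + intros HD. set (kap := K 0). assert (Z0 : Cmod 0 < R0) by (rewrite Cmod_0; auto).
    assert (Hkap : Cmod kap = 1%R). { apply P3. rewrite Rabs_R0; auto. }
    destruct (Cder_continuous_eps _ _ _ (Cder_differentiable _ _ (D 0 Z0)) 1%R Rlt_0_1) as [d4 [Hd4 N4]].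
    set (R1 := Rmin R0 d4). assert (HR1 : (0 < R1)%R) by (apply Rmin_pos; auto).
    assert (Hne : forall z, Cmod z < R1 -> kap + K z <> RtoC 0).
    { intros z Hz. apply Cmod_gt_0. specialize (N4 z). replace (z - 0) with z in N4 by ring.
      specialize (N4 (Rlt_le_trans _ _ _ Hz (Rmin_r _ _))). fold kap in N4.
      assert (T := Cmod_triangle (kap + K z) (- (K z - kap))).
      replace (kap + K z + - (K z - kap)) with (2 * kap) in T by ring.
      rewrite Cmod_opp, Cmod_mult, Hkap, Cmod_RtoC_pos in T by lra. lra. }
    assert (DR1 : forall z, Cmod z < R1 -> C_differentiable K z). { intros z Hz. apply D.
      eapply Rlt_le_trans; [exact Hz|apply Rmin_l]. }
    assert (Dh : forall z, Cmod z < R1 -> Cder (fun z => Ci * ((kap - K z) / (kap + K z))) z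
      (Ci * (((0 - C_derive K z) * (kap + K z) - (kap - K z) * (0 + C_derive K z)) / ((kap + K z) * (kap + K z))))).
    { intros z Hz. assert (DK := Cder_differentiable _ _ (DR1 z Hz)). specialize (Hne z Hz). eapply Cder_eq. cder. auto.
      unfold Cdiv. ring. }
    apply (hopf (fun z => Ci * ((kap - K z) / (kap + K z))) R1 HR1).
    * intros z Hz. eapply Cder_is_differentiable, Dh; auto.
    * intros z Hz Hi. assert (Hz2 : half_disk R0 1 z). { split. eapply Rlt_le_trans; [exact Hz|apply Rmin_l]. lra. }
      apply Im_cayley. rewrite Hkap, P1 by auto. apply (finv_spec _ (HQ z Hz2)). apply Hne; auto.
    * fold kap. replace (kap - kap) with (RtoC 0) by ring. unfold Cdiv. rewrite Cmult_0_l, Cmult_0_r. auto.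
    * assert (Z1 : Cmod 0 < R1) by (rewrite Cmod_0; auto). rewrite (Cder_C_derive _ _ _ (Dh 0 Z1)), HD. unfold Cdiv.
      ring.
Qed.

Definition arc_limit (tau : R) (l : C) : Prop := forall e, (0 < e)%R -> exists d, (0 < d)%R /\
  forall xi, Cmod (xi - RtoC tau) < d -> (0 < Im xi)%R -> Cmod (g (arc t r1 xi) - l) < e.

Lemma above_real (tau y : R) : (0 < y)%R -> Cmod (RtoC tau + Ci * RtoC y - RtoC tau) = y /\
  Im (RtoC tau + Ci * RtoC y) = y /\ Re (RtoC tau + Ci * RtoC y) = tau.
Proof.
intros Hy. splits. replace (RtoC tau + Ci * RtoC y - RtoC tau) with (Ci * RtoC y) by ring.
rewrite Cmod_mult, Cmod_Ci, Cmod_RtoC_pos; lra.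
simpl; ring. simpl; ring.
Qed.

Lemma arc_limit_unique tau l l' : arc_limit tau l -> arc_limit tau l' -> l = l'.
Proof.
intros H1 H2. apply NNPP. intros HN. assert (P := Cmod_pos_neq _ _ HN).
destruct (H1 (Cmod (l - l') / 2)%R ltac:(lra)) as [d1 [Hd1 K1]].
destruct (H2 (Cmod (l - l') / 2)%R ltac:(lra)) as [d2 [Hd2 K2]].
set (y := (Rmin d1 d2 / 2)%R). assert (M1 := Rmin_l d1 d2). assert (M2 := Rmin_r d1 d2).
assert (M0 : (0 < Rmin d1 d2)%R) by (apply Rmin_pos; auto).
destruct (above_real tau y ltac:(unfold y; lra)) as [A [B _]].
specialize (K1 (RtoC tau + Ci * RtoC y)). specialize (K2 (RtoC tau + Ci * RtoC y)). rewrite A, B in *.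
specialize (K1 ltac:(unfold y; lra) ltac:(unfold y; lra)). specialize (K2 ltac:(unfold y; lra) ltac:(unfold y; lra)).
set (u := g (arc t r1 (RtoC tau + Ci * RtoC y))) in *.
assert (T := Cmod_triangle (l - u) (u - l')). replace (l - u + (u - l')) with (l - l') in T by ring.
rewrite (Cmod_minus_sym l u) in T. lra.
Qed.

(** Local surjectivity of [arc] turns a limit in the coordinate [xi] into one over values of [f]:
    these lie outside the disk about [t], which is exactly [Im xi > 0]. *)
Lemma arc_limit_nbhd tau l : arc_limit tau l -> forall e, (0 < e)%R -> exists d, (0 < d)%R /\
  forall z, unit_disk z -> Cmod (f z - arc t r1 (RtoC tau)) < d -> Cmod (z - l) < e.
Proof.
intros H e He. assert (Hr1 : (0 < r1)%R) by apply HT. destruct (H e He) as [d1 [Hd1 K1]].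
destruct (arc_local_inverse t r1 tau Hr1 d1 Hd1) as [d [Hd K]]. exists d. split; auto.
intros z Uz Hz. destruct (K (f z) Hz) as [xi [Hxi E]]. rewrite <- (finv_f z Uz), <- E. apply K1; auto.
assert (Hq := f_in z Uz). apply component_in in Hq. destruct Hq as [Hq _]. unfold closed_disk in Hq.
rewrite <- E, arc_dist in Hq by auto.
apply Rnot_le_lt. intros HN. apply Hq. assert (exp (Im xi) <= 1)%R. { rewrite <- exp_0.
  destruct HN as [HN| ->]; [left; apply exp_increasing; auto|lra]. } nra.
Qed.

(** Approaching the arc along its radius stays in the closed quadrant, which the inverse preserves.
    Real values come from real points, which will identify the limit at [tau = 0] as 1. *)
Lemma arc_limit_quadrant tau l : (0 <= tau < tA)%R -> arc_limit tau l ->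
  (0 <= Re l)%R /\ (0 <= Im l)%R /\ (tau = 0%R -> Im l = 0%R).
Proof.
intros Htau Hl. destruct (apex_angle_bound t s r1 r2 HT) as [A1 A2].
destruct (quadrilateral_near_arc t s r1 r2 HT tau) as [d1 [Hd1 N1]]. rewrite Rabs_right; lra.
destruct HT as [H1 [H2 H3]].
assert (Hln : (0 < ln (t / r1))%R). { rewrite <- ln_1. apply ln_increasing. lra. apply Rlt_div_r; lra. }
assert (Key : forall e, (0 < e)%R -> exists u, Cmod (u - l) < e /\ (0 <= Re u)%R /\ (0 <= Im u)%R /\ (tau = 0%R ->
  Im u = 0%R)).
{ intros e He. destruct (Hl e He) as [d2 [Hd2 K2]].
  set (m := Rmin (ln (t / r1)) (Rmin d1 d2)). assert (M1 : (m <= ln (t / r1))%R) by apply Rmin_l.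
  assert (M2 : (m <= d1)%R) by (eapply Rle_trans; [apply Rmin_r|apply Rmin_l]).
  assert (M3 : (m <= d2)%R) by (eapply Rle_trans; [apply Rmin_r|apply Rmin_r]).
  assert (M0 : (0 < m)%R) by (repeat apply Rmin_pos; auto).
  set (y := (m / 2)%R). assert (Hy : (0 < y)%R) by (unfold y; lra). destruct (above_real tau y Hy) as [A [B Cc]].
  set (xi := RtoC tau + Ci * RtoC y) in *.
  assert (HQ : Q (arc t r1 xi)). { apply N1; rewrite ?A, ?B; auto. unfold y; lra. }
  destruct (finv_spec _ HQ) as [U E]. exists (g (arc t r1 xi)). splits.
  - apply K2; rewrite ?A, ?B; auto. unfold y; lra.
  - apply f_right_le; auto. rewrite E, arc_re, B, Cc. assert (exp y < t / r1)%R.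
    { rewrite <- (exp_ln (t / r1)) by (apply Rdiv_lt_0_compat; lra). apply exp_increasing. unfold y; lra. }
    apply Rlt_div_r in H; [|lra]. assert (CB := COS_bound tau). assert (P := exp_pos y).
    assert (r1 * exp y * cos tau <= r1 * exp y * 1)%R by (apply Rmult_le_compat_l; [nra|lra]). lra.
  - apply f_upper_le; auto. rewrite E, arc_im, B, Cc. assert (P := exp_pos y). assert (0 <= sin tau)%R.
    { apply sin_ge_0; lra. } apply Rmult_le_pos; auto. nra.
  - intros Ht. apply f_real; auto. rewrite E, arc_im, Cc, Ht, sin_0. ring. }
splits.
- apply Rnot_lt_le. intros HN. destruct (Key (- Re l)%R ltac:(lra)) as [u [Hu [K1 _]]].
  assert (B := re_le_Cmod (u - l)). rewrite Re_minus in B. apply Rabs_le_between in B. lra.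
- apply Rnot_lt_le. intros HN. destruct (Key (- Im l)%R ltac:(lra)) as [u [Hu [_ [K1 _]]]].
  assert (B := im_le_Cmod (u - l)). rewrite Im_minus in B. apply Rabs_le_between in B. lra.
- intros Ht. apply NNPP. intros HN. assert (P := Rabs_pos_lt _ HN).
  destruct (Key (Rabs (Im l)) P) as [u [Hu [_ [_ K1]]]]. specialize (K1 Ht).
  assert (B := im_le_Cmod (u - l)). rewrite Im_minus, K1 in B. replace (0 - Im l)%R with (- Im l)%R in B by ring.
  rewrite Rabs_Ropp in B. lra.
Qed.

(** [b tau] is the value of the continued inverse at the point [tau] of the arc. Its continuity
    comes from a single continuation covering neighbouring points; that [f] tends to the arc point
    at [b tau] comes from the openness of the continuation. *)
Theorem arc_boundary_values : exists b : R -> C,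
  (forall tau, (Rabs tau < tA)%R -> Cmod (b tau) = 1%R /\ Rcont b tau /\ blim f (b tau) (arc t r1 (RtoC tau)) /\
     (forall e, (0 < e)%R -> exists d, (0 < d)%R /\ forall z, unit_disk z -> Cmod (f z - arc t r1 (RtoC tau)) < d ->
     Cmod (z - b tau) < e)) /\
  (forall tau, (0 <= tau < tA)%R -> (0 <= Re (b tau))%R /\ (0 <= Im (b tau))%R) /\ b 0%R = 1.
Proof.
destruct (apex_angle_bound t s r1 r2 HT) as [A1 A2].
assert (Hext : forall tau0 R0 K, (forall z, Cmod z < R0 -> C_differentiable K z) ->
  (forall z, half_disk R0 1 z -> Q (arc t r1 (RtoC tau0 + z)) /\ K z = g (arc t r1 (RtoC tau0 + z))) ->
  forall x, (Rabs x < R0)%R -> arc_limit (tau0 + x) (K (RtoC x))).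
{ intros tau0 R0 K D P x Hx e He. assert (Hx2 : Cmod (RtoC x) < R0) by (rewrite Cmod_R; auto).
  destruct (Cder_continuous_eps _ _ _ (Cder_differentiable _ _ (D _ Hx2)) e He) as [d [Hd H]].
  exists (Rmin d (R0 - Rabs x)). split. apply Rmin_pos; lra. intros xi Hxi Hi. set (z := xi - RtoC tau0).
  assert (Ez : xi = RtoC tau0 + z) by (unfold z; ring).
  assert (Dz : xi - RtoC (tau0 + x) = z - RtoC x) by (unfold z; rewrite RtoC_plus; ring).
  rewrite Dz in Hxi. assert (W1 := Rlt_le_trans _ _ _ Hxi (Rmin_l _ _)).
  assert (W2 := Rlt_le_trans _ _ _ Hxi (Rmin_r _ _)).
  assert (Hz : half_disk R0 1 z). { split. assert (T := Cmod_triangle (z - RtoC x) (RtoC x)).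
    replace (z - RtoC x + RtoC x) with z in T by ring. rewrite (Cmod_R x) in T. lra.
    rewrite Ez in Hi. destruct z as [z1 z2]; simpl in *. lra. }
  rewrite Ez. destruct (P z Hz) as [_ <-]. apply H; auto. }
assert (Hex : forall tau, exists l, (Rabs tau < tA)%R -> arc_limit tau l).
{ intros tau. destruct (Rlt_or_le (Rabs tau) tA) as [H|H].
  - destruct (arc_extension tau H) as (R0 & K & HR0 & D & P & _). exists (K (RtoC 0)). intros _.
    assert (L := Hext tau R0 K D P 0%R ltac:(rewrite Rabs_R0; auto)). rewrite Rplus_0_r in L. auto.
  - exists 0. lra. }
set (b := fun tau => proj1_sig (constructive_indefinite_description _ (Hex tau))).
assert (Hb : forall tau, (Rabs tau < tA)%R -> arc_limit tau (b tau)).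
{ intros tau. apply (proj2_sig (constructive_indefinite_description _ (Hex tau))). }
assert (Hq : forall tau, (0 <= tau < tA)%R -> (0 <= Re (b tau))%R /\ (0 <= Im (b tau))%R /\ (tau = 0%R ->
  Im (b tau) = 0%R)).
{ intros tau Ht. apply (arc_limit_quadrant tau); auto. apply Hb. rewrite Rabs_right; lra. }
assert (Main : forall tau, (Rabs tau < tA)%R -> Cmod (b tau) = 1%R /\ Rcont b tau /\
  blim f (b tau) (arc t r1 (RtoC tau))).
{ intros tau Htau. destruct (arc_extension tau Htau) as (R0 & K & HR0 & D & P & Pm & P1 & PD).
  assert (Kb : forall x, (Rabs x < R0)%R -> (Rabs (tau + x) < tA)%R -> K (RtoC x) = b (tau + x)%R).
  { intros x Hx Hx2. apply (arc_limit_unique (tau + x)). apply Hext with R0; auto. apply Hb; auto. }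
  assert (K0 : K (RtoC 0) = b tau). { rewrite Kb. f_equal; ring. rewrite Rabs_R0; auto. rewrite Rplus_0_r; auto. }
  assert (Z0 : Cmod (RtoC 0) < R0) by (rewrite Cmod_0; auto).
  splits.
  - rewrite <- K0. apply P1. rewrite Rabs_R0; auto.
  - apply Rcont_eps. intros e He.
    destruct (Cder_continuous_eps _ _ _ (Cder_differentiable _ _ (D _ Z0)) e He) as [d [Hd H]].
    exists (Rmin d (Rmin R0 (tA - Rabs tau))). split. repeat apply Rmin_pos; lra. intros w Hw.
    assert (W1 := Rlt_le_trans _ _ _ Hw (Rmin_l _ _)). assert (W := Rlt_le_trans _ _ _ Hw (Rmin_r _ _)).
    assert (W2 := Rlt_le_trans _ _ _ W (Rmin_l _ _)). assert (W3 := Rlt_le_trans _ _ _ W (Rmin_r _ _)).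
    specialize (H (RtoC (w - tau))). rewrite K0, Kb in H; auto. replace (tau + (w - tau))%R with w in H by ring.
    apply H.
    replace (RtoC (w - tau) - 0) with (RtoC (w - tau)) by ring. rewrite Cmod_R; auto.
    replace (tau + (w - tau))%R with w by ring. assert (T := Rabs_triang (w - tau) tau).
    replace (w - tau + tau)%R with w in T by ring. lra.
  - rewrite <- K0. intros e He. destruct (proj1 (Ccont_eps _ _) (arc_Ccont (RtoC tau)) e He) as [d1 [Hd1 N1]].
    destruct (local_open_mapping K 0 R0 HR0) with (r0 := Rmin d1 R0) as [d [Hd H]]; auto.
    { intros z Hz. apply D. replace (z - 0) with z in Hz by ring. auto. }
    { apply Rmin_pos; auto. }
    exists d. split; auto. intros z Uz Hz. destruct (H z Hz) as [xi [Hxi E]]. replace (xi - 0) with xi in Hxi by ring.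
    assert (W1 := Rlt_le_trans _ _ _ Hxi (Rmin_l _ _)). assert (W2 := Rlt_le_trans _ _ _ Hxi (Rmin_r _ _)).
    (* On and below the diameter the continuation has modulus at least 1, so a preimage of a point
       of the disk lies above it. *)
    assert (Hh : half_disk R0 1 xi).
    { split; auto. destruct (Rtotal_order (Im xi) 0) as [Hi|[Hi|Hi]]; try lra; exfalso; unfold unit_disk in Uz.
      - assert (X := Pm xi ltac:(split; auto; lra)). rewrite E in X. lra.
      - assert (Ex : xi = RtoC (Re xi)). { destruct xi; simpl in Hi; subst; auto. }
        specialize (P1 (Re xi)). rewrite <- Ex, E in P1. rewrite Ex, Cmod_R in W2. specialize (P1 W2). lra. }
    destruct (P xi Hh) as [HQ E2]. destruct (finv_spec _ HQ) as [_ E3]. rewrite <- E, E2, E3. apply N1.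
    replace (RtoC tau + xi - RtoC tau) with xi by ring. auto. }
exists b. splits.
- intros tau Htau. destruct (Main tau Htau) as [M1 [M2 M3]]. splits; auto. apply arc_limit_nbhd. apply Hb; auto.
- intros tau Ht. destruct (Hq tau Ht) as [X [Y _]]; auto.
- destruct (Hq 0%R ltac:(lra)) as [X [_ Y]]. specialize (Y eq_refl).
  destruct (Main 0%R ltac:(rewrite Rabs_R0; lra)) as [M _].
  apply Cmod_eq_iff in M; [|lra]. destruct (b 0%R) as [x y]. simpl in *. subst.
  apply injective_projections; simpl; auto. nra.
Qed.

End Map.

(** * Half-plane coordinates at a boundary point *)

(** The Moebius map of the upper half plane onto the unit disk sending [0] to [zeta] and [i] to [0];
    [to_half_plane] is its inverse. *)
Definition from_half_plane (zeta xi : C) : C := zeta * (Ci - xi) / (Ci + xi).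
Definition to_half_plane (zeta z : C) : C := Ci * ((zeta - z) / (zeta + z)).

Lemma Ci_plus_neq0 xi : Cmod xi < 1 -> Ci + xi <> RtoC 0.
Proof. intros H. apply Cmod_gt_0. assert (T := Cmod_triangle_sub Ci (- xi)). rewrite Cmod_opp, Cmod_Ci in T.
replace (Ci - - xi) with (Ci + xi) in T by ring. lra. Qed.

Lemma from_half_plane_Cder zeta xi : Cmod xi < 1 ->
  Cder (from_half_plane zeta) xi (- (2 * Ci * zeta) / ((Ci + xi) * (Ci + xi))).
Proof. intros H. assert (N := Ci_plus_neq0 xi H). unfold from_half_plane. eapply Cder_eq. cder. auto. field. auto. Qed.

Lemma from_half_plane_0 zeta : from_half_plane zeta 0 = zeta.
Proof. unfold from_half_plane. field. replace (Ci + 0) with Ci by ring. apply Ci_neq0. Qed.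

Lemma Ci_mod_diff xi : (Cmod (Ci + xi) * Cmod (Ci + xi) - Cmod (Ci - xi) * Cmod (Ci - xi) = 4 * Im xi)%R.
Proof. rewrite !Cmod_sq. destruct xi; simpl. ring. Qed.

Lemma from_half_plane_mod zeta xi : Cmod zeta = 1%R -> Cmod xi < 1 ->
  (Cmod (from_half_plane zeta xi) * Cmod (Ci + xi) = Cmod (Ci - xi))%R.
Proof. intros Hz H. assert (N := Ci_plus_neq0 xi H). unfold from_half_plane. rewrite Cmod_div, Cmod_mult, Hz by auto.
field. apply Cmod_gt_0 in N. lra. Qed.

Lemma from_half_plane_disk zeta xi : Cmod zeta = 1%R -> Cmod xi < 1 -> (0 < Im xi)%R ->
  unit_disk (from_half_plane zeta xi).
Proof.
intros Hz H Hi. assert (E := from_half_plane_mod zeta xi Hz H). assert (D := Ci_mod_diff xi).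
assert (N := proj1 (Cmod_gt_0 _) (Ci_plus_neq0 xi H)).
unfold unit_disk. assert (P1 := Cmod_ge_0 (from_half_plane zeta xi)). rewrite <- E in D. apply Rnot_le_lt. intros HN.
assert (Cmod (Ci + xi) <= Cmod (from_half_plane zeta xi) * Cmod (Ci + xi))%R by nra. nra.
Qed.

Lemma from_half_plane_circle zeta (x : R) : Cmod zeta = 1%R -> (Rabs x < 1)%R ->
  Cmod (from_half_plane zeta (RtoC x)) = 1%R.
Proof.
intros Hz H. assert (H' : Cmod (RtoC x) < 1) by (rewrite Cmod_R; auto). assert (E := from_half_plane_mod zeta _ Hz H').
assert (D := Ci_mod_diff (RtoC x)). simpl (Im (RtoC x)) in D.
assert (N := proj1 (Cmod_gt_0 _) (Ci_plus_neq0 _ H')). assert (P2 := Cmod_ge_0 (Ci - RtoC x)).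
assert (K : (Cmod (Ci - RtoC x) = Cmod (Ci + RtoC x))%R) by (apply Rsqr_inj; unfold Rsqr; lra). rewrite K in E.
apply Rmult_eq_reg_r with (Cmod (Ci + RtoC x)); lra.
Qed.

Lemma circle_plus_neq0 zeta z : Cmod zeta = 1%R -> unit_disk z -> zeta + z <> RtoC 0.
Proof. intros Hz Uz E. unfold unit_disk in Uz. assert (T := Cmod_triangle_sub zeta (- z)).
replace (zeta - - z) with (zeta + z) in T by ring. rewrite E, Cmod_0, Cmod_opp in T. lra. Qed.

Lemma to_half_plane_im zeta z : Cmod zeta = 1%R -> unit_disk z -> (0 < Im (to_half_plane zeta z))%R.
Proof. intros Hz Uz. unfold to_half_plane. apply Im_cayley. rewrite Hz. exact Uz. apply circle_plus_neq0; auto. Qed.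

Lemma from_to_half_plane zeta z : Cmod zeta = 1%R -> unit_disk z -> from_half_plane zeta (to_half_plane zeta z) = z.
Proof.
intros Hz Uz. assert (N := circle_plus_neq0 zeta z Hz Uz). unfold from_half_plane, to_half_plane. field.
assert (zeta <> RtoC 0) by (apply Cmod_gt_0; lra). splits; auto.
replace (Ci * (zeta + z) + Ci * (zeta - z)) with (2 * Ci * zeta) by ring. repeat apply Cmult_neq_0; auto.
intros E; apply (f_equal fst) in E; simpl in E; lra. apply Ci_neq0.
Qed.

Lemma blim_half_plane f zeta (x : R) p : Cmod zeta = 1%R -> (Rabs x < 1)%R ->
  blim f (from_half_plane zeta (RtoC x)) p ->
  forall e, (0 < e)%R -> exists d, (0 < d)%R /\ forall xi, half_disk 1 1 xi -> Cmod (xi - RtoC x) < d ->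
    Cmod (f (from_half_plane zeta xi) - p) < e.
Proof.
intros Hz Hx H e He. destruct (H e He) as [d1 [Hd1 H1]]. assert (H' : Cmod (RtoC x) < 1) by (rewrite Cmod_R; auto).
destruct (Cder_continuous_eps _ _ _ (from_half_plane_Cder zeta (RtoC x) H') d1 Hd1) as [d [Hd H2]]. exists d.
split; auto.
intros xi [Hxi1 Hxi2] Hxd. apply H1; auto. apply from_half_plane_disk; auto. lra.
Qed.

(** In the half-plane coordinate [f - p] glues with the zero function below the diameter. The glued
    function vanishes identically by the identity principle, which would make [p] a value of [f]. *)
Lemma no_constant_limit t s r1 r2 f zeta d p : tangent_circles t s r1 r2 ->
  conformal_map unit_disk (quadrilateral t s r1 r2) f ->
  Cmod zeta = 1%R -> (0 < d)%R -> ~ quadrilateral t s r1 r2 p ->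
  (forall zeta', Cmod zeta' = 1%R -> Cmod (zeta' - zeta) < d -> blim f zeta' p) -> False.
Proof.
intros HT Hf Hz Hd Hp Hlim.
assert (Z1 : Cmod 0 < 1) by (rewrite Cmod_0; lra).
destruct (Cder_continuous_eps _ _ _ (from_half_plane_Cder zeta 0 Z1) d Hd) as [d1 [Hd1 H1]].
rewrite from_half_plane_0 in H1.
set (R0 := Rmin 1 d1). assert (HR0 : (0 < R0)%R) by (apply Rmin_pos; lra). assert (R1 : (R0 <= 1)%R) by apply Rmin_l.
assert (R2 : (R0 <= d1)%R) by apply Rmin_r.
assert (HU : forall z, half_disk R0 1 z -> unit_disk (from_half_plane zeta z)).
{ intros z [A B]. apply from_half_plane_disk; auto; lra. }
destruct (half_disk_gluing R0 (fun z => f (from_half_plane zeta z) - p) (fun _ => 0) (t + s +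
  Cmod p)) as [k [D [P1 P2]]]; auto.
- destruct HT as [X [Y _]]. assert (Q := Cmod_ge_0 p). lra.
- intros z Hzz. assert (Df := Cder_differentiable _ _ (f_hol t s r1 r2 f Hf _ (HU z Hzz))).
  eapply Cder_is_differentiable.
  apply (Cder_minus (fun z => f (from_half_plane zeta z)) (fun _ => p)). apply (Cder_comp f (from_half_plane zeta)).
  exact Df. apply from_half_plane_Cder. destruct Hzz; lra. apply Cder_const.
- intros z _. eapply Cder_is_differentiable, Cder_const.
- intros z Hzz. unfold Cminus. eapply Rle_trans. apply Cmod_triangle. rewrite Cmod_opp. apply Rplus_le_compat_r.
  apply (quadrilateral_bounded t s r1 r2); auto. apply f_in; auto.
- intros z _. rewrite Cmod_0. destruct HT as [X [Y _]]. assert (Q := Cmod_ge_0 p). lra.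
- intros x Hx e He. destruct (blim_half_plane f zeta x p Hz) with (e := e) as [d2 [Hd2 H2]]; auto; try lra.
  { apply Hlim. apply from_half_plane_circle; auto; lra. apply H1. replace (RtoC x - 0) with (RtoC x) by ring.
    rewrite Cmod_R. lra. }
  exists d2. split; auto. intros z [Hz1 Hz2] Hzx.
  replace (f (from_half_plane zeta z) - p - 0) with (f (from_half_plane zeta z) - p) by ring.
  left. apply H2; auto. split; lra.
- assert (K : half_disk R0 1 (Ci * RtoC (R0 / 2))).
  { split. rewrite Cmod_mult, Cmod_Ci, Cmod_RtoC_pos; lra. simpl. lra. }
  assert (E : k (Ci * RtoC (R0 / 2)) = 0). { apply (zero_half_disk k R0); auto. intros z Hz1 Hz2. apply P2.
    split; auto; lra. destruct K; auto. }
  rewrite P1 in E by auto. apply Hp.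
  replace p with (f (from_half_plane zeta (Ci * RtoC (R0 / 2))) - (f (from_half_plane zeta (Ci * RtoC (R0 / 2)))
    - p)) by ring.
  rewrite E.
  replace (f (from_half_plane zeta (Ci * RtoC (R0 / 2))) - 0) with (f (from_half_plane zeta (Ci * RtoC (R0 / 2)))) by
    ring.
  apply f_in; auto.
Qed.

(** * Correspondence of boundary points in the first quadrant *)

Lemma quarter_circle_unique z w : Cmod z = 1%R -> Cmod w = 1%R -> (0 <= Re z)%R -> (0 <= Re w)%R -> Im z = Im w ->
  z = w.
Proof.
intros Hz Hw Rz Rw E. apply Cmod_eq_iff in Hz; [|lra]. apply Cmod_eq_iff in Hw; [|lra]. rewrite <- E in Hw.
assert (Re z = Re w) by (apply Rsqr_inj; auto; unfold Rsqr; lra). destruct z, w; simpl in *; subst; auto.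
Qed.

Lemma quarter_circle_ivt (b : R -> C) tau1 zeta : (0 <= tau1)%R ->
  (forall tau, (0 <= tau <= tau1)%R -> Cmod (b tau) = 1%R /\ Rcont b tau /\ (0 <= Re (b tau))%R) ->
  b 0%R = 1 -> Cmod zeta = 1%R -> (0 <= Re zeta)%R -> (0 <= Im zeta <= Im (b tau1))%R ->
  exists tau, (0 <= tau <= tau1)%R /\ b tau = zeta.
Proof.
intros H1 Hb Hb0 Hz HR HI. apply NNPP. intros HN.
assert (Hne : forall tau, (0 <= tau <= tau1)%R -> Im (b tau) <> Im zeta).
{ intros tau Ht E. apply HN. exists tau. split; auto. destruct (Hb tau Ht) as [A [_ B]].
  apply quarter_circle_unique; auto. }
destruct (path_connected_aux b 0 tau1 (fun w => Im w < Im zeta)%R (fun w => Im zeta < Im w)%R) as [t [_ [A B]]]; auto;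
  try lra.
- intros t Ht. apply Hb; auto.
- intros w Hw. exists (Im zeta - Im w)%R. split. lra. intros u Hu. assert (B := im_le_Cmod (u - w)).
  rewrite Im_minus in B. apply Rabs_le_between in B. lra.
- intros w Hw. exists (Im w - Im zeta)%R. split. lra. intros u Hu. assert (B := im_le_Cmod (u - w)).
  rewrite Im_minus in B. apply Rabs_le_between in B. lra.
- intros t Ht. specialize (Hne t Ht). destruct (Rtotal_order (Im (b t)) (Im zeta)) as [|[|]]; auto. tauto.
- specialize (Hne 0%R ltac:(lra)). rewrite Hb0 in *. simpl in *. lra.
- specialize (Hne tau1 ltac:(lra)). lra.
Qed.

Lemma blim_swap f zeta p : blim f zeta p -> blim (f_swap f) (Cswap zeta) (Cswap p).
Proof.
intros H e He. destruct (H e He) as [d [Hd H1]]. exists d. split; auto. intros z Uz Hz. unfold f_swap.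
rewrite <- Cswap_minus, Cmod_Cswap. apply H1. apply unit_disk_swap; auto. rewrite Cswap_dist. auto.
Qed.

Lemma f_swap_invol f z : f_swap (f_swap f) z = f z.
Proof. unfold f_swap. rewrite !Cswap_invol. auto. Qed.

Lemma cis_swap beta : Cswap (cis beta) = cis (PI / 2 - beta).
Proof. unfold cis, Cswap. simpl. rewrite cos_shift, sin_shift. auto. Qed.

(** The prevertex stops the preimage of the other arc. If [zeta] were missed, the preimage of this
    arc would stop below [zeta], and between the two the apex would be the only cluster value. *)
Lemma lower_arc_correspondence t s r1 r2 beta f : tangent_circles t s r1 r2 -> (0 < beta < PI / 2)%R ->
  conformal_map unit_disk (quadrilateral t s r1 r2) f ->
  (forall z, unit_disk z -> f (Cconj z) = Cconj (f z)) -> (forall z, unit_disk z -> f (- z) = - f z) ->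
  (Im (C_derive f 0) = 0%R /\ (0 < Re (C_derive f 0))%R) -> blim f (cis beta) (apex t s r1 r2) ->
  forall zeta, Cmod zeta = 1%R -> (0 <= Re zeta)%R -> (0 <= Im zeta < sin beta)%R ->
  exists tau : R, (0 <= tau < apex_angle t s)%R /\ blim f zeta (arc t r1 (RtoC tau)).
Proof.
intros HT Hbeta Hf Hconj Hodd Hpos Hlim zeta Hz HR HI. apply NNPP. intros HN.
assert (HTs := tangent_circles_swap _ _ _ _ HT).
assert (Hfs := f_swap_conformal t s r1 r2 f HT Hf Hconj).
destruct (arc_boundary_values t s r1 r2 f HT Hf Hconj Hodd Hpos) as [b [B1 [B2 B3]]].
destruct (arc_boundary_values s t r2 r1 (f_swap f) HTs Hfs (f_swap_conj f Hconj Hodd) (f_swap_odd f Hodd)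
  (f_swap_pos t s r1 r2 f Hf Hconj Hpos)) as [c [C1 [C2 C3]]].
destruct (apex_angle_bound t s r1 r2 HT) as [A1 A2]. destruct (apex_angle_bound s t r2 r1 HTs) as [A1' A2'].
assert (Hcos : (0 < cos beta)%R) by (apply cos_gt_0; lra). assert (Hsin : (0 < sin beta)%R) by (apply sin_gt_0; lra).
assert (SC := sin2_cos2 beta). unfold Rsqr in SC.
(* [b] starts at 1 and runs continuously on the quarter circle; to get past [zeta] it would have to
   take that value. *)
assert (F1 : forall tau, (0 <= tau < apex_angle t s)%R -> (Im (b tau) < Im zeta)%R).
{ intros tau Ht. apply Rnot_le_lt. intros HL. destruct (quarter_circle_ivt b tau zeta) as [tau' [Ht' E]]; auto; try lra.
  { intros u Hu. destruct (B1 u) as [X [Y _]]. rewrite Rabs_right; lra. splits; auto. apply B2; lra. }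
  apply HN. exists tau'. split. lra. rewrite <- E. apply B1. rewrite Rabs_right; lra. }
(* [c] belongs to the exchanged axes. It cannot take the value [Cswap (cis beta)], where the limit
   of [f_swap f] is the exchanged apex and not a point of the open arc. *)
assert (F2 : forall tau, (0 <= tau < apex_angle s t)%R -> (Im (c tau) < cos beta)%R).
{ intros tau Ht. apply Rnot_le_lt. intros HL.
  destruct (quarter_circle_ivt c tau (Cswap (cis beta))) as [tau' [Ht' E]]; auto; try lra.
  { intros u Hu. destruct (C1 u) as [X [Y _]]. rewrite Rabs_right; lra. splits; auto. apply C2; lra. }
  { rewrite Cmod_Cswap. apply Cmod_cis. } { simpl. lra. } { simpl. lra. }
  destruct (C1 tau') as [X [_ [Y _]]]. rewrite Rabs_right; lra.
  apply (arc_neq_apex s t r2 r1 HTs tau'). rewrite Rabs_right; lra.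
  rewrite <- apex_swap. apply (blim_unique (f_swap f) (c tau')); auto. rewrite E. apply blim_swap; auto. }
(* [(x0, y0)] is a point of the unit circle strictly between [zeta] and [cis beta]; the radius [d0]
   keeps its neighbours strictly between them as well. *)
set (y0 := ((Im zeta + sin beta) / 2)%R). assert (Hy0 : (0 < y0 < sin beta)%R) by (unfold y0; lra).
set (x0 := sqrt (1 - y0 * y0)). assert (Hx0 : (x0 * x0 = 1 - y0 * y0)%R). { apply sqrt_sqrt. nra. }
assert (Hx0c : (cos beta < x0)%R). { apply Rsqr_incrst_0; unfold Rsqr. nra. lra. apply sqrt_pos. }
set (d0 := Rmin (y0 - Im zeta) (x0 - cos beta)). assert (Hd0 : (0 < d0)%R) by (apply Rmin_pos; unfold y0; lra).
assert (Hap : ~ quadrilateral t s r1 r2 (apex t s r1 r2)). { rewrite apex_eq_arc by auto. apply arc_real_not_in; auto. }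
apply (no_constant_limit t s r1 r2 f (x0, y0) d0 (apex t s r1 r2)); auto.
{ apply Cmod_eq_iff. lra. simpl. lra. }
intros z' Hz' Hzd.
assert (Bx := re_le_Cmod (z' - (x0, y0))). assert (By := im_le_Cmod (z' - (x0, y0))). rewrite Re_minus in Bx.
rewrite Im_minus in By. simpl (Re (x0, y0)) in Bx. simpl (Im (x0, y0)) in By.
apply Rabs_le_between in Bx. apply Rabs_le_between in By. assert (D1 := Rlt_le_trans _ _ _ Hzd (Rmin_l _ _)).
assert (D2 := Rlt_le_trans _ _ _ Hzd (Rmin_r _ _)).
assert (G1 : (Im zeta < Im z')%R) by lra. assert (G2 : (cos beta < Re z')%R) by lra.
(* Candidates for cluster values outside the closed quadrant are excluded since [f] preserves the
   quadrant. A point of an open arc is excluded since values near it are taken only near [b tau], or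
   near the swap of [c tau], both different from [z']. *)
intros e He. apply (cluster_property t s r1 r2 f HT Hf z' (fun z => Cmod (f z - apex t s r1 r2) < e) Hz').
intros w1 Hw1 Hadh.
destruct (Rlt_or_le (Re w1) 0) as [Rn|Rp].
{ exists (Rmin (Re z') (- Re w1)). split. apply Rmin_pos; lra. intros z Uz K1 K2. exfalso.
  assert (X1 := Rlt_le_trans _ _ _ K1 (Rmin_l _ _)). assert (X2 := Rlt_le_trans _ _ _ K2 (Rmin_r _ _)).
  assert (Y1 := re_le_Cmod (z - z')). assert (Y2 := re_le_Cmod (f z - w1)). rewrite Re_minus in Y1, Y2.
  apply Rabs_le_between in Y1. apply Rabs_le_between in Y2.
  assert (0 < Re (f z))%R. { apply (f_right t s r1 r2); auto. lra. } lra. }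
destruct (Rlt_or_le (Im w1) 0) as [In|Ip].
{ exists (Rmin (Im z') (- Im w1)). split. apply Rmin_pos; lra. intros z Uz K1 K2. exfalso.
  assert (X1 := Rlt_le_trans _ _ _ K1 (Rmin_l _ _)). assert (X2 := Rlt_le_trans _ _ _ K2 (Rmin_r _ _)).
  assert (Y1 := im_le_Cmod (z - z')). assert (Y2 := im_le_Cmod (f z - w1)). rewrite Im_minus in Y1, Y2.
  apply Rabs_le_between in Y1. apply Rabs_le_between in Y2.
  assert (0 < Im (f z))%R. { apply (f_upper t s r1 r2); auto. lra. } lra. }
destruct (quadrilateral_boundary t s r1 r2 w1 HT Hw1 Hadh Rp Ip) as [E|[[tau [Ht E]]|[tau [Ht E]]]].
- exists e. split; auto. intros z Uz _ K. rewrite <- E. auto.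
- assert (Hne : b tau <> z'). { intros EE. specialize (F1 tau Ht). rewrite EE in F1. lra.
    } assert (P := Cmod_pos_neq _ _ Hne).
  destruct (B1 tau) as [_ [_ [_ L]]]. rewrite Rabs_right; lra.
  destruct (L (Cmod (b tau - z') / 2)%R ltac:(lra)) as [d1 [Hd1 L1]].
  exists (Rmin d1 (Cmod (b tau - z') / 2)). split. apply Rmin_pos; lra. intros z Uz K1 K2. exfalso. rewrite E in K2.
  specialize (L1 z Uz (Rlt_le_trans _ _ _ K2 (Rmin_l _ _))). assert (X2 := Rlt_le_trans _ _ _ K1 (Rmin_r _ _)).
  assert (T := Cmod_triangle (b tau - z) (z - z')). replace (b tau - z + (z - z')) with (b tau - z') in T by ring.
  rewrite (Cmod_minus_sym (b tau) z) in T. lra.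
- assert (Hne : c tau <> Cswap z'). { intros EE. specialize (F2 tau Ht). rewrite EE in F2. simpl in F2. lra.
    } assert (P := Cmod_pos_neq _ _ Hne).
  destruct (C1 tau) as [_ [_ [_ L]]]. rewrite Rabs_right; lra.
  destruct (L (Cmod (c tau - Cswap z') / 2)%R ltac:(lra)) as [d1 [Hd1 L1]].
  exists (Rmin d1 (Cmod (c tau - Cswap z') / 2)). split. apply Rmin_pos; lra. intros z Uz K1 K2. exfalso.
  rewrite E in K2.
  specialize (L1 (Cswap z) (unit_disk_swap z Uz)). unfold f_swap in L1. rewrite Cswap_invol, Cswap_dist in L1.
  specialize (L1 (Rlt_le_trans _ _ _ K2 (Rmin_l _ _))). assert (X2 := Rlt_le_trans _ _ _ K1 (Rmin_r _ _)).
  assert (T := Cmod_triangle (c tau - Cswap z) (Cswap z - Cswap z')).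
  replace (c tau - Cswap z + (Cswap z - Cswap z')) with (c tau - Cswap z') in T by ring.
  rewrite (Cmod_minus_sym (c tau) (Cswap z)), <- Cswap_minus, Cmod_Cswap in T. lra.
Qed.

Lemma arc_quadrant t s r1 r2 tau : tangent_circles t s r1 r2 -> (0 <= tau < apex_angle t s)%R ->
  (0 <= Re (arc t r1 (RtoC tau)))%R /\ (0 <= Im (arc t r1 (RtoC tau)))%R.
Proof.
intros HT Ht. destruct (apex_angle_bound t s r1 r2 HT) as [A1 A2]. destruct HT as [H1 [H2 H3]]. rewrite arc_re, arc_im.
simpl. rewrite exp_0.
assert (CB := COS_bound tau). assert (0 <= sin tau)%R by (apply sin_ge_0; lra). split; nra.
Qed.

(** Points above the prevertex are treated by exchanging the axes, which turns [beta] into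
    [PI / 2 - beta]. Whether [w0] is the apex is recorded because it decides whether the continued
    exponential vanishes at [zeta]. *)
Theorem boundary_correspondence t s r1 r2 beta f : tangent_circles t s r1 r2 -> (0 < beta < PI / 2)%R ->
  conformal_map unit_disk (quadrilateral t s r1 r2) f ->
  (forall z, unit_disk z -> f (Cconj z) = Cconj (f z)) -> (forall z, unit_disk z -> f (- z) = - f z) ->
  (Im (C_derive f 0) = 0%R /\ (0 < Re (C_derive f 0))%R) -> blim f (cis beta) (apex t s r1 r2) ->
  forall zeta, Cmod zeta = 1%R -> (0 <= Re zeta)%R -> (0 <= Im zeta)%R ->
  exists w0, (0 <= Re w0)%R /\ (0 <= Im w0)%R /\ blim f zeta w0 /\ ~ quadrilateral t s r1 r2 w0 /\
    (zeta = cis beta -> w0 = apex t s r1 r2) /\ (zeta <> cis beta -> w0 <> apex t s r1 r2).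
Proof.
intros HT Hbeta Hf Hconj Hodd Hpos Hlim zeta Hz HR HI.
assert (HTs := tangent_circles_swap _ _ _ _ HT).
assert (Hcos : (0 < cos beta)%R) by (apply cos_gt_0; lra). assert (Hsin : (0 < sin beta)%R) by (apply sin_gt_0; lra).
destruct (Rtotal_order (Im zeta) (sin beta)) as [Hlt|[Heq|Hgt]].
- destruct (lower_arc_correspondence t s r1 r2 beta f HT Hbeta Hf Hconj Hodd Hpos Hlim zeta Hz HR) as [tau [Ht L]];
  auto.
  destruct (arc_quadrant t s r1 r2 tau HT Ht) as [Q1 Q2].
  exists (arc t r1 (RtoC tau)). splits; auto. apply arc_real_not_in; auto.
  intros E. rewrite E in Hlt. simpl in Hlt. lra. intros _. apply arc_neq_apex; auto. rewrite Rabs_right; lra.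
- assert (E : zeta = cis beta). { apply quarter_circle_unique; auto. apply Cmod_cis. simpl; lra. }
  exists (apex t s r1 r2). splits; try tauto.
  + simpl. destruct HT as [H1 [H2 H3]]. left. apply Rdiv_lt_0_compat. nra. lra.
  + simpl. destruct HT as [H1 [H2 H3]]. left. apply Rdiv_lt_0_compat. nra. lra.
  + rewrite E; auto.
  + rewrite apex_eq_arc by auto. apply arc_real_not_in; auto.
- assert (Hfs := f_swap_conformal t s r1 r2 f HT Hf Hconj).
  destruct (lower_arc_correspondence s t r2 r1 (PI / 2 - beta)
    (f_swap f) HTs ltac:(lra) Hfs (f_swap_conj f Hconj Hodd) (f_swap_odd f Hodd)
      (f_swap_pos t s r1 r2 f Hf Hconj Hpos)) with (zeta := Cswap zeta) as [tau [Ht L]].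
  + rewrite <- cis_swap, <- apex_swap. apply blim_swap; auto.
  + rewrite Cmod_Cswap; auto.
  + simpl; auto.
  + simpl. rewrite sin_shift. split; auto. apply Cmod_eq_iff in Hz; [|lra]. assert (SC := sin2_cos2 beta).
    unfold Rsqr in SC.
    apply Rnot_le_lt. intros HH. nra.
  + destruct (arc_quadrant s t r2 r1 tau HTs Ht) as [Q1 Q2].
    exists (Cswap (arc s r2 (RtoC tau))). splits; auto.
    * apply blim_swap in L. rewrite Cswap_invol in L. intros e He. destruct (L e He) as [d [Hd H]]. exists d.
      split; auto. intros z Uz Hzz. rewrite <- (f_swap_invol f z). auto.
    * intros HQ. apply quadrilateral_swap in HQ; try apply HT. rewrite Cswap_invol in HQ.
      apply (arc_real_not_in s t r2 r1 HTs tau); auto.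
    * intros E. rewrite E in Hgt. simpl in Hgt. lra.
    * intros _ E. apply (f_equal Cswap) in E. rewrite Cswap_invol, apex_swap in E.
      apply (arc_neq_apex s t r2 r1 HTs tau); auto. rewrite Rabs_right; lra.
Qed.

Lemma Im_Cexp z : Im (Cexp z) = (exp (Re z) * sin (Im z))%R.
Proof. reflexivity. Qed.

(** * Reflection at a cusp *)

Section Cusp.
Variables t s r1 r2 : R.
Hypothesis HT : tangent_circles t s r1 r2.
Notation Q := (quadrilateral t s r1 r2).
Notation A := (apex t s r1 r2).

(* Unit vector from the centre [t] to the centre [is]. *)
Definition cusp_dir : C := ((- t / (r1 + r2)), s / (r1 + r2))%R.
(* [w -> cusp_dir / (w - A)] maps the exterior of the two disks tangent at [A] onto the strip
   [- 1 / (2 r1) < Re < 1 / (2 r2)]. *)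
Definition cusp_strip (w : C) : C := cusp_dir / (w - A).
(** The factor that scales the strip to the width [PI]. With [cusp_c1] and [cusp_c2] the strip is
    also turned by a right angle and shifted, its edges becoming the lines of imaginary part [0] and
    [PI], which the exponential maps into the real axis. *)
Definition cusp_rate : R := (PI / (1 / (2 * r1) + 1 / (2 * r2)))%R.
Definition cusp_c1 : C := - (Ci * RtoC cusp_rate * cusp_dir).
Definition cusp_c2 : C := Ci * RtoC (cusp_rate * (1 / (2 * r2))).
Definition cusp_exp (w : C) : C := Cexp (cusp_c1 / (w - A) + cusp_c2).

Lemma cusp_dir_mod : (Re cusp_dir * Re cusp_dir + Im cusp_dir * Im cusp_dir = 1)%R.
Proof.
destruct HT as [H1 [H2 H3]]. unfold cusp_dir. simpl.
replace (- t / (r1 + r2) * (- t / (r1 + r2)) + s / (r1 + r2) * (s / (r1 + r2)))%R with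
  ((t ^ 2 + s ^ 2) / (r1 + r2) ^ 2)%R by (field; lra).
rewrite H3. field; lra.
Qed.

Lemma cusp_dir_neq0 : cusp_dir <> RtoC 0.
Proof. intros E. assert (H := cusp_dir_mod). rewrite E in H. simpl in H. lra. Qed.

Lemma cusp_rate_pos : (0 < cusp_rate)%R.
Proof. destruct HT as [H1 [H2 H3]]. unfold cusp_rate. apply Rdiv_lt_0_compat. apply PI_RGT_0.
assert (0 < 1 / (2 * r1))%R by (apply Rdiv_lt_0_compat; lra).
assert (0 < 1 / (2 * r2))%R by (apply Rdiv_lt_0_compat; lra). lra. Qed.

Lemma cusp_c1_neq0 : cusp_c1 <> RtoC 0.
Proof.
unfold cusp_c1. intros E. apply (Cmult_neq_0 (Ci * RtoC cusp_rate) cusp_dir). apply Cmult_neq_0. apply Ci_neq0.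
intros E2; apply (f_equal fst) in E2; simpl in E2. assert (H := cusp_rate_pos). lra. apply cusp_dir_neq0.
replace (Ci * RtoC cusp_rate * cusp_dir) with (- - (Ci * RtoC cusp_rate * cusp_dir)) by ring. rewrite E. ring.
Qed.

Lemma cusp_exp_parts w : w <> A ->
  Re (cusp_c1 / (w - A) + cusp_c2) = (cusp_rate * Im (cusp_strip w))%R /\
  Im (cusp_c1 / (w - A) + cusp_c2) = (cusp_rate * (1 / (2 * r2) - Re (cusp_strip w)))%R.
Proof.
intros Hw. replace (cusp_c1 / (w - A) + cusp_c2) with (- (Ci * RtoC cusp_rate * (cusp_strip w - RtoC (1 / (2 * r2))))).
2:{ unfold cusp_strip, cusp_c1, cusp_c2. rewrite RtoC_mult. field. apply Cminus_neq0; auto. }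
destruct (cusp_strip w) as [X Y]. simpl. split; ring.
Qed.

(** The left sides are the powers of [w] with respect to the circles about [t] and [is], and the
    signed distance to the line of centres. All three are read off from
    [cusp_strip w * (w - A) = cusp_dir]. *)
Lemma cusp_strip_sq w : w <> A ->
  (((Re w - t) * (Re w - t) + Im w * Im w - r1 * r1) = ((Re w - Re A) * (Re w - Re A) +
  (Im w - Im A) * (Im w - Im A)) * (1 + 2 * r1 * Re (cusp_strip w)))%R /\
  ((Re w * Re w + (Im w - s) * (Im w - s) - r2 * r2) = ((Re w - Re A) * (Re w - Re A) +
  (Im w - Im A) * (Im w - Im A)) * (1 - 2 * r2 * Re (cusp_strip w)))%R /\
  ((s * (Re w - Re A) + t * (Im w - Im A)) / (r1 + r2) = ((Re w - Re A) * (Re w - Re A) +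
    (Im w - Im A) * (Im w - Im A)) * Im (cusp_strip w))%R.
Proof.
intros Hw. destruct HT as [H1 [H2 H3]].
assert (E : cusp_strip w * (w - A) = cusp_dir). { unfold cusp_strip. field. apply Cminus_neq0; auto. }
assert (D := cusp_dir_mod).
assert (Ax : (Re A = t + r1 * Re cusp_dir)%R). { unfold cusp_dir. simpl. field; lra. }
assert (Ay : (Im A = r1 * Im cusp_dir)%R). { unfold cusp_dir. simpl. field; lra. }
assert (Bx : (Re A = - r2 * Re cusp_dir)%R). { unfold cusp_dir. simpl. field; lra. }
assert (By : (Im A = s - r2 * Im cusp_dir)%R). { unfold cusp_dir. simpl. field; lra. }
assert (E1 := f_equal Re E). assert (E2 := f_equal Im E). rewrite re_mult, Re_minus, Im_minus in E1.
rewrite im_mult, Re_minus, Im_minus in E2.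
set (dx := (Re w - Re A)%R) in *. set (dy := (Im w - Im A)%R) in *.
set (X := Re (cusp_strip w)) in *. set (Y := Im (cusp_strip w)) in *.
assert (Px : ((dx * dx + dy * dy) * X = Re cusp_dir * dx + Im cusp_dir * dy)%R) by (rewrite <- E1, <- E2; ring).
assert (Py : ((dx * dx + dy * dy) * Y = Im cusp_dir * dx - Re cusp_dir * dy)%R) by (rewrite <- E1, <- E2; ring).
splits.
- replace ((dx * dx + dy * dy) * (1 + 2 * r1 * X))%R with (dx * dx + dy * dy + 2 * r1 * ((dx * dx + dy * dy) * X))%R by
  ring.
  rewrite Px.
  replace (Re w - t)%R with (dx + r1 * Re cusp_dir)%R by (unfold dx; lra).
  replace (Im w) with (dy + r1 * Im cusp_dir)%R by (unfold dy; lra).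
  replace (r1 * r1)%R with (r1 * r1 * (Re cusp_dir * Re cusp_dir + Im cusp_dir * Im cusp_dir))%R by (rewrite D; ring).
  ring.
- replace ((dx * dx + dy * dy) * (1 - 2 * r2 * X))%R with (dx * dx + dy * dy - 2 * r2 * ((dx * dx + dy * dy) * X))%R by
  ring.
  rewrite Px.
  replace (Re w) with (dx - r2 * Re cusp_dir)%R by (unfold dx; lra).
  replace (Im w - s)%R with (dy - r2 * Im cusp_dir)%R by (unfold dy; lra).
  replace (r2 * r2)%R with (r2 * r2 * (Re cusp_dir * Re cusp_dir + Im cusp_dir * Im cusp_dir))%R by (rewrite D; ring).
  ring.
- rewrite Py. unfold cusp_dir. simpl. field; lra.
Qed.

Lemma dist_apex_pos w : w <> A -> (0 < (Re w - Re A) * (Re w - Re A) + (Im w - Im A) * (Im w - Im A))%R.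
Proof.
intros Hw. assert (P := Cmod_pos_neq _ _ Hw). assert (E := Cmod_sq (w - A)). rewrite Re_minus, Im_minus in E.
rewrite <- E. nra.
Qed.

Lemma quadrilateral_neq_apex w : Q w -> w <> A.
Proof. intros Hw ->. rewrite apex_eq_arc in Hw by auto. eapply arc_real_not_in; eauto. Qed.

(** The strip comes from the two disks. The sign of the imaginary part comes from the rhombus, which
    leaves the quadrilateral on one side of the line of centres; it makes [cusp_exp] bounded. *)
Lemma cusp_strip_quadrilateral w : Q w -> (- (1 / (2 * r1)) < Re (cusp_strip w) < 1 / (2 * r2))%R /\
  (Im (cusp_strip w) < 0)%R.
Proof.
intros Hw. assert (Hn := quadrilateral_neq_apex w Hw). destruct (cusp_strip_sq w Hn) as [E1 [E2 E3]].
assert (P := dist_apex_pos w Hn).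
assert (Hrh := quadrilateral_rhombus t s r1 r2 w HT Hw). apply component_in in Hw. destruct HT as [H1 [H2 H3]].
apply outside_disks_iff in Hw; try lra. destruct Hw as (O1 & _ & O3 & _).
set (N := ((Re w - Re A) * (Re w - Re A) + (Im w - Im A) * (Im w - Im A))%R) in *.
assert (K1 : (0 < 1 + 2 * r1 * Re (cusp_strip w))%R) by (apply Rnot_le_lt; intros HH; nra).
assert (K2 : (0 < 1 - 2 * r2 * Re (cusp_strip w))%R) by (apply Rnot_le_lt; intros HH; nra).
split; [split|].
- apply Rmult_lt_reg_l with (2 * r1)%R. lra. replace (2 * r1 * - (1 / (2 * r1)))%R with (-1)%R by (field; lra). lra.
- apply Rmult_lt_reg_l with (2 * r2)%R. lra. replace (2 * r2 * (1 / (2 * r2)))%R with 1%R by (field; lra). lra.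
- assert (L : (s * (Re w - Re A) + t * (Im w - Im A) < 0)%R).
  { assert (C1 := Rle_abs (Re w)). assert (C2 := Rle_abs (Im w)).
    assert (K : (Re w / t + Im w / s < 1)%R).
    { assert (I1 : (0 < / t)%R) by (apply Rinv_0_lt_compat; lra).
      assert (I2 : (0 < / s)%R) by (apply Rinv_0_lt_compat; lra). unfold Rdiv in *.
      assert (Re w * / t <= Rabs (Re w) * / t)%R by (apply Rmult_le_compat_r; lra).
      assert (Im w * / s <= Rabs (Im w) * / s)%R by (apply Rmult_le_compat_r; lra). lra. }
    apply (Rmult_lt_compat_l (t * s)) in K; [|nra].
    replace (t * s * (Re w / t + Im w / s))%R with (s * Re w + t * Im w)%R in K by (field; lra).
    assert (EA : (s * Re A + t * Im A = t * s)%R) by (simpl; field; lra). lra. }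
  assert ((s * (Re w - Re A) + t * (Im w - Im A)) / (r1 + r2) < 0)%R. { apply Rlt_div_l; lra. }
  apply Rnot_le_lt. intros HH. nra.
Qed.

Lemma cusp_rate_width : (cusp_rate * (1 / (2 * r2) + 1 / (2 * r1)) = PI)%R.
Proof. destruct HT as [H1 [H2 H3]]. unfold cusp_rate. field. lra. Qed.

Lemma cusp_exp_Im_pos w : Q w -> (0 < Im (cusp_exp w))%R.
Proof.
intros Hw. destruct (cusp_strip_quadrilateral w Hw) as [[K1 K2] K3].
destruct (cusp_exp_parts w (quadrilateral_neq_apex w Hw)) as [E1 E2].
assert (Rp := cusp_rate_pos). unfold cusp_exp. rewrite Im_Cexp, E2. apply Rmult_lt_0_compat. apply exp_pos.
assert (W := cusp_rate_width). apply sin_gt_0. apply Rmult_lt_0_compat; lra. rewrite <- W. apply Rmult_lt_compat_l; lra.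
Qed.

Lemma cusp_exp_mod w : w <> A -> Cmod (cusp_exp w) = exp (cusp_rate * Im (cusp_strip w)).
Proof. intros Hw. unfold cusp_exp. rewrite Cmod_Cexp. destruct (cusp_exp_parts w Hw) as [-> _]. auto. Qed.

Lemma cusp_exp_bounded w : Q w -> Cmod (cusp_exp w) <= 1.
Proof.
intros Hw. destruct (cusp_strip_quadrilateral w Hw) as [_ K3].
rewrite cusp_exp_mod by (apply quadrilateral_neq_apex; auto).
assert (Rp := cusp_rate_pos). left. rewrite <- exp_0. apply exp_increasing. nra.
Qed.

Lemma cusp_exp_Cder w : w <> A -> Cder cusp_exp w (cusp_exp w * (- cusp_c1 / ((w - A) * (w - A)))).
Proof. intros Hw. unfold cusp_exp. assert (N := Cminus_neq0 _ _ Hw). eapply Cder_eq. cder. auto. field. auto. Qed.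

(** Near [A] the modulus of [cusp_strip] is large while its real part stays in the strip, so its
    negative imaginary part is large and the exponential small. *)
Lemma cusp_exp_apex e : (0 < e)%R -> exists d, (0 < d)%R /\ forall w, Q w -> Cmod (w - A) < d -> Cmod (cusp_exp w) < e.
Proof.
intros He. assert (Rp := cusp_rate_pos). destruct HT as [H1 [H2 H3]].
set (B := (1 / (2 * r1) + 1 / (2 * r2))%R).
assert (P1 : (0 < 1 / (2 * r1))%R) by (apply Rdiv_lt_0_compat; lra).
assert (P2 : (0 < 1 / (2 * r2))%R) by (apply Rdiv_lt_0_compat; lra).
assert (HB : (0 < B)%R) by (unfold B; lra).
set (M := (B + Rabs (ln e) / cusp_rate + 1)%R).
assert (HL : (0 <= Rabs (ln e) / cusp_rate)%R) by (apply Rle_div_r; [lra|rewrite Rmult_0_l; apply Rabs_pos]).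
assert (HM : (0 < M)%R) by (unfold M; lra).
exists (/ M)%R. split. apply Rinv_0_lt_compat; auto. intros w Hw Hwd.
assert (Hn := quadrilateral_neq_apex w Hw). destruct (cusp_strip_quadrilateral w Hw) as [[K1 K2] K3].
rewrite cusp_exp_mod by auto.
assert (P := Cmod_pos_neq _ _ Hn).
assert (Hv : Cmod (cusp_strip w) = (/ Cmod (w - A))%R).
{ unfold cusp_strip. rewrite Cmod_div by (apply Cminus_neq0; auto). replace (Cmod cusp_dir) with 1%R. unfold Rdiv; ring.
  symmetry. apply Cmod_eq_iff. lra. rewrite cusp_dir_mod. ring. }
assert (Hv2 : (M < Cmod (cusp_strip w))%R). { rewrite Hv. rewrite <- (Rinv_inv M). apply Rinv_lt_contravar; auto.
  apply Rmult_lt_0_compat; auto. apply Rinv_0_lt_compat; auto. }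
assert (T := Cmod_le_re_im (cusp_strip w)). rewrite (Rabs_left (Im (cusp_strip w))) in T by auto.
assert (Rabs (Re (cusp_strip w)) <= B)%R by (apply Rabs_le; unfold B; lra).
assert (HI : (Im (cusp_strip w) < - (Rabs (ln e) / cusp_rate))%R) by (unfold M in Hv2; lra).
rewrite <- (exp_ln e) by auto. apply exp_increasing.
apply (Rmult_lt_compat_l cusp_rate) in HI; auto.
replace (cusp_rate * - (Rabs (ln e) / cusp_rate))%R with (- Rabs (ln e))%R in HI by (field; lra).
assert (X := Rle_abs (- ln e)). rewrite Rabs_Ropp in X. lra.
Qed.

(** With the circles about [-t] and [-is] kept away, a boundary point lies on a circle through [A],
    where the exponent has imaginary part [PI] or [0]. At [A] itself [cusp_exp] has no continuous
    exponent, but it tends to zero. *)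
Lemma cusp_exp_boundary w1 : ~ Q w1 -> adherent Q w1 -> (r1 < Cmod (w1 - - RtoC t))%R ->
  (r2 < Cmod (w1 - - (Ci * RtoC s)))%R ->
  forall e, (0 < e)%R -> exists d, (0 < d)%R /\ forall w, Q w -> Cmod (w - w1) < d -> (Rabs (Im (cusp_exp w)) < e)%R.
Proof.
intros Hw1 Hadh O2 O4 e He.
destruct (classic (w1 = A)) as [->|Hn].
{ destruct (cusp_exp_apex e He) as [d [Hd H]]. exists d. split; auto. intros w Hw Hwd. eapply Rle_lt_trans.
  apply im_le_Cmod. auto. }
assert (HN : ~ outside_disks t s r1 r2 w1). { apply (component_boundary _ (RtoC 0)); auto. apply outside_disks_open. }
assert (O1 : (r1 <= Cmod (w1 - RtoC t))%R).
{ apply (adherent_outside t s r1 r2); auto. intros z Hz. apply component_in in Hz. destruct Hz as (X & _).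
  unfold closed_disk in X. lra. }
assert (O3 : (r2 <= Cmod (w1 - Ci * RtoC s))%R).
{ apply (adherent_outside t s r1 r2); auto. intros z Hz. apply component_in in Hz. destruct Hz as (_ & _ & X & _).
  unfold closed_disk in X. lra. }
assert (P := dist_apex_pos w1 Hn). destruct (cusp_strip_sq w1 Hn) as [S1 [S2 _]]. assert (W := cusp_rate_width).
destruct HT as [H1 [H2 H3]].
assert (HI : Im (cusp_exp w1) = 0%R).
{ destruct (cusp_exp_parts w1 Hn) as [_ E2]. unfold cusp_exp. rewrite Im_Cexp, E2.
  assert (Cases : Cmod (w1 - RtoC t) = r1 \/ Cmod (w1 - Ci * RtoC s) = r2).
  { destruct (Rle_lt_or_eq_dec _ _ O1) as [L1|L1]; auto. destruct (Rle_lt_or_eq_dec _ _ O3) as [L3|L3]; auto. exfalso.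
    apply HN.
    unfold outside_disks, closed_disk. repeat split; lra. }
  set (N := ((Re w1 - Re A) * (Re w1 - Re A) + (Im w1 - Im A) * (Im w1 - Im A))%R) in *.
  destruct Cases as [E|E]; apply Cmod_eq_iff in E; try lra; rewrite Re_minus, Im_minus in E; simpl (Re (RtoC _)) in E;
    simpl (Im (RtoC _)) in E.
  - rewrite Rminus_0_r in E. assert (Z : (N * (1 + 2 * r1 * Re (cusp_strip w1)) = 0)%R) by lra.
    apply Rmult_integral in Z. destruct Z as [Z|Z]; [lra|].
    replace (Re (cusp_strip w1)) with (- (1 / (2 * r1)))%R. 2:{ apply Rmult_eq_reg_l with (2 * r1)%R; [|lra].
      replace (2 * r1 * - (1 / (2 * r1)))%R with (-1)%R by (field; lra). lra. }
    replace (1 / (2 * r2) - - (1 / (2 * r1)))%R with (1 / (2 * r2) + 1 / (2 * r1))%R by ring. rewrite W, sin_PI. ring.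
  - replace (Re (Ci * RtoC s)) with 0%R in E by (simpl; ring). replace (Im (Ci * RtoC s)) with s in E by (simpl; ring).
    rewrite Rminus_0_r in E.
    assert (Z : (N * (1 - 2 * r2 * Re (cusp_strip w1)) = 0)%R) by lra. apply Rmult_integral in Z.
    destruct Z as [Z|Z]; [lra|].
    replace (Re (cusp_strip w1)) with (1 / (2 * r2))%R. 2:{ apply Rmult_eq_reg_l with (2 * r2)%R; [|lra].
      replace (2 * r2 * (1 / (2 * r2)))%R with 1%R by (field; lra). lra. }
    replace (1 / (2 * r2) - 1 / (2 * r2))%R with 0%R by ring. rewrite Rmult_0_r, sin_0. ring. }
destruct (Cder_continuous_eps _ _ _ (cusp_exp_Cder w1 Hn) e He) as [d [Hd H]]. exists d. split; auto.
intros w Hw Hwd. specialize (H w Hwd). assert (B := im_le_Cmod (cusp_exp w - cusp_exp w1)).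
rewrite Im_minus, HI, Rminus_0_r in B. lra.
Qed.

Variable f : C -> C.
Hypothesis Hf : conformal_map unit_disk Q f.

(* Both sides of the cusp at [A] become the real line under [cusp_exp], so that [f] can be
   continued across a boundary arc and across a prevertex by one and the same reflection. *)
Theorem cusp_reflection zeta w0 : Cmod zeta = 1%R -> (0 <= Re w0)%R -> (0 <= Im w0)%R -> blim f zeta w0 -> ~ Q w0 ->
  exists R0 Et, (0 < R0 <= 1)%R /\ (forall xi, Cmod xi < R0 -> C_differentiable Et xi) /\
    (forall xi, half_disk R0 1 xi -> Et xi = cusp_exp (f (from_half_plane zeta xi))) /\
    (forall xi, Cmod xi < R0 -> Et (Cconj xi) = Cconj (Et xi)) /\ C_derive Et 0 <> RtoC 0 /\
    (w0 = A -> Et 0 = 0) /\ (w0 <> A -> Et 0 <> RtoC 0).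
Proof.
intros Hz Rw Iw Hlim HQw. assert (HT' := HT). destruct HT' as [H1 [H2 H3]].
(* A point of the closed first quadrant is at least [t] away from [-t] and at least [s] away from
   [-is]; within [eta] of [w0] one still avoids these two closed disks. *)
set (eta := Rmin (t - r1) (s - r2)). assert (Heta : (0 < eta)%R) by (apply Rmin_pos; lra).
destruct (Hlim (eta / 2)%R ltac:(lra)) as [d0 [Hd0 N0]].
assert (Z1 : Cmod 0 < 1) by (rewrite Cmod_0; lra).
destruct (Cder_continuous_eps _ _ _ (from_half_plane_Cder zeta 0 Z1) (d0 / 2)%R ltac:(lra)) as [d1 [Hd1 N1]].
rewrite from_half_plane_0 in N1.
set (R0 := Rmin 1 d1). assert (HR0 : (0 < R0 <= 1)%R) by (split; [apply Rmin_pos; lra|apply Rmin_l]).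
assert (HR1 : (R0 <= d1)%R) by apply Rmin_r.
assert (HU : forall z, half_disk R0 1 z -> unit_disk (from_half_plane zeta z)).
{ intros z [X Y]. apply from_half_plane_disk; auto; lra. }
assert (HQ : forall z, half_disk R0 1 z -> Q (f (from_half_plane zeta z))).
{ intros z Hzz. apply f_in; auto. }
assert (Hd : forall z, half_disk R0 1 z -> C_differentiable (fun xi => cusp_exp (f (from_half_plane zeta xi))) z).
{ intros z Hzz. assert (Df := Cder_differentiable _ _ (f_hol t s r1 r2 f Hf _ (HU z Hzz))).
  eapply Cder_is_differentiable.
  apply (Cder_comp cusp_exp (fun xi => f (from_half_plane zeta xi))).
  apply cusp_exp_Cder, quadrilateral_neq_apex, HQ; auto.
  apply (Cder_comp f (from_half_plane zeta)). exact Df. apply from_half_plane_Cder. destruct Hzz; lra. }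
destruct (schwarz_reflection (fun xi => cusp_exp (f (from_half_plane zeta xi))) R0 1) as [Et [D [P1 P2]]]; auto;
  try lra.
- intros z Hzz. apply cusp_exp_bounded; auto.
- intros x Hx e He. set (z' := from_half_plane zeta (RtoC x)).
  assert (Hz' : Cmod z' = 1%R) by (apply from_half_plane_circle; auto; lra).
  assert (Hz'd : Cmod (z' - zeta) < d0 / 2). { apply N1. replace (RtoC x - 0) with (RtoC x) by ring. rewrite Cmod_R.
    lra. }
  assert (Cl : exists d, (0 < d)%R /\ forall z, unit_disk z -> Cmod (z - z') < d -> (Rabs (Im (cusp_exp (f z))) < e)%R).
  { apply (cluster_property t s r1 r2 f HT Hf z' (fun z => (Rabs (Im (cusp_exp (f z))) < e)%R) Hz').
    intros w1 Hw1 Hadh. destruct (Rlt_or_le (Cmod (w1 - w0)) eta) as [Hlt|Hge].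
    - assert (K2 : (r1 < Cmod (w1 - - RtoC t))%R).
      { assert (X := Cmod_triangle_sub (w0 - - RtoC t) (w0 - w1)).
        replace (w0 - - RtoC t - (w0 - w1)) with (w1 - - RtoC t) in X by ring.
        rewrite (Cmod_minus_sym w0 w1) in X. assert (Y := re_le_Cmod (w0 - - RtoC t)). apply Rabs_le_between in Y.
        rewrite Re_minus in Y. simpl (Re (- RtoC t)) in Y. assert (eta <= t - r1)%R by apply Rmin_l. lra. }
      assert (K4 : (r2 < Cmod (w1 - - (Ci * RtoC s)))%R).
      { assert (X := Cmod_triangle_sub (w0 - - (Ci * RtoC s)) (w0 - w1)).
        replace (w0 - - (Ci * RtoC s) - (w0 - w1)) with (w1 - - (Ci * RtoC s)) in X by ring.
        rewrite (Cmod_minus_sym w0 w1) in X. assert (Y := im_le_Cmod (w0 - - (Ci * RtoC s))).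
        apply Rabs_le_between in Y. rewrite Im_minus in Y.
        replace (Im (- (Ci * RtoC s))) with (- s)%R in Y by (simpl; ring). assert (eta <= s - r2)%R by apply Rmin_r.
        lra. }
      destruct (cusp_exp_boundary w1 Hw1 Hadh K2 K4 e He) as [d [Hdp H]]. exists d. split; auto. intros z Uz _ K.
      apply H; auto. apply (f_in t s r1 r2 f Hf); auto.
    - exists (Rmin (d0 / 2) (eta / 2)). split. apply Rmin_pos; lra. intros z Uz K1 K2. exfalso.
      assert (X1 := Rlt_le_trans _ _ _ K1 (Rmin_l _ _)). assert (X2 := Rlt_le_trans _ _ _ K2 (Rmin_r _ _)).
      assert (T := Cmod_triangle (z - z') (z' - zeta)). replace (z - z' + (z' - zeta)) with (z - zeta) in T by ring.
      specialize (N0 z Uz ltac:(lra)). assert (T2 := Cmod_triangle (w1 - f z) (f z - w0)).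
      replace (w1 - f z + (f z - w0)) with (w1 - w0) in T2 by ring.
      rewrite (Cmod_minus_sym w1 (f z)) in T2. lra. }
  destruct Cl as [d [Hdp Cl]]. assert (Hx1 : Cmod (RtoC x) < 1) by (rewrite Cmod_R; lra).
  destruct (Cder_continuous_eps _ _ _ (from_half_plane_Cder zeta (RtoC x) Hx1) d Hdp) as [d2 [Hd2 N2]]. exists d2.
  split; auto.
  intros z Hzz Hzx. left. apply Cl. auto. apply N2; auto.
- assert (Z0 : Cmod 0 < R0) by (rewrite Cmod_0; lra).
  assert (Lim0 : forall l, (forall e, (0 < e)%R -> exists d, (0 < d)%R /\ forall w, Q w -> Cmod (w - w0) < d ->
    Cmod (cusp_exp w - l) < e) -> Et 0 = l).
  { intros l Hl.
    assert (Zc : Cmod (Et 0 - l) = 0%R); [|apply Cmod_eq_0 in Zc; replace (Et 0) with (Et 0 - l + l) by ring;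
      rewrite Zc; ring].
    apply Rle_antisym; [|apply Cmod_ge_0]. apply Rle_all_eps with (c := 2%R). lra. intros e He.
    destruct (Hl e He) as [d2 [Hd2 N2]].
    destruct (Cder_continuous_eps _ _ _ (Cder_differentiable _ _ (D 0 Z0)) e He) as [d3 [Hd3 N3]].
    destruct (blim_half_plane f zeta 0 w0 Hz) with (e := d2) as [d4 [Hd4 N4]]; auto. rewrite Rabs_R0; lra.
    change (RtoC 0) with (0 : C). rewrite from_half_plane_0. auto.
    destruct (half_disk_adherent' R0 1 0 (or_introl eq_refl) Z0 ltac:(simpl; lra) (Rmin d3 d4) ltac:(apply Rmin_pos;
      auto)) as [xi [Hxi Hxd]].
    specialize (N3 xi (Rlt_le_trans _ _ _ Hxd (Rmin_l _ _))). rewrite P1 in N3 by auto.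
    assert (N4' := N4 xi ltac:(destruct Hxi; split; lra) (Rlt_le_trans _ _ _ Hxd (Rmin_r _ _))).
    specialize (N2 _ (HQ xi Hxi) N4').
    set (u := cusp_exp (f (from_half_plane zeta xi))) in *.
    assert (T := Cmod_triangle (Et 0 - u) (u - l)). replace (Et 0 - u + (u - l)) with (Et 0 - l) in T by ring.
    rewrite (Cmod_minus_sym (Et 0) u) in T. lra. }
  exists R0, Et. splits; auto; try lra.
  + apply (hopf Et R0); auto; try lra. intros z Hz1 Hz2. assert (Hh : half_disk R0 1 z) by (split; auto; lra).
    rewrite P1 by auto. apply cusp_exp_Im_pos; auto.
    apply real_of_conj. rewrite <- P2 by auto. f_equal. apply injective_projections; simpl; ring.
  + intros E. apply Lim0. rewrite E. intros e He. destruct (cusp_exp_apex e He) as [d [Hdp H]]. exists d. split; auto.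
    intros w Hw Hwd. replace (cusp_exp w - 0) with (cusp_exp w) by ring. auto.
  + intros Hn. rewrite (Lim0 (cusp_exp w0)). apply Cexp_neq0. intros e He.
    destruct (Cder_continuous_eps _ _ _ (cusp_exp_Cder w0 Hn) e He) as [d [Hdp H]]. exists d. split; auto.
Qed.

End Cusp.

(** * The Schwarzian *)

Definition to_half_plane_d (zeta z : C) : C := - (2 * Ci * zeta) / ((zeta + z) * (zeta + z)).

Lemma to_half_plane_Cder zeta z : zeta + z <> RtoC 0 -> Cder (to_half_plane zeta) z (to_half_plane_d zeta z).
Proof. intros H. unfold to_half_plane, to_half_plane_d. eapply Cder_eq. cder. auto. field. auto. Qed.

Lemma to_half_plane_d_Cder zeta z : zeta + z <> RtoC 0 ->
  Cder (to_half_plane_d zeta) z (- 2 / (zeta + z) * to_half_plane_d zeta z).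
Proof. intros H. unfold to_half_plane_d. eapply Cder_eq. cder. apply Cmult_neq_0; auto. field. auto. Qed.

Lemma two_neq0 : RtoC 2 <> RtoC 0.
Proof. intros E. apply (f_equal fst) in E. simpl in E. lra. Qed.

Lemma to_half_plane_d_neq0 zeta z : zeta <> RtoC 0 -> zeta + z <> RtoC 0 -> to_half_plane_d zeta z <> RtoC 0.
Proof.
intros Hz H E. unfold to_half_plane_d in E. apply (f_equal (fun x => x * ((zeta + z) * (zeta + z)))) in E.
replace (- (2 * Ci * zeta) / ((zeta + z) * (zeta + z)) * ((zeta + z) * (zeta + z))) with (- (2 * Ci * zeta)) in E by
  (field; auto).
apply (Cmult_neq_0 (2 * Ci) zeta); auto. apply Cmult_neq_0. apply two_neq0. apply Ci_neq0.
replace (2 * Ci * zeta) with (- - (2 * Ci * zeta)) by ring. rewrite E. ring.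
Qed.

Definition pre_schwarzian (f : C -> C) (z : C) : C := C_derive (C_derive f) z / C_derive f z.

Lemma pre_schwarzian_Cder (D : C -> Prop) f z : openC D -> (forall z, D z -> C_differentiable f z) -> D z ->
  C_derive f z <> RtoC 0 ->
  Cder (pre_schwarzian f) z (schwarzian f z + / 2 * (pre_schwarzian f z * pre_schwarzian f z)).
Proof.
intros HO Hf Hz Hn. assert (D1 := C_derive_differentiable D f HO Hf). assert (D2 := C_derive_differentiable D _ HO D1).
assert (X : C_differentiable (pre_schwarzian f) z).
{ assert (E1 := Cder_differentiable _ _ (D1 z Hz)). assert (E2 := Cder_differentiable _ _ (D2 z Hz)).
  eapply Cder_is_differentiable. unfold pre_schwarzian. cder. auto. }
apply Cder_differentiable in X. eapply Cder_eq. exact X. unfold schwarzian. fold (pre_schwarzian f).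
change (C_derive (C_derive f) z / C_derive f z) with (pre_schwarzian f z).
replace (RtoC (1 / 2)) with (/ 2). simpl. ring.
rewrite RtoC_div by lra. field.
Qed.

Lemma schwarzian_eq f z l : Cder (pre_schwarzian f) z l ->
  schwarzian f z = l - / 2 * (pre_schwarzian f z * pre_schwarzian f z).
Proof.
intros H. unfold schwarzian. fold (pre_schwarzian f).
change (C_derive (C_derive f) z / C_derive f z) with (pre_schwarzian f z).
rewrite (Cder_C_derive _ _ _ H). replace (RtoC (1 / 2)) with (/ 2). simpl. ring. rewrite RtoC_div by lra. field.
Qed.

(* Schwarzian of [f] from the continuation [Et] of [exp (c1 / (f - A) + c2)] in the half-plane
   coordinate: a Moebius map does not change it, the exponential adds half the squared logarithmic
   derivative. *)
Theorem schwarzian_cusp (O D : C -> Prop) (f Et : C -> C) (A c1 c2 zeta : C) : openC O -> openC D ->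
  (forall z, O z -> C_differentiable f z /\ C_derive f z <> RtoC 0 /\ f z <> A /\ zeta + z <> RtoC 0 /\
  D (to_half_plane zeta z) /\
     Cexp (c1 / (f z - A) + c2) = Et (to_half_plane zeta z)) ->
  (forall xi, D xi -> C_differentiable Et xi) -> c1 <> RtoC 0 -> zeta <> RtoC 0 ->
  forall z, O z -> Et (to_half_plane zeta z) <> RtoC 0 /\ C_derive Et (to_half_plane zeta z) <> RtoC 0 /\
    schwarzian f z = to_half_plane_d zeta z * to_half_plane_d zeta z *
     (schwarzian Et (to_half_plane zeta z) +
       / 2 * ((C_derive Et (to_half_plane zeta z) / Et (to_half_plane zeta z)) * (C_derive Et (to_half_plane zeta z) /
         Et (to_half_plane zeta z)))).
Proof.
intros HO HD Hall DE Hc1 Hzeta.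
assert (Df : forall z, O z -> C_differentiable f z) by (intros; apply Hall; auto).
assert (D1 := C_derive_differentiable O f HO Df). assert (DE1 := C_derive_differentiable D Et HD DE).
set (X := to_half_plane zeta) in *. set (X1 := to_half_plane_d zeta) in *.
(* The logarithmic derivative of [Cexp (c1 / (f - A) + c2)]. Comparing it with that of [Et] along
   [X] gives [R1]; one more differentiation gives [f'' / f'] in [R2]. *)
set (lam := fun z => - (c1 * C_derive f z) / ((f z - A) * (f z - A))).
assert (Loc : forall (u v : C -> C) z l, O z -> (forall w, O w -> u w = v w) -> Cder u z l -> Cder v z l).
{ intros u v z l Hz Heq. apply Cder_ext_loc. destruct (HO z Hz) as [d [Hd H]]. exists d; split; auto. }
assert (R1 : forall z, O z -> Et (X z) * lam z = C_derive Et (X z) * X1 z).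
{ intros z Hz. destruct (Hall z Hz) as (Dz & Nz & Az & Zz & Xz & Ez).
  assert (NA := Cminus_neq0 _ _ Az).
  assert (K1 : Cder (fun z => Et (X z)) z (Et (X z) * lam z)).
  { apply (Loc (fun z => Cexp (c1 / (f z - A) + c2))); auto. intros w Hw; apply Hall; auto.
    assert (E := Cder_differentiable _ _ Dz). eapply Cder_eq. cder. auto. rewrite <- Ez. unfold lam. field. auto. }
  assert (K2 : Cder (fun z => Et (X z)) z (C_derive Et (X z) * X1 z)).
  { apply (Cder_comp Et X). apply Cder_differentiable; auto. apply to_half_plane_Cder; auto. }
  apply (Cder_unique _ _ _ _ K1 K2). }
assert (NE : forall z, O z -> Et (X z) <> RtoC 0).
{ intros z Hz. destruct (Hall z Hz) as (_ & _ & _ & _ & _ & <-). apply Cexp_neq0. }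
assert (NX : forall z, O z -> X1 z <> RtoC 0).
{ intros z Hz. apply to_half_plane_d_neq0; auto. apply Hall; auto. }
assert (Nl : forall z, O z -> lam z <> RtoC 0).
{ intros z Hz E. destruct (Hall z Hz) as (Dz & Nz & Az & _). assert (NA := Cminus_neq0 _ _ Az). unfold lam in E.
  apply (Cmult_neq_0 c1 (C_derive f z)); auto.
  replace (c1 * C_derive f z) with (- (- (c1 * C_derive f z) / ((f z - A) * (f z - A))) * ((f z - A) * (f z - A))) by
    (field; auto).
  rewrite E. ring. }
assert (NE1 : forall z, O z -> C_derive Et (X z) <> RtoC 0).
{ intros z Hz E. specialize (R1 z Hz). rewrite E, Cmult_0_l in R1. apply (Cmult_neq_0 (Et (X z)) (lam z)); auto. }
assert (dlam : forall z, O z -> Cder lam z (lam z * (pre_schwarzian f z - 2 * (C_derive f z / (f z - A))))).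
{ intros z Hz. destruct (Hall z Hz) as (Dz & Nz & Az & _). assert (NA := Cminus_neq0 _ _ Az).
  assert (E := Cder_differentiable _ _ Dz). assert (E1 := Cder_differentiable _ _ (D1 z Hz)).
  unfold lam, pre_schwarzian. eapply Cder_eq. cder. apply Cmult_neq_0; auto. field. auto. }
assert (R2 : forall z, O z -> pre_schwarzian f z = pre_schwarzian Et (X z) * X1 z + - 2 / (zeta + z) +
  2 * (C_derive f z / (f z - A)) - lam z).
{ intros z Hz. destruct (Hall z Hz) as (Dz & Nz & Az & Zz & Xz & _). assert (NA := Cminus_neq0 _ _ Az).
  assert (CX : Cder X z (X1 z)) by (apply to_half_plane_Cder; auto).
  assert (CX1 : Cder X1 z (- 2 / (zeta + z) * X1 z)) by (apply to_half_plane_d_Cder; auto).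
  assert (K1 : Cder (fun z => Et (X z) * lam z) z (C_derive Et (X z) * X1 z * lam z +
    Et (X z) * (lam z * (pre_schwarzian f z - 2 * (C_derive f z / (f z - A)))))).
  { apply (Cder_mult (fun z => Et (X z)) lam). apply (Cder_comp Et X); auto. apply Cder_differentiable; auto.
    apply dlam; auto. }
  assert (K2 : Cder (fun z => Et (X z) * lam z) z (C_derive (C_derive Et) (X z) * X1 z * X1 z +
    C_derive Et (X z) * (- 2 / (zeta + z) * X1 z))).
  { apply (Loc (fun z => C_derive Et (X z) * X1 z)); auto. intros w Hw. symmetry. auto.
    apply (Cder_mult (fun z => C_derive Et (X z)) X1); auto. apply (Cder_comp (C_derive Et) X); auto.
    apply Cder_differentiable; auto. }
  assert (K := Cder_unique _ _ _ _ K1 K2). specialize (R1 z Hz). specialize (NE1 z Hz). specialize (NX z Hz).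
  set (M := C_derive f z / (f z - A)) in *. set (P := pre_schwarzian f z) in *. unfold pre_schwarzian.
  replace (Et (X z) * (lam z * (P - 2 * M))) with ((Et (X z) * lam z) * (P - 2 * M)) in K by ring. rewrite R1 in K.
  replace P with ((C_derive Et (X z) * X1 z * lam z +
    C_derive Et (X z) * X1 z * (P - 2 * M)) / (C_derive Et (X z) * X1 z) + 2 * M - lam z) by (field; auto).
  rewrite K. field. auto. }
intros z Hz. splits; auto.
destruct (Hall z Hz) as (Dz & Nz & Az & Zz & Xz & _). assert (NA := Cminus_neq0 _ _ Az).
assert (CX : Cder X z (X1 z)) by (apply to_half_plane_Cder; auto).
assert (CX1 : Cder X1 z (- 2 / (zeta + z) * X1 z)) by (apply to_half_plane_d_Cder; auto).
assert (CP := pre_schwarzian_Cder D Et (X z) HD DE Xz (NE1 z Hz)).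
set (Sg := schwarzian Et (X z)) in *. set (q := pre_schwarzian Et (X z)) in *.
assert (CM : Cder (fun z => C_derive f z / (f z - A)) z (C_derive f z / (f z - A) * (pre_schwarzian f z - C_derive f z
  / (f z - A)))).
{ assert (E := Cder_differentiable _ _ Dz). assert (E1 := Cder_differentiable _ _ (D1 z Hz)). unfold pre_schwarzian.
  eapply Cder_eq. cder. auto. field. auto. }
assert (CB : Cder (fun z => - 2 / (zeta + z)) z (2 / ((zeta + z) * (zeta + z)))).
{ eapply Cder_eq. cder. auto. field. auto. }
assert (CT : Cder (pre_schwarzian f) z ((Sg + / 2 * (q * q)) * X1 z * X1 z + q * (- 2 / (zeta + z) * X1 z) +
2 / ((zeta + z) * (zeta + z))
   + 2 * (C_derive f z / (f z - A) * (pre_schwarzian f z - C_derive f z / (f z - A)))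
     - lam z * (pre_schwarzian f z - 2 * (C_derive f z / (f z - A))))).
{ apply (Loc (fun z => pre_schwarzian Et (X z) * X1 z + - 2 / (zeta + z) + 2 * (C_derive f z / (f z - A)) - lam z));
  auto.
  intros w Hw; symmetry; auto.
  apply (Cder_minus (fun z => pre_schwarzian Et (X z) * X1 z + - 2 / (zeta + z) + 2 * (C_derive f z / (f z - A))) lam);
    auto.
  apply (Cder_plus (fun z => pre_schwarzian Et (X z) * X1 z + - 2 / (zeta + z))
    (fun z => 2 * (C_derive f z / (f z - A)))).
  2: apply (Cder_scal 2 (fun z => C_derive f z / (f z - A))); auto.
  apply (Cder_plus (fun z => pre_schwarzian Et (X z) * X1 z) (fun z => - 2 / (zeta + z))); auto.
  apply (Cder_mult (fun z => pre_schwarzian Et (X z)) X1); auto. apply (Cder_comp (pre_schwarzian Et) X); auto. }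
rewrite (schwarzian_eq _ _ _ CT).
assert (EL : C_derive Et (X z) / Et (X z) * X1 z = lam z).
{ specialize (R1 z Hz). specialize (NE z Hz).
  replace (C_derive Et (X z) / Et (X z) * X1 z) with ((C_derive Et (X z) * X1 z) / Et (X z)) by (field; auto).
  rewrite <- R1. field. auto. }
set (M := C_derive f z / (f z - A)) in *. set (LE := C_derive Et (X z) / Et (X z)) in *.
rewrite (R2 z Hz). fold q. rewrite <- EL. fold M. field. auto.
Qed.

Lemma openC_neq0 (D : C -> Prop) h : openC D -> (forall z, D z -> C_differentiable h z) -> openC (fun z => D z /\
  h z <> RtoC 0).
Proof.
intros HO Hh z [Dz Nz]. destruct (HO z Dz) as [d1 [Hd1 H1]].
destruct (Cder_continuous_eps _ _ _ (Cder_differentiable _ _ (Hh z Dz)) _ (proj1 (Cmod_gt_0 _) Nz)) as [d2 [Hd2 H2]].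
exists (Rmin d1 d2). split. apply Rmin_pos; auto. intros w Hw. split. apply H1.
eapply Rlt_le_trans; [exact Hw|apply Rmin_l].
intros E. specialize (H2 w (Rlt_le_trans _ _ _ Hw (Rmin_r _ _))). rewrite E in H2.
replace (0 - h z) with (- h z) in H2 by ring. rewrite Cmod_opp in H2. lra.
Qed.

Lemma pre_schwarzian_differentiable (D : C -> Prop) f : openC D -> (forall z, D z -> C_differentiable f z) ->
  (forall z, D z -> C_derive f z <> RtoC 0) -> forall z, D z -> C_differentiable (pre_schwarzian f) z.
Proof. intros HO Hf Hn z Hz. eapply Cder_is_differentiable. apply (pre_schwarzian_Cder D); auto. Qed.

Lemma schwarzian_differentiable (D : C -> Prop) f : openC D -> (forall z, D z -> C_differentiable f z) ->
  (forall z, D z -> C_derive f z <> RtoC 0) -> forall z, D z -> C_differentiable (schwarzian f) z.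
Proof.
intros HO Hf Hn z Hz. assert (H := pre_schwarzian_differentiable D f HO Hf Hn).
assert (X := Cder_differentiable _ _ (C_derive_differentiable D _ HO H z Hz)).
assert (Y := Cder_differentiable _ _ (H z Hz)).
eapply Cder_is_differentiable.
apply (Cder_ext_loc (fun z => C_derive (pre_schwarzian f) z - / 2 * (pre_schwarzian f z * pre_schwarzian f z))).
- destruct (HO z Hz) as [d [Hd HH]]. exists d. split; auto. intros w Hw. symmetry. apply schwarzian_eq.
  apply Cder_differentiable, H, HH; auto.
- cder.
Qed.

Lemma Cconj_neq0 z : z <> RtoC 0 -> Cconj z <> RtoC 0.
Proof. intros H E. apply H. apply (f_equal Cmod) in E. rewrite Cmod_conj, Cmod_0 in E. apply Cmod_eq_0; auto. Qed.

Lemma C_derive_conj_sym (D : C -> Prop) f : openC D -> (forall z, D z -> C_differentiable f z) ->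
  (forall z, D z -> f (Cconj z) = Cconj (f z)) -> forall z, D z -> C_derive f (Cconj z) = Cconj (C_derive f z).
Proof.
intros HO Hf Hs z Hz. apply Cder_C_derive, C_derive_conj; auto. destruct (HO z Hz) as [d [Hd H]]. exists d; split; auto.
Qed.

Lemma pre_schwarzian_conj_sym (D : C -> Prop) f : openC D -> (forall z, D z -> C_differentiable f z) ->
  (forall z, D z -> C_derive f z <> RtoC 0) -> (forall z, D z -> f (Cconj z) = Cconj (f z)) ->
  forall z, D z -> pre_schwarzian f (Cconj z) = Cconj (pre_schwarzian f z).
Proof.
intros HO Hf Hn Hs z Hz. assert (S1 := C_derive_conj_sym D f HO Hf Hs).
assert (D1 := C_derive_differentiable D f HO Hf).
unfold pre_schwarzian. rewrite (S1 z Hz), (C_derive_conj_sym D _ HO D1 S1 z Hz), Cdiv_conj; auto.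
Qed.

Lemma schwarzian_conj_sym (D : C -> Prop) f : openC D -> (forall z, D z -> C_differentiable f z) ->
  (forall z, D z -> C_derive f z <> RtoC 0) -> (forall z, D z -> f (Cconj z) = Cconj (f z)) ->
  forall z, D z -> schwarzian f (Cconj z) = Cconj (schwarzian f z).
Proof.
intros HO Hf Hn Hs z Hz. assert (S1 := pre_schwarzian_conj_sym D f HO Hf Hn Hs).
assert (D1 := pre_schwarzian_differentiable D f HO Hf Hn).
rewrite (schwarzian_eq f z (C_derive (pre_schwarzian f) z)) by (apply Cder_differentiable; auto).
rewrite (schwarzian_eq f (Cconj z) (Cconj (C_derive (pre_schwarzian f) z))).
- rewrite (S1 z Hz), Cminus_conj, !Cmult_conj. f_equal. f_equal. apply injective_projections; simpl; field.
- apply C_derive_conj; auto. destruct (HO z Hz) as [d [Hd H]]. exists d; split; auto.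
Qed.

(* The Schwarzian with its double poles at the prevertices removed, times the denominator
   of the last term; here [u = e^(2 i beta)]. *)
Definition reduced_schwarzian (f : C -> C) (u z : C) : C :=
  (/ 2 * schwarzian f z - u / ((z * z - u) * (z * z - u)) - Cconj u / ((z * z - Cconj u) * (z * z - Cconj u)))
  * ((z * z - u) * (z * z - Cconj u)).

Lemma square_neq_unit u z : Cmod u = 1%R -> unit_disk z -> z * z - u <> RtoC 0.
Proof.
intros Hu Hz E. assert (z * z = u) by (replace u with (z * z - (z * z - u)) by ring; rewrite E; ring).
apply (f_equal Cmod) in H. rewrite Cmod_mult, Hu in H. unfold unit_disk in Hz. assert (P := Cmod_ge_0 z). nra.
Qed.

Lemma unit_conj_inv u : Cmod u = 1%R -> Cconj u = / u.
Proof.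
intros H. assert (N : u <> RtoC 0) by (apply Cmod_gt_0; lra). assert (E := Cmod2_conj u). rewrite H in E.
replace (1 ^ 2)%R with 1%R in E by ring.
replace (Cconj u) with ((u * Cconj u) / u) by (field; auto). rewrite <- E. field. auto.
Qed.

Lemma climit_unit_eps h zeta l : climit (within unit_disk (locally (T:=C_UniformSpace) zeta)) h l ->
  forall e, (0 < e)%R -> exists d, (0 < d)%R /\ forall z, unit_disk z -> Cmod (z - zeta) < d -> Cmod (h z - l) < e.
Proof. intros H e He. specialize (H e He). apply locally_C_iff in H. destruct H as [d [Hd H]]. exists d; split; auto.
Qed.

Section Climit_unit.
Variable zeta : C.
Notation F := (within unit_disk (locally (T:=C_UniformSpace) zeta)).
Global Instance within_disk_filter : Filter F.
Proof. apply within_filter, locally_filter. Qed.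

Lemma climit_unit_id : climit F (fun z => z) zeta.
Proof. intros e He. apply locally_C_iff. exists e; auto. Qed.

Lemma climit_unit_Ccont h : Ccont h zeta -> climit F h (h zeta).
Proof. intros H. apply (climit_comp F h (fun z => z) zeta); auto. apply climit_unit_id. Qed.

Lemma climit_div h k l m : m <> RtoC 0 -> climit F h l -> climit F k m -> climit F (fun z => h z / k z) (l / m).
Proof. intros Hm H1 H2. apply climit_mult; auto. apply within_disk_filter. apply climit_inv; auto.
apply within_disk_filter. Qed.
End Climit_unit.

Ltac climit := first [eassumption | lazymatch goal with
  | |- climit _ (fun z => z) _ => apply climit_unit_id
  | |- climit ?F (fun _ => ?a) _ => apply (climit_const F a)
  | |- climit ?F (fun w => @?f w + @?g w) _ => eapply (climit_plus F f g); climit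
  | |- climit ?F (fun w => @?f w - @?g w) _ => eapply (climit_minus F f g); climit
  | |- climit ?F (fun w => @?f w * @?g w) _ => eapply (climit_mult F f g); climit
  | |- climit _ (fun w => @?f w / @?g w) _ => eapply (climit_div _ f g); [repeat apply Cmult_neq_0;
  assumption|climit|climit]
  end].

Lemma disk0_openC R0 : openC (fun z => Cmod z < R0).
Proof. intros u Hu. exists (R0 - Cmod u)%R. split. lra. intros w Hw. assert (T := Cmod_triangle (w - u) u).
replace (w - u + u) with w in T by ring. lra. Qed.

Lemma real_div a b : b <> RtoC 0 -> Cconj a = a -> Cconj b = b -> Cconj (a / b) = a / b.
Proof. intros H Ha Hb. rewrite Cdiv_conj, Ha, Hb; auto. Qed.

Lemma conj_half : Cconj (/ 2) = / 2.
Proof. apply injective_projections; simpl; field. Qed.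

(** It is enough that the reduced Schwarzian has a real limit at each [zeta]. The limit is found
    through the continuation [Et] in the half-plane coordinate, whose value, derivative and
    Schwarzian at [0] are real by reflection symmetry. *)
Theorem reduced_schwarzian_boundary t s r1 r2 beta f : tangent_circles t s r1 r2 -> (0 < beta < PI / 2)%R ->
  conformal_map unit_disk (quadrilateral t s r1 r2) f ->
  (forall z, unit_disk z -> f (Cconj z) = Cconj (f z)) -> (forall z, unit_disk z -> f (- z) = - f z) ->
  (Im (C_derive f 0) = 0%R /\ (0 < Re (C_derive f 0))%R) -> blim f (cis beta) (apex t s r1 r2) ->
  forall zeta, Cmod zeta = 1%R -> (0 <= Re zeta)%R -> (0 <= Im zeta)%R ->
  forall e, (0 < e)%R -> exists d, (0 < d)%R /\
    forall z, unit_disk z -> Cmod (z - zeta) < d -> (Rabs (Im (reduced_schwarzian f (cis (2 * beta)) z)) < e)%R.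
Proof.
intros HT Hbeta Hf Hconj Hodd Hpos Hlim zeta Hz HR HI.
set (F := within unit_disk (locally (T:=C_UniformSpace) zeta)). assert (FF : Filter F) by apply within_disk_filter.
set (u := cis (2 * beta)). assert (Hu : Cmod u = 1%R) by apply Cmod_cis. assert (Nu : u <> RtoC 0) by apply cis_neq0.
assert (Ea : u = cis beta * cis beta). { unfold u. rewrite <- cis_plus. f_equal. ring. }
assert (Hcu : Cmod (Cconj u) = 1%R) by (rewrite Cmod_conj; auto).
assert (Nz : zeta <> RtoC 0) by (apply Cmod_gt_0; lra).
cut (exists l, Cconj l = l /\ climit F (reduced_schwarzian f u) l).
{ intros [l [Rl Hl]] e He. destruct (climit_unit_eps _ _ _ Hl e He) as [d [Hd H]]. exists d. split; auto.
  intros z Uz Hzz. specialize (H z Uz Hzz).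
  apply real_of_conj in Rl. assert (B := im_le_Cmod (reduced_schwarzian f u z - l)).
  rewrite Im_minus, Rl, Rminus_0_r in B. lra. }
destruct (boundary_correspondence t s r1 r2 beta f HT Hbeta Hf Hconj Hodd Hpos Hlim zeta Hz HR HI) as [w0 [W1 [W2 [W3
  [W4 [W5 W6]]]]]].
destruct (cusp_reflection t s r1 r2 HT f Hf zeta w0 Hz W1 W2 W3 W4) as (R0 & Et & HR0 & DE & E1 & E2 & E3 & E4 & E5).
set (X := to_half_plane zeta). set (X1 := to_half_plane_d zeta).
assert (Nzz : zeta + zeta <> RtoC 0). { replace (zeta + zeta) with (2 * zeta) by ring. apply Cmult_neq_0; auto.
  apply two_neq0. }
assert (X0 : X zeta = 0). { unfold X, to_half_plane. field. auto. }
set (D := fun xi : C => Cmod xi < R0). assert (OD : openC D) by apply disk0_openC.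
assert (D0 : D 0) by (unfold D; rewrite Cmod_0; lra).
set (O := fun z => unit_disk z /\ D (X z)).
assert (OO : openC O).
{ intros z [Uz Dz]. destruct (unit_disk_openC z Uz) as [d1 [Hd1 H1]]. unfold D in Dz.
  destruct (Cder_continuous_eps _ _ _ (to_half_plane_Cder zeta z (circle_plus_neq0 zeta z Hz Uz))
    (R0 - Cmod (X z))%R ltac:(lra)) as [d2 [Hd2 H2]].
  exists (Rmin d1 d2). split. apply Rmin_pos; auto. intros w Hw. split. apply H1.
  eapply Rlt_le_trans; [exact Hw|apply Rmin_l].
  specialize (H2 w (Rlt_le_trans _ _ _ Hw (Rmin_r _ _))). fold X in H2. unfold D.
  assert (T := Cmod_triangle (X w - X z) (X z)). replace (X w - X z + X z) with (X w) in T by ring. lra. }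
assert (HS := schwarzian_cusp O D f Et (apex t s r1 r2) (cusp_c1 t s r1 r2) (cusp_c2 r1 r2) zeta OO OD).
assert (Hyp : forall z, O z -> C_differentiable f z /\ C_derive f z <> RtoC 0 /\ f z <> apex t s r1 r2 /\
zeta + z <> RtoC 0 /\ D (to_half_plane zeta z) /\
     Cexp (cusp_c1 t s r1 r2 / (f z - apex t s r1 r2) + cusp_c2 r1 r2) = Et (to_half_plane zeta z)).
{ intros z [Uz Dz]. splits; auto.
  - apply (f_hol t s r1 r2); auto.
  - apply (f_derive_neq0 t s r1 r2); auto.
  - apply quadrilateral_neq_apex; auto. apply (f_in t s r1 r2); auto.
  - apply circle_plus_neq0; auto.
  - rewrite E1. rewrite from_to_half_plane by auto. reflexivity. split; auto.
    assert (H := to_half_plane_im zeta z Hz Uz). lra. }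
specialize (HS Hyp DE (cusp_c1_neq0 t s r1 r2 HT) Nz). fold X X1 in HS.
assert (LX : climit F X 0). { rewrite <- X0. apply climit_unit_Ccont. eapply Cder_Ccont, to_half_plane_Cder; auto. }
assert (LX1 : climit F X1 (X1 zeta)). { apply climit_unit_Ccont. eapply Cder_Ccont, to_half_plane_d_Cder; auto. }
assert (LC : forall h, C_differentiable h 0 -> climit F (fun z => h (X z)) (h 0)).
{ intros h Hh. apply (climit_comp F h X (RtoC 0)); auto. eapply Cder_Ccont, Cder_differentiable, Hh. }
assert (InO : F O).
{ specialize (LX R0 ltac:(lra)). revert LX. unfold F, within. apply filter_imp. intros z Hzz Uz. split; auto. unfold D.
  specialize (Hzz Uz).
  replace (X z - 0) with (X z) in Hzz by ring. auto. }
assert (DE1 := C_derive_differentiable D Et OD DE). assert (DE2 := C_derive_differentiable D _ OD DE1).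
(* The Schwarzian of [Et] is controlled only where the derivative of [Et] does not vanish, which
   [cusp_reflection] ensures at [0]. *)
set (D' := fun xi => D xi /\ C_derive Et xi <> RtoC 0). assert (OD' : openC D') by (apply openC_neq0; auto).
assert (D'0 : D' 0) by (split; auto).
assert (DS : C_differentiable (schwarzian Et) 0). { apply (schwarzian_differentiable D'); auto. intros xi [H _]; auto.
  intros xi [_ H]; auto. }
assert (C0 : Cconj 0 = 0) by (apply injective_projections; simpl; ring).
assert (RS : Cconj (schwarzian Et 0) = schwarzian Et 0).
{ rewrite <- (schwarzian_conj_sym D' Et OD'), C0; auto. intros xi [H _]; auto. intros xi [_ H]; auto.
  intros xi [H _]; auto. }
assert (RE1 : Cconj (C_derive Et 0) = C_derive Et 0). { rewrite <- (C_derive_conj_sym D Et OD DE E2), C0; auto. }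
assert (RE0 : Cconj (Et 0) = Et 0). { rewrite <- E2, C0; auto. }
assert (EX1 : X1 zeta = - Ci / (2 * zeta)). { unfold X1, to_half_plane_d. field. splits; auto. }
assert (EX2 : X1 zeta * X1 zeta = - / (4 * (zeta * zeta))).
{ rewrite EX1.
  replace (- Ci / (2 * zeta) * (- Ci / (2 * zeta))) with ((Ci * Ci) / (4 * (zeta * zeta))) by (field; auto).
  replace (Ci * Ci) with (- (RtoC 1)) by (apply injective_projections; simpl; ring). field. auto. }
assert (CI' : Cconj Ci = - Ci) by (apply injective_projections; simpl; ring).
assert (Ecu := unit_conj_inv u Hu). assert (Ecz := unit_conj_inv zeta Hz).
destruct (classic (zeta = cis beta)) as [Eb|Nb].
(* At the prevertex [Et xi = xi * h xi] with [h 0 <> 0], so [Et' / Et = 1 / xi + h' / h]. Since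
   [X1 = X * (2 * zeta / (z * z - u))], the term [X1 ^ 2 / (4 * X ^ 2)] equals
   [u / (z * z - u) ^ 2], exactly the double pole removed; the cross term loses its simple pole to
   the factor [z * z - u]. *)
- specialize (E4 (W5 Eb)). assert (Eu : u = zeta * zeta) by (rewrite Ea, Eb; auto).
  set (h := diff_quot Et 0).
  assert (Dh : forall xi, D xi -> C_differentiable h xi) by (intros; apply (diff_quot_differentiable D); auto).
  assert (h0 : h 0 = C_derive Et 0) by (apply diff_quot_diag).
  assert (Eh : forall xi, Et xi = xi * h xi). { intros xi. assert (Q := diff_quot_mult Et 0 xi). rewrite E4 in Q.
    fold h in Q. replace (xi - 0) with xi in Q by ring. rewrite Q. ring. }
  assert (Sh : forall xi, D xi -> h (Cconj xi) = Cconj (h xi)).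
  { intros xi Hxi. destruct (classic (xi = 0)) as [->|Hx0]. rewrite C0, h0. auto.
    assert (Hc0 : Cconj xi <> RtoC 0) by (apply Cconj_neq0; auto).
    replace (h (Cconj xi)) with (Et (Cconj xi) / Cconj xi). 2:{ rewrite Eh. field. auto. }
    rewrite E2, (Eh xi), Cmult_conj by auto. field. auto. }
  assert (Dh1 := C_derive_differentiable D h OD Dh).
  assert (Rh1 : Cconj (C_derive h 0) = C_derive h 0). { rewrite <- (C_derive_conj_sym D h OD Dh Sh), C0; auto. }
  assert (Nh : h 0 <> RtoC 0) by (rewrite h0; auto).
  set (rr := C_derive h 0 / h 0). assert (Rr : Cconj rr = rr). { apply real_div; auto. rewrite h0; auto. }
  (* Only the cross term survives in the limit. It is real because [u - Cconj u] and
     [zeta * X1 zeta = - i / 2] are both imaginary and [rr] is real. *)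
  exists ((u - Cconj u) * (zeta * (X1 zeta * rr))). split.
  + rewrite EX1, !Cmult_conj, Cminus_conj, Cconj_conj, Rr.
    rewrite Cdiv_conj by (apply Cmult_neq_0; auto; apply two_neq0). rewrite Copp_conj, CI', Cmult_conj, Ecz.
    replace (Cconj 2) with (RtoC 2) by (apply injective_projections; simpl; ring). field. auto.
  + apply (climit_ext F (fun z => (z * z - u) * (z * z - Cconj u) * (/ 2 * (X1 z * X1 z) * (schwarzian Et (X z) +
    / 2 * ((C_derive h (X z) / h (X z)) * (C_derive h (X z) / h (X z)))))
       + (z * z - Cconj u) * (zeta * (X1 z * (C_derive h (X z) / h (X z))))
         - Cconj u * (z * z - u) / (z * z - Cconj u))).
    * revert InO. apply filter_imp. intros z Oz. destruct (HS z Oz) as [K1 [K2 K3]]. destruct Oz as [Uz Dz].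
      assert (Nx : X z <> RtoC 0). { intros E. assert (H := to_half_plane_im zeta z Hz Uz). fold X in H. rewrite E in H.
        simpl in H. lra. }
      assert (Nhz : h (X z) <> RtoC 0). { intros E. apply K1. rewrite Eh, E. ring. }
      assert (EE1 : C_derive Et (X z) = h (X z) + X z * C_derive h (X z)).
      { apply Cder_C_derive. apply (Cder_ext_loc (fun xi => xi * h xi)). exists 1%R. split. lra. intros; symmetry; auto.
        assert (H := Cder_differentiable _ _ (Dh _ Dz)). eapply Cder_eq. cder. ring. }
      unfold reduced_schwarzian. rewrite K3, EE1, (Eh (X z)).
      assert (M1 := square_neq_unit u z Hu Uz). assert (M2 := square_neq_unit _ z Hcu Uz).
      assert (Np : zeta + z <> RtoC 0) by (apply circle_plus_neq0; auto).
      assert (Kx : X1 z = X z * (2 * zeta / (z * z - u))).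
      { unfold X1, X, to_half_plane, to_half_plane_d. rewrite Eu in *. field. splits; auto. }
      rewrite Kx. set (w := C_derive h (X z)). set (S := schwarzian Et (X z)). rewrite Eu in *. field. splits; auto.
    * assert (L1 := LC h (Dh 0 D0)). assert (L2 := LC _ (Dh1 0 D0)). assert (L3 := LC _ DS).
      assert (LL : climit F (fun z => (z * z - u) * (z * z - Cconj u) * (/ 2 * (X1 z * X1 z) * (schwarzian Et (X z) +
      / 2 * ((C_derive h (X z) / h (X z)) * (C_derive h (X z) / h (X z)))))
       + (z * z - Cconj u) * (zeta * (X1 z * (C_derive h (X z) / h (X z)))) - Cconj u * (z * z - u) / (z * z - Cconj u))
       ((zeta * zeta - u) * (zeta * zeta - Cconj u) * (/ 2 * (X1 zeta * X1 zeta) * (schwarzian Et 0 + / 2 * (rr * rr)))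
       + (zeta * zeta - Cconj u) * (zeta * (X1 zeta * rr)) - Cconj u * (zeta * zeta - u) / (zeta * zeta - Cconj u))).
      { assert (Lr : climit F (fun z => C_derive h (X z) / h (X z)) rr) by (apply climit_div; auto).
        assert (Lz : climit F (fun z => z * z) (zeta * zeta)) by climit.
        assert (N2 : zeta * zeta - Cconj u <> RtoC 0).
        { rewrite <- Eu. intros E. apply (f_equal Im) in E. rewrite Im_minus, im_conj in E. unfold u, cis in E.
          simpl in E. assert (0 < sin (2 * beta))%R by (apply sin_gt_0; lra). lra. }
        assert (La : climit F (fun z => z * z - u) (zeta * zeta - u)) by (apply climit_minus; auto; apply climit_const;
          auto).
        assert (Lb : climit F (fun z => z * z - Cconj u) (zeta * zeta - Cconj u)) by (apply climit_minus; auto;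
          apply climit_const; auto).
        climit. }
      match type of LL with climit _ _ ?a => replace ((u - Cconj u) * (zeta * (X1 zeta * rr))) with a; [exact LL|] end.
      rewrite <- Eu. unfold Cdiv. ring.
- specialize (E5 (W6 Nb)).
  assert (Hc : (0 < cos beta)%R) by (apply cos_gt_0; lra). assert (Hs : (0 < sin beta)%R) by (apply sin_gt_0; lra).
  assert (N1 : zeta * zeta - u <> RtoC 0).
  { rewrite Ea. replace (zeta * zeta - cis beta * cis beta) with ((zeta - cis beta) * (zeta - - cis beta)) by ring.
    apply Cmult_neq_0; apply Cminus_neq0; auto.
    intros E. rewrite E in HR. simpl in HR. lra. }
  assert (N2 : zeta * zeta - Cconj u <> RtoC 0).
  { rewrite Ea, Cmult_conj.
    replace (zeta * zeta - Cconj (cis beta) * Cconj (cis beta)) with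
      ((zeta - Cconj (cis beta)) * (zeta - - Cconj (cis beta))) by ring.
    apply Cmult_neq_0; apply Cminus_neq0; intros E.
    rewrite E in HI. simpl in HI. lra. rewrite E in HR. simpl in HR. lra. }
  set (rho := schwarzian Et 0 + / 2 * ((C_derive Et 0 / Et 0) * (C_derive Et 0 / Et 0))).
  assert (Rrho : Cconj rho = rho). { unfold rho. assert (K := real_div _ _ E5 RE1 RE0).
    rewrite Cplus_conj, !Cmult_conj, K, RS, conj_half. auto. }
  exists ((/ 2 * (X1 zeta * X1 zeta * rho) - u / ((zeta * zeta - u) * (zeta * zeta - u))
    - Cconj u / ((zeta * zeta - Cconj u) * (zeta * zeta - Cconj u))) * ((zeta * zeta - u) * (zeta * zeta - Cconj u))).
  split.
  (* On the unit circle conjugation is inversion, so that reality of the limit is an identity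
     between rational functions of [zeta] and [u], with [rho] real. *)
  + rewrite EX2, Ecu in *. rewrite Cmult_conj, !Cminus_conj.
    assert (N3 : u - zeta * zeta <> RtoC 0). { intros E. apply N1.
      replace (zeta * zeta - u) with (- (u - zeta * zeta)) by ring. rewrite E; ring. }
    assert (N4 : u * (zeta * zeta) - 1 <> RtoC 0). { intros E. apply N2.
      replace (zeta * zeta - / u) with ((u * (zeta * zeta) - 1) / u) by (field; auto). rewrite E. unfold Cdiv; ring. }
    assert (N5 : 1 - u * (zeta * zeta) <> RtoC 0). { intros E. apply N4.
      replace (u * (zeta * zeta) - 1) with (- (1 - u * (zeta * zeta))) by ring. rewrite E; ring. }
    assert (M1 : / zeta * / zeta - / u <> RtoC 0).
    { replace (/ zeta * / zeta - / u) with ((u - zeta * zeta) * / (zeta * zeta * u)) by (field; auto).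
      apply Cmult_neq_0; auto. intros E. apply (f_equal Cmod) in E. rewrite Cmod_inv, !Cmod_mult, Hu, Hz, Cmod_0 in E.
      lra. repeat apply Cmult_neq_0; auto. }
    assert (M2 : / zeta * / zeta - u <> RtoC 0).
    { replace (/ zeta * / zeta - u) with ((1 - u * (zeta * zeta)) * / (zeta * zeta)) by (field; auto).
      apply Cmult_neq_0; auto. intros E. apply (f_equal Cmod) in E. rewrite Cmod_inv, !Cmod_mult, Hz, Cmod_0 in E. lra.
      repeat apply Cmult_neq_0; auto. }
    assert (Eiu : Cconj (/ u) = u). { rewrite <- Ecu. apply Cconj_conj. }
    assert (Ezz : Cconj (zeta * zeta) = / zeta * / zeta) by (rewrite Cmult_conj, Ecz; auto).
    assert (T1 : Cconj (u / ((zeta * zeta - u) * (zeta * zeta - u))) =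
      / u / ((/ zeta * / zeta - / u) * (/ zeta * / zeta - / u))).
    { rewrite Cdiv_conj by (apply Cmult_neq_0; auto). rewrite Cmult_conj, Cminus_conj, Ezz, Ecu. auto. }
    assert (T2 : Cconj (/ u / ((zeta * zeta - / u) * (zeta * zeta - / u))) =
      u / ((/ zeta * / zeta - u) * (/ zeta * / zeta - u))).
    { rewrite Cdiv_conj by (apply Cmult_neq_0; auto). rewrite Cmult_conj, Cminus_conj, Ezz, Eiu. auto. }
    assert (T0 : Cconj (/ 2 * (- / (4 * (zeta * zeta)) * rho)) = / 2 * (- / (4 * (/ zeta * / zeta)) * rho)).
    { rewrite !Cmult_conj, Rrho, conj_half, Copp_conj, Cinv_conj, Cmult_conj, Ezz.
      replace (Cconj 4) with (RtoC 4) by (apply injective_projections; simpl; ring). auto.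
      repeat apply Cmult_neq_0; auto. intros E; apply (f_equal fst) in E; simpl in E; lra. }
    rewrite T0, T1, T2. rewrite Cmult_conj, !Cminus_conj, Ezz, Ecu, Eiu.
    field.
    splits; auto; intros E; first [apply N1; rewrite <- E; ring | apply N3; rewrite <- E; ring | apply N4;
      rewrite <- E; ring | apply N5; rewrite <- E; ring].
  + apply (climit_ext F (fun z => (/ 2 * (X1 z * X1 z * (schwarzian Et (X z) +
    / 2 * ((C_derive Et (X z) / Et (X z)) * (C_derive Et (X z) / Et (X z))))) - u / ((z * z - u) * (z * z - u))
      - Cconj u / ((z * z - Cconj u) * (z * z - Cconj u))) * ((z * z - u) * (z * z - Cconj u)))).
    * revert InO. apply filter_imp. intros z Oz. destruct (HS z Oz) as [_ [_ K3]]. unfold reduced_schwarzian.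
      rewrite K3. auto.
    * assert (L1 := LC _ (DE 0 D0)). assert (L2 := LC _ (DE1 0 D0)). assert (L3 := LC _ DS).
      assert (Lr : climit F (fun z => C_derive Et (X z) / Et (X z)) (C_derive Et 0 / Et 0)) by (apply climit_div; auto).
      assert (Lz : climit F (fun z => z * z) (zeta * zeta)) by climit.
      assert (La : climit F (fun z => z * z - u) (zeta * zeta - u)) by (apply climit_minus; auto; apply climit_const;
        auto).
      assert (Lb : climit F (fun z => z * z - Cconj u) (zeta * zeta - Cconj u)) by (apply climit_minus; auto;
        apply climit_const; auto).
      unfold rho. climit.
Qed.

(** * Odd symmetry, and functions that are real at the boundary *)

Lemma Cder_reflect f z l : Cder f (- z) l -> Cder (fun w => f (- w)) z (- l).
Proof. intros H. eapply Cder_eq. apply (Cder_comp f (fun w => - w)). exact H. cder. ring. Qed.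

Lemma C_derive_odd (D : C -> Prop) f sg : openC D -> (forall z, D z -> D (- z)) -> (forall z, D z ->
  C_differentiable f z) ->
  (forall z, D z -> f (- z) = sg * f z) -> forall z, D z -> C_derive f (- z) = - sg * C_derive f z.
Proof.
intros HO HD Hf Hs z Hz.
assert (K1 : Cder (fun w => f (- w)) z (- C_derive f (- z))) by (apply Cder_reflect, Cder_differentiable; auto).
assert (K2 : Cder (fun w => f (- w)) z (sg * C_derive f z)).
{ apply (Cder_ext_loc (fun w => sg * f w)). destruct (HO z Hz) as [d [Hd H]]. exists d. split; auto. intros w Hw.
  symmetry. auto.
  apply Cder_scal, Cder_differentiable; auto. }
assert (E := Cder_unique _ _ _ _ K1 K2). replace (C_derive f (- z)) with (- - C_derive f (- z)) by ring. rewrite E.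
ring.
Qed.

Lemma schwarzian_odd (D : C -> Prop) f : openC D -> (forall z, D z -> D (- z)) -> (forall z, D z ->
  C_differentiable f z) ->
  (forall z, D z -> C_derive f z <> RtoC 0) -> (forall z, D z -> f (- z) = - f z) ->
  forall z, D z -> schwarzian f (- z) = schwarzian f z.
Proof.
intros HO HD Hf Hn Hs z Hz.
assert (D1 := C_derive_differentiable D f HO Hf). assert (D2 := pre_schwarzian_differentiable D f HO Hf Hn).
assert (S1 := C_derive_odd D f (- 1) HO HD Hf). assert (S1' : forall z, D z -> C_derive f (- z) = 1 * C_derive f z).
{ intros w Hw. rewrite S1; auto. ring. intros v Hv. rewrite Hs by auto. ring. }
assert (S2 := C_derive_odd D _ 1 HO HD D1 S1').
assert (S3 : forall z, D z -> pre_schwarzian f (- z) = (- 1) * pre_schwarzian f z).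
{ intros w Hw. unfold pre_schwarzian. rewrite S2, S1' by auto. field. auto. }
assert (S4 := C_derive_odd D _ (- 1) HO HD D2 S3).
rewrite (schwarzian_eq f (- z) _ (Cder_differentiable _ _ (D2 _ (HD z Hz)))), (schwarzian_eq f z _ (Cder_differentiable
  _ _ (D2 z Hz))).
rewrite S4, S3 by auto. ring.
Qed.

(** The increments of [h] in the directions [1] and [i] are real, so both [l] and [i l] have
    imaginary part zero and the derivative [l] vanishes. *)
Lemma real_valued_const (h : C -> C) : (forall z, unit_disk z -> C_differentiable h z) -> (forall z, unit_disk z ->
  Im (h z) = 0%R) ->
  forall z, unit_disk z -> h z = h 0.
Proof.
intros Hh HI z Hz. apply (C_derive_zero_const unit_disk); auto using unit_disk_convex, unit_disk_0.
clear z Hz. intros z Hz. assert (Dz := Cder_differentiable _ _ (Hh z Hz)). set (l := C_derive h z) in *.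
destruct (unit_disk_openC z Hz) as [d1 [Hd1 H1]].
assert (Key : forall e, (0 < e)%R -> (Rabs (Im l) <= e)%R /\ (Rabs (Re l) <= e)%R).
{ intros e He. destruct (proj1 (Cder_eps _ _ _) Dz e He) as [d2 [Hd2 H2]].
  set (y := (Rmin d1 d2 / 2)%R). assert (M1 := Rmin_l d1 d2). assert (M2 := Rmin_r d1 d2).
  assert (M0 : (0 < Rmin d1 d2)%R) by (apply Rmin_pos; auto).
  assert (Hy : (0 < y)%R) by (unfold y; lra).
  assert (Step : forall v, Cmod v = y -> (Rabs (Im (l * v)) <= e * y)%R).
  { intros v Hv. assert (Ev : z + v - z = v) by ring. specialize (H2 (z + v)). rewrite Ev, Hv in H2.
    specialize (H2 ltac:(unfold y; lra)).
    assert (U : unit_disk (z + v)). { apply H1. rewrite Ev, Hv. unfold y; lra. }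
    assert (B := im_le_Cmod (h (z + v) - h z - l * v)). rewrite !Im_minus, !HI in B by auto.
    replace (0 - 0 - Im (l * v))%R with (- Im (l * v))%R in B by ring. rewrite Rabs_Ropp in B. lra. }
  split; apply Rmult_le_reg_r with y; auto.
  - specialize (Step (RtoC y)). rewrite Cmod_RtoC_pos in Step by lra. specialize (Step eq_refl).
    rewrite im_scal_r, Rabs_mult, (Rabs_right y) in Step by lra. auto.
  - specialize (Step (Ci * RtoC y)). rewrite Cmod_mult, Cmod_Ci, Cmod_RtoC_pos in Step by lra.
    specialize (Step ltac:(ring)).
    replace (Im (l * (Ci * RtoC y))) with (Re l * y)%R in Step by (destruct l; simpl; ring).
    rewrite Rabs_mult, (Rabs_right y) in Step by lra. auto. }
assert (E1 : (Rabs (Im l) <= 0)%R). { apply Rle_all_eps with (c := 1%R). lra. intros e He. destruct (Key e He). lra. }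
assert (E2 : (Rabs (Re l) <= 0)%R). { apply Rle_all_eps with (c := 1%R). lra. intros e He. destruct (Key e He). lra. }
assert (El : l = 0). { apply Cmod_eq_0, Rle_antisym; [|apply Cmod_ge_0]. eapply Rle_trans. apply Cmod_le_re_im. lra. }
rewrite <- El. exact Dz.
Qed.

(** The maximum principle is applied to [Cexp (i h)] and [Cexp (- i h)], whose moduli are
    exponentials of [- Im h] and [Im h]. Compactness of the circle makes the boundary hypothesis
    uniform, so circles of radius close to 1 can be used. *)
Lemma zero_boundary_imaginary_part (h : C -> C) : (forall z, unit_disk z -> C_differentiable h z) ->
  (forall zeta, Cmod zeta = 1%R -> forall e, (0 < e)%R -> exists d, (0 < d)%R /\ forall z, unit_disk z ->
  Cmod (z - zeta) < d -> (Rabs (Im (h z)) < e)%R) ->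
  forall z, unit_disk z -> Im (h z) = 0%R.
Proof.
intros Hh HB.
assert (Unif : forall e, (0 < e)%R -> exists d, (0 < d)%R /\ forall z, unit_disk z -> (1 - d < Cmod z)%R ->
  (Rabs (Im (h z)) < e)%R).
{ intros e He.
  destruct (compact_disk 1 (fun z d => unit_disk z -> (1 - d < Cmod z)%R -> (Rabs (Im (h z)) < e)%R)) as [d [Hd H]].
  - intros z d d' Hdd H U L. apply H; auto. lra.
  - intros u Hu. destruct (Rle_lt_or_eq_dec _ _ Hu) as [Hlt|Heq].
    + exists ((1 - Cmod u) / 2)%R. split. lra. intros z Hzu U L. exfalso. assert (T := Cmod_triangle (z - u) u).
      replace (z - u + u) with z in T by ring. lra.
    + destruct (HB u Heq e He) as [d [Hd H]]. exists d. split; auto.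
  - exists d. split; auto. intros z U L. apply H; auto. unfold unit_disk in U. lra. }
assert (Main : forall sg : C, (sg = Ci \/ sg = - Ci) -> forall z, unit_disk z -> (Re (sg * h z) <= 0)%R).
{ intros sg Hsg z0 U0. apply Rnot_lt_le. intros HN. set (m := Re (sg * h z0)) in *.
  assert (Rsg : forall w, (Re (sg * w) <= Rabs (Im w))%R).
  { intros w. destruct Hsg as [-> | ->]. replace (Re (Ci * w)) with (- Im w)%R by (destruct w; simpl; ring).
    rewrite <- Rabs_Ropp. apply Rle_abs.
    replace (Re (- Ci * w)) with (Im w) by (destruct w; simpl; ring). apply Rle_abs. }
  destruct (Unif (m / 2)%R ltac:(lra)) as [d [Hd H]]. unfold unit_disk in U0.
  set (r := Rmax (1 - d / 2) ((1 + Cmod z0) / 2)). assert (A1 : (1 - d / 2 <= r)%R) by apply Rmax_l.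
  assert (A2 : ((1 + Cmod z0) / 2 <= r)%R) by apply Rmax_r.
  assert (A3 : (r < 1)%R) by (apply Rmax_lub_lt; lra). assert (P0 := Cmod_ge_0 z0).
  assert (K : Cmod (Cexp (sg * h z0)) <= exp (m / 2)).
  { apply (max_modulus (fun z => Cexp (sg * h z)) 0 r). lra.
    - intros z Hz. replace (z - 0) with z in Hz by ring.
      assert (Dz := Cder_differentiable _ _ (Hh z ltac:(unfold unit_disk; lra))). eapply Cder_is_differentiable. cder.
    - intros t _. assert (Hc := circ_dist 0 r t ltac:(lra)). replace (circ 0 r t - 0) with (circ 0 r t) in Hc by ring.
      rewrite Cmod_Cexp.
      assert (L : (Rabs (Im (h (circ 0 r t))) < m / 2)%R) by (apply H; unfold unit_disk; rewrite Hc; lra).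
      left. apply exp_increasing. eapply Rle_lt_trans. apply Rsg. auto.
    - replace (z0 - 0) with z0 by ring. lra. }
  rewrite Cmod_Cexp in K. fold m in K. apply Rle_not_lt in K. apply K, exp_increasing. lra. }
intros z Uz. assert (M1 := Main Ci (or_introl eq_refl) z Uz). assert (M2 := Main (- Ci) (or_intror eq_refl) z Uz).
replace (Re (Ci * h z)) with (- Im (h z))%R in M1 by (destruct (h z); simpl; ring).
replace (Re (- Ci * h z)) with (Im (h z)) in M2 by (destruct (h z); simpl; ring). lra.
Qed.

Lemma unit_disk_opp z : unit_disk z -> unit_disk (- z).
Proof. unfold unit_disk. rewrite Cmod_opp; auto. Qed.
Lemma unit_disk_conj z : unit_disk z -> unit_disk (Cconj z).
Proof. unfold unit_disk. rewrite Cmod_conj; auto. Qed.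

(** The boundary estimate is known for [zeta] in the closed first quadrant; conjugation symmetry
    [Gc] and evenness [Go], which holds since the Schwarzian of an odd function is even, carry it to
    the whole circle. *)
Theorem schwarzian_formula t s r1 r2 beta f : tangent_circles t s r1 r2 -> (0 < beta < PI / 2)%R ->
  conformal_map unit_disk (quadrilateral t s r1 r2) f ->
  (forall z, unit_disk z -> f (Cconj z) = Cconj (f z)) -> (forall z, unit_disk z -> f (- z) = - f z) ->
  (Im (C_derive f 0) = 0%R /\ (0 < Re (C_derive f 0))%R) -> blim f (cis beta) (apex t s r1 r2) ->
  exists gamma : R, forall z, unit_disk z ->
    / 2 * schwarzian f z = cis (2 * beta) / ((z * z - cis (2 * beta)) * (z * z - cis (2 * beta)))
      + cis (- (2 * beta)) / ((z * z - cis (- (2 * beta))) * (z * z - cis (- (2 * beta))))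
      - RtoC gamma / ((z * z - cis (2 * beta)) * (z * z - cis (- (2 * beta)))).
Proof.
intros HT Hbeta Hf Hconj Hodd Hpos Hlim.
set (u := cis (2 * beta)). assert (Hu : Cmod u = 1%R) by apply Cmod_cis.
assert (Hcu : Cmod (Cconj u) = 1%R) by (rewrite Cmod_conj; auto).
assert (Df := f_hol t s r1 r2 f Hf). assert (Nf := f_derive_neq0 t s r1 r2 f Hf).
set (G := reduced_schwarzian f u).
assert (DG : forall z, unit_disk z -> C_differentiable G z).
{ intros z Uz. assert (S := Cder_differentiable _ _ (schwarzian_differentiable unit_disk f unit_disk_openC Df Nf z Uz)).
  assert (N1 := square_neq_unit u z Hu Uz). assert (N2 := square_neq_unit _ z Hcu Uz). eapply Cder_is_differentiable.
  unfold G, reduced_schwarzian. cder; apply Cmult_neq_0; auto. }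
assert (Gc : forall z, unit_disk z -> G (Cconj z) = Cconj (G z)).
{ intros z Uz. unfold G, reduced_schwarzian. rewrite (schwarzian_conj_sym unit_disk f unit_disk_openC Df Nf Hconj z Uz).
  assert (N1 := square_neq_unit u z Hu Uz). assert (N2 := square_neq_unit _ z Hcu Uz).
  rewrite Cmult_conj, !Cminus_conj, !Cdiv_conj by (apply Cmult_neq_0; auto).
  rewrite !Cmult_conj, !Cminus_conj, !Cmult_conj, Cconj_conj, conj_half. ring. }
assert (Go : forall z, unit_disk z -> G (- z) = G z).
{ intros z Uz. unfold G, reduced_schwarzian.
  rewrite (schwarzian_odd unit_disk f unit_disk_openC unit_disk_opp Df Nf Hodd z Uz).
  replace (- z * - z) with (z * z) by ring. auto. }
assert (Gb : forall zeta, Cmod zeta = 1%R -> forall e, (0 < e)%R -> exists d, (0 < d)%R /\ forall z, unit_disk z ->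
  Cmod (z - zeta) < d -> (Rabs (Im (G z)) < e)%R).
{ assert (B0 := reduced_schwarzian_boundary t s r1 r2 beta f HT Hbeta Hf Hconj Hodd Hpos Hlim).
  assert (B1 : forall zeta, Cmod zeta = 1%R -> (0 <= Re zeta)%R -> forall e, (0 < e)%R -> exists d, (0 < d)%R /\
    forall z, unit_disk z -> Cmod (z - zeta) < d -> (Rabs (Im (G z)) < e)%R).
  { intros zeta Hz HR e He. destruct (Rle_or_lt 0 (Im zeta)) as [HI|HI]. apply B0; auto.
    destruct (B0 (Cconj zeta) ltac:(rewrite Cmod_conj; auto) ltac:(rewrite re_conj; auto) ltac:(rewrite im_conj;
      lra) e He) as [d [Hd H]].
    exists d. split; auto. intros z Uz Hzz. specialize (H (Cconj z) (unit_disk_conj z Uz)).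
    rewrite <- Cminus_conj, Cmod_conj in H. specialize (H Hzz).
    fold u G in H. rewrite Gc, im_conj, Rabs_Ropp in H by auto. auto. }
  intros zeta Hz e He. destruct (Rle_or_lt 0 (Re zeta)) as [HR|HR]. apply B1; auto.
  destruct (B1 (- zeta) ltac:(rewrite Cmod_opp; auto) ltac:(rewrite re_opp; lra) e He) as [d [Hd H]].
  exists d. split; auto. intros z Uz Hzz. specialize (H (- z) (unit_disk_opp z Uz)).
  replace (- z - - zeta) with (- (z - zeta)) in H by ring. rewrite Cmod_opp in H. specialize (H Hzz).
  rewrite Go in H by auto. auto. }
assert (GI := zero_boundary_imaginary_part G DG Gb). assert (GC := real_valued_const G DG GI).
exists (- Re (G 0))%R. intros z Uz. replace (cis (- (2 * beta))) with (Cconj u) by (unfold u; rewrite cis_opp; auto).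
assert (N1 := square_neq_unit u z Hu Uz). assert (N2 := square_neq_unit _ z Hcu Uz).
assert (EG : RtoC (- Re (G 0)) = - G z).
{ rewrite (GC z Uz). assert (I0 := GI 0 unit_disk_0). destruct (G 0) as [a b]. simpl in *. subst.
  apply injective_projections; simpl; ring. }
rewrite EG. unfold G, reduced_schwarzian. field. auto.
Qed.

(** * The linear differential equation *)

Lemma wronskian_const (q v w : C -> C) : holomorphic_on unit_disk v -> holomorphic_on unit_disk (C_derive v) ->
  (forall z, unit_disk z -> C_derive (C_derive v) z + q z * v z = 0) ->
  holomorphic_on unit_disk w -> holomorphic_on unit_disk (C_derive w) -> (forall z, unit_disk z ->
  C_derive (C_derive w) z + q z * w z = 0) ->
  forall z, unit_disk z -> C_derive w z * v z - w z * C_derive v z = C_derive w 0 * v 0 - w 0 * C_derive v 0.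
Proof.
intros Hv Hv1 Ev Hw Hw1 Ew z Uz.
apply (C_derive_zero_const unit_disk (fun z => C_derive w z * v z - w z * C_derive v z));
  auto using unit_disk_convex, unit_disk_0.
clear z Uz. intros z Uz. assert (A1 := Cder_differentiable _ _ (Hv z Uz)).
assert (A2 := Cder_differentiable _ _ (Hv1 z Uz)).
assert (A3 := Cder_differentiable _ _ (Hw z Uz)). assert (A4 := Cder_differentiable _ _ (Hw1 z Uz)). eapply Cder_eq.
cder.
specialize (Ev z Uz). specialize (Ew z Uz).
replace (C_derive (C_derive w) z * v z + C_derive w z * C_derive v z - (C_derive w z * C_derive v z +
w z * C_derive (C_derive v) z)) with
 ((C_derive (C_derive w) z + q z * w z) * v z - w z * (C_derive (C_derive v) z + q z * v z)) by ring. rewrite Ev, Ew.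
 ring.
Qed.

(* [v = (f'(0) / f')^(1/2)] and [u = f v / f'(0)]. *)
Theorem schwarzian_ode (f : C -> C) : (forall z, unit_disk z -> C_differentiable f z) -> (forall z, unit_disk z ->
  C_derive f z <> RtoC 0) ->
  f 0 = 0 -> C_derive (C_derive f) 0 = 0 ->
  exists u v : C -> C, the_solution (fun z => / 2 * schwarzian f z) 0 1 u /\
  the_solution (fun z => / 2 * schwarzian f z) 1 0 v /\
    forall z, unit_disk z -> v z <> RtoC 0 /\ f z = C_derive f 0 * u z / v z.
Proof.
intros Df Nf F0 F20. assert (HO := unit_disk_openC). assert (U0 := unit_disk_0).
assert (D1 := C_derive_differentiable unit_disk f HO Df).
assert (DP := pre_schwarzian_differentiable unit_disk f HO Df Nf).
set (P := pre_schwarzian f) in *. set (q := fun z => / 2 * schwarzian f z).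
set (L := segment_integral P 0).
assert (DL : forall z, unit_disk z -> Cder L z (P z)) by (apply primitive_segment_integral;
  auto using unit_disk_convex).
(* [L] is the branch of the logarithm of [f' / f'(0)] vanishing at [0], so the square root needs no
   further choice and [v] has no zeros. *)
set (v := fun z => Cexp (- (/ 2 * L z))). set (c := C_derive f 0). assert (Nc : c <> RtoC 0) by (apply Nf; auto).
assert (L0 : L 0 = 0). { unfold L, segment_integral. ring. }
assert (P0 : P 0 = 0). { unfold P, pre_schwarzian. rewrite F20. unfold Cdiv. ring. }
assert (v0 : v 0 = 1). { unfold v. rewrite L0. replace (- (/ 2 * 0)) with (RtoC 0) by ring. apply Cexp_0. }
assert (Nv : forall z, v z <> RtoC 0) by (intros; apply Cexp_neq0).
assert (Loc : forall (a b : C -> C) z l, unit_disk z -> (forall w, unit_disk w -> a w = b w) -> Cder a z l ->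
  Cder b z l).
{ intros a b z l Hz Heq. apply Cder_ext_loc. destruct (HO z Hz) as [d [Hd H]]. exists d; split; auto. }
assert (v1 : forall z, unit_disk z -> Cder v z (- (/ 2 * (P z * v z)))).
{ intros z Uz. assert (H := DL z Uz). unfold v. eapply Cder_eq. cder. ring. }
assert (Ev1 : forall z, unit_disk z -> C_derive v z = - (/ 2 * (P z * v z))) by (intros; apply Cder_C_derive; auto).
assert (v2 : forall z, unit_disk z -> Cder (C_derive v) z (- (q z * v z))).
{ intros z Uz. apply (Loc (fun z => - (/ 2 * (P z * v z)))); auto. intros w Hw; symmetry; auto.
  assert (H1 := v1 z Uz). assert (H2 := pre_schwarzian_Cder unit_disk f z HO Df Uz (Nf z Uz)). fold P in H2.
  eapply Cder_eq. cder. unfold q. field. }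
set (u := fun z => / c * (f z * v z)).
assert (u1 : forall z, unit_disk z -> Cder u z (/ c * (C_derive f z * v z + f z * C_derive v z))).
{ intros z Uz. assert (H1 := v1 z Uz). rewrite <- Ev1 in H1 by auto. assert (H2 := Cder_differentiable _ _ (Df z Uz)).
  unfold u. eapply Cder_eq. cder. ring. }
assert (Eu1 : forall z, unit_disk z -> C_derive u z = / c * (C_derive f z * v z + f z * C_derive v z)) by (intros;
  apply Cder_C_derive; auto).
assert (u2 : forall z, unit_disk z -> Cder (C_derive u) z (- (q z * u z))).
{ intros z Uz. apply (Loc (fun z => / c * (C_derive f z * v z + f z * C_derive v z))); auto.
  intros w Hw; symmetry; auto.
  assert (H1 := v1 z Uz). assert (H2 := Cder_differentiable _ _ (Df z Uz)).
  assert (H3 := Cder_differentiable _ _ (D1 z Uz)). assert (H4 := v2 z Uz).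
  assert (EP : C_derive (C_derive f) z = P z * C_derive f z) by (unfold P, pre_schwarzian; field; auto).
  eapply Cder_eq. cder. rewrite EP, Ev1 by auto. unfold u. field. auto. }
assert (Sv : solves_ivp q 1 0 v).
{ unfold solves_ivp. splits; auto.
  - intros z Uz. eapply Cder_is_differentiable; auto.
  - intros z Uz. eapply Cder_is_differentiable, v2; auto.
  - intros z Uz. rewrite (Cder_C_derive _ _ _ (v2 z Uz)). ring.
  - rewrite Ev1, P0 by auto. ring. }
assert (Su : solves_ivp q 0 1 u).
{ unfold solves_ivp. splits; auto.
  - intros z Uz. eapply Cder_is_differentiable; auto.
  - intros z Uz. eapply Cder_is_differentiable, u2; auto.
  - intros z Uz. rewrite (Cder_C_derive _ _ _ (u2 z Uz)). ring.
  - unfold u. rewrite F0. ring.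
  - rewrite Eu1, F0, v0 by auto. fold c. field. auto. }
(* Uniqueness without power series: two solutions with the same data have the same Wronskian with
   [v], so the quotient of their difference by the zero-free [v] is constant. *)
assert (Ratio : forall a b w y, solves_ivp q a b w -> solves_ivp q a b y -> forall z, unit_disk z -> w z = y z).
{ intros a b w y (W1 & W2 & W3 & W4 & W5) (Y1 & Y2 & Y3 & Y4 & Y5) z Uz. destruct Sv as (V1 & V2 & V3 & V4 & V5).
  assert (K1 := wronskian_const q v w V1 V2 V3 W1 W2 W3). assert (K2 := wronskian_const q v y V1 V2 V3 Y1 Y2 Y3).
  rewrite W4, W5 in K1. rewrite Y4, Y5 in K2.
  assert (E : (w z - y z) / v z = (w 0 - y 0) / v 0).
  { apply (C_derive_zero_const unit_disk (fun x => (w x - y x) / v x)); auto using unit_disk_convex. intros x Ux.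
    assert (A1 := Cder_differentiable _ _ (V1 x Ux)). assert (A2 := Cder_differentiable _ _ (W1 x Ux)).
    assert (A3 := Cder_differentiable _ _ (Y1 x Ux)). assert (Nx := Nv x).
    eapply Cder_eq. cder. auto. specialize (K1 x Ux). specialize (K2 x Ux).
    replace ((C_derive w x - C_derive y x) * v x - (w x - y x) * C_derive v x) with
      ((C_derive w x * v x - w x * C_derive v x) - (C_derive y x * v x - y x * C_derive v x)) by ring.
    rewrite K1, K2. unfold Cdiv. ring. }
  rewrite W4, Y4 in E. assert (Nz := Nv z).
  replace (w z) with ((w z - y z) / v z * v z + y z) by (field; auto). rewrite E. unfold Cdiv. ring. }
exists u, v. split; [|split].
- split; auto. intros w Hw z Uz. apply (Ratio 0 1); auto.
- split; auto. intros w Hw z Uz. apply (Ratio 1 0); auto.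
- intros z Uz. split; auto. unfold u. assert (Nz := Nv z). fold c. field. auto.
Qed.

Theorem theorem3 (t s r1 r2 beta : R) (f : C -> C)
  (hQ : tangent_circles t s r1 r2)
  (hbeta : (0 < beta < PI / 2)%R)
  (hf : conformal_map unit_disk (quadrilateral t s r1 r2) f)
  (hconj : forall z : C, unit_disk z -> f (Cconj z) = Cconj (f z))
  (hodd : forall z : C, unit_disk z -> f (- z)%C = (- f z)%C)
  (hpos : Im (C_derive f (RtoC 0)) = 0%R /\ (0 < Re (C_derive f (RtoC 0)))%R)
  (hvert : prevertices_correspond_to (vertex t s r1 r2) beta f) :
  exists gamma : R,
    (forall z : C, unit_disk z ->
       (RtoC (1 / 2) * schwarzian f z =
          cis (2 * beta) / (z ^ 2 - cis (2 * beta)) ^ 2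
          + cis (- (2 * beta)) / (z ^ 2 - cis (- (2 * beta))) ^ 2
          - RtoC gamma
            / ((z ^ 2 - cis (2 * beta)) * (z ^ 2 - cis (- (2 * beta)))))%C) /\
    exists (c : R) (u v : C -> C),
      (0 < c)%R /\
      the_solution (fun z : C => (RtoC (1 / 2) * schwarzian f z)%C)
        (RtoC 0) (RtoC 1) u /\
      the_solution (fun z : C => (RtoC (1 / 2) * schwarzian f z)%C)
        (RtoC 1) (RtoC 0) v /\
      (forall z : C, unit_disk z ->
         v z <> RtoC 0 /\ f z = (RtoC c * u z / v z)%C).
Proof.
(* Which vertex corresponds to [cis beta] is not prescribed. Since [f] preserves the open first
   quadrant, the vertex lies in the closed one, and the apex is the only such vertex. *)
assert (Hb : blim f (cis beta) (apex t s r1 r2)).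
{ destruct hvert as [hv _]. destruct (hv (cis beta) (or_introl eq_refl)) as [p [Vp Bp]].
  apply boundary_value_blim in Bp.
  assert (Hc : (0 < cos beta)%R) by (apply cos_gt_0; lra). assert (Hs : (0 < sin beta)%R) by (apply sin_gt_0; lra).
  assert (Near : forall e, (0 < e)%R -> exists z, (0 < Re (f z))%R /\ (0 < Im (f z))%R /\ Cmod (f z - p) < e).
  { intros e He. destruct (Bp e He) as [d [Hd H]].
    destruct (unit_circle_adherent (cis beta) (Cmod_cis beta) (Rmin d (Rmin (cos beta) (sin beta)))) as [z [Uz Hz]].
    repeat apply Rmin_pos; auto.
    assert (Z1 := Rlt_le_trans _ _ _ Hz (Rmin_l _ _)). assert (Z := Rlt_le_trans _ _ _ Hz (Rmin_r _ _)).
    assert (Z2 := Rlt_le_trans _ _ _ Z (Rmin_l _ _)). assert (Z3 := Rlt_le_trans _ _ _ Z (Rmin_r _ _)).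
    assert (B1 := re_le_Cmod (z - cis beta)). assert (B2 := im_le_Cmod (z - cis beta)). rewrite Re_minus in B1.
    rewrite Im_minus in B2. simpl (Re (cis beta)) in B1. simpl (Im (cis beta)) in B2.
    apply Rabs_le_between in B1. apply Rabs_le_between in B2.
    exists z. split; [|split]; auto. apply (f_right t s r1 r2); auto. lra. apply (f_upper t s r1 r2); auto. lra. }
  replace (apex t s r1 r2) with p; auto. apply (vertex_first_quadrant t s r1 r2); auto.
  - apply Rnot_lt_le. intros HN. destruct (Near (- Re p)%R ltac:(lra)) as [z [A [_ B]]].
    assert (B1 := re_le_Cmod (f z - p)). rewrite Re_minus in B1. apply Rabs_le_between in B1. lra.
  - apply Rnot_lt_le. intros HN. destruct (Near (- Im p)%R ltac:(lra)) as [z [_ [A B]]].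
    assert (B1 := im_le_Cmod (f z - p)). rewrite Im_minus in B1. apply Rabs_le_between in B1. lra. }
assert (E2 : RtoC (1 / 2) = / 2). { rewrite RtoC_div by lra. field. }
destruct (schwarzian_formula t s r1 r2 beta f hQ hbeta hf hconj hodd hpos Hb) as [gamma HG].
assert (Df := f_hol t s r1 r2 f hf). assert (Nf := f_derive_neq0 t s r1 r2 f hf).
exists gamma. split.
- intros z Uz. rewrite E2, (HG z Uz).
  replace ((z ^ 2 - cis (2 * beta)) ^ 2) with ((z * z - cis (2 * beta)) * (z * z - cis (2 * beta))) by ring.
  replace ((z ^ 2 - cis (- (2 * beta))) ^ 2) with ((z * z - cis (- (2 * beta))) * (z * z - cis (- (2 * beta)))) by ring.
  replace (z ^ 2) with (z * z) by ring. reflexivity.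
(* The derivative of the odd function [f] is even and the second derivative odd; its vanishing at
   [0] gives [v'(0) = 0]. *)
- assert (F2 : C_derive (C_derive f) 0 = 0).
  { assert (D1 := C_derive_differentiable unit_disk f unit_disk_openC Df).
    assert (S1 : forall z, unit_disk z -> C_derive f (- z) = 1 * C_derive f z).
    { intros w Uw. rewrite (C_derive_odd unit_disk f (- 1) unit_disk_openC unit_disk_opp Df); auto. ring. intros x Ux.
      rewrite hodd by auto. ring. }
    assert (H := C_derive_odd unit_disk _ 1 unit_disk_openC unit_disk_opp D1 S1 0 unit_disk_0).
    replace (- 0) with (RtoC 0) in H by ring.
    assert (K : 2 * C_derive (C_derive f) 0 = 0).
    { replace (2 * C_derive (C_derive f) 0) with (C_derive (C_derive f) 0 + C_derive (C_derive f) 0) by ring.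
      rewrite H at 1. ring. }
    replace (C_derive (C_derive f) 0) with (/ 2 * (2 * C_derive (C_derive f) 0)) by field. rewrite K. ring. }
  destruct (schwarzian_ode f Df Nf (f_0 f hodd) F2) as [u [v [Hu [Hv Huv]]]].
  destruct hpos as [P1 P2]. exists (Re (C_derive f (RtoC 0))), u, v.
  assert (Ec : RtoC (Re (C_derive f (RtoC 0))) = C_derive f (RtoC 0)).
  { destruct (C_derive f (RtoC 0)) as [a b]; simpl in *. subst. auto. }
  rewrite Ec, E2. auto.
Qed.
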